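(* Let $X_*>0$ and let $y=\phi(x)$, $0\le x\le X_*$, be a prescribed shock, where $\phi\in C^2([0,X_*])$ and $\phi(0)=0$. Suppose that (i) for all $x\in[0,X_*]$: $\phi''(x)>0$, $\phi'(x)\in\mathcal I_{\rm sup}$ and $\mathcal D(\phi'(x))<0$; (ii) $M<+\infty$ and $-\frac{\pi}{2}<\theta-\theta_m<\theta+\theta_m<\frac{\pi}{2}$ at every point of the compact phase region $\mathcal P$. If $$B_{\rm mass}(x)<B_{\rm nd}(x)\qquad\text{for all }0\le x\le X_*,$$ then the hybrid problem admits a $C^2$ wedge surface $\mathbf W^*$ and a $C^1$ post-shock flow in $\Omega^*$; that is, there exists a solution $(f;\rho,u,v,p)$ of the hybrid inverse problem (in the sense defined in the context) with $f$ of class $C^2$ and $(\rho,u,v,p)$ of class $C^1$ in $\Omega^*$.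
   Context: **Gas and incoming state.** Fix $1<\gamma<3$, $\rho_\infty>0$, $p_\infty>0$ with $M_\infty^2=\rho_\infty/(\gamma p_\infty)>1$, and put $\epsilon=M_\infty^{-2}\in(0,1)$. The uniform incoming state is $(\rho,u,v,p)=(\rho_\infty,1,0,p_\infty)$. **Post-shock state.** For a shock $y=\phi(x)$ with slope $s=\phi'(x)>0$ let $$M_{n,\infty}^2=\frac{s^2}{\epsilon(1+s^2)}>1,\qquad r=\frac{(\gamma+1)M_{n,\infty}^2}{(\gamma-1)M_{n,\infty}^2+2},$$ $$\rho_{\rm sh}=\rho_\infty r,\quad p_{\rm sh}=p_\infty\Bigl[1+\tfrac{2\gamma}{\gamma+1}(M_{n,\infty}^2-1)\Bigr],\quad u_{\rm sh}=\frac{1+s^2/r}{1+s^2},\quad v_{\rm sh}=\frac{s(1-1/r)}{1+s^2}.$$ These are functions of $x$ through $s=\phi'(x)$. **Flow variables.** For a state $(\rho,u,v,p)$ with $\rho,p,u>0$: $c=\sqrt{\gamma p/\rho}$, $q=\sqrt{u^2+v^2}$, $\Sigma=p/\rho^\gamma$, $M=q/c$, $\theta_m=\arcsin(1/M)$, $\theta=\arctan(v/u)$, $\lambda_\pm=\tan(\theta\pm\theta_m)$, $R=\theta+\nu(M)$, $S=\theta-\nu(M)$, where for $M>1$ $$\nu(M)=\sqrt{\tfrac{\gamma+1}{\gamma-1}}\arctan\sqrt{\tfrac{\gamma-1}{\gamma+1}(M^2-1)}-\arctan\sqrt{M^2-1}.$$ **Admissible slopes.** $\mathcal I_{\rm sup}=(s_-,s_+)$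 with $$s_-=\sqrt{\tfrac{\epsilon}{1-\epsilon}},\qquad s_+=\left[\frac{\mathscr L+\sqrt{\Delta}}{2(\gamma-1+2\epsilon)(1-\epsilon)}-1\right]^{1/2},$$ $\mathscr L=\gamma(3-\epsilon)+3\epsilon-1$, $\Delta=\mathscr L^2-8\gamma(\gamma-1+2\epsilon)(1-\epsilon)$. **Sign polynomial.** $\mathcal D(s)=s^2C(s)N(s)^2-4(\gamma+1)B(s)^2P_0(s)$, where $P_0(s)=-(1-\epsilon)(\gamma-1+2\epsilon)s^4+(4\epsilon^2+\epsilon\gamma-3\epsilon+\gamma+1)s^2+2\epsilon^2$, $B(s)=\epsilon^2(1+s^2)^2+\gamma s^4$, $N(s)=P_0(s)+\epsilon(\gamma+1)(1+s^2)$, $C(s)=[2\epsilon+(2\epsilon+\gamma-1)s^2][2\gamma s^2-\epsilon(\gamma-1)(1+s^2)]$. **Phase plane.** $R_{\rm sh}(x),S_{\rm sh}(x)$ denote the values of $R,S$ for the post-shock state at $(x,\phi(x))$. Under (i), $R_{\rm sh}'<0<S_{\rm sh}'$, so the trace $\{(R_{\rm sh}(x),S_{\rm sh}(x))\}$ is the graph of a strictly decreasing $C^1$ function $S=\chi(R)$ on $[R_{\min},R_{\max}]=[R_{\rm sh}(X_* ),R_{\rm sh}(0)]$. With $S_{\max}=S_{\rm sh}(X_* )$, $$\mathcal P=\{(R,S):R_{\min}\le R\le R_{\max},\ \chi(R)\le S\le S_{\max}\}.$$ On $\mathcal P$, $\theta,M$ (and hence $\theta_m,\lambda_\pm$) are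 viewed as functions of $(R,S)$ via $\theta=\frac{R+S}2$, $M=\nu^{-1}\bigl(\frac{R-S}2\bigr)$. **Bounds.** On $\mathcal P$ put $$a=\frac{\partial_R\lambda_-}{\lambda_+-\lambda_-},\quad b=\frac{\partial_S\lambda_+}{\lambda_+-\lambda_-},\quad \mathcal A(R,S)=a(R,S)\exp\Bigl(\int_{\chi(R)}^S b(R,\tau)\,d\tau\Bigr),$$ $$\alpha(R)=\max_{\chi(R)\le S\le S_{\max}}\mathcal A(R,S),\qquad \beta(R)=\min_{\chi(R)\le S\le S_{\max}}\lambda_-^2(R,S).$$ Then $$B_{\rm mass}(x)=\frac{\rho_\infty\,\phi(x)}{\sqrt{\gamma\rho_{\rm sh}(x)p_{\rm sh}(x)}\,\sqrt{1+\beta(R_{\rm sh}(x))}},\qquad B_{\rm nd}(x)=\frac{-x_R(R_{\rm sh}(x),S_{\rm sh}(x))}{\alpha(R_{\rm sh}(x))},$$ where $x_R$ on the shock trace is the prescribed quantity $$x_R(R_{\rm sh}(x),S_{\rm sh}(x))=\frac{\phi'(x)-\lambda_-}{(\lambda_+-\lambda_-)\,R_{\rm sh}'(x)},$$ with $\lambda_\pm$ evaluated at $(R_{\rm sh}(x),S_{\rm sh}(x))$. **Hybrid inverse problem.** A solution consists of a function $f$ on an interval $[0,X_w]$, $X_w>0$, $f(0)=0$ (wedge segment $\mathbf W^*=\{(x,f(x)):0\le x\le X_w\}$), and a supersonic state $(\rho,u,v,p)$ (with $\rho,p,u>0$, $M>1$) on $\Omega^*$, continuous up to the boundary, where $\Omega^*$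 is the bounded domain enclosed by the shock segment $\mathbf S^*=\{(x,\phi(x)):0\le x\le X_*\}$, the wedge segment $\mathbf W^*$, and the curve $\mathbf\Gamma^*$, the backward $\lambda_+$-characteristic (integral curve of $dy/dx=\lambda_+$) issuing from $(X_*,\phi(X_* ))$ and ending on the wedge (the flow lies below the shock and above the wedge), such that - in $\Omega^*$: $R_x+\lambda_-R_y=0$, $\;S_x+\lambda_+S_y=0$, $\;u\Sigma_x+v\Sigma_y=0$, $\;\frac{u^2+v^2}{2}+\frac{\gamma p}{(\gamma-1)\rho}=\frac12+\frac{\gamma p_\infty}{(\gamma-1)\rho_\infty}$; - on $\mathbf S^*$: $(\rho,u,v,p)(x,\phi(x)-)=(\rho_{\rm sh},u_{\rm sh},v_{\rm sh},p_{\rm sh})(x)$; - on $\mathbf W^*$: $v=uf'(x)$. *)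

(* Defs.v *)
From Stdlib Require Import Reals.
From Coquelicot Require Import Coquelicot.

Open Scope R_scope.

(** * Calculus on a closed interval and on a planar set *)

(* [is_derive] with [locally x] restricted to [a, b]: the derivative relative
   to [a, b], i.e. one-sided at the end points. *)
Definition is_derive_on (a b : R) (f : R -> R) (x l : R) : Prop :=
  filterdiff f (within (fun y => a <= y <= b) (locally x)) (fun y => scal y l).

Definition ex_derive_on (a b : R) (f : R -> R) (x : R) : Prop :=
  exists l, is_derive_on a b f x l.

(* [iota P] is the unique real satisfying [P] (arbitrary if there is none). *)
Definition Derive_on (a b : R) (f : R -> R) (x : R) : R :=
  iota (fun l : R => is_derive_on a b f x l).

Definition C1_on (a b : R) (f : R -> R) : Prop :=
  (forall x, a <= x <= b -> ex_derive_on a b f x) /\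
  continuous_on (fun x => a <= x <= b) (Derive_on a b f).

Definition C2_on (a b : R) (f : R -> R) : Prop :=
  C1_on a b f /\ C1_on a b (Derive_on a b f).

(* Meant for open [D], where two-sided partial derivatives make sense. *)
Definition C1_in (D : R -> R -> Prop) (w : R -> R -> R) : Prop :=
  forall x y, D x y ->
    ex_derive (fun t => w t y) x /\ ex_derive (fun t => w x t) y /\
    continuity_2d_pt (fun x y => Derive (fun t => w t y) x) x y /\
    continuity_2d_pt (fun x y => Derive (fun t => w x t) y) x y.

Definition continuous_on_2d (D : R -> R -> Prop) (w : R -> R -> R) : Prop :=
  continuous_on (fun z : R * R => D (fst z) (snd z))
                (fun z : R * R => w (fst z) (snd z)).

(* [k1 w_x + k2 w_y = 0] holds classically in [D]. *)
Definition transported_in (D : R -> R -> Prop) (k1 k2 w : R -> R -> R) : Prop :=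
  forall x y, D x y ->
    exists wx wy, is_derive (fun t => w t y) x wx /\
                  is_derive (fun t => w x t) y wy /\
                  k1 x y * wx + k2 x y * wy = 0.

Definition max_over (D : R -> Prop) (h : R -> R) : R :=
  iota (fun m : R => (exists t, D t /\ h t = m) /\ forall t, D t -> h t <= m).

Definition min_over (D : R -> Prop) (h : R -> R) : R :=
  iota (fun m : R => (exists t, D t /\ h t = m) /\ forall t, D t -> m <= h t).

(** * Flow states and flow variables *)

Record state := State { rho : R; vx : R; vy : R; prs : R }.

Section Gas.

Context (gamma : R).

Definition sound (U : state) : R := sqrt (gamma * prs U / rho U).
Definition speed (U : state) : R := sqrt (vx U ^ 2 + vy U ^ 2).
Definition entropy (U : state) : R := prs U / Rpower (rho U) gamma.
Definition mach (U : state) : R := speed U / sound U.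
Definition flow_angle (U : state) : R := atan (vy U / vx U).

Definition mach_angle (m : R) : R := asin (1 / m).

(* Prandtl-Meyer function. *)
Definition nu (m : R) : R :=
  sqrt ((gamma + 1) / (gamma - 1))
    * atan (sqrt ((gamma - 1) / (gamma + 1) * (m ^ 2 - 1)))
  - atan (sqrt (m ^ 2 - 1)).

(* Meaningful only for [w] in the bounded range of [nu] on (1, +oo). *)
Definition nu_inv (w : R) : R := iota (fun m : R => 1 < m /\ nu m = w).

Definition lambda_plus (U : state) : R :=
  tan (flow_angle U + mach_angle (mach U)).
Definition lambda_minus (U : state) : R :=
  tan (flow_angle U - mach_angle (mach U)).

Definition inv_R (U : state) : R := flow_angle U + nu (mach U).
Definition inv_S (U : state) : R := flow_angle U - nu (mach U).

(** The same variables as functions of the invariants [(r, s)]. *)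

Definition theta_ph (r s : R) : R := (r + s) / 2.
Definition mach_ph (r s : R) : R := nu_inv ((r - s) / 2).
Definition theta_m_ph (r s : R) : R := mach_angle (mach_ph r s).
Definition lp_ph (r s : R) : R := tan (theta_ph r s + theta_m_ph r s).
Definition lm_ph (r s : R) : R := tan (theta_ph r s - theta_m_ph r s).

Definition coef_a (r s : R) : R :=
  Derive (fun t => lm_ph t s) r / (lp_ph r s - lm_ph r s).
Definition coef_b (r s : R) : R :=
  Derive (fun t => lp_ph r t) s / (lp_ph r s - lm_ph r s).

(** * Incoming state, post-shock state and admissible slopes *)

Context (rho_inf p_inf : R).

Definition Minf2 : R := rho_inf / (gamma * p_inf).
Definition eps : R := / Minf2.

Definition Mn2 (s : R) : R := s ^ 2 / (eps * (1 + s ^ 2)).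
Definition shock_ratio (s : R) : R :=
  (gamma + 1) * Mn2 s / ((gamma - 1) * Mn2 s + 2).

Definition post_shock (s : R) : state :=
  let r := shock_ratio s in
  {| rho := rho_inf * r;
     vx := (1 + s ^ 2 / r) / (1 + s ^ 2);
     vy := s * (1 - 1 / r) / (1 + s ^ 2);
     prs := p_inf * (1 + 2 * gamma / (gamma + 1) * (Mn2 s - 1)) |}.

Definition slope_L : R := gamma * (3 - eps) + 3 * eps - 1.
Definition slope_Delta : R :=
  slope_L ^ 2 - 8 * gamma * (gamma - 1 + 2 * eps) * (1 - eps).
Definition s_minus : R := sqrt (eps / (1 - eps)).
Definition s_plus : R :=
  sqrt ((slope_L + sqrt slope_Delta)
          / (2 * (gamma - 1 + 2 * eps) * (1 - eps)) - 1).
Definition I_sup (s : R) : Prop := s_minus < s < s_plus.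

Definition poly_P0 (s : R) : R :=
  - (1 - eps) * (gamma - 1 + 2 * eps) * s ^ 4
  + (4 * eps ^ 2 + eps * gamma - 3 * eps + gamma + 1) * s ^ 2 + 2 * eps ^ 2.
Definition poly_B (s : R) : R := eps ^ 2 * (1 + s ^ 2) ^ 2 + gamma * s ^ 4.
Definition poly_N (s : R) : R :=
  poly_P0 s + eps * (gamma + 1) * (1 + s ^ 2).
Definition poly_C (s : R) : R :=
  (2 * eps + (2 * eps + gamma - 1) * s ^ 2)
  * (2 * gamma * s ^ 2 - eps * (gamma - 1) * (1 + s ^ 2)).
Definition poly_D (s : R) : R :=
  s ^ 2 * poly_C s * poly_N s ^ 2
  - 4 * (gamma + 1) * poly_B s ^ 2 * poly_P0 s.

(** * Data along the prescribed shock [y = phi x], [0 <= x <= X] *)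

Context (X : R) (phi : R -> R).

Definition dphi : R -> R := Derive_on 0 X phi.
Definition d2phi : R -> R := Derive_on 0 X dphi.

Definition U_sh (x : R) : state := post_shock (dphi x).
Definition R_sh (x : R) : R := inv_R (U_sh x).
Definition S_sh (x : R) : R := inv_S (U_sh x).

Definition R_min : R := R_sh X.
Definition R_max : R := R_sh 0.
Definition S_max : R := S_sh X.

(* The function whose graph is the shock trace in the (R, S) plane. *)
Definition chi (r : R) : R :=
  iota (fun s : R => exists x, 0 <= x <= X /\ R_sh x = r /\ S_sh x = s).

Definition phase_region (r s : R) : Prop :=
  R_min <= r <= R_max /\ chi r <= s <= S_max.

Definition ampl (r s : R) : R :=
  coef_a r s * exp (RInt (fun t => coef_b r t) (chi r) s).

Definition alpha (r : R) : R :=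
  max_over (fun s => chi r <= s <= S_max) (fun s => ampl r s).
Definition beta (r : R) : R :=
  min_over (fun s => chi r <= s <= S_max) (fun s => lm_ph r s ^ 2).

(* The value of [x_R] at the trace point [(R_sh x, S_sh x)]. *)
Definition xR_sh (x : R) : R :=
  let lp := lp_ph (R_sh x) (S_sh x) in
  let lm := lm_ph (R_sh x) (S_sh x) in
  (dphi x - lm) / ((lp - lm) * Derive_on 0 X R_sh x).

Definition B_mass (x : R) : R :=
  rho_inf * phi x
  / (sqrt (gamma * rho (U_sh x) * prs (U_sh x)) * sqrt (1 + beta (R_sh x))).

Definition B_nd (x : R) : R := - xR_sh x / alpha (R_sh x).

(** * The hybrid inverse problem *)

(* The domain between the shock [phi] (above) and, below, the wedge [f] over
   [0, Xw] followed by the characteristic [g] over [Xw, X].  As [lambda_plus]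
   is finite, that characteristic is a graph over the x axis. *)
Definition Omega (Xw : R) (f g : R -> R) (x y : R) : Prop :=
  0 < x < X /\ y < phi x /\ (x <= Xw -> f x < y) /\ (Xw <= x -> g x < y).

Definition Omega_closure (Xw : R) (f g : R -> R) (x y : R) : Prop :=
  0 <= x <= X /\ y <= phi x /\ (x <= Xw -> f x <= y) /\ (Xw <= x -> g x <= y).

Record hybrid_solution
    (Xw : R) (f g : R -> R) (U : R -> R -> state) : Prop := {
  hs_Xw : 0 < Xw < X;
  hs_tip : f 0 = 0;
  hs_wedge_below : forall x, 0 < x <= Xw -> f x < phi x;
  hs_char_below : forall x, Xw <= x < X -> g x < phi x;
  hs_char_start : g X = phi X;
  hs_char_end : g Xw = f Xw;
  hs_char_ode : forall x, Xw <= x <= X ->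
    is_derive_on Xw X g x (lambda_plus (U x (g x)));
  hs_supersonic : forall x y, Omega_closure Xw f g x y ->
    0 < rho (U x y) /\ 0 < prs (U x y) /\ 0 < vx (U x y) /\ 1 < mach (U x y);
  (* the tangents defining [lambda_plus] and [lambda_minus] exist *)
  hs_lambda_finite : forall x y, Omega_closure Xw f g x y ->
    cos (flow_angle (U x y) + mach_angle (mach (U x y))) <> 0 /\
    cos (flow_angle (U x y) - mach_angle (mach (U x y))) <> 0;
  hs_cont_rho :
    continuous_on_2d (Omega_closure Xw f g) (fun x y => rho (U x y));
  hs_cont_vx :
    continuous_on_2d (Omega_closure Xw f g) (fun x y => vx (U x y));
  hs_cont_vy :
    continuous_on_2d (Omega_closure Xw f g) (fun x y => vy (U x y));
  hs_cont_prs :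
    continuous_on_2d (Omega_closure Xw f g) (fun x y => prs (U x y));
  hs_eq_R : transported_in (Omega Xw f g) (fun _ _ => 1)
    (fun x y => lambda_minus (U x y)) (fun x y => inv_R (U x y));
  hs_eq_S : transported_in (Omega Xw f g) (fun _ _ => 1)
    (fun x y => lambda_plus (U x y)) (fun x y => inv_S (U x y));
  hs_eq_entropy : transported_in (Omega Xw f g) (fun x y => vx (U x y))
    (fun x y => vy (U x y)) (fun x y => entropy (U x y));
  hs_bernoulli : forall x y, Omega Xw f g x y ->
    (vx (U x y) ^ 2 + vy (U x y) ^ 2) / 2
      + gamma * prs (U x y) / ((gamma - 1) * rho (U x y))
    = 1 / 2 + gamma * p_inf / ((gamma - 1) * rho_inf);
  (* [U] being continuous on the closure, its value on the shock is the
     trace from below *)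
  hs_shock : forall x, 0 <= x <= X -> U x (phi x) = U_sh x;
  hs_wedge : forall x, 0 <= x <= Xw ->
    ex_derive_on 0 Xw f x /\
    vy (U x (f x)) = vx (U x (f x)) * Derive_on 0 Xw f x
}.

Definition flow_C1 (D : R -> R -> Prop) (U : R -> R -> state) : Prop :=
  C1_in D (fun x y => rho (U x y)) /\ C1_in D (fun x y => vx (U x y)) /\
  C1_in D (fun x y => vy (U x y)) /\ C1_in D (fun x y => prs (U x y)).

End Gas.

(* Main.v *)
(** Hodograph method.  On the shock trace both invariants are monotone in the
    shock abscissa, so a point of the flow is labelled by the abscissae
    (xi, eta), xi <= eta, of the feet of the C- and C+ characteristics through
    it: R = R_sh(xi), S = S_sh(eta).  In these coordinates the unknowns
    P = x_xi and Q = x_eta solve a linear Goursat problem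
    P_eta = Q_xi = - (ta Q + tb P) with positive coefficients and positive data
    on the diagonal; y and a stream function are then potentials of closed
    forms.  The wedge is the zero streamline.  Positivity of P and Q, i.e.
    invertibility of (xi, eta) -> (x, y), propagates from the shock: Q > 0 is
    immediate from P, Q > 0 nearer to the shock, while P > 0 follows from an
    integrating factor as long as x - xi stays below B_nd; conservation of mass
    along the C- characteristic, with the entropy increasing along the convex
    shock, gives x - xi <= B_mass above the wedge.  Monotonicity of x, y and of
    the stream function in (xi, eta) makes the map a homeomorphism onto the
    closed flow domain, and its inverse is differentiated by the implicit
    function theorem. *)

Require Import Defs.
From Stdlib Require Import Reals Lra Lia Psatz Classical ClassicalEpsilon.
From Coquelicot Require Import Coquelicot.
Open Scope R_scope.

(** * Calculus relative to a closed interval *)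

(** The positivity statements are circular: P > 0 uses the bound on x - xi, which uses Q > 0 and a
    nonnegative stream function along the C- characteristic, while Q > 0 uses P and Q along the C+
    characteristic. The circle is broken by induction on the distance eta - xi from the shock,
    inside the set of points whose whole domain of dependence has a nonnegative stream function; the
    wedge is the edge of this set, so it is found together with the positivity. The transport of R
    and S does not see the entropy. Hence the stream function is that of an isentropic gas with the
    same R and S: its mass flux is the physical one times a factor K of the entropy. The bound of
    the stream function at xi by rho_inf K phi and the lower bound of the flux across the C-
    characteristic both carry K at xi, so K cancels in their quotient, which is B_mass: sqrt (gamma
    rho p) is rho c at the foot, and sqrt (1 + beta) bounds 1 / cos (theta - mu) from below. In
    B_nd, alpha bounds the coefficient of Q once P is multiplied by its integrating factor. *)

Lemma within_locally_iff (D : R -> Prop) (x : R) (P : R -> Prop) :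
  within D (locally x) P <->
  exists d, 0 < d /\ forall y, D y -> Rabs (y - x) < d -> P y.
Proof.
split.
- intros [d Hd]. exists d. split; [apply cond_pos|].
  intros y Dy Hy. apply Hd; [exact Hy|exact Dy].
- intros [d [Hd H]]. exists (mkposreal d Hd). intros y Hy Dy.
  apply H; [exact Dy|exact Hy].
Qed.

(** [filterdiff] asks for the estimate at every limit point of the filter. For [x] in [a, b] the
    only such point is [x] itself, so the notion reduces to the usual first-order estimate, from
    which the calculus below starts. *)
Lemma is_derive_on_iff (a b : R) (f : R -> R) (x l : R) :
  a <= x <= b ->
  is_derive_on a b f x l <->
  forall eps, 0 < eps -> exists d, 0 < d /\ forall y, a <= y <= b ->
    Rabs (y - x) < d -> Rabs (f y - f x - l * (y - x)) <= eps * Rabs (y - x).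
Proof.
intros Hx. split.
- intros [_ H] eps Heps.
  assert (Hlim : is_filter_lim (within (fun y => a <= y <= b) (locally x)) x).
  { intros Q [d Hd]. exists d. intros y Hy _. now apply Hd. }
  specialize (H x Hlim (mkposreal eps Heps)).
  apply within_locally_iff in H. destruct H as [d [Hd H]].
  exists d. split; [exact Hd|]. intros y Dy Hy. specialize (H y Dy Hy).
  unfold minus, plus, opp, scal in H; simpl in H. unfold mult in H; simpl in H.
  unfold norm in H; simpl in H. unfold abs in H; simpl in H.
  replace (f y - f x - l * (y - x)) with (f y + - f x + - ((y + - x) * l)) by ring.
  exact H.
- intros H. split.
  { exact (@is_linear_scal_l R_AbsRing R_NormedModule l). }
  intros x' Hx'.
  assert (x' = x) as ->.
  { apply NNPP. intros Hne.
    assert (Hd : 0 < Rabs (x' - x)) by (apply Rabs_pos_lt; lra).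
    specialize (Hx' (ball x' (Rabs (x' - x))) (locally_ball x' (mkposreal _ Hd))).
    apply within_locally_iff in Hx'. destruct Hx' as [d [Hd' H']].
    assert (Hb : ball x' (Rabs (x' - x)) x).
    { apply H'; [exact Hx|]. rewrite Rminus_diag, Rabs_R0. exact Hd'. }
    unfold ball in Hb; simpl in Hb. unfold AbsRing_ball, abs, minus, plus, opp in Hb; simpl in Hb.
    rewrite (Rabs_minus_sym x' x) in Hb. unfold Rminus in Hb. lra. }
  intros eps. destruct (H eps (cond_pos eps)) as [d [Hd H']].
  apply within_locally_iff. exists d. split; [exact Hd|].
  intros y Dy Hy. specialize (H' y Dy Hy).
  unfold minus, plus, opp, scal; simpl. unfold mult; simpl.
  unfold norm; simpl. unfold abs; simpl.
  replace (f y + - f x + - ((y + - x) * l)) with (f y - f x - l * (y - x)) by ring.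
  exact H'.
Qed.


Lemma is_derive_on_interior (a b : R) (f : R -> R) (x l : R) :
  a < x < b -> is_derive_on a b f x l <-> is_derive f x l.
Proof.
intros Hx. rewrite is_derive_on_iff by lra. rewrite is_derive_Reals. split.
- intros H eps Heps.
  destruct (H (eps/2)) as [d [Hd H']]; [lra|].
  assert (Hd2 : 0 < Rmin d (Rmin (x - a) (b - x))).
  { repeat apply Rmin_glb_lt; lra. }
  exists (mkposreal _ Hd2). intros h Hh Hhd. simpl in Hhd.
  assert (Rabs h < d) by (eapply Rlt_le_trans; [exact Hhd|apply Rmin_l]).
  assert (Rabs h < x - a).
  { eapply Rlt_le_trans; [exact Hhd|]. eapply Rle_trans; [apply Rmin_r|apply Rmin_l]. }
  assert (Rabs h < b - x).
  { eapply Rlt_le_trans; [exact Hhd|]. eapply Rle_trans; [apply Rmin_r|apply Rmin_r]. }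
  assert (Hab : a <= x + h <= b).
  { unfold Rabs in *; destruct (Rcase_abs h); lra. }
  specialize (H' (x + h) Hab). replace (x + h - x) with h in H' by ring.
  specialize (H' H0).
  assert (0 < Rabs h) by (now apply Rabs_pos_lt).
  replace ((f (x + h) - f x) / h - l) with ((f (x + h) - f x - l * h) / h) by (now field).
  unfold Rdiv. rewrite Rabs_mult, Rabs_inv.
  apply (Rmult_lt_reg_r (Rabs h)); [lra|].
  rewrite Rmult_assoc, Rinv_l by lra. nra.
- intros H eps Heps. destruct (H eps Heps) as [d Hd].
  exists d. split; [apply cond_pos|]. intros y Hy Hyx.
  destruct (Req_dec y x) as [->|Hne].
  { replace (f x - f x - l * (x - x)) with 0 by ring.
    rewrite Rminus_diag, Rabs_R0. lra. }
  specialize (Hd (y - x) ltac:(lra) Hyx).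
  replace (x + (y - x)) with y in Hd by ring.
  assert (0 < Rabs (y - x)) by (apply Rabs_pos_lt; lra).
  replace (f y - f x - l * (y - x)) with (((f y - f x) / (y - x) - l) * (y - x)) by (field; lra).
  rewrite Rabs_mult. apply Rmult_le_compat_r; lra.
Qed.

Lemma is_derive_on_subinterval (a b a' b' : R) (f : R -> R) (x l : R) :
  a <= a' -> b' <= b -> a' <= x <= b' ->
  is_derive_on a b f x l -> is_derive_on a' b' f x l.
Proof.
intros Ha Hb Hx H. rewrite is_derive_on_iff by lra.
rewrite is_derive_on_iff in H by lra.
intros eps Heps. destruct (H eps Heps) as [d [Hd H']].
exists d. split; [exact Hd|]. intros y Hy. apply H'. lra.
Qed.

Lemma is_derive_derive_on (a b : R) (f : R -> R) (x l : R) :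
  a <= x <= b -> is_derive f x l -> is_derive_on a b f x l.
Proof.
intros Hx H.
apply (is_derive_on_subinterval (a - 1) (b + 1)); try lra.
apply is_derive_on_interior; [lra|exact H].
Qed.

Lemma is_derive_on_ext (a b : R) (f g : R -> R) (x l : R) :
  a <= x <= b -> (forall y, a <= y <= b -> f y = g y) ->
  is_derive_on a b f x l -> is_derive_on a b g x l.
Proof.
intros Hx E H. rewrite is_derive_on_iff in H |- * by exact Hx.
intros eps Heps. destruct (H eps Heps) as [d [Hd H']].
exists d. split; [exact Hd|]. intros y Hy Hyx.
rewrite <- !E by lra. now apply H'.
Qed.

(** Since [a < b], there are points of [a, b] other than [x] and arbitrarily close to it, on the
    right or, at the right end point, on the left. Comparing the two estimates there bounds the
    distance of the slopes by half of itself. *)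
Lemma is_derive_on_unique (a b : R) (f : R -> R) (x l1 l2 : R) :
  a < b -> a <= x <= b ->
  is_derive_on a b f x l1 -> is_derive_on a b f x l2 -> l1 = l2.
Proof.
intros Hab Hx H1 H2. rewrite is_derive_on_iff in H1, H2 by exact Hx.
apply NNPP. intros Hne.
assert (He : 0 < Rabs (l1 - l2) / 4).
{ assert (0 < Rabs (l1 - l2)) by (apply Rabs_pos_lt; lra). lra. }
destruct (H1 _ He) as [d1 [Hd1 K1]]. destruct (H2 _ He) as [d2 [Hd2 K2]].
assert (exists y, a <= y <= b /\ y <> x /\ Rabs (y - x) < Rmin d1 d2) as [y [Hy [Hyx Hyd]]].
{ set (d := Rmin d1 d2). assert (0 < d) by (now apply Rmin_glb_lt).
  destruct (Rlt_dec x b) as [Hxb|Hxb].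
  - exists (x + Rmin (d/2) (b - x)).
    assert (0 < Rmin (d/2) (b-x)) by (apply Rmin_glb_lt; lra).
    assert (Hl := Rmin_l (d/2) (b-x)). assert (Hr := Rmin_r (d/2) (b-x)).
    repeat split; try lra. rewrite Rabs_right; lra.
  - exists (x - Rmin (d/2) (x - a)).
    assert (0 < Rmin (d/2) (x-a)) by (apply Rmin_glb_lt; lra).
    assert (Hl := Rmin_l (d/2) (x-a)). assert (Hr := Rmin_r (d/2) (x-a)).
    repeat split; try lra. rewrite Rabs_left; lra. }
specialize (K1 y Hy (Rlt_le_trans _ _ _ Hyd (Rmin_l _ _))).
specialize (K2 y Hy (Rlt_le_trans _ _ _ Hyd (Rmin_r _ _))).
assert (0 < Rabs (y - x)) by (apply Rabs_pos_lt; lra).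
assert (Rabs ((l1 - l2) * (y - x)) <= Rabs (l1 - l2) / 2 * Rabs (y - x)).
{ replace ((l1 - l2) * (y - x)) with
    ((f y - f x - l2 * (y - x)) - (f y - f x - l1 * (y - x))) by ring.
  eapply Rle_trans; [apply Rabs_triang|]. rewrite Rabs_Ropp. lra. }
rewrite Rabs_mult in H0.
assert (Rabs (l1 - l2) <= Rabs (l1 - l2) / 2) by (apply (Rmult_le_reg_r (Rabs (y - x))); lra).
lra.
Qed.

Lemma Derive_on_eq (a b : R) (f : R -> R) (x l : R) :
  a < b -> a <= x <= b -> is_derive_on a b f x l -> Derive_on a b f x = l.
Proof.
intros Hab Hx H. unfold Derive_on. apply (@iota_unique R_AbsRing R_CompleteNormedModule); [|exact H].
intros y Hy. now apply (is_derive_on_unique a b f x).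
Qed.

Lemma Derive_on_correct (a b : R) (f : R -> R) (x : R) :
  a < b -> a <= x <= b -> ex_derive_on a b f x ->
  is_derive_on a b f x (Derive_on a b f x).
Proof.
intros Hab Hx [l Hl]. now rewrite (Derive_on_eq a b f x l).
Qed.

Definition cont_at_on (a b : R) (f : R -> R) (x : R) : Prop :=
  forall eps, 0 < eps -> exists d, 0 < d /\ forall y, a <= y <= b ->
    Rabs (y - x) < d -> Rabs (f y - f x) < eps.

Lemma continuous_on_iff (a b : R) (f : R -> R) :
  continuous_on (fun x => a <= x <= b) f <->
  forall x, a <= x <= b -> cont_at_on a b f x.
Proof.
split.
- intros H x Hx eps Heps.
  assert (Hb := H x Hx (ball (f x) eps) (locally_ball (f x) (mkposreal eps Heps))).
  apply within_locally_iff in Hb. destruct Hb as [d [Hd Hb]].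
  exists d. split; [exact Hd|]. intros y Hy Hyx. exact (Hb y Hy Hyx).
- intros H x Hx P [eps He].
  destruct (H x Hx eps (cond_pos eps)) as [d [Hd Hb]].
  apply within_locally_iff. exists d. split; [exact Hd|].
  intros y Hy Hyx. apply He. exact (Hb y Hy Hyx).
Qed.

Lemma is_derive_on_cont (a b : R) (f : R -> R) (x l : R) :
  a <= x <= b -> is_derive_on a b f x l -> cont_at_on a b f x.
Proof.
intros Hx H eps Heps. rewrite is_derive_on_iff in H by exact Hx.
destruct (H 1 Rlt_0_1) as [d [Hd H']].
assert (Hl : 0 < Rabs l + 2) by (assert (H0 := Rabs_pos l); lra).
exists (Rmin d (eps / (Rabs l + 2))). split.
{ apply Rmin_glb_lt; [exact Hd|]. now apply Rdiv_lt_0_compat. }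
intros y Hy Hyx.
assert (H1 : Rabs (y - x) < d) by (eapply Rlt_le_trans; [exact Hyx|apply Rmin_l]).
assert (H2 : Rabs (y - x) < eps / (Rabs l + 2)) by (eapply Rlt_le_trans; [exact Hyx|apply Rmin_r]).
specialize (H' y Hy H1).
apply (Rmult_lt_compat_r (Rabs l + 2)) in H2; [|exact Hl].
unfold Rdiv in H2; rewrite Rmult_assoc, Rinv_l, Rmult_1_r in H2 by lra.
replace (f y - f x) with ((f y - f x - l * (y - x)) + l * (y - x)) by ring.
eapply Rle_lt_trans; [apply Rabs_triang|]. rewrite (Rabs_mult l).
assert (H3 := Rabs_pos (y - x)). lra.
Qed.

Lemma cont_at_on_subinterval (a b a' b' : R) (f : R -> R) (x : R) :
  a <= a' -> b' <= b -> cont_at_on a b f x -> cont_at_on a' b' f x.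
Proof.
intros Ha Hb H eps Heps. destruct (H eps Heps) as [d [Hd H']].
exists d. split; [exact Hd|]. intros y Hy. apply H'. lra.
Qed.

Lemma cont_at_on_comp_pt (a b : R) (f u : R -> R) (x : R) :
  continuity_pt f (u x) -> cont_at_on a b u x -> cont_at_on a b (fun t => f (u t)) x.
Proof.
intros Hf Hu eps Heps.
destruct (Hf eps Heps) as [e [He Hf']].
destruct (Hu e He) as [d [Hd Hu']].
exists d. split; [exact Hd|]. intros y Hy Hyx.
destruct (Req_dec (u x) (u y)) as [E|E].
{ rewrite E, Rminus_diag, Rabs_R0. exact Heps. }
apply Hf'. split; [split; [exact I|exact E]|]. apply Hu'; assumption.
Qed.

Lemma cont_at_on_comp_2d (a b : R) (F : R -> R -> R) (u v : R -> R) (x : R) :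
  continuity_2d_pt F (u x) (v x) -> cont_at_on a b u x -> cont_at_on a b v x ->
  cont_at_on a b (fun t => F (u t) (v t)) x.
Proof.
intros HF Hu Hv eps Heps.
destruct (HF (mkposreal eps Heps)) as [e He].
destruct (Hu e (cond_pos e)) as [d1 [Hd1 Hu']].
destruct (Hv e (cond_pos e)) as [d2 [Hd2 Hv']].
exists (Rmin d1 d2). split; [now apply Rmin_glb_lt|]. intros y Hy Hyx.
apply He.
- apply Hu'; [exact Hy|]. eapply Rlt_le_trans; [exact Hyx|apply Rmin_l].
- apply Hv'; [exact Hy|]. eapply Rlt_le_trans; [exact Hyx|apply Rmin_r].
Qed.

Lemma cont_at_on_comp (a b c d : R) (f u : R -> R) (x : R) :
  (forall t, a <= t <= b -> c <= u t <= d) ->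
  cont_at_on c d f (u x) -> cont_at_on a b u x -> cont_at_on a b (fun t => f (u t)) x.
Proof.
intros Hr Hf Hu eps Heps.
destruct (Hf eps Heps) as [e [He Hf']].
destruct (Hu e He) as [d' [Hd Hu']].
exists d'. split; [exact Hd|]. intros y Hy Hyx. apply Hf'; [now apply Hr|now apply Hu'].
Qed.

Lemma cont_at_on_ext (a b : R) (f g : R -> R) (x : R) :
  a <= x <= b -> (forall t, a <= t <= b -> f t = g t) ->
  cont_at_on a b f x -> cont_at_on a b g x.
Proof.
intros Hx E H eps Heps. destruct (H eps Heps) as [d [Hd H']].
exists d. split; [exact Hd|]. intros y Hy Hyx. rewrite <- !E by lra. now apply H'.
Qed.

Lemma is_derive_on_comp (a b c d : R) (f u : R -> R) (x l l' : R) :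
  a <= x <= b -> (forall t, a <= t <= b -> c <= u t <= d) ->
  is_derive_on c d f (u x) l -> is_derive_on a b u x l' ->
  is_derive_on a b (fun t => f (u t)) x (l * l').
Proof.
intros Hx Hr Hf Hu.
assert (Hc := is_derive_on_cont _ _ _ _ _ Hx Hu).
rewrite is_derive_on_iff in Hu |- * by exact Hx.
rewrite is_derive_on_iff in Hf by (now apply Hr).
intros eps Heps.
(* [A] bounds the difference quotients of [u] near [x] and [B] exceeds |l|; half of [eps] goes to
   the error of [f] and half to that of [u]. *)
set (A := Rabs l' + 1). set (B := Rabs l + 1).
assert (0 < A) by (unfold A; assert (H := Rabs_pos l'); lra).
assert (0 < B) by (unfold B; assert (H0 := Rabs_pos l); lra).
destruct (Hf (eps / (2 * A))) as [e [He Hf']].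
{ apply Rdiv_lt_0_compat; lra. }
destruct (Hc e He) as [d1 [Hd1 Hc']].
assert (He2 : 0 < Rmin 1 (eps / (2 * B))).
{ apply Rmin_glb_lt; [lra|]. apply Rdiv_lt_0_compat; lra. }
destruct (Hu _ He2) as [d2 [Hd2 Hu']].
exists (Rmin d1 d2). split; [now apply Rmin_glb_lt|]. intros y Hy Hyx.
assert (Hy1 : Rabs (y - x) < d1) by (eapply Rlt_le_trans; [exact Hyx|apply Rmin_l]).
assert (Hy2 : Rabs (y - x) < d2) by (eapply Rlt_le_trans; [exact Hyx|apply Rmin_r]).
specialize (Hf' (u y) (Hr y Hy) (Hc' y Hy Hy1)). specialize (Hu' y Hy Hy2).
assert (H1 := Rmin_l 1 (eps / (2 * B))). assert (H2 := Rmin_r 1 (eps / (2 * B))).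
set (m := Rmin 1 (eps / (2 * B))) in *.
set (k := Rabs (y - x)) in *. assert (0 <= k) by apply Rabs_pos.
assert (Hk : Rabs (u y - u x) <= A * k).
{ replace (u y - u x) with ((u y - u x - l' * (y - x)) + l' * (y - x)) by ring.
  eapply Rle_trans; [apply Rabs_triang|]. rewrite (Rabs_mult l'). fold k.
  unfold A. assert (m * k <= 1 * k) by (apply Rmult_le_compat_r; lra). lra. }
replace (f (u y) - f (u x) - l * l' * (y - x)) with
  ((f (u y) - f (u x) - l * (u y - u x)) + l * (u y - u x - l' * (y - x))) by ring.
eapply Rle_trans; [apply Rabs_triang|]. rewrite (Rabs_mult l).
assert (E1 : eps / (2 * A) * Rabs (u y - u x) <= eps / 2 * k).
{ replace (eps / 2 * k) with (eps / (2 * A) * (A * k)) by (field; lra).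
  apply Rmult_le_compat_l; [|exact Hk]. apply Rlt_le, Rdiv_lt_0_compat; lra. }
assert (E2 : Rabs l * Rabs (u y - u x - l' * (y - x)) <= eps / 2 * k).
{ apply Rle_trans with (B * (eps / (2 * B) * k)).
  - apply Rmult_le_compat; try apply Rabs_pos.
    + unfold B; lra.
    + eapply Rle_trans; [exact Hu'|]. apply Rmult_le_compat_r; lra.
  - right. field. lra. }
lra.
Qed.

Lemma is_derive_on_const (a b c x : R) : a <= x <= b -> is_derive_on a b (fun _ => c) x 0.
Proof. intros Hx. apply is_derive_derive_on; [exact Hx|]. apply @is_derive_const. Qed.

Lemma is_derive_on_id (a b x : R) : a <= x <= b -> is_derive_on a b (fun t => t) x 1.
Proof. intros Hx. apply is_derive_derive_on; [exact Hx|]. apply @is_derive_id. Qed.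

(** * Planar sets and functions *)

(** Phrased with [locally_2d], so that the neighbourhoods are the same boxes as those of
    [continuity_2d_pt]. *)
Definition closed_2d (K : R -> R -> Prop) : Prop :=
  forall x y, ~ K x y -> locally_2d (fun u v => ~ K u v) x y.

Lemma closed_2d_forall {T : Type} (K : T -> R -> R -> Prop) :
  (forall i, closed_2d (K i)) -> closed_2d (fun x y => forall i, K i x y).
Proof.
intros H x y Hn. apply not_all_ex_not in Hn. destruct Hn as [i Hi].
apply (locally_2d_impl (fun u v => ~ K i u v)); [|now apply H].
apply locally_2d_forall. intros u v Hu Hall. now apply Hu.
Qed.

Lemma closed_2d_and (K L : R -> R -> Prop) :
  closed_2d K -> closed_2d L -> closed_2d (fun x y => K x y /\ L x y).
Proof.
intros HK HL x y Hn. destruct (not_and_or _ _ Hn) as [H|H].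
- apply (locally_2d_impl (fun u v => ~ K u v)); [|now apply HK].
  apply locally_2d_forall. tauto.
- apply (locally_2d_impl (fun u v => ~ L u v)); [|now apply HL].
  apply locally_2d_forall. tauto.
Qed.

Lemma closed_2d_or (K L : R -> R -> Prop) :
  closed_2d K -> closed_2d L -> closed_2d (fun x y => K x y \/ L x y).
Proof.
intros HK HL x y Hn. apply not_or_and in Hn. destruct Hn as [H1 H2].
apply (locally_2d_impl (fun u v => ~ K u v)); [|now apply HK].
apply (locally_2d_impl (fun u v => ~ L u v)); [|now apply HL].
apply locally_2d_forall. tauto.
Qed.

(** Continuity on the whole plane. Functions given on a triangle are extended by a retraction, so
    that parameter integrals and their derivatives never meet a boundary. *)
Definition cont2 (F : R -> R -> R) : Prop := forall x y, continuity_2d_pt F x y.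

Lemma closed_2d_ge (F : R -> R -> R) (c : R) : cont2 F -> closed_2d (fun x y => c <= F x y).
Proof.
intros HF x y Hn. apply Rnot_le_lt in Hn.
assert (He : 0 < c - F x y) by lra.
destruct (HF x y (mkposreal _ He)) as [d Hd]. exists d.
intros u v Hu Hv H. specialize (Hd u v Hu Hv). simpl in Hd.
apply Rabs_def2 in Hd. lra.
Qed.

Lemma cont2_opp (F : R -> R -> R) : cont2 F -> cont2 (fun x y => - F x y).
Proof. intros H x y. now apply continuity_2d_pt_opp. Qed.
Lemma cont2_plus (F K : R -> R -> R) : cont2 F -> cont2 K -> cont2 (fun x y => F x y + K x y).
Proof. intros H H' x y. now apply continuity_2d_pt_plus. Qed.
Lemma cont2_minus (F K : R -> R -> R) : cont2 F -> cont2 K -> cont2 (fun x y => F x y - K x y).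
Proof. intros H H' x y. now apply continuity_2d_pt_minus. Qed.
Lemma cont2_mult (F K : R -> R -> R) : cont2 F -> cont2 K -> cont2 (fun x y => F x y * K x y).
Proof. intros H H' x y. now apply continuity_2d_pt_mult. Qed.
Lemma cont2_const (c : R) : cont2 (fun _ _ => c).
Proof. intros x y. apply continuity_2d_pt_const. Qed.
Lemma cont2_fst (f : R -> R) : (forall x, continuity_pt f x) -> cont2 (fun x _ => f x).
Proof.
intros H x y. apply (continuity_1d_2d_pt_comp f (fun u _ => u)); [apply H|apply continuity_2d_pt_id1].
Qed.
Lemma cont2_snd (f : R -> R) : (forall x, continuity_pt f x) -> cont2 (fun _ y => f y).
Proof.
intros H x y. apply (continuity_1d_2d_pt_comp f (fun _ v => v)); [apply H|apply continuity_2d_pt_id2].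
Qed.

Lemma continuity_2d_pt_comp2 (F u v : R -> R -> R) (x y : R) :
  continuity_2d_pt F (u x y) (v x y) -> continuity_2d_pt u x y -> continuity_2d_pt v x y ->
  continuity_2d_pt (fun s t => F (u s t) (v s t)) x y.
Proof.
intros HF Hu Hv eps. destruct (HF eps) as [e He].
destruct (Hu e) as [d1 H1]. destruct (Hv e) as [d2 H2].
assert (Hd : 0 < Rmin d1 d2) by (apply Rmin_glb_lt; apply cond_pos).
exists (mkposreal _ Hd). simpl. intros s t Hs Ht.
assert (L1 := Rmin_l d1 d2). assert (L2 := Rmin_r d1 d2).
apply He; [apply H1|apply H2]; lra.
Qed.

Lemma continuity_2d_pt_fst_pt (F : R -> R -> R) (x y : R) :
  continuity_2d_pt F x y -> continuity_pt (fun t => F t y) x.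
Proof.
intros H eps Heps. destruct (H (mkposreal eps Heps)) as [d Hd].
exists d. split; [apply cond_pos|]. intros z [_ Hz].
apply Hd; [exact Hz|]. rewrite Rminus_diag, Rabs_R0. apply cond_pos.
Qed.

Lemma continuity_2d_pt_snd_pt (F : R -> R -> R) (x y : R) :
  continuity_2d_pt F x y -> continuity_pt (fun t => F x t) y.
Proof.
intros H eps Heps. destruct (H (mkposreal eps Heps)) as [d Hd].
exists d. split; [apply cond_pos|]. intros z [_ Hz].
apply Hd; [|exact Hz]. rewrite Rminus_diag, Rabs_R0. apply cond_pos.
Qed.

Lemma closed_2d_eq (F : R -> R -> R) (c : R) : cont2 F -> closed_2d (fun x y => F x y = c).
Proof.
intros HF x y Hn.
assert (H : closed_2d (fun x y => c <= F x y /\ - c <= - F x y)).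
{ apply closed_2d_and; apply closed_2d_ge; [exact HF|now apply cont2_opp]. }
apply (locally_2d_impl (fun u v => ~ (c <= F u v /\ - c <= - F u v))).
- apply locally_2d_forall. intros u v H1 H2. apply H1. lra.
- apply H. intros [H1 H2]. apply Hn. lra.
Qed.

(* The radius handed to the Lebesgue-number lemma is also capped by F/2, so
   that the Lebesgue number itself bounds F from below. *)
Lemma pos_lower_bound_2d (K : R -> R -> Prop) (F : R -> R -> R) (a b c d : R) :
  closed_2d K -> (forall x y, K x y -> a <= x <= b /\ c <= y <= d) ->
  (forall x y, K x y -> continuity_2d_pt F x y /\ 0 < F x y) ->
  exists m, 0 < m /\ forall x y, K x y -> m <= F x y.
Proof.
intros HK Hbox HF.
assert (Hdelta : forall x y, exists r : posreal,
  (forall u v, Rabs (u - x) < r -> Rabs (v - y) < r -> K u v -> r <= F u v)).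
{ intros x y. destruct (classic (K x y)) as [Hxy|Hxy].
  - destruct (HF x y Hxy) as [Hc Hp].
    assert (He : 0 < F x y / 2) by lra.
    destruct (Hc (mkposreal _ He)) as [r Hr].
    assert (Hr' : 0 < Rmin r (F x y / 2)) by (apply Rmin_glb_lt; [apply cond_pos|lra]).
    exists (mkposreal _ Hr'). simpl. intros u v Hu Hv _.
    assert (L1 := Rmin_l r (F x y / 2)). assert (L2 := Rmin_r r (F x y / 2)).
    specialize (Hr u v ltac:(lra) ltac:(lra)). simpl in Hr.
    apply Rabs_def2 in Hr. lra.
  - destruct (HK x y Hxy) as [r Hr]. exists r. intros u v Hu Hv Huv.
    exfalso. now apply (Hr u v Hu Hv). }
set (delta := fun x y => proj1_sig (constructive_indefinite_description _ (Hdelta x y))).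
assert (Hd : forall x y u v, Rabs (u - x) < delta x y -> Rabs (v - y) < delta x y ->
  K u v -> delta x y <= F u v).
{ intros x y. exact (proj2_sig (constructive_indefinite_description _ (Hdelta x y))). }
destruct (compactness_value_2d a b c d delta) as [m Hm].
exists m. split; [apply cond_pos|]. intros x y Hxy.
destruct (Hbox x y Hxy) as [Hx Hy].
apply NNPP. intros Hn. apply (Hm x y Hx Hy).
intros [u [v [_ [_ [H1 [H2 H3]]]]]]. apply Hn.
eapply Rle_trans; [exact H3|]. now apply Hd.
Qed.

(** On the compact part of [K] where the ordinate stays [eps] away from [u t], uniqueness over [t]
    makes |x - t| positive, hence bounded below; that bound is the modulus of continuity. The
    functions defined below by solving equations get their continuity in this way. *)
Lemma closed_graph_cont (K : R -> R -> Prop) (u : R -> R) (a b c d t : R) :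
  closed_2d K -> (forall x y, K x y -> a <= x <= b /\ c <= y <= d) ->
  (forall x, a <= x <= b -> K x (u x)) ->
  (forall y, K t y -> y = u t) ->
  cont_at_on a b u t.
Proof.
intros HK Hbox Hu Huniq eps Heps.
destruct (pos_lower_bound_2d (fun x y => K x y /\ eps <= Rabs (y - u t))
            (fun x _ => Rabs (x - t)) a b c d) as [m [Hm H]].
- apply closed_2d_and; [exact HK|].
  apply (closed_2d_ge (fun _ y => Rabs (y - u t))). apply (cont2_snd (fun y => Rabs (y - u t))).
  intros y. apply (continuity_pt_comp (fun y => y - u t) Rabs).
  + reg.
  + apply Rcontinuity_abs.
- intros x y [Hxy _]. now apply Hbox.
- intros x y [Hxy He]. split.
  + apply (cont2_fst (fun x => Rabs (x - t))). intros z.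
    apply (continuity_pt_comp (fun y => y - t) Rabs); [reg|apply Rcontinuity_abs].
  + apply Rabs_pos_lt. intros E. assert (x = t) as -> by lra.
    rewrite (Huniq y Hxy), Rminus_diag, Rabs_R0 in He. lra.
- exists m. split; [exact Hm|]. intros y Hy Hyt.
  apply Rnot_le_lt. intros Hle.
  specialize (H y (u y) (conj (Hu y Hy) Hle)). simpl in H. lra.
Qed.

(** * Retraction of the line onto an interval *)

Definition clamp (a b x : R) : R := Rmax a (Rmin b x).

Lemma clamp_range (a b x : R) : a <= b -> a <= clamp a b x <= b.
Proof.
intros H. unfold clamp. split; [apply Rmax_l|].
apply Rmax_lub; [exact H|apply Rmin_l].
Qed.

Lemma clamp_id (a b x : R) : a <= x <= b -> clamp a b x = x.
Proof. intros H. unfold clamp. rewrite Rmin_right, Rmax_right; lra. Qed.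

Lemma clamp_lipschitz (a b x y : R) : Rabs (clamp a b x - clamp a b y) <= Rabs (x - y).
Proof.
unfold clamp, Rmax, Rmin. destruct (Rle_dec b x), (Rle_dec b y);
repeat match goal with |- context [Rle_dec ?u ?v] => destruct (Rle_dec u v) end;
unfold Rabs; repeat match goal with |- context [Rcase_abs ?u] => destruct (Rcase_abs u) end; lra.
Qed.

Lemma continuity_pt_of_lipschitz (f : R -> R) (x : R) :
  (forall y, Rabs (f y - f x) <= Rabs (y - x)) -> continuity_pt f x.
Proof.
intros H eps Heps. exists eps. split; [exact Heps|]. intros y [_ Hy].
eapply Rle_lt_trans; [apply H|exact Hy].
Qed.

Lemma continuity_clamp (a b x : R) : continuity_pt (clamp a b) x.
Proof. apply continuity_pt_of_lipschitz. intros y. apply clamp_lipschitz. Qed.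

(** Turns relative continuity into continuity on the line, the form in which the mean value,
    intermediate value and extreme value theorems take their hypothesis. *)
Lemma cont_at_on_clamp (a b : R) (f : R -> R) :
  a <= b -> (forall x, a <= x <= b -> cont_at_on a b f x) ->
  forall x, continuity_pt (fun t => f (clamp a b t)) x.
Proof.
intros Hab H x eps Heps.
destruct (H (clamp a b x) (clamp_range a b x Hab) eps Heps) as [d [Hd H']].
exists d. split; [exact Hd|]. intros y [_ Hy].
apply H'; [now apply clamp_range|].
eapply Rle_lt_trans; [apply clamp_lipschitz|exact Hy].
Qed.

Lemma continuity_pt_cont_at_on (a b : R) (f : R -> R) (x : R) :
  continuity_pt f x -> cont_at_on a b f x.
Proof.
intros H. apply (cont_at_on_comp_pt a b f (fun t => t)); [exact H|].
intros eps Heps. exists eps. split; [exact Heps|]. now intros y _ Hy.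
Qed.

Lemma locally_interior (a b x : R) (P : R -> Prop) :
  a < x < b -> (forall y, a < y < b -> P y) -> locally x P.
Proof.
intros Hx H. assert (Hd : 0 < Rmin (x - a) (b - x)) by (apply Rmin_glb_lt; lra).
exists (mkposreal _ Hd). intros y Hy. apply H.
assert (Hy' : Rabs (y - x) < Rmin (x - a) (b - x)) by exact Hy.
assert (L1 := Rmin_l (x - a) (b - x)). assert (L2 := Rmin_r (x - a) (b - x)).
apply Rabs_def2 in Hy'. lra.
Qed.

(** * Mean value, monotonicity and extremum arguments on a closed interval *)

Lemma mvt_on (a b : R) (f f' : R -> R) :
  a < b -> (forall x, a <= x <= b -> cont_at_on a b f x) ->
  (forall x, a < x < b -> is_derive f x (f' x)) ->
  exists c, a < c < b /\ f b - f a = f' c * (b - a).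
Proof.
intros Hab Hc Hd.
set (g := fun t => f (clamp a b t)).
assert (Hg : forall x, a < x < b -> derivable_pt_lim g x (f' x)).
{ intros x Hx. apply is_derive_Reals.
  apply (is_derive_ext_loc f); [|now apply Hd].
  apply (locally_interior a b); [exact Hx|]. intros y Hy. unfold g.
  rewrite clamp_id; lra. }
assert (pr : forall c, a < c < b -> derivable_pt g c).
{ intros c Hx. exists (f' c). now apply Hg. }
destruct (MVT g id a b pr (fun c _ => derivable_pt_id c) Hab) as [c [P E]].
- intros c _. now apply cont_at_on_clamp; [lra|].
- intros c _. apply derivable_continuous_pt, derivable_pt_id.
- exists c. split; [exact P|].
  rewrite (derive_pt_eq_0 g c (f' c) (pr c P) (Hg c P)) in E.
  rewrite derive_pt_id in E. unfold g, id in E.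
  rewrite !clamp_id in E by lra. lra.
Qed.

Lemma nondecr_on (a b : R) (f : R -> R) :
  a <= b -> (forall x, a <= x <= b -> cont_at_on a b f x) ->
  (forall x, a < x < b -> exists l, is_derive f x l /\ 0 <= l) -> f a <= f b.
Proof.
intros Hab Hc Hd. destruct (Req_dec a b) as [->|Hne]; [lra|].
destruct (mvt_on a b f (Derive f)) as [c [Hx E]]; [lra|exact Hc| |].
- intros x Hx. destruct (Hd x Hx) as [l [Hl _]]. apply Derive_correct. now exists l.
- destruct (Hd c Hx) as [l [Hl Hl0]]. rewrite (is_derive_unique _ _ _ Hl) in E. nra.
Qed.

Lemma incr_on (a b : R) (f : R -> R) :
  a < b -> (forall x, a <= x <= b -> cont_at_on a b f x) ->
  (forall x, a < x < b -> exists l, is_derive f x l /\ 0 < l) -> f a < f b.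
Proof.
intros Hab Hc Hd.
destruct (mvt_on a b f (Derive f)) as [c [Hx E]]; [lra|exact Hc| |].
- intros x Hx. destruct (Hd x Hx) as [l [Hl _]]. apply Derive_correct. now exists l.
- destruct (Hd c Hx) as [l [Hl Hl0]]. rewrite (is_derive_unique _ _ _ Hl) in E. nra.
Qed.

Lemma is_derive_zero_eq (a b : R) (f : R -> R) :
  a <= b -> (forall x, a <= x <= b -> cont_at_on a b f x) ->
  (forall x, a < x < b -> is_derive f x 0) -> f a = f b.
Proof.
intros Hab Hc Hd. destruct (Req_dec a b) as [->|Hne]; [lra|].
destruct (mvt_on a b f (fun _ => 0)) as [c [Hx E]]; [lra|exact Hc|exact Hd|].
lra.
Qed.

Lemma ivt_on (a b : R) (f : R -> R) (y : R) :
  a <= b -> (forall x, a <= x <= b -> cont_at_on a b f x) ->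
  Rmin (f a) (f b) <= y <= Rmax (f a) (f b) -> exists c, a <= c <= b /\ f c = y.
Proof.
intros Hab Hc Hy.
destruct (IVT_gen (fun t => f (clamp a b t)) a b y) as [x [Hx E]].
- intros x. now apply cont_at_on_clamp.
- rewrite !clamp_id by lra. exact Hy.
- exists (clamp a b x). split; [now apply clamp_range|exact E].
Qed.

Lemma max_attained_on (a b : R) (f : R -> R) :
  a <= b -> (forall x, a <= x <= b -> cont_at_on a b f x) ->
  exists c, a <= c <= b /\ forall x, a <= x <= b -> f x <= f c.
Proof.
intros Hab Hc.
destruct (continuity_ab_maj (fun t => f (clamp a b t)) a b Hab) as [c [H Hcab]].
- intros x _. now apply cont_at_on_clamp.
- exists c. split; [exact Hcab|]. intros x Hx. specialize (H x Hx).
  now rewrite !clamp_id in H by lra.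
Qed.

Lemma bounded_on (a b : R) (f : R -> R) :
  a <= b -> (forall x, a <= x <= b -> cont_at_on a b f x) ->
  exists M, 0 < M /\ forall x, a <= x <= b -> Rabs (f x) <= M.
Proof.
intros Hab Hc. destruct (max_attained_on a b (fun x => Rabs (f x)) Hab) as [c [_ H]].
- intros x Hx. apply cont_at_on_comp_pt; [apply Rcontinuity_abs|now apply Hc].
- exists (Rabs (f c) + 1). split; [assert (H0 := Rabs_pos (f c)); lra|].
  intros x Hx. specialize (H x Hx). simpl in H. lra.
Qed.

Lemma is_derive_comp_R (f g : R -> R) (x lf lg : R) :
  is_derive f (g x) lf -> is_derive g x lg -> is_derive (fun t => f (g t)) x (lf * lg).
Proof.
intros Hf Hg. rewrite Rmult_comm. exact (is_derive_comp f g x lf lg Hf Hg).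
Qed.

Lemma is_derive_continuity_pt (f : R -> R) (x l : R) : is_derive f x l -> continuity_pt f x.
Proof.
intros H. apply continuity_pt_filterlim. apply (ex_derive_continuous f). now exists l.
Qed.

(** * Differentiation along implicitly defined curves *)

(* The defining relations are linearised at [t]; since the linear system has
   determinant [det <> 0], the increments of [u] and [v] are controlled by
   that of the parameter, and Cramer's rule gives the derivatives. *)
Lemma implicit_curve (a b t : R) (u v A B : R -> R) (F K : R -> R -> R)
    (Fu Fv Ku Kv A' B' : R) :
  a <= t <= b ->
  cont_at_on a b u t -> cont_at_on a b v t ->
  differentiable_pt_lim F (u t) (v t) Fu Fv ->
  differentiable_pt_lim K (u t) (v t) Ku Kv ->
  is_derive_on a b A t A' -> is_derive_on a b B t B' ->
  (forall s, a <= s <= b -> F (u s) (v s) = A s) ->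
  (forall s, a <= s <= b -> K (u s) (v s) = B s) ->
  Fu * Kv - Fv * Ku <> 0 ->
  is_derive_on a b u t ((A' * Kv - B' * Fv) / (Fu * Kv - Fv * Ku)) /\
  is_derive_on a b v t ((B' * Fu - A' * Ku) / (Fu * Kv - Fv * Ku)).
Proof.
intros Ht Hu Hv HF HK HA HB EF EK Hdet.
rewrite is_derive_on_iff in HA, HB by exact Ht.
set (det := Fu * Kv - Fv * Ku) in *.
set (lu := (A' * Kv - B' * Fv) / det). set (lv := (B' * Fu - A' * Ku) / det).
set (C := (Rabs Fu + Rabs Fv + Rabs Ku + Rabs Kv) / Rabs det).
assert (Hdp : 0 < Rabs det) by (now apply Rabs_pos_lt).
assert (HC : 0 <= C).
{ unfold C. apply Rmult_le_pos; [|left; now apply Rinv_0_lt_compat].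
  assert (H1 := Rabs_pos Fu). assert (H2 := Rabs_pos Fv).
  assert (H3 := Rabs_pos Ku). assert (H4 := Rabs_pos Kv). lra. }
set (L := 2 * (Rabs lu + Rabs lv) + 2).
assert (HL : 0 < L).
{ unfold L. assert (H1 := Rabs_pos lu). assert (H2 := Rabs_pos lv). lra. }
assert (key : forall eps, 0 < eps -> exists d, 0 < d /\ forall s, a <= s <= b ->
  Rabs (s - t) < d ->
  Rabs (u s - u t - lu * (s - t)) <= eps * Rabs (s - t) /\
  Rabs (v s - v t - lv * (s - t)) <= eps * Rabs (s - t)).
{ intros eps Heps.
  (* The bound C e <= 1/2 allows the increment [N] to be absorbed into the left-hand side, which
     yields N + |h| <= L |h|; the bound C e L <= eps then makes the remainder at most eps |h|. *)
  set (e := Rmin (eps / ((C + 1) * L)) (/ (2 * (C + 1)))).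
  assert (HCL : 0 < (C + 1) * L) by (apply Rmult_lt_0_compat; lra).
  assert (He : 0 < e).
  { unfold e. apply Rmin_glb_lt; [now apply Rdiv_lt_0_compat|apply Rinv_0_lt_compat; lra]. }
  assert (HeL : C * e * L <= eps).
  { assert (e <= eps / ((C + 1) * L)) by apply Rmin_l.
    apply (Rmult_le_compat_r ((C + 1) * L)) in H; [|lra].
    unfold Rdiv in H. rewrite Rmult_assoc, Rinv_l, Rmult_1_r in H by lra.
    assert (0 < e * L) by (now apply Rmult_lt_0_compat). nra. }
  assert (He2 : C * e <= / 2).
  { assert (e <= / (2 * (C + 1))) by apply Rmin_r.
    apply (Rmult_le_compat_r (2 * (C + 1))) in H; [|lra].
    rewrite Rinv_l in H by lra. nra. }
  destruct (HF (mkposreal e He)) as [r1 Hr1].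
  destruct (HK (mkposreal e He)) as [r2 Hr2]. simpl in Hr1, Hr2.
  set (r := Rmin r1 r2).
  assert (Hr : 0 < r) by (apply Rmin_glb_lt; apply cond_pos).
  assert (Hrl : r <= r1) by apply Rmin_l. assert (Hrr : r <= r2) by apply Rmin_r.
  destruct (Hu r Hr) as [d1 [Hd1 Hu']]. destruct (Hv r Hr) as [d2 [Hd2 Hv']].
  destruct (HA e He) as [d3 [Hd3 HA']]. destruct (HB e He) as [d4 [Hd4 HB']].
  exists (Rmin (Rmin d1 d2) (Rmin d3 d4)). split.
  { repeat apply Rmin_glb_lt; assumption. }
  intros s Hs Hst.
  assert (M1 := Rmin_l (Rmin d1 d2) (Rmin d3 d4)). assert (M2 := Rmin_r (Rmin d1 d2) (Rmin d3 d4)).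
  assert (M3 := Rmin_l d1 d2). assert (M4 := Rmin_r d1 d2).
  assert (M5 := Rmin_l d3 d4). assert (M6 := Rmin_r d3 d4).
  specialize (Hu' s Hs ltac:(lra)). specialize (Hv' s Hs ltac:(lra)).
  specialize (HA' s Hs ltac:(lra)). specialize (HB' s Hs ltac:(lra)).
  specialize (Hr1 (u s) (v s) ltac:(lra) ltac:(lra)).
  specialize (Hr2 (u s) (v s) ltac:(lra) ltac:(lra)).
  rewrite !EF in Hr1 by lra. rewrite !EK in Hr2 by lra.
  set (h := s - t) in *. set (du := u s - u t) in *. set (dv := v s - v t) in *.
  set (N := Rmax (Rabs du) (Rabs dv)) in *.
  set (e1 := Fu * du + Fv * dv - A' * h).
  set (e2 := Ku * du + Kv * dv - B' * h).
  assert (Hh := Rabs_pos h).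
  assert (HN1 : Rabs du <= N) by apply Rmax_l. assert (HN2 : Rabs dv <= N) by apply Rmax_r.
  assert (HN0 : 0 <= N) by (eapply Rle_trans; [apply Rabs_pos|exact HN1]).
  assert (B1 : Rabs e1 <= e * (N + Rabs h)).
  { replace e1 with ((A s - A t - A' * h) - (A s - A t - (Fu * du + Fv * dv)))
      by (unfold e1; ring).
    eapply Rle_trans; [apply Rabs_triang|]. rewrite Rabs_Ropp. lra. }
  assert (B2 : Rabs e2 <= e * (N + Rabs h)).
  { replace e2 with ((B s - B t - B' * h) - (B s - B t - (Ku * du + Kv * dv)))
      by (unfold e2; ring).
    eapply Rle_trans; [apply Rabs_triang|]. rewrite Rabs_Ropp. lra. }
  set (W := e * (N + Rabs h)) in *.
  assert (HW : 0 <= W) by (eapply Rle_trans; [apply Rabs_pos|exact B1]).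
  assert (Pu : Rabs (du - lu * h) <= C * W).
  { replace (du - lu * h) with ((Kv * e1 - Fv * e2) / det).
    2:{ unfold e1, e2, lu. unfold det. field. exact Hdet. }
    unfold Rdiv, C. rewrite Rabs_mult, Rabs_inv. unfold Rdiv.
    rewrite Rmult_assoc, (Rmult_comm (/ Rabs det)), <- Rmult_assoc.
    apply Rmult_le_compat_r; [left; now apply Rinv_0_lt_compat|].
    eapply Rle_trans; [apply Rabs_triang|]. rewrite Rabs_Ropp, !Rabs_mult.
    assert (H1 := Rabs_pos Fu). assert (H2 := Rabs_pos Fv).
    assert (H3 := Rabs_pos Ku). assert (H4 := Rabs_pos Kv).
    assert (Rabs Kv * Rabs e1 <= Rabs Kv * W) by (apply Rmult_le_compat_l; assumption).
    assert (Rabs Fv * Rabs e2 <= Rabs Fv * W) by (apply Rmult_le_compat_l; assumption).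
    nra. }
  assert (Pv : Rabs (dv - lv * h) <= C * W).
  { replace (dv - lv * h) with ((Fu * e2 - Ku * e1) / det).
    2:{ unfold e1, e2, lv. unfold det. field. exact Hdet. }
    unfold Rdiv, C. rewrite Rabs_mult, Rabs_inv. unfold Rdiv.
    rewrite Rmult_assoc, (Rmult_comm (/ Rabs det)), <- Rmult_assoc.
    apply Rmult_le_compat_r; [left; now apply Rinv_0_lt_compat|].
    eapply Rle_trans; [apply Rabs_triang|]. rewrite Rabs_Ropp, !Rabs_mult.
    assert (H1 := Rabs_pos Fu). assert (H2 := Rabs_pos Fv).
    assert (H3 := Rabs_pos Ku). assert (H4 := Rabs_pos Kv).
    assert (Rabs Ku * Rabs e1 <= Rabs Ku * W) by (apply Rmult_le_compat_l; assumption).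
    assert (Rabs Fu * Rabs e2 <= Rabs Fu * W) by (apply Rmult_le_compat_l; assumption).
    nra. }
  assert (HCW : C * W <= / 2 * (N + Rabs h)).
  { unfold W. rewrite <- Rmult_assoc. apply Rmult_le_compat_r; lra. }
  assert (Nu : Rabs du <= Rabs lu * Rabs h + C * W).
  { replace du with (lu * h + (du - lu * h)) by ring.
    eapply Rle_trans; [apply Rabs_triang|]. rewrite Rabs_mult. lra. }
  assert (Nv : Rabs dv <= Rabs lv * Rabs h + C * W).
  { replace dv with (lv * h + (dv - lv * h)) by ring.
    eapply Rle_trans; [apply Rabs_triang|]. rewrite Rabs_mult. lra. }
  assert (HNb : N <= (Rabs lu + Rabs lv) * Rabs h + C * W).
  { assert (H1 := Rabs_pos lu). assert (H2 := Rabs_pos lv).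
    unfold N. apply Rmax_lub; nra. }
  assert (HNh : N + Rabs h <= L * Rabs h) by (unfold L; nra).
  assert (HCWe : C * W <= eps * Rabs h).
  { apply Rle_trans with (C * e * L * Rabs h).
    - unfold W. rewrite !Rmult_assoc. apply Rmult_le_compat_l; [exact HC|].
      apply Rmult_le_compat_l; lra.
    - apply Rmult_le_compat_r; lra. }
  lra. }
split; apply is_derive_on_iff; try exact Ht; intros eps Heps;
destruct (key eps Heps) as [d [Hd H]]; exists d; (split; [exact Hd|]);
intros y Hy Hyt; now apply H.
Qed.

Lemma C1_differentiable (F Fx Fy : R -> R -> R) (x y : R) :
  (forall u v, is_derive (fun t => F t v) u (Fx u v)) ->
  (forall u v, is_derive (fun t => F u t) v (Fy u v)) ->
  continuity_2d_pt Fx x y -> differentiable_pt_lim F x y (Fx x y) (Fy x y).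
Proof.
intros H1 H2 Hc. apply filterdiff_differentiable_pt_lim.
apply (is_derive_filterdiff F x y Fx (Fy x y)).
- apply filter_forall. intros [u v]. apply H1.
- apply H2.
- apply continuity_2d_pt_filterlim in Hc. exact Hc.
Qed.

(** * Integrals depending on parameters *)

Lemma ex_RInt_cont (f : R -> R) (a b : R) : (forall x, continuity_pt f x) -> ex_RInt f a b.
Proof.
intros H. apply (@ex_RInt_continuous R_CompleteNormedModule). intros z _.
apply continuity_pt_filterlim, H.
Qed.

Lemma RInt_abs_le (f : R -> R) (a b M : R) :
  (forall x, continuity_pt f x) ->
  (forall x, Rmin a b <= x <= Rmax a b -> Rabs (f x) <= M) ->
  Rabs (RInt f a b) <= M * Rabs (b - a).
Proof.
intros Hc HM.
destruct (Rle_dec a b) as [Hab|Hab].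
- rewrite (Rabs_right (b - a)), Rmult_comm by lra.
  apply (abs_RInt_le_const f a b M Hab).
  + now apply ex_RInt_cont.
  + intros t Ht. apply HM. rewrite Rmin_left, Rmax_right; lra.
- rewrite <- (opp_RInt_swap f b a) by (now apply ex_RInt_cont).
  change (opp (RInt f b a)) with (- RInt f b a).
  rewrite Rabs_Ropp, Rabs_minus_sym, (Rabs_right (a - b)), Rmult_comm by lra.
  apply (abs_RInt_le_const f b a M); [lra| |].
  + now apply ex_RInt_cont.
  + intros t Ht. apply HM. rewrite Rmin_right, Rmax_left; lra.
Qed.

(** Two errors are separated: moving the end point costs at most (M + 1) |s - s0|, and moving the
    parameter changes the integrand uniformly little on a compact interval. *)
Lemma cont2_RInt_l (h : R -> R -> R) (c : R) :
  cont2 h -> cont2 (fun s t => RInt (fun z => h z t) c s).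
Proof.
intros Hh s0 t0 eps.
assert (Hh1 : forall t z, continuity_pt (fun z => h z t) z).
{ intros t z. now apply (continuity_2d_pt_fst_pt h). }
(* The margin 1 keeps every end point [s] with |s - s0| < 1 inside the compact interval. *)
set (lo := Rmin c s0 - 1). set (hi := Rmax c s0 + 1).
assert (Hlh : lo <= hi).
{ unfold lo, hi. assert (H1 := Rmin_l c s0). assert (H2 := Rmax_l c s0). lra. }
destruct (bounded_on lo hi (fun z => h z t0) Hlh) as [M [HM HMb]].
{ intros x _. now apply continuity_pt_cont_at_on. }
set (W := hi - lo + 1). assert (HW : 0 < W) by (unfold W; lra).
assert (He : 0 < Rmin 1 (eps / (2 * W))).
{ apply Rmin_glb_lt; [lra|]. apply Rdiv_lt_0_compat; [apply cond_pos|lra]. }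
destruct (uniform_continuity_2d_1d h lo hi t0 (fun x _ => Hh x t0) (mkposreal _ He)) as [d Hd].
simpl in Hd. assert (Hd0 := cond_pos d).
assert (E1 := Rmin_l 1 (eps / (2 * W))). assert (E2 := Rmin_r 1 (eps / (2 * W))).
set (e := Rmin 1 (eps / (2 * W))) in *.
assert (Hclose : forall z t, lo <= z <= hi -> Rabs (t - t0) < d -> Rabs (h z t - h z t0) < e).
{ intros z t Hz Ht. apply Rabs_def2 in Ht. apply Hd; try lra.
  rewrite Rminus_diag, Rabs_R0. exact Hd0. }
assert (Hr : 0 < Rmin d (Rmin 1 (eps / (2 * (M + 1))))).
{ repeat apply Rmin_glb_lt; try lra. apply Rdiv_lt_0_compat; [apply cond_pos|lra]. }
exists (mkposreal _ Hr). simpl. intros s t Hs Ht.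
assert (R1 := Rmin_l d (Rmin 1 (eps / (2 * (M + 1))))).
assert (R2 := Rmin_r d (Rmin 1 (eps / (2 * (M + 1))))).
assert (R3 := Rmin_l 1 (eps / (2 * (M + 1)))).
assert (R4 := Rmin_r 1 (eps / (2 * (M + 1)))).
assert (Hs1 : Rabs (s - s0) < 1) by lra. apply Rabs_def2 in Hs1.
assert (L1 := Rmin_l c s0). assert (L2 := Rmin_r c s0).
assert (L3 := Rmax_l c s0). assert (L4 := Rmax_r c s0).
assert (Eq : RInt (fun z => h z t) c s - RInt (fun z => h z t0) c s0 =
  RInt (fun z => h z t) s0 s + RInt (fun z => h z t - h z t0) c s0).
{ rewrite <- (RInt_Chasles (fun z => h z t) c s0 s) by (apply ex_RInt_cont; apply Hh1).
  assert (Em : RInt (fun z => h z t - h z t0) c s0 =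
    RInt (fun z => h z t) c s0 - RInt (fun z => h z t0) c s0).
  { apply (@RInt_minus R_CompleteNormedModule); apply ex_RInt_cont; apply Hh1. }
  rewrite Em.
  change (plus (RInt (fun z => h z t) c s0) (RInt (fun z => h z t) s0 s))
    with (RInt (fun z => h z t) c s0 + RInt (fun z => h z t) s0 s).
  ring. }
rewrite Eq. eapply Rle_lt_trans; [apply Rabs_triang|].
assert (I1 : Rabs (RInt (fun z => h z t) s0 s) <= (M + 1) * Rabs (s - s0)).
{ apply RInt_abs_le; [apply Hh1|]. intros z Hz.
  assert (Hz' : lo <= z <= hi).
  { unfold lo, hi. assert (Q1 : s0 - 1 <= Rmin s0 s) by (apply Rmin_glb; lra).
    assert (Q2 : Rmax s0 s <= s0 + 1) by (apply Rmax_lub; lra). lra. }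
  specialize (HMb z Hz'). specialize (Hclose z t Hz' ltac:(lra)).
  replace (h z t) with (h z t0 + (h z t - h z t0)) by ring.
  eapply Rle_trans; [apply Rabs_triang|]. lra. }
assert (I2 : Rabs (RInt (fun z => h z t - h z t0) c s0) <= e * Rabs (s0 - c)).
{ apply RInt_abs_le.
  - intros z. apply continuity_pt_minus; apply Hh1.
  - intros z Hz. left. apply Hclose; [unfold lo, hi; lra|lra]. }
assert (I3 : e * Rabs (s0 - c) <= eps / 2).
{ assert (Rabs (s0 - c) <= W).
  { unfold W, lo, hi, Rabs. destruct (Rcase_abs (s0 - c)); lra. }
  apply Rle_trans with (eps / (2 * W) * W); [|right; field; lra].
  apply Rmult_le_compat; try lra; [apply Rabs_pos]. }
assert (I4 : (M + 1) * Rabs (s - s0) < eps / 2).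
{ apply Rlt_le_trans with ((M + 1) * (eps / (2 * (M + 1)))); [|right; field; lra].
  apply Rmult_lt_compat_l; lra. }
lra.
Qed.

Lemma cont2_swap (h : R -> R -> R) : cont2 h -> cont2 (fun x y => h y x).
Proof.
intros H x y eps. destruct (H y x eps) as [d Hd]. exists d.
intros u v Hu Hv. now apply Hd.
Qed.

Lemma cont2_RInt_r (h : R -> R -> R) (c : R) :
  cont2 h -> cont2 (fun s t => RInt (fun z => h s z) c t).
Proof.
intros H. apply (cont2_swap (fun s t => RInt (fun z => h t z) c s)).
apply (cont2_RInt_l (fun z t => h t z)). now apply cont2_swap.
Qed.

Lemma cont2_RInt_diag_l (h : R -> R -> R) :
  cont2 h -> cont2 (fun s t => RInt (fun z => h z t) s t).
Proof.
intros H.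
assert (Hc : forall t z, continuity_pt (fun z => h z t) z).
{ intros t z. now apply (continuity_2d_pt_fst_pt h). }
intros x y.
apply (continuity_2d_pt_ext
  (fun s t => RInt (fun z => h z t) 0 t - RInt (fun z => h z t) 0 s)).
- intros s t. rewrite <- (RInt_Chasles (fun z => h z t) 0 s t) by (apply ex_RInt_cont; apply Hc).
  change (plus (RInt (fun z => h z t) 0 s) (RInt (fun z => h z t) s t))
    with (RInt (fun z => h z t) 0 s + RInt (fun z => h z t) s t). ring.
- apply continuity_2d_pt_minus.
  + apply (continuity_2d_pt_comp2 (fun s t => RInt (fun z => h z t) 0 s) (fun _ t => t) (fun _ t => t)).
    * now apply cont2_RInt_l.
    * apply continuity_2d_pt_id2.
    * apply continuity_2d_pt_id2.
  + now apply (cont2_RInt_l h 0).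
Qed.

Lemma cont2_RInt_diag_r (h : R -> R -> R) :
  cont2 h -> cont2 (fun s t => RInt (fun z => h s z) s t).
Proof.
intros H.
assert (Hc : forall s z, continuity_pt (fun z => h s z) z).
{ intros s z. now apply (continuity_2d_pt_snd_pt h). }
intros x y.
apply (continuity_2d_pt_ext
  (fun s t => RInt (fun z => h s z) 0 t - RInt (fun z => h s z) 0 s)).
- intros s t. rewrite <- (RInt_Chasles (fun z => h s z) 0 s t) by (apply ex_RInt_cont; apply Hc).
  change (plus (RInt (fun z => h s z) 0 s) (RInt (fun z => h s z) s t))
    with (RInt (fun z => h s z) 0 s + RInt (fun z => h s z) s t). ring.
- apply continuity_2d_pt_minus.
  + now apply (cont2_RInt_r h 0).
  + apply (continuity_2d_pt_comp2 (fun s t => RInt (fun z => h s z) 0 t) (fun s _ => s) (fun s _ => s)).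
    * now apply cont2_RInt_r.
    * apply continuity_2d_pt_id1.
    * apply continuity_2d_pt_id1.
Qed.

Lemma is_derive_on_comp_2d (a b t : R) (F : R -> R -> R) (u v : R -> R) (Fu Fv u' v' : R) :
  a <= t <= b -> differentiable_pt_lim F (u t) (v t) Fu Fv ->
  is_derive_on a b u t u' -> is_derive_on a b v t v' ->
  is_derive_on a b (fun s => F (u s) (v s)) t (Fu * u' + Fv * v').
Proof.
intros Ht HF Hu Hv.
assert (Cu := is_derive_on_cont _ _ _ _ _ Ht Hu).
assert (Cv := is_derive_on_cont _ _ _ _ _ Ht Hv).
rewrite is_derive_on_iff in Hu, Hv |- * by exact Ht.
intros eps Heps.
set (L := Rabs u' + Rabs v' + 1).
assert (H1 := Rabs_pos u'). assert (H2 := Rabs_pos v').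
assert (H3 := Rabs_pos Fu). assert (H4 := Rabs_pos Fv).
assert (HL : 0 < L) by (unfold L; lra).
set (W := Rabs Fu + Rabs Fv + 1). assert (HW : 0 < W) by (unfold W; lra).
assert (He : 0 < eps / (2 * L)) by (apply Rdiv_lt_0_compat; lra).
destruct (HF (mkposreal _ He)) as [r Hr]. simpl in Hr.
destruct (Cu r (cond_pos r)) as [d1 [Hd1 Cu']]. destruct (Cv r (cond_pos r)) as [d2 [Hd2 Cv']].
assert (He' : 0 < Rmin 1 (eps / (2 * W))).
{ apply Rmin_glb_lt; [lra|]. apply Rdiv_lt_0_compat; lra. }
destruct (Hu _ He') as [d3 [Hd3 Hu']]. destruct (Hv _ He') as [d4 [Hd4 Hv']].
assert (E1 := Rmin_l 1 (eps / (2 * W))). assert (E2 := Rmin_r 1 (eps / (2 * W))).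
set (e := Rmin 1 (eps / (2 * W))) in *.
exists (Rmin (Rmin d1 d2) (Rmin d3 d4)). split.
{ repeat apply Rmin_glb_lt; assumption. }
intros s Hs Hst.
assert (M1 := Rmin_l (Rmin d1 d2) (Rmin d3 d4)). assert (M2 := Rmin_r (Rmin d1 d2) (Rmin d3 d4)).
assert (M3 := Rmin_l d1 d2). assert (M4 := Rmin_r d1 d2).
assert (M5 := Rmin_l d3 d4). assert (M6 := Rmin_r d3 d4).
specialize (Cu' s Hs ltac:(lra)). specialize (Cv' s Hs ltac:(lra)).
specialize (Hu' s Hs ltac:(lra)). specialize (Hv' s Hs ltac:(lra)).
specialize (Hr (u s) (v s) Cu' Cv').
set (k := Rabs (s - t)) in *. assert (Hk : 0 <= k) by apply Rabs_pos.
set (du := u s - u t) in *. set (dv := v s - v t) in *.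
assert (Ek : e * k <= 1 * k) by (apply Rmult_le_compat_r; lra).
assert (Bu : Rabs du <= L * k).
{ replace du with ((du - u' * (s - t)) + u' * (s - t)) by ring.
  eapply Rle_trans; [apply Rabs_triang|]. rewrite (Rabs_mult u'). fold k. unfold L. nra. }
assert (Bv : Rabs dv <= L * k).
{ replace dv with ((dv - v' * (s - t)) + v' * (s - t)) by ring.
  eapply Rle_trans; [apply Rabs_triang|]. rewrite (Rabs_mult v'). fold k. unfold L. nra. }
replace (F (u s) (v s) - F (u t) (v t) - (Fu * u' + Fv * v') * (s - t)) with
  ((F (u s) (v s) - F (u t) (v t) - (Fu * du + Fv * dv))
   + (Fu * (du - u' * (s - t)) + Fv * (dv - v' * (s - t)))) by ring.
eapply Rle_trans; [apply Rabs_triang|].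
assert (A1 : eps / (2 * L) * Rmax (Rabs du) (Rabs dv) <= eps / 2 * k).
{ replace (eps / 2 * k) with (eps / (2 * L) * (L * k)) by (field; lra).
  apply Rmult_le_compat_l; [lra|]. now apply Rmax_lub. }
assert (A2 : Rabs (Fu * (du - u' * (s - t)) + Fv * (dv - v' * (s - t))) <= eps / 2 * k).
{ eapply Rle_trans; [apply Rabs_triang|]. rewrite !Rabs_mult.
  apply Rle_trans with (W * (e * k)).
  - unfold W. assert (0 <= e * k) by (apply Rmult_le_pos; lra).
    assert (Rabs Fu * Rabs (du - u' * (s - t)) <= Rabs Fu * (e * k)) by (now apply Rmult_le_compat_l).
    assert (Rabs Fv * Rabs (dv - v' * (s - t)) <= Rabs Fv * (e * k)) by (now apply Rmult_le_compat_l).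
    nra.
  - replace (eps / 2 * k) with (W * (eps / (2 * W) * k)) by (field; lra).
    apply Rmult_le_compat_l; [lra|]. apply Rmult_le_compat_r; lra. }
lra.
Qed.

(** * Goursat problem in a triangle *)

(** The reciprocal 1 / (1 + |F|) is continuous and positive on the compact box; its positive lower
    bound is an upper bound for |F|. *)
Lemma bounded_2d (a b c d : R) (F : R -> R -> R) :
  cont2 F -> exists M, 0 < M /\ forall x y, a <= x <= b -> c <= y <= d -> Rabs (F x y) <= M.
Proof.
intros HF.
assert (HA : cont2 (fun x y => 1 + Rabs (F x y))).
{ apply cont2_plus; [apply cont2_const|]. intros x y.
  apply (continuity_1d_2d_pt_comp Rabs F); [apply Rcontinuity_abs|apply HF]. }
destruct (pos_lower_bound_2d (fun x y => (a <= x /\ - b <= - x) /\ (c <= y /\ - d <= - y))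
            (fun x y => / (1 + Rabs (F x y))) a b c d) as [m [Hm H]].
- assert (H1 : cont2 (fun x _ => x)) by (intros x y; apply continuity_2d_pt_id1).
  assert (H2 : cont2 (fun _ y => y)) by (intros x y; apply continuity_2d_pt_id2).
  repeat apply closed_2d_and.
  + now apply (closed_2d_ge (fun x _ => x)).
  + apply (closed_2d_ge (fun x _ => - x)). now apply cont2_opp.
  + now apply (closed_2d_ge (fun _ y => y)).
  + apply (closed_2d_ge (fun _ y => - y)). now apply cont2_opp.
- intros x y H. lra.
- intros x y _. assert (0 < 1 + Rabs (F x y)) by (assert (H0 := Rabs_pos (F x y)); lra).
  split; [|now apply Rinv_0_lt_compat].
  apply continuity_2d_pt_inv; [apply HA|lra].
- exists (/ m). split; [now apply Rinv_0_lt_compat|]. intros x y Hx Hy.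
  specialize (H x y ltac:(lra)). simpl in H.
  assert (Hp : 0 < 1 + Rabs (F x y)) by (assert (H0 := Rabs_pos (F x y)); lra).
  apply Rinv_le_contravar in H; [|exact Hm]. rewrite Rinv_inv in H. lra.
Qed.

(** Together with [retr2] this retracts the plane onto the triangle 0 <= x <= y <= X: the two
    coordinates are sorted and then clamped. *)
Definition retr1 (X x y : R) : R := clamp 0 X (Rmin x y).
Definition retr2 (X x y : R) : R := clamp 0 X (Rmax x y).

Lemma retr_range (X x y : R) : 0 <= X -> 0 <= retr1 X x y /\ retr1 X x y <= retr2 X x y <= X.
Proof.
intros HX. unfold retr1, retr2. assert (H1 := clamp_range 0 X (Rmin x y) HX).
assert (H2 := clamp_range 0 X (Rmax x y) HX). repeat split; try lra.
unfold clamp. apply Rle_max_compat_l, Rle_min_compat_l.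
eapply Rle_trans; [apply Rmin_l|apply Rmax_l].
Qed.

Lemma retr_id (X x y : R) : 0 <= x <= y -> y <= X -> retr1 X x y = x /\ retr2 X x y = y.
Proof.
intros H1 H2. unfold retr1, retr2. rewrite Rmin_left, Rmax_right by lra.
rewrite !clamp_id by lra. split; reflexivity.
Qed.

Lemma Rmin_lipschitz (x y u v d : R) :
  Rabs (u - x) < d -> Rabs (v - y) < d -> Rabs (Rmin u v - Rmin x y) < d.
Proof.
intros H1 H2. apply Rabs_def2 in H1, H2.
unfold Rmin. destruct (Rle_dec u v), (Rle_dec x y); apply Rabs_def1; lra.
Qed.

Lemma Rmax_lipschitz (x y u v d : R) :
  Rabs (u - x) < d -> Rabs (v - y) < d -> Rabs (Rmax u v - Rmax x y) < d.
Proof.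
intros H1 H2. apply Rabs_def2 in H1, H2.
unfold Rmax. destruct (Rle_dec u v), (Rle_dec x y); apply Rabs_def1; lra.
Qed.

Lemma cont2_retr1 (X : R) : cont2 (retr1 X).
Proof.
intros x y eps. exists eps. intros u v Hu Hv. unfold retr1.
eapply Rle_lt_trans; [apply clamp_lipschitz|]. now apply Rmin_lipschitz.
Qed.

Lemma cont2_retr2 (X : R) : cont2 (retr2 X).
Proof.
intros x y eps. exists eps. intros u v Hu Hv. unfold retr2.
eapply Rle_lt_trans; [apply clamp_lipschitz|]. now apply Rmax_lipschitz.
Qed.

Lemma cont2_comp (F u v : R -> R -> R) :
  cont2 F -> cont2 u -> cont2 v -> cont2 (fun x y => F (u x y) (v x y)).
Proof. intros HF Hu Hv x y. apply continuity_2d_pt_comp2; [apply HF|apply Hu|apply Hv]. Qed.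

(** The increments are summable, so the sequence is Cauchy, and the tail of the geometric series
    gives the explicit rate that later makes the limit uniform in parameters. *)
Lemma geometric_limit (s : nat -> R) (D : R) :
  (forall n, Rabs (s (S n) - s n) <= D * (/ 2) ^ n) ->
  exists l, forall n, Rabs (l - s n) <= 2 * D * (/ 2) ^ n.
Proof.
intros H.
assert (HD : 0 <= D). { specialize (H 0%nat). simpl in H. assert (H0 := Rabs_pos (s 1%nat - s 0%nat)). lra. }
assert (Hp : forall n, 0 < (/ 2) ^ n) by (intros n; apply pow_lt; lra).
(* The subtracted term, the part of the series not yet used, is what closes the induction on [k]. *)
assert (Hnm : forall n k, Rabs (s (n + k)%nat - s n) <= 2 * D * (/ 2) ^ n - 2 * D * (/2) ^ (n + k)).
{ intros n k. induction k as [|k IH].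
  - rewrite Nat.add_0_r, Rminus_diag, Rabs_R0. lra.
  - rewrite Nat.add_succ_r. replace (s (S (n + k)) - s n) with
      ((s (S (n + k)) - s (n + k)%nat) + (s (n + k)%nat - s n)) by ring.
    eapply Rle_trans; [apply Rabs_triang|]. specialize (H (n + k)%nat). simpl. lra. }
assert (Hc : ex_finite_lim_seq s).
{ apply ex_lim_seq_cauchy_corr. intros eps.
  assert (Hz : is_lim_seq (fun n => 2 * D * (/2) ^ n) 0).
  { replace 0 with (2 * D * 0) by ring.
    apply (is_lim_seq_scal_l _ (2 * D) 0). apply is_lim_seq_geom.
    rewrite Rabs_right; lra. }
  apply is_lim_seq_spec in Hz.
  assert (He : 0 < eps / 2) by (assert (H0 := cond_pos eps); lra).
  destruct (Hz (mkposreal _ He)) as [N HN]. simpl in HN.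
  exists N. assert (key : forall n, (N <= n)%nat -> Rabs (s n - s N) < eps / 2).
  { intros n Hn. replace n with (N + (n - N))%nat by lia.
    specialize (Hnm N (n - N)%nat). specialize (HN N (Nat.le_refl N)).
    rewrite Rminus_0_r in HN. apply Rabs_def2 in HN.
    assert (Hp2 := Hp (N + (n - N))%nat). nra. }
  intros n m Hn Hm. replace (s n - s m) with ((s n - s N) - (s m - s N)) by ring.
  eapply Rle_lt_trans; [apply Rabs_triang|]. rewrite Rabs_Ropp.
  assert (K1 := key n Hn). assert (K2 := key m Hm). lra. }
destruct Hc as [l Hl]. exists l. intros n.
assert (Hlim : is_lim_seq (fun k => Rabs (s (n + k)%nat - s n)) (Rabs (l - s n))).
{ apply (is_lim_seq_abs _ (Finite (l - s n))).
  apply is_lim_seq_minus'; [|apply is_lim_seq_const].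
  apply (is_lim_seq_ext (fun k => s (k + n)%nat)).
  - intros k. now rewrite Nat.add_comm.
  - now apply is_lim_seq_incr_n. }
apply (is_lim_seq_le (fun k => Rabs (s (n + k)%nat - s n)) (fun _ => 2 * D * (/2) ^ n)
         (Rabs (l - s n)) (2 * D * (/2) ^ n)).
- intros k. specialize (Hnm n k). assert (Hp2 := Hp (n + k)%nat). nra.
- exact Hlim.
- apply is_lim_seq_const.
Qed.

(** Integrating the weight exp (k (y - x)) along a characteristic reproduces it with the gain 1 / k,
    which makes the iteration contract. *)
Lemma is_RInt_exp_left (B k x y : R) : 0 < k ->
  is_RInt (fun z => B * exp (k * (y - z))) x y (B * (exp (k * (y - x)) - 1) / k).
Proof.
intros Hk.
replace (B * (exp (k * (y - x)) - 1) / k) with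
  (minus (- B / k * exp (k * (y - y))) (- B / k * exp (k * (y - x)))).
2:{ unfold minus, plus, opp; simpl. rewrite Rminus_diag, Rmult_0_r, exp_0. field. lra. }
apply (is_RInt_derive (fun z => - B / k * exp (k * (y - z)))).
- intros z _. auto_derive; [exact I|]. unfold Rminus. field. lra.
- intros z _. apply continuity_pt_filterlim. apply derivable_continuous_pt. reg.
Qed.

Lemma is_RInt_exp_right (B k x y : R) : 0 < k ->
  is_RInt (fun z => B * exp (k * (z - x))) x y (B * (exp (k * (y - x)) - 1) / k).
Proof.
intros Hk.
replace (B * (exp (k * (y - x)) - 1) / k) with
  (minus (B / k * exp (k * (y - x))) (B / k * exp (k * (x - x)))).
2:{ unfold minus, plus, opp; simpl. rewrite Rminus_diag, Rmult_0_r, exp_0. field. lra. }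
apply (is_RInt_derive (fun z => B / k * exp (k * (z - x)))).
- intros z _. auto_derive; [exact I|]. unfold Rminus. field. lra.
- intros z _. apply continuity_pt_filterlim. apply derivable_continuous_pt. reg.
Qed.

Lemma RInt_abs_le_fct (f g : R -> R) (a b l : R) :
  a <= b -> (forall x, continuity_pt f x) ->
  (forall x, a <= x <= b -> Rabs (f x) <= g x) -> is_RInt g a b l ->
  Rabs (RInt f a b) <= l.
Proof.
intros Hab Hf H Hg.
apply (norm_RInt_le f g a b (RInt f a b) l Hab H); [|exact Hg].
apply (@RInt_correct R_CompleteNormedModule). now apply ex_RInt_cont.
Qed.

Lemma RInt_sub (f g : R -> R) (a b : R) :
  (forall x, continuity_pt f x) -> (forall x, continuity_pt g x) ->
  RInt (fun z => f z - g z) a b = RInt f a b - RInt g a b.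
Proof.
intros Hf Hg. apply (@RInt_minus R_CompleteNormedModule); now apply ex_RInt_cont.
Qed.

(* Successive approximations contract in the norm weighted by
   [exp (k (y - x))] with [k = 4 L]. *)
Lemma goursat_solution (X : R) (ta tb : R -> R -> R) (P0 Q0 : R -> R) :
  0 <= X -> cont2 ta -> cont2 tb ->
  (forall x, continuity_pt P0 x) -> (forall x, continuity_pt Q0 x) ->
  exists h, cont2 h /\ forall x y, 0 <= x <= y -> y <= X ->
    h x y = ta x y * (Q0 y + RInt (fun z => h z y) x y)
          + tb x y * (P0 x - RInt (fun z => h x z) x y).
Proof.
intros HX Hta Htb HP0 HQ0.
assert (Hf : forall F, cont2 F -> forall y x, continuity_pt (fun z => F z y) x).
{ intros F HF y x. apply (continuity_2d_pt_fst_pt F), HF. }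
assert (Hs : forall F, cont2 F -> forall x y, continuity_pt (fun z => F x z) y).
{ intros F HF x y. apply (continuity_2d_pt_snd_pt F), HF. }
(* The unknown is the common value h = - P_y = - Q_x. Integrating it from the diagonal recovers P
   and Q, so the system becomes the fixed-point equation h = step h. *)
set (step := fun (F : R -> R -> R) x y =>
  ta x y * (Q0 y + RInt (fun z => F z y) x y) + tb x y * (P0 x - RInt (fun z => F x z) x y)).
assert (Hstep : forall F, cont2 F -> cont2 (step F)).
{ intros F HF. unfold step. apply cont2_plus; apply cont2_mult; try assumption.
  - apply cont2_plus; [now apply cont2_snd|now apply cont2_RInt_diag_l].
  - apply cont2_minus; [now apply cont2_fst|now apply cont2_RInt_diag_r]. }
(* Each iterate is composed with the retraction: it is continuous on the whole plane and determined
   by its values on the triangle, so that estimates on the triangle hold everywhere. *)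
set (s := fix s n := match n with
  | O => fun _ _ : R => 0
  | S n => fun x y => step (s n) (retr1 X x y) (retr2 X x y) end).
assert (Hsc : forall n, cont2 (s n)).
{ induction n as [|n IH]; simpl; [apply cont2_const|].
  apply cont2_comp; [now apply Hstep|apply cont2_retr1|apply cont2_retr2]. }
destruct (bounded_2d 0 X 0 X ta Hta) as [L1 [HL1 Hb1]].
destruct (bounded_2d 0 X 0 X tb Htb) as [L2 [HL2 Hb2]].
set (L := Rmax L1 L2).
assert (HL1' : L1 <= L) by apply Rmax_l. assert (HL2' : L2 <= L) by apply Rmax_r.
set (k := 4 * L). assert (Hk : 0 < k) by (unfold k; lra).
destruct (bounded_2d 0 X 0 X (step (s 0%nat)) (Hstep _ (Hsc 0%nat))) as [C [HC Hb0]].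
assert (Hdiff : forall F G B, cont2 F -> cont2 G -> 0 <= B ->
  (forall x y, 0 <= x <= y -> y <= X -> Rabs (F x y - G x y) <= B * exp (k * (y - x))) ->
  forall x y, 0 <= x <= y -> y <= X ->
  Rabs (step F x y - step G x y) <= B / 2 * exp (k * (y - x))).
{ intros F G B HF HG HB H x y Hxy HyX.
  replace (step F x y - step G x y) with
    (ta x y * RInt (fun z => F z y - G z y) x y - tb x y * RInt (fun z => F x z - G x z) x y).
  2:{ unfold step. rewrite (RInt_sub (fun z => F z y) (fun z => G z y)),
        (RInt_sub (fun z => F x z) (fun z => G x z)) by auto. ring. }
  assert (I1 : Rabs (RInt (fun z => F z y - G z y) x y) <= B * (exp (k * (y - x)) - 1) / k).
  { apply (RInt_abs_le_fct _ (fun z => B * exp (k * (y - z)))); [lra| | |].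
    - intros z. apply continuity_pt_minus; auto.
    - intros z Hz. apply H; lra.
    - now apply is_RInt_exp_left. }
  assert (I2 : Rabs (RInt (fun z => F x z - G x z) x y) <= B * (exp (k * (y - x)) - 1) / k).
  { apply (RInt_abs_le_fct _ (fun z => B * exp (k * (z - x)))); [lra| | |].
    - intros z. apply continuity_pt_minus; auto.
    - intros z Hz. apply H; lra.
    - now apply is_RInt_exp_right. }
  set (J := B * (exp (k * (y - x)) - 1) / k) in *.
  (* Each of the two integral terms contributes at most L J; the choice k = 4 L turns their sum into
     half of the weighted bound. *)
  assert (HJ : 2 * L * J <= B / 2 * exp (k * (y - x))).
  { unfold J, k. replace (2 * L * (B * (exp (4 * L * (y - x)) - 1) / (4 * L)))
      with (B / 2 * (exp (4 * L * (y - x)) - 1)) by (field; lra). nra. }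
  assert (HJ0 : 0 <= J) by (eapply Rle_trans; [apply Rabs_pos|exact I1]).
  eapply Rle_trans; [apply Rabs_triang|]. rewrite Rabs_Ropp, !Rabs_mult.
  assert (A1 := Hb1 x y ltac:(lra) ltac:(lra)). assert (A2 := Hb2 x y ltac:(lra) ltac:(lra)).
  assert (Rabs (ta x y) * Rabs (RInt (fun z => F z y - G z y) x y) <= L * J).
  { apply Rmult_le_compat; try apply Rabs_pos; lra. }
  assert (Rabs (tb x y) * Rabs (RInt (fun z => F x z - G x z) x y) <= L * J).
  { apply Rmult_le_compat; try apply Rabs_pos; lra. }
  lra. }
assert (Hsb : forall n x y, 0 <= x <= y -> y <= X ->
  Rabs (s (S n) x y - s n x y) <= C * (/ 2) ^ n * exp (k * (y - x))).
{ induction n as [|n IH]; intros x y Hxy HyX.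
  - change (Rabs (step (s 0%nat) (retr1 X x y) (retr2 X x y) - 0) <= C * 1 * exp (k * (y - x))).
    destruct (retr_id X x y Hxy HyX) as [-> ->]. rewrite Rminus_0_r, Rmult_1_r.
    assert (H1 := Hb0 x y ltac:(lra) ltac:(lra)).
    assert (1 <= exp (k * (y - x))).
    { rewrite <- exp_0. destruct (Req_dec x y) as [->|Hne].
      - rewrite Rminus_diag, Rmult_0_r. lra.
      - left. apply exp_increasing. apply Rmult_lt_0_compat; lra. }
    nra.
  - change (Rabs (step (s (S n)) (retr1 X x y) (retr2 X x y) -
                  step (s n) (retr1 X x y) (retr2 X x y))
            <= C * (/ 2) ^ S n * exp (k * (y - x))).
    destruct (retr_id X x y Hxy HyX) as [-> ->].
    replace (C * (/ 2) ^ S n) with (C * (/2) ^ n / 2) by (simpl; field).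
    apply Hdiff; auto. apply Rmult_le_pos; [lra|apply pow_le; lra]. }
(* On the triangle y - x <= X, so the weight is at most exp (k X) and the rate of convergence no
   longer depends on the point. *)
set (D := C * exp (k * X)).
assert (Hretr : forall n x y, s n x y = s n (retr1 X x y) (retr2 X x y)).
{ intros [|n] x y; [reflexivity|].
  change (step (s n) (retr1 X x y) (retr2 X x y) = step (s n)
    (retr1 X (retr1 X x y) (retr2 X x y)) (retr2 X (retr1 X x y) (retr2 X x y))).
  destruct (retr_range X x y HX) as [R1 R2].
  destruct (retr_id X (retr1 X x y) (retr2 X x y)) as [-> ->]; try lra. }
assert (HsD : forall x y n, Rabs (s (S n) x y - s n x y) <= D * (/ 2) ^ n).
{ intros x y n. rewrite (Hretr (S n)), (Hretr n).
  destruct (retr_range X x y HX) as [R1 R2].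
  eapply Rle_trans; [apply Hsb; lra|].
  unfold D. rewrite Rmult_assoc, (Rmult_comm _ (exp _)), <- Rmult_assoc.
  apply Rmult_le_compat_r; [apply pow_le; lra|].
  apply Rmult_le_compat_l; [lra|].
  assert (k * (retr2 X x y - retr1 X x y) <= k * X) by (apply Rmult_le_compat_l; lra).
  destruct (Rle_lt_or_eq_dec _ _ H) as [H1| ->]; [left; now apply exp_increasing|lra]. }
set (h := fun x y => proj1_sig (constructive_indefinite_description _
                       (geometric_limit (fun n => s n x y) D (HsD x y)))).
assert (Hh : forall x y n, Rabs (h x y - s n x y) <= 2 * D * (/ 2) ^ n).
{ intros x y. exact (proj2_sig (constructive_indefinite_description _
                       (geometric_limit (fun n => s n x y) D (HsD x y)))). }
assert (HD : 0 < D) by (apply Rmult_lt_0_compat; [lra|apply exp_pos]).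
assert (Hsmall : forall A eps, 0 < A -> 0 < eps -> exists n, A * (/ 2) ^ n < eps).
{ intros A eps HA Heps. destruct (pow_lt_1_zero (/ 2)) with (y := eps / A) as [N HN].
  - rewrite Rabs_right; lra.
  - now apply Rdiv_lt_0_compat.
  - exists N. specialize (HN N (Nat.le_refl N)).
    rewrite Rabs_right in HN by (apply Rle_ge, pow_le; lra).
    apply (Rmult_lt_compat_l A) in HN; [|exact HA].
    unfold Rdiv in HN. rewrite (Rmult_comm eps), <- Rmult_assoc, Rinv_r, Rmult_1_l in HN; lra. }
assert (Hhc : cont2 h).
{ intros x y eps. destruct (Hsmall (2 * D) (eps / 3)) as [n Hn]; [lra| |].
  { assert (H0 := cond_pos eps); lra. }
  assert (He : 0 < eps / 3) by (assert (H0 := cond_pos eps); lra).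
  destruct (Hsc n x y (mkposreal _ He)) as [d Hd]. exists d. intros u v Hu Hv.
  specialize (Hd u v Hu Hv). simpl in Hd.
  replace (h u v - h x y) with
    ((h u v - s n u v) + (s n u v - s n x y) - (h x y - s n x y)) by ring.
  assert (A1 := Hh u v n). assert (A2 := Hh x y n).
  eapply Rle_lt_trans; [apply Rabs_triang|]. rewrite Rabs_Ropp.
  assert (A3 := Rabs_triang (h u v - s n u v) (s n u v - s n x y)). lra. }
exists h. split; [exact Hhc|]. intros x y Hxy HyX.
change (h x y = step h x y).
(* [h] and [step h] are both compared with the iterate n + 1, which is [step] of the iterate n; both
   distances tend to zero. *)
apply NNPP. intros Hne.
assert (He : 0 < Rabs (h x y - step h x y)) by (apply Rabs_pos_lt; lra).
set (E := exp (k * (y - x))). assert (HE : 0 < E) by apply exp_pos.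
assert (HDE : 0 < D * E) by now apply Rmult_lt_0_compat.
destruct (Hsmall (2 * D + D * E) (Rabs (h x y - step h x y))) as [n Hn]; [lra|exact He|].
assert (A1 := Hh x y (S n)).
assert (A2 : Rabs (step h x y - step (s n) x y) <= 2 * D * (/2) ^ n / 2 * E).
{ apply Hdiff; auto.
  - apply Rmult_le_pos; [lra|apply pow_le; lra].
  - intros u v Huv HvX. eapply Rle_trans; [apply Hh|].
    rewrite <- (Rmult_1_r (2 * D * (/ 2) ^ n)) at 1.
    apply Rmult_le_compat_l; [apply Rmult_le_pos; [lra|apply pow_le; lra]|].
    rewrite <- exp_0. destruct (Req_dec u v) as [->|Hne'].
    + rewrite Rminus_diag, Rmult_0_r. lra.
    + left. apply exp_increasing. apply Rmult_lt_0_compat; lra. }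
assert (A3 : s (S n) x y = step (s n) x y).
{ change (step (s n) (retr1 X x y) (retr2 X x y) = step (s n) x y).
  destruct (retr_id X x y Hxy HyX) as [-> ->]. reflexivity. }
rewrite A3 in A1. simpl in A1.
assert (Hp : 0 < (/2) ^ n) by (apply pow_lt; lra).
assert (Rabs (h x y - step h x y) <= 2 * D * (/ 2 * (/ 2) ^ n) + 2 * D * (/ 2) ^ n / 2 * E).
{ replace (h x y - step h x y) with
    ((h x y - step (s n) x y) - (step h x y - step (s n) x y)) by ring.
  eapply Rle_trans; [apply Rabs_triang|]. rewrite Rabs_Ropp. lra. }
nra.
Qed.

Lemma is_derive_RInt_upper (f : R -> R) (a x : R) :
  (forall z, continuity_pt f z) -> is_derive (fun t => RInt f a t) x (f x).
Proof.
intros Hf. apply (is_derive_RInt f (fun t => RInt f a t) a x).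
- apply filter_forall. intros t. apply (@RInt_correct R_CompleteNormedModule).
  now apply ex_RInt_cont.
- apply continuity_pt_filterlim, Hf.
Qed.

Lemma is_derive_RInt_lower (f : R -> R) (b x : R) :
  (forall z, continuity_pt f z) -> is_derive (fun t => RInt f t b) x (- f x).
Proof.
intros Hf. apply (is_derive_RInt' f (fun t => RInt f t b) x b).
- apply filter_forall. intros t. apply (@RInt_correct R_CompleteNormedModule).
  now apply ex_RInt_cont.
- apply continuity_pt_filterlim, Hf.
Qed.

Lemma RInt_point_R (f : R -> R) (a : R) : RInt f a a = 0.
Proof. exact (@RInt_point R_CompleteNormedModule a f). Qed.

(** [k] is the prescribed mixed derivative F_xy, while [e] and [d] prescribe F_x and F_y on the
    diagonal. Integrating [k] from the diagonal in either variable gives the two partial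
    derivatives. *)
Lemma plane_potential (k : R -> R -> R) (d e : R -> R) :
  cont2 k -> (forall x, continuity_pt d x) -> (forall x, continuity_pt e x) ->
  exists F : R -> R -> R, forall x y,
    is_derive (fun t => F t y) x (e x + RInt (fun z => k x z) x y) /\
    is_derive (fun t => F x t) y (d y - RInt (fun z => k z y) x y) /\
    F x x = RInt (fun z => e z + d z) 0 x.
Proof.
intros Hk Hd He.
assert (Hkf : forall y x, continuity_pt (fun z => k z y) x).
{ intros y x. now apply (continuity_2d_pt_fst_pt k). }
assert (Hks : forall x y, continuity_pt (fun z => k x z) y).
{ intros x y. now apply (continuity_2d_pt_snd_pt k). }
set (Q := fun x y => d y - RInt (fun z => k z y) x y).
assert (HQ : cont2 Q).
{ apply cont2_minus; [now apply cont2_snd|now apply cont2_RInt_diag_l]. }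
assert (HQs : forall x y, continuity_pt (fun z => Q x z) y).
{ intros x y. now apply (continuity_2d_pt_snd_pt Q). }
assert (HQx : forall x y, is_derive (fun t => Q t y) x (k x y)).
{ intros x y. unfold Q. replace (k x y) with (0 - - k x y) by ring.
  apply (is_derive_minus (fun _ => d y) (fun t => RInt (fun z => k z y) t y)).
  - apply @is_derive_const.
  - now apply (is_derive_RInt_lower (fun z => k z y)). }
assert (HDQ : forall x y, Derive (fun t => Q t y) x = k x y).
{ intros x y. apply is_derive_unique, HQx. }
assert (Hde : forall z, continuity_pt (fun z => e z + d z) z).
{ intros z. apply continuity_pt_plus; auto. }
assert (HcD : cont2 (fun u v => Derive (fun z => Q z v) u)).
{ intros u v. apply (continuity_2d_pt_ext k); [|apply Hk]. intros. now rewrite HDQ. }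
(* The path of integration runs along the diagonal to (x, x) and then vertically to (x, y). *)
exists (fun x y => RInt (fun z => e z + d z) 0 x + RInt (fun z => Q x z) x y).
intros x y. split; [|split].
- replace (e x + RInt (fun z => k x z) x y) with
    ((e x + d x) + (RInt (fun z => Derive (fun u => Q u z) x) x y + - Q x x * 1 + Q x y * 0)).
  2:{ rewrite (RInt_ext (fun z => Derive (fun u => Q u z) x) (fun z => k x z)) by (intros; apply HDQ).
      unfold Q at 1. rewrite RInt_point_R. ring. }
  apply (is_derive_plus (fun t => RInt (fun z => e z + d z) 0 t)).
  + now apply (is_derive_RInt_upper (fun z => e z + d z)).
  + apply (is_derive_RInt_param_bound_comp Q (fun t => t) (fun _ => y)).
    * apply filter_forall. intros t. apply ex_RInt_cont. apply HQs.
    * exists (mkposreal 1 Rlt_0_1). apply filter_forall. intros t. apply ex_RInt_cont. apply HQs.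
    * exists (mkposreal 1 Rlt_0_1). apply filter_forall. intros t. apply ex_RInt_cont. apply HQs.
    * apply @is_derive_id.
    * apply @is_derive_const.
    * exists (mkposreal 1 Rlt_0_1). apply filter_forall. intros t z _. exists (k t z). apply HQx.
    * intros t _. apply HcD.
    * apply locally_2d_forall. intros u v. apply HcD.
    * apply locally_2d_forall. intros u v. apply HcD.
    * apply HQs.
    * apply HQs.
- replace (d y - RInt (fun z => k z y) x y) with (0 + Q x y) by (unfold Q; ring).
  apply (is_derive_plus (fun _ => RInt (fun z => e z + d z) 0 x)).
  + apply @is_derive_const.
  + now apply (is_derive_RInt_upper (fun z => Q x z)).
- rewrite RInt_point_R. ring.
Qed.

(** * Potentials of the characteristic system *)

Section Characteristic.

Context (X : R) (ta tb h : R -> R -> R) (P0 Q0 : R -> R).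
Context (HX : 0 <= X) (Hta : cont2 ta) (Htb : cont2 tb) (Hh : cont2 h).
Context (HP0 : forall x, continuity_pt P0 x) (HQ0 : forall x, continuity_pt Q0 x).

Definition char_P (x y : R) : R := P0 x - RInt (fun z => h x z) x y.
Definition char_Q (x y : R) : R := Q0 y + RInt (fun z => h z y) x y.

Lemma cont2_char_P : cont2 char_P.
Proof. apply cont2_minus; [now apply cont2_fst|now apply cont2_RInt_diag_r]. Qed.

Lemma cont2_char_Q : cont2 char_Q.
Proof. apply cont2_plus; [now apply cont2_snd|now apply cont2_RInt_diag_l]. Qed.

Lemma is_derive_char_P (x y : R) : is_derive (fun t => char_P x t) y (- h x y).
Proof.
unfold char_P. replace (- h x y) with (0 - h x y) by ring.
apply (is_derive_minus (fun _ => P0 x) (fun t => RInt (fun z => h x z) x t)).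
- apply @is_derive_const.
- apply (is_derive_RInt_upper (fun z => h x z)). intros z. now apply (continuity_2d_pt_snd_pt h).
Qed.

Lemma is_derive_char_Q (x y : R) : is_derive (fun t => char_Q t y) x (- h x y).
Proof.
unfold char_Q. replace (- h x y) with (0 + - h x y) by ring.
apply (is_derive_plus (fun _ => Q0 y) (fun t => RInt (fun z => h z y) t y)).
- apply @is_derive_const.
- apply (is_derive_RInt_lower (fun z => h z y)). intros z. now apply (continuity_2d_pt_fst_pt h).
Qed.

Lemma char_P_diag (x : R) : char_P x x = P0 x.
Proof. unfold char_P. rewrite RInt_point_R. ring. Qed.

Lemma char_Q_diag (x : R) : char_Q x x = Q0 x.
Proof. unfold char_Q. rewrite RInt_point_R. ring. Qed.

Context (Heq : forall x y, 0 <= x <= y -> y <= X ->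
  h x y = ta x y * char_Q x y + tb x y * char_P x y).

(* The two equations for [Kp], [Km] are the compatibility condition
   d_y (Kp P) = d_x (Km Q) for the linear system P_y = Q_x = - h. *)
Lemma char_potential (Kp Km : R -> R -> R) :
  cont2 Kp -> cont2 Km ->
  (forall x y, 0 <= x < y -> y < X ->
     is_derive (fun t => Kp x t) y (tb x y * (Kp x y - Km x y))) ->
  (forall x y, 0 < x < y -> y <= X ->
     is_derive (fun t => Km t y) x (- ta x y * (Kp x y - Km x y))) ->
  exists F Fx Fy : R -> R -> R, cont2 Fx /\ cont2 Fy /\
    (forall x y, is_derive (fun t => F t y) x (Fx x y)) /\
    (forall x y, is_derive (fun t => F x t) y (Fy x y)) /\
    (forall x y, 0 <= x <= y -> y <= X ->
       Fx x y = Kp x y * char_P x y /\ Fy x y = Km x y * char_Q x y) /\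
    (forall x, F x x = RInt (fun z => Kp z z * P0 z + Km z z * Q0 z) 0 x).
Proof.
intros HKp HKm HdKp HdKm.
(* The mixed derivative that the potential must have: d_y (Kp P) expanded by the equations for Kp
   and P, which equals d_x (Km Q). *)
set (k := fun x y => - (tb x y * Km x y * char_P x y + ta x y * Kp x y * char_Q x y)).
assert (Hk : cont2 k).
{ apply cont2_opp, cont2_plus; repeat apply cont2_mult; auto using cont2_char_P, cont2_char_Q. }
assert (Hdiag : forall F, cont2 F -> forall x, continuity_pt (fun z => F z z) x).
{ intros F HF x. apply (continuity_2d_pt_fst_pt (fun u v => F u u) x 0).
  apply (continuity_2d_pt_comp2 F (fun u _ => u) (fun u _ => u));
  [apply HF|apply continuity_2d_pt_id1|apply continuity_2d_pt_id1]. }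
set (d := fun y => Km y y * Q0 y). set (e := fun x => Kp x x * P0 x).
assert (Hd : forall x, continuity_pt d x).
{ intros x. apply continuity_pt_mult; [now apply (Hdiag Km)|auto]. }
assert (He : forall x, continuity_pt e x).
{ intros x. apply continuity_pt_mult; [now apply (Hdiag Kp)|auto]. }
destruct (plane_potential k d e Hk Hd He) as [F HF].
exists F, (fun x y => e x + RInt (fun z => k x z) x y),
  (fun x y => d y - RInt (fun z => k z y) x y).
split; [|split; [|split; [|split; [|split]]]].
- apply cont2_plus; [now apply cont2_fst|now apply cont2_RInt_diag_r].
- apply cont2_minus; [now apply cont2_snd|now apply cont2_RInt_diag_l].
- intros x y. apply HF.
- intros x y. apply HF.
- intros x y Hxy HyX. split.
  (* F_x - Kp P vanishes on the diagonal and has zero derivative in the second variable. The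
     argument for F_y - Km Q is the same in the first variable. *)
  + set (f := fun t => e x + RInt (fun z => k x z) x t - Kp x t * char_P x t).
    assert (E : f x = f y).
    { apply is_derive_zero_eq; [lra| |].
      - intros t _. apply continuity_pt_cont_at_on. unfold f.
        apply continuity_pt_minus; [apply continuity_pt_plus|apply continuity_pt_mult].
        + apply continuity_pt_const. now intros a b.
        + apply continuity_pt_filterlim. apply (ex_derive_continuous (fun t => RInt (fun z => k x z) x t)).
          exists (k x t). apply (is_derive_RInt_upper (fun z => k x z)).
          intros z. now apply (continuity_2d_pt_snd_pt k).
        + now apply (continuity_2d_pt_snd_pt Kp).
        + apply (continuity_2d_pt_snd_pt char_P). apply cont2_char_P.
      - intros t Ht. unfold f.
        replace 0 with ((0 + k x t) - (tb x t * (Kp x t - Km x t) * char_P x t + Kp x t * - h x t)).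
        2:{ rewrite Heq by lra. unfold k. ring. }
        apply (is_derive_minus (fun t => e x + RInt (fun z => k x z) x t)
                 (fun t => Kp x t * char_P x t)).
        + apply (is_derive_plus (fun _ => e x)); [apply @is_derive_const|].
          apply (is_derive_RInt_upper (fun z => k x z)).
          intros z. now apply (continuity_2d_pt_snd_pt k).
        + apply (is_derive_mult (fun t => Kp x t) (fun t => char_P x t)).
          * apply HdKp; lra.
          * apply is_derive_char_P.
          * intros u v. apply Rmult_comm. }
    unfold f in E. rewrite RInt_point_R, char_P_diag in E.
    unfold e in E |- *. lra.
  + set (f := fun t => d y - RInt (fun z => k z y) t y - Km t y * char_Q t y).
    assert (E : f x = f y).
    { apply is_derive_zero_eq; [lra| |].
      - intros t _. apply continuity_pt_cont_at_on. unfold f.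
        apply continuity_pt_minus; [apply continuity_pt_minus|apply continuity_pt_mult].
        + apply continuity_pt_const. now intros a b.
        + apply continuity_pt_filterlim. apply (ex_derive_continuous (fun t => RInt (fun z => k z y) t y)).
          exists (- k t y). apply (is_derive_RInt_lower (fun z => k z y)).
          intros z. now apply (continuity_2d_pt_fst_pt k).
        + now apply (continuity_2d_pt_fst_pt Km).
        + apply (continuity_2d_pt_fst_pt char_Q). apply cont2_char_Q.
      - intros t Ht. unfold f.
        replace 0 with ((0 - - k t y) - (- ta t y * (Kp t y - Km t y) * char_Q t y + Km t y * - h t y)).
        2:{ rewrite Heq by lra. unfold k. ring. }
        apply (is_derive_minus (fun t => d y - RInt (fun z => k z y) t y)
                 (fun t => Km t y * char_Q t y)).
        + apply (is_derive_minus (fun _ => d y) (fun t => RInt (fun z => k z y) t y));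
            [apply @is_derive_const|].
          apply (is_derive_RInt_lower (fun z => k z y)).
          intros z. now apply (continuity_2d_pt_fst_pt k).
        + apply (is_derive_mult (fun t => Km t y) (fun t => char_Q t y)).
          * apply HdKm; lra.
          * apply is_derive_char_Q.
          * intros u v. apply Rmult_comm. }
    unfold f in E. rewrite RInt_point_R, char_Q_diag in E.
    unfold d in E |- *. lra.
- intros x. apply (HF x x).
Qed.

End Characteristic.

(** * The hodograph map and its inverse *)

Section Hodograph.

Context (X : R) (HX : 0 < X).

(* [xx], [yy], [ps] : physical coordinates and stream function of the point
   where the C- characteristic from shock abscissa xi meets the C+
   characteristic from eta. *)
Context (ta tb h P Q lamp lamm Ap Am xx yy ps xx1 xx2 yy1 yy2 ps1 ps2 E : R -> R -> R).
Context (phi Ps al m : R -> R).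

Context (ta_nonneg : forall x y, 0 <= x <= y -> y <= X -> 0 <= ta x y).
Context (tb_nonneg : forall x y, 0 <= x <= y -> y <= X -> 0 <= tb x y).
Context (cP : cont2 P) (cQ : cont2 Q).
Context (dP : forall x y, is_derive (fun t => P x t) y (- h x y)).
Context (dQ : forall x y, is_derive (fun t => Q t y) x (- h x y)).
Context (h_eq : forall x y, 0 <= x <= y -> y <= X -> h x y = ta x y * Q x y + tb x y * P x y).
Context (P_diag : forall x, 0 <= x <= X -> 0 < P x x).
Context (Q_diag : forall x, 0 <= x <= X -> 0 < Q x x).

Context (dxx1 : forall x y, is_derive (fun t => xx t y) x (xx1 x y)).
Context (dxx2 : forall x y, is_derive (fun t => xx x t) y (xx2 x y)).
Context (cxx1 : cont2 xx1).
Context (exx : forall x y, 0 <= x <= y -> y <= X -> xx1 x y = P x y /\ xx2 x y = Q x y).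
Context (xx_diag : forall x, 0 <= x <= X -> xx x x = x).

Context (dyy1 : forall x y, is_derive (fun t => yy t y) x (yy1 x y)).
Context (dyy2 : forall x y, is_derive (fun t => yy x t) y (yy2 x y)).
Context (cyy1 : cont2 yy1).
Context (eyy : forall x y, 0 <= x <= y -> y <= X ->
  yy1 x y = lamp x y * P x y /\ yy2 x y = lamm x y * Q x y).
Context (yy_diag : forall x, 0 <= x <= X -> yy x x = phi x).

Context (dps1 : forall x y, is_derive (fun t => ps t y) x (ps1 x y)).
Context (dps2 : forall x y, is_derive (fun t => ps x t) y (ps2 x y)).
Context (cps1 : cont2 ps1).
Context (eps_ : forall x y, 0 <= x <= y -> y <= X ->
  ps1 x y = Ap x y * P x y /\ ps2 x y = - Am x y * Q x y).
Context (ps_diag : forall x, 0 <= x <= X -> ps x x = Ps x).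
Context (Ps_0 : Ps 0 = 0) (Ps_incr : forall x y, 0 <= x < y -> y <= X -> Ps x < Ps y).

Context (lam_lt : forall x y, 0 <= x <= y -> y <= X -> lamm x y < lamp x y).
Context (Ap_pos : forall x y, 0 <= x <= y -> y <= X -> 0 < Ap x y).

(** Data of the bootstrap along the C- characteristic from [x]: [E x] is the integrating factor of
    P, [al x] bounds the coefficient of Q after multiplication by it, and [m x] bounds from below
    the loss of [ps] per unit of x. [nondegenerate] is the form in which B_mass < B_nd enters. *)
Context (cE : forall x y, 0 <= x <= y -> y <= X -> cont_at_on x X (E x) y).
Context (dE : forall x y, 0 <= x < y -> y < X -> is_derive (fun t => E x t) y (tb x y * E x y)).
Context (E_pos : forall x y, 0 <= x <= y -> y <= X -> 0 < E x y).
Context (E_diag : forall x, 0 <= x <= X -> E x x = 1).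
Context (al_bound : forall x y, 0 <= x <= y -> y <= X -> ta x y * E x y <= al x).
Context (m_pos : forall x, 0 <= x <= X -> 0 < m x).
Context (m_bound : forall x y, 0 <= x <= y -> y <= X -> m x <= Am x y).
Context (nondegenerate : forall x, 0 <= x <= X -> al x * (Ps x / m x) < P x x).

Lemma Am_pos (x y : R) : 0 <= x <= y -> y <= X -> 0 < Am x y.
Proof.
intros H1 H2. apply Rlt_le_trans with (m x); [apply m_pos; lra|now apply m_bound].
Qed.

Lemma C1_cont2 (F F1 F2 : R -> R -> R) :
  (forall x y, is_derive (fun t => F t y) x (F1 x y)) ->
  (forall x y, is_derive (fun t => F x t) y (F2 x y)) -> cont2 F1 -> cont2 F.
Proof.
intros H1 H2 Hc x y. apply differentiable_continuity_pt.
exists (F1 x y), (F2 x y). apply C1_differentiable; auto.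
Qed.

Lemma cxx : cont2 xx. Proof. now apply (C1_cont2 xx xx1 xx2). Qed.
Lemma cyy : cont2 yy. Proof. now apply (C1_cont2 yy yy1 yy2). Qed.
Lemma cps : cont2 ps. Proof. now apply (C1_cont2 ps ps1 ps2). Qed.

Lemma cont_fst (F : R -> R -> R) (a b y t : R) : cont2 F -> cont_at_on a b (fun s => F s y) t.
Proof. intros H. apply continuity_pt_cont_at_on. now apply (continuity_2d_pt_fst_pt F). Qed.

Lemma cont_snd (F : R -> R -> R) (a b x t : R) : cont2 F -> cont_at_on a b (fun s => F x s) t.
Proof. intros H. apply continuity_pt_cont_at_on. now apply (continuity_2d_pt_snd_pt F). Qed.

Lemma Ps_nonneg (x : R) : 0 <= x <= X -> 0 <= Ps x.
Proof.
intros Hx. destruct (Req_dec x 0) as [->|Hne]; [lra|].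
rewrite <- Ps_0. left. apply Ps_incr; lra.
Qed.

(* Positivity of P and Q, hence monotonicity of [ps], is only known where
   [ps >= 0] on the whole domain of dependence. *)
Definition flow_set (x y : R) : Prop :=
  (0 <= x <= y /\ y <= X) /\ forall s t, x <= s <= t -> t <= y -> 0 <= ps s t.

Lemma flow_set_sub (x y x' y' : R) :
  flow_set x y -> x <= x' <= y' -> y' <= y -> flow_set x' y'.
Proof.
intros [[H1 H2] H3] Hx Hy. split; [lra|]. intros s t Hs Ht. apply H3; lra.
Qed.

Lemma flow_set_diag (x : R) : 0 <= x <= X -> flow_set x x.
Proof.
intros Hx. split; [lra|]. intros s t Hs Ht.
replace s with x by lra. replace t with x by lra. rewrite ps_diag by exact Hx. now apply Ps_nonneg.
Qed.

Lemma closed_triangle : closed_2d (fun x y => 0 <= x <= y /\ y <= X).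
Proof.
assert (H : closed_2d (fun x y => (0 <= x /\ 0 <= y - x) /\ - X <= - y)).
{ assert (C1 : cont2 (fun x _ => x)) by (intros x y; apply continuity_2d_pt_id1).
  assert (C2 : cont2 (fun _ y => y)) by (intros x y; apply continuity_2d_pt_id2).
  repeat apply closed_2d_and.
  - now apply (closed_2d_ge (fun x _ => x)).
  - apply (closed_2d_ge (fun x y => y - x)). now apply cont2_minus.
  - apply (closed_2d_ge (fun _ y => - y)). now apply cont2_opp. }
intros x y Hn. apply (locally_2d_impl (fun u v => ~ ((0 <= u /\ 0 <= v - u) /\ - X <= - v))).
- apply locally_2d_forall. intros u v H1 H2. apply H1. lra.
- apply H. intros H1. apply Hn. lra.
Qed.

Lemma clamp_monotone (a b s t : R) : s <= t -> clamp a b s <= clamp a b t.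
Proof. intros H. unfold clamp. now apply Rle_max_compat_l, Rle_min_compat_l. Qed.

(** The condition ranges over a triangle that moves with (x, y). Clamping fixed ordered pairs into
    that triangle replaces it by a family of closed conditions, each continuous in (x, y), indexed
    by a fixed set. *)
Lemma flow_set_closed : closed_2d flow_set.
Proof.
assert (Hc : forall s, cont2 (fun x y => clamp x y s)).
{ intros s x y eps. exists eps. intros u v Hu Hv. unfold clamp.
  apply Rmax_lipschitz; [exact Hu|]. apply Rmin_lipschitz; [exact Hv|].
  rewrite Rminus_diag, Rabs_R0. apply cond_pos. }
assert (H : closed_2d (fun x y => (0 <= x <= y /\ y <= X) /\
  forall p : { st : R * R | fst st <= snd st },
    0 <= ps (clamp x y (fst (proj1_sig p))) (clamp x y (snd (proj1_sig p))))).
{ apply closed_2d_and; [apply closed_triangle|]. apply closed_2d_forall. intros p.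
  apply closed_2d_ge. apply cont2_comp; [apply cps|apply Hc|apply Hc]. }
assert (Heq : forall x y, flow_set x y <-> (0 <= x <= y /\ y <= X) /\
  forall p : { st : R * R | fst st <= snd st },
    0 <= ps (clamp x y (fst (proj1_sig p))) (clamp x y (snd (proj1_sig p)))).
{ intros x y. split; intros [H1 H2]; (split; [exact H1|]).
  - intros [[s t] Hst]. simpl in *.
    assert (R1 := clamp_range x y s ltac:(lra)). assert (R2 := clamp_range x y t ltac:(lra)).
    apply H2; [|lra]. split; [lra|]. now apply clamp_monotone.
  - intros s t Hs Ht. specialize (H2 (exist _ (s, t) (proj2 Hs))). simpl in H2.
    rewrite !clamp_id in H2 by lra. exact H2. }
intros x y Hn. rewrite Heq in Hn.
apply (locally_2d_impl _ _ x y) with (2 := H x y Hn).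
apply locally_2d_forall. intros u v H1 H2. apply H1. now apply Heq.
Qed.

(** * Positivity of P and Q on the flow set *)

Lemma xx_along_P (x x' y : R) :
  0 <= x < x' -> x' <= y -> y <= X -> (forall s, x < s < x' -> 0 < P s y) ->
  xx x y < xx x' y /\ ps x y < ps x' y.
Proof.
intros H1 H2 H3 HP. split.
- apply (incr_on x x' (fun s => xx s y)); [lra| |].
  + intros s _. apply cont_fst, cxx.
  + intros s Hs. exists (xx1 s y). split; [apply dxx1|].
    destruct (exx s y) as [-> _]; try lra. now apply HP.
- apply (incr_on x x' (fun s => ps s y)); [lra| |].
  + intros s _. apply cont_fst, cps.
  + intros s Hs. exists (ps1 s y). split; [apply dps1|].
    destruct (eps_ s y) as [-> _]; try lra. apply Rmult_lt_0_compat; [apply Ap_pos; lra|now apply HP].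
Qed.

Lemma xx_along_Q (x y y' : R) :
  0 <= x <= y -> y < y' -> y' <= X -> (forall t, y < t < y' -> 0 < Q x t) ->
  xx x y < xx x y' /\ ps x y' < ps x y.
Proof.
intros H1 H2 H3 HQ. split.
- apply (incr_on y y' (fun t => xx x t)); [lra| |].
  + intros s _. apply cont_snd, cxx.
  + intros s Hs. exists (xx2 x s). split; [apply dxx2|].
    destruct (exx x s) as [_ ->]; try lra. now apply HQ.
- apply Ropp_lt_cancel. apply (incr_on y y' (fun t => - ps x t)); [lra| |].
  + intros s _. apply (cont_snd (fun x t => - ps x t)). apply cont2_opp, cps.
  + intros s Hs. exists (- ps2 x s). split.
    * apply (is_derive_opp (fun t => ps x t)). apply dps2.
    * destruct (eps_ x s) as [_ ->]; try lra.
      assert (0 < Am x s * Q x s); [|lra].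
      apply Rmult_lt_0_compat; [apply Am_pos; lra|now apply HQ].
Qed.

(* The bootstrap step: [E P + al x] is nondecreasing and [ps + m x] is
   nonincreasing along a C- characteristic, and [nondegenerate] bridges them. *)
Lemma flow_set_step (x y : R) :
  flow_set x y ->
  (forall s t, x <= s <= t -> t <= y -> t - s < y - x -> 0 < P s t /\ 0 < Q s t) ->
  0 < P x y /\ 0 < Q x y.
Proof.
intros [[H0 HyX] Hps] Hgood.
destruct (Req_dec x y) as [<-|Hne]; [split; [apply P_diag|apply Q_diag]; lra|].
assert (Hxy : x < y) by lra. split.
- assert (HQ : forall t, x < t < y -> 0 < Q x t) by (intros t Ht; apply Hgood; lra).
  (* The factor [E] removes the term - tb P from the derivative; what remains is - ta E Q, and it is
     dominated by al Q, the derivative of al x. *)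
  assert (V : E x x * P x x + al x * xx x x <= E x y * P x y + al x * xx x y).
  { apply (nondecr_on x y (fun t => E x t * P x t + al x * xx x t)); [lra| |].
    - intros t Ht.
      apply (cont_at_on_comp_2d x y (fun u v => u + v)
               (fun t => E x t * P x t) (fun t => al x * xx x t)).
      + apply continuity_2d_pt_plus; [apply continuity_2d_pt_id1|apply continuity_2d_pt_id2].
      + apply (cont_at_on_comp_2d x y Rmult (E x) (fun t => P x t)).
        * apply continuity_2d_pt_mult; [apply continuity_2d_pt_id1|apply continuity_2d_pt_id2].
        * apply (cont_at_on_subinterval x X); try lra. apply cE; lra.
        * now apply cont_snd.
      + apply (cont_snd (fun x' t => al x * xx x' t)). apply cont2_mult; [apply cont2_const|apply cxx].
    - intros t Ht. exists ((tb x t * E x t * P x t + E x t * - h x t) + al x * xx2 x t). split.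
      + apply (is_derive_plus (fun t => E x t * P x t) (fun t => al x * xx x t)).
        * apply (is_derive_mult (fun t => E x t) (fun t => P x t)).
          -- apply dE; lra.
          -- apply dP.
          -- intros u v. apply Rmult_comm.
        * apply (is_derive_scal (fun t => xx x t)). apply dxx2.
      + destruct (exx x t) as [_ ->]; try lra. rewrite h_eq by lra.
        replace (tb x t * E x t * P x t + E x t * - (ta x t * Q x t + tb x t * P x t)
                 + al x * Q x t) with ((al x - ta x t * E x t) * Q x t) by ring.
        apply Rmult_le_pos; [|left; apply HQ; lra].
        assert (HB := al_bound x t ltac:(lra) ltac:(lra)). lra. }
  (* Per unit of x the stream function drops by at least [m x]. It starts at [Ps x] on the shock and
     is still nonnegative, hence x - xi <= Ps / m. *)
  assert (W : - (ps x x + m x * xx x x) <= - (ps x y + m x * xx x y)).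
  { apply (nondecr_on x y (fun t => - (ps x t + m x * xx x t))); [lra| |].
    - intros t Ht. apply (cont_snd (fun x' t => - (ps x' t + m x * xx x' t))).
      apply cont2_opp, cont2_plus; [apply cps|apply cont2_mult; [apply cont2_const|apply cxx]].
    - intros t Ht. exists (- (ps2 x t + m x * xx2 x t)). split.
      + apply (is_derive_opp (fun t => ps x t + m x * xx x t)).
        apply (is_derive_plus (fun t => ps x t) (fun t => m x * xx x t)); [apply dps2|].
        apply (is_derive_scal (fun t => xx x t)). apply dxx2.
      + destruct (exx x t) as [_ ->]; try lra. destruct (eps_ x t) as [_ ->]; try lra.
        replace (- (- Am x t * Q x t + m x * Q x t)) with ((Am x t - m x) * Q x t) by ring.
        apply Rmult_le_pos; [|left; apply HQ; lra].
        assert (HB := m_bound x t ltac:(lra) ltac:(lra)). lra. }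
  assert (Hpxy := Hps x y ltac:(lra) ltac:(lra)).
  rewrite E_diag, xx_diag in V by lra. rewrite ps_diag, xx_diag in W by lra.
  assert (Hm := m_pos x ltac:(lra)).
  assert (Hx : xx x y - x <= Ps x / m x).
  { apply (Rmult_le_reg_l (m x)); [exact Hm|].
    replace (m x * (Ps x / m x)) with (Ps x) by (field; lra). lra. }
  assert (Hal : 0 <= al x).
  { eapply Rle_trans; [|apply (al_bound x x); lra]. rewrite E_diag, Rmult_1_r by lra.
    apply ta_nonneg; lra. }
  assert (Hn := nondegenerate x ltac:(lra)).
  assert (Hax : al x * (xx x y - x) <= al x * (Ps x / m x)) by (now apply Rmult_le_compat_l).
  assert (Hpos : 0 < E x y * P x y) by lra.
  assert (HE := E_pos x y ltac:(lra) HyX). nra.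
(* On the open segment from (x, y) to (y, y) the points are nearer to the diagonal, so P and Q are
   positive there and h >= 0: Q decreases in its first variable and is at least its diagonal
   value. *)
- assert (HQ : - Q x y <= - Q y y).
  { apply (nondecr_on x y (fun s => - Q s y)); [lra| |].
    - intros s _. apply (cont_fst (fun s y => - Q s y)). now apply cont2_opp.
    - intros s Hs. exists (- - h s y). split.
      + apply (is_derive_opp (fun s => Q s y)). apply dQ.
      + rewrite h_eq by lra. destruct (Hgood s y) as [G1 G2]; try lra.
        assert (H1 := ta_nonneg s y ltac:(lra) HyX). assert (H2 := tb_nonneg s y ltac:(lra) HyX).
        assert (0 <= ta s y * Q s y) by (apply Rmult_le_pos; lra).
        assert (0 <= tb s y * P s y) by (apply Rmult_le_pos; lra). lra. }
  assert (H1 := Q_diag y ltac:(lra)). lra.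
Qed.

(** Continuation in the distance t - s from the diagonal. Let - d be the infimum of this distance
    over the points of the triangle where P or Q is not positive. [flow_set_step] gives positivity
    up to and including the distance - d. The bad set is compact, so t - s + d has a positive lower
    bound on it, which contradicts the choice of d. *)
Lemma flow_set_pos (x y : R) : flow_set x y -> 0 < P x y /\ 0 < Q x y.
Proof.
intros Hxy.
set (N := fun s t => (x <= s <= t /\ t <= y) /\ (P s t <= 0 \/ Q s t <= 0)).
assert (Hgood : forall s t, x <= s <= t -> t <= y -> ~ N s t -> 0 < P s t /\ 0 < Q s t).
{ intros s t Hs Ht Hn. destruct (Rlt_dec 0 (P s t)) as [H1|H1], (Rlt_dec 0 (Q s t)) as [H2|H2];
  try (split; assumption); exfalso; apply Hn; (split; [lra|]); lra. }
destruct (classic (exists s t, N s t)) as [[s0 [t0 HN]]|Hno].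
2:{ destruct Hxy as [[H1 H2] H3]. apply Hgood; try lra. intros HN. apply Hno. now exists x, y. }
exfalso.
destruct (completeness (fun d => exists s t, N s t /\ d = s - t)) as [d [Hub Hlub]].
{ exists 0. intros d [s [t [[[H1 _] _] ->]]]. lra. }
{ exists (s0 - t0). now exists s0, t0. }
assert (Hbelow : forall s t, x <= s <= t -> t <= y -> t - s < - d -> 0 < P s t /\ 0 < Q s t).
{ intros s t Hs Ht Hd. apply Hgood; try assumption. intros HN'.
  assert (s - t <= d) by (apply Hub; now exists s, t). lra. }
assert (Hat : forall s t, x <= s <= t -> t <= y -> t - s <= - d -> 0 < P s t /\ 0 < Q s t).
{ intros s t Hs Ht Hd. apply flow_set_step.
  - now apply (flow_set_sub x y).
  - intros s' t' Hs' Ht' Hd'. apply Hbelow; lra. }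
destruct (pos_lower_bound_2d N (fun s t => t - s + d) x y x y) as [e [He Hmin]].
- assert (C1 : cont2 (fun x _ => x)) by (intros u v; apply continuity_2d_pt_id1).
  assert (C2 : cont2 (fun _ y => y)) by (intros u v; apply continuity_2d_pt_id2).
  assert (HNc : closed_2d (fun s t => ((x <= s /\ 0 <= t - s) /\ - y <= - t) /\
    (0 <= - P s t \/ 0 <= - Q s t))).
  { apply closed_2d_and; [repeat apply closed_2d_and|apply closed_2d_or].
    - now apply (closed_2d_ge (fun x _ => x)).
    - apply (closed_2d_ge (fun x y => y - x)). now apply cont2_minus.
    - apply (closed_2d_ge (fun _ y => - y)). now apply cont2_opp.
    - apply (closed_2d_ge (fun x y => - P x y)). now apply cont2_opp.
    - apply (closed_2d_ge (fun x y => - Q x y)). now apply cont2_opp. }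
  intros s t Hn. eapply locally_2d_impl; [|apply HNc].
  + apply locally_2d_forall. intros u v H1 H2. apply H1. unfold N in H2. lra.
  + intros H1. apply Hn. unfold N. lra.
- intros s t [H1 _]. lra.
- intros s t HNst. split.
  + apply continuity_2d_pt_plus; [apply continuity_2d_pt_minus|apply continuity_2d_pt_const].
    * apply continuity_2d_pt_id2.
    * apply continuity_2d_pt_id1.
  + apply Rnot_le_lt. intros Hle. destruct HNst as [[H1 H2] H3].
    destruct (Hat s t) as [H4 H5]; lra.
- assert (d <= d - e); [|lra]. apply Hlub. intros d' [s [t [HNst ->]]].
  specialize (Hmin s t HNst). simpl in Hmin. lra.
Qed.

Lemma incr_xi (x x' y : R) : flow_set x y -> x < x' <= y -> xx x y < xx x' y /\ ps x y < ps x' y.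
Proof.
intros H Hx. assert (HT := proj1 H). apply xx_along_P; try lra.
intros s Hs. apply flow_set_pos. apply (flow_set_sub x y); [exact H| |]; lra.
Qed.

Lemma incr_eta (x y' y : R) : flow_set x y -> x <= y' < y -> xx x y' < xx x y /\ ps x y < ps x y'.
Proof.
intros H Hx. assert (HT := proj1 H). apply xx_along_Q; try lra.
intros s Hs. apply flow_set_pos. apply (flow_set_sub x y); [exact H| |]; lra.
Qed.

Lemma incr_xi_le (x x' y : R) : flow_set x y -> x <= x' <= y -> xx x y <= xx x' y /\ ps x y <= ps x' y.
Proof.
intros H Hx. destruct (Req_dec x x') as [->|Hne]; [lra|].
destruct (incr_xi x x' y H); lra.
Qed.

Lemma incr_eta_le (x y' y : R) : flow_set x y -> x <= y' <= y -> xx x y' <= xx x y /\ ps x y <= ps x y'.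
Proof.
intros H Hx. destruct (Req_dec y' y) as [->|Hne]; [lra|].
destruct (incr_eta x y' y H); lra.
Qed.

(** The C+ characteristic leads to the shock point of abscissa [y] and the C- characteristic back to
    the one of abscissa [x]; the coordinate [xx] is monotone along both. *)
Lemma xx_le_eta (x y : R) : flow_set x y -> x <= xx x y <= y.
Proof.
intros H. assert (HT := proj1 H).
destruct (incr_xi_le x y y H); [lra|]. destruct (incr_eta_le x x y H); [lra|].
rewrite xx_diag in * by lra. lra.
Qed.

(** The least [w] with (w, y) in the flow set exists because the set is closed. If [ps w y] were
    positive, uniform continuity would keep [ps] nonnegative on a slightly larger triangle, against
    minimality. For y > 0 also w > 0, since along the C- characteristic from the tip [ps] decreases
    strictly from Ps 0 = 0. *)
Lemma wedge_point_exists (y : R) : 0 <= y <= X ->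
  exists x, flow_set x y /\ ps x y = 0 /\ (0 < y -> 0 < x).
Proof.
intros Hy.
destruct (completeness (fun z => flow_set (- z) y)) as [z [Hub Hlub]].
{ exists 0. intros z [[H _] _]. lra. }
{ exists (- y). rewrite Ropp_involutive. now apply flow_set_diag. }
set (w := - z).
assert (Hmin : forall x, flow_set x y -> w <= x).
{ intros x Hx. assert (- x <= z); [|unfold w; lra]. apply Hub. now rewrite Ropp_involutive. }
assert (HG : flow_set w y).
{ apply NNPP. intros Hn. destruct (flow_set_closed w y Hn) as [d Hd].
  assert (z <= z - d); [|assert (H0 := cond_pos d); lra]. apply Hlub. intros z' Hz'.
  apply Rnot_lt_le. intros Hlt. assert (H1 := Hub z' Hz').
  apply (Hd (- z') y); [| |exact Hz'].
  - unfold w. apply Rabs_def1; lra.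
  - rewrite Rminus_diag, Rabs_R0. apply cond_pos. }
assert (HT := proj1 HG).
assert (Hw0 : 0 < y -> 0 < w).
{ intros Hy0. apply Rnot_le_lt. intros Hle. assert (w = 0) as Hz by lra.
  destruct (incr_eta w w y HG) as [_ H]; [lra|].
  rewrite ps_diag, Hz, Ps_0 in H by lra.
  assert (0 <= ps w y) by (apply HG; lra). rewrite Hz in *. lra. }
exists w. split; [exact HG|]. split; [|exact Hw0].
destruct (Req_dec y 0) as [->|Hy0].
{ replace w with 0 by lra. rewrite ps_diag; lra. }
specialize (Hw0 ltac:(lra)).
apply NNPP. intros Hne.
assert (Hp : 0 < ps w y). { assert (0 <= ps w y) by (apply HG; lra). lra. }
destruct (uniform_continuity_2d ps 0 X 0 X (fun u v _ _ => cps u v) (mkposreal _ Hp)) as [d Hd].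
simpl in Hd. assert (Hd0 := cond_pos d).
set (x := Rmax 0 (w - d / 2)).
assert (Hx0 : 0 <= x) by apply Rmax_l. assert (Hxd : w - d / 2 <= x) by apply Rmax_r.
assert (Hxw : x < w) by (unfold x; apply Rmax_lub_lt; lra).
assert (w <= x); [|lra]. apply Hmin. split; [lra|].
intros s t Hs Ht.
(* The point (s, t) of the enlarged triangle is compared with its projection onto the old one, where
   [ps] is at least [ps w y] by monotonicity in both variables. *)
assert (L1 := Rmax_l s w). assert (L2 := Rmax_r s w).
assert (L3 := Rmax_l t w). assert (L4 := Rmax_r t w).
assert (M1 : Rmax s w <= Rmax t w) by (apply Rle_max_compat_r; lra).
assert (M2 : Rmax t w <= y) by (apply Rmax_lub; lra).
assert (Hs' : Rabs (s - Rmax s w) < d).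
{ unfold Rmax in *. destruct (Rle_dec s w); apply Rabs_def1; lra. }
assert (Ht' : Rabs (t - Rmax t w) < d).
{ unfold Rmax in *. destruct (Rle_dec t w); apply Rabs_def1; lra. }
specialize (Hd (Rmax s w) (Rmax t w) s t ltac:(lra) ltac:(lra) ltac:(lra) ltac:(lra) Hs' Ht').
apply Rabs_def2 in Hd.
destruct (incr_xi_le w (Rmax s w) y HG) as [_ K1]; [lra|].
destruct (incr_eta_le (Rmax s w) (Rmax t w) y) as [_ K2]; [|lra|].
{ apply (flow_set_sub w y); [exact HG| |]; lra. }
lra.
Qed.

Lemma wedge_fun_exists : exists w : R -> R, forall y, 0 <= y <= X ->
  flow_set (w y) y /\ ps (w y) y = 0 /\ (0 < y -> 0 < w y).
Proof.
exists (fun y => epsilon (inhabits 0) (fun x => flow_set x y /\ ps x y = 0 /\ (0 < y -> 0 < x))).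
intros y Hy. apply epsilon_spec. now apply wedge_point_exists.
Qed.

(** * Inversion of the hodograph map *)

Section Inverse.

(* The wedge in characteristic coordinates: [w eta] is the xi-coordinate of
   the point where the C+ characteristic from eta leaves the flow. *)
Context (w : R -> R).
Context (w_spec : forall y, 0 <= y <= X ->
  flow_set (w y) y /\ ps (w y) y = 0 /\ (0 < y -> 0 < w y)).

Lemma w_unique (x y : R) : flow_set x y -> ps x y = 0 -> x = w y.
Proof.
intros H Hp. assert (HT := proj1 H).
destruct (w_spec y) as [Hw [Hw0 _]]; [lra|]. assert (HTw := proj1 Hw).
destruct (Rtotal_order x (w y)) as [Hlt|[Heq|Hgt]]; [|exact Heq|].
- destruct (incr_xi x (w y) y H); lra.
- destruct (incr_xi (w y) x y Hw); lra.
Qed.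

Lemma w_le (x y : R) : flow_set x y -> w y <= x.
Proof.
intros H. assert (HT := proj1 H). destruct (w_spec y) as [Hw [Hw0 _]]; [lra|].
assert (HTw := proj1 Hw). apply Rnot_lt_le. intros Hlt.
destruct (incr_xi x (w y) y H) as [_ K]; [lra|].
assert (0 <= ps x y) by (apply H; lra). lra.
Qed.

Lemma flow_set_right (x y : R) : 0 <= y <= X -> w y <= x <= y -> flow_set x y.
Proof.
intros Hy Hx. destruct (w_spec y Hy) as [Hw _].
apply (flow_set_sub (w y) y); [exact Hw| |]; lra.
Qed.

Lemma w_range (y : R) : 0 <= y <= X -> 0 <= w y <= y.
Proof. intros Hy. destruct (w_spec y Hy) as [[H _] _]. lra. Qed.

Lemma w_lt (y : R) : 0 < y <= X -> w y < y.
Proof.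
intros Hy. destruct (w_spec y) as [Hw [Hw0 _]]; [lra|].
assert (HT := proj1 Hw). destruct (Req_dec (w y) y) as [E1|E1]; [|lra].
rewrite E1, ps_diag in Hw0 by lra. assert (H := Ps_incr 0 y). lra.
Qed.

(** Going back along C- from the wedge point of [y'] makes [ps] positive at (w y', y), while [ps]
    vanishes at (w y, y) and increases in xi; so w y' cannot be at most w y. *)
Lemma w_incr (y y' : R) : 0 <= y < y' -> y' <= X -> w y < w y'.
Proof.
intros Hy Hy'. destruct (w_spec y) as [H [H0 _]]; [lra|].
destruct (w_spec y') as [H' [H0' _]]; [lra|].
assert (HT := proj1 H). assert (HT' := proj1 H').
apply Rnot_le_lt. intros Hle.
destruct (incr_eta (w y') y y' H') as [_ K]; [lra|].
destruct (incr_xi_le (w y') (w y) y) as [_ K']; [|lra|].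
- apply (flow_set_sub (w y') y'); [exact H'| |]; lra.
- lra.
Qed.

Lemma w_cont (y : R) : 0 <= y <= X -> cont_at_on 0 X w y.
Proof.
intros Hy. apply (closed_graph_cont (fun t x => flow_set x t /\ ps x t = 0) w 0 X 0 X y).
- intros t x Hn.
  assert (HC : closed_2d (fun x y => flow_set x y /\ ps x y = 0)).
  { apply closed_2d_and; [apply flow_set_closed|apply closed_2d_eq, cps]. }
  destruct (HC x t Hn) as [d Hd]. exists d. intros u v Hu Hv. now apply Hd.
- intros t x [H _]. assert (HT := proj1 H). lra.
- intros t Ht. destruct (w_spec t Ht) as [H1 [H2 _]]. now split.
- intros x [H1 H2]. now apply w_unique.
Qed.

Definition wedge_x (y : R) : R := xx (w y) y.
Definition Xw : R := wedge_x X.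

(** If w y' <= y, the corner (w y', y) joins the two wedge points by one C+ and one C- step, both
    increasing x. Otherwise the abscissae are separated: the first is at most y and the second at
    least w y' > y. *)
Lemma wedge_x_incr (y y' : R) : 0 <= y < y' -> y' <= X -> wedge_x y < wedge_x y'.
Proof.
intros Hy Hy'. unfold wedge_x.
destruct (w_spec y) as [H [_ _]]; [lra|]. destruct (w_spec y') as [H' [_ _]]; [lra|].
assert (HT := proj1 H). assert (HT' := proj1 H').
assert (Hw := w_incr y y' Hy Hy').
destruct (Rle_dec (w y') y) as [Hle|Hgt].
- destruct (incr_eta (w y') y y' H') as [K _]; [lra|].
  destruct (incr_xi (w y) (w y') y H) as [K' _]; lra.
- assert (K := xx_le_eta _ _ H). assert (K' := xx_le_eta _ _ H'). lra.
Qed.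

Lemma wedge_x_incr_le (y y' : R) : 0 <= y <= y' -> y' <= X -> wedge_x y <= wedge_x y'.
Proof.
intros H H'. destruct (Req_dec y y') as [->|Hne]; [lra|].
left. apply wedge_x_incr; lra.
Qed.

Lemma wedge_x_0 : wedge_x 0 = 0.
Proof.
unfold wedge_x. assert (Hw := w_range 0). replace (w 0) with 0 by lra. apply xx_diag. lra.
Qed.

Lemma wedge_x_lt (y : R) : 0 < y <= X -> wedge_x y < y.
Proof.
intros Hy. unfold wedge_x. destruct (w_spec y) as [H _]; [lra|].
destruct (incr_xi (w y) y y H) as [K _].
- split; [now apply w_lt|lra].
- rewrite xx_diag in K; lra.
Qed.

Lemma wedge_x_cont (y : R) : 0 <= y <= X -> cont_at_on 0 X wedge_x y.
Proof.
intros Hy. unfold wedge_x. apply (cont_at_on_comp_2d 0 X xx w (fun t => t)).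
- apply cxx.
- now apply w_cont.
- apply continuity_pt_cont_at_on. apply derivable_continuous_pt, derivable_pt_id.
Qed.

Lemma Xw_range : 0 < Xw < X.
Proof.
split.
- rewrite <- wedge_x_0. apply wedge_x_incr; lra.
- apply wedge_x_lt. lra.
Qed.

Lemma wedge_eta_exists : exists e : R -> R, forall x, 0 <= x <= Xw ->
  0 <= e x <= X /\ wedge_x (e x) = x.
Proof.
exists (fun x => epsilon (inhabits 0) (fun y => 0 <= y <= X /\ wedge_x y = x)).
intros x Hx. apply epsilon_spec.
apply (ivt_on 0 X wedge_x x); [lra|apply wedge_x_cont|].
assert (H := Xw_range). fold Xw. rewrite wedge_x_0, Rmin_left, Rmax_right; lra.
Qed.

(* Injectivity and surjectivity of the hodograph map are both read off the
   vertical lines, on which the height is a decreasing function of eta. *)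
Lemma vertical_line (x e : R) : 0 <= x <= e -> e <= X -> wedge_x e <= x ->
  exists z : R -> R,
    (forall y, x <= y <= e -> flow_set (z y) y /\ xx (z y) y = x) /\
    (forall y s, x <= y <= e -> flow_set s y -> xx s y = x -> s = z y) /\
    (forall y, x <= y <= e -> cont_at_on x e (fun t => yy (z t) t) y) /\
    (forall y y', x <= y < y' -> y' <= e -> yy (z y') y' < yy (z y) y).
Proof.
intros Hx He Hwe.
(* Intermediate value along the C+ characteristic of [y]: its wedge point has abscissa at most
   [wedge_x e], hence at most x, and its shock point has abscissa y >= x. *)
assert (Hex : forall y, x <= y <= e -> exists s, flow_set s y /\ xx s y = x).
{ intros y Hy. assert (Hy0 : 0 <= y <= X) by lra.
  assert (Hw := w_range y Hy0).
  destruct (ivt_on (w y) y (fun s => xx s y) x) as [s [Hs Es]].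
  - lra.
  - intros s _. apply cont_fst, cxx.
  - rewrite xx_diag by lra. fold (wedge_x y).
    assert (wedge_x y <= wedge_x e) by (apply wedge_x_incr_le; lra).
    rewrite Rmin_left, Rmax_right; lra.
  - exists s. split; [now apply flow_set_right|exact Es]. }
assert (Huni : forall y s s', flow_set s y -> flow_set s' y -> xx s y = xx s' y -> s = s').
{ intros y s s' H H' Heq. assert (HT := proj1 H). assert (HT' := proj1 H').
  destruct (Rtotal_order s s') as [Hlt|[E1|Hgt]]; [|exact E1|].
  - destruct (incr_xi s s' y H); lra.
  - destruct (incr_xi s' s y H'); lra. }
set (z := fun y => epsilon (inhabits 0) (fun s => flow_set s y /\ xx s y = x)).
assert (Hz : forall y, x <= y <= e -> flow_set (z y) y /\ xx (z y) y = x).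
{ intros y Hy. apply epsilon_spec. now apply Hex. }
assert (Hzu : forall y s, x <= y <= e -> flow_set s y -> xx s y = x -> s = z y).
{ intros y s Hy Hs Es. destruct (Hz y Hy) as [H1 H2]. apply (Huni y); congruence. }
assert (Cz : forall y, x <= y <= e -> cont_at_on x e z y).
{ intros y Hy.
  apply (closed_graph_cont (fun t s => (x <= t /\ - e <= - t) /\ flow_set s t /\ xx s t = x) z x e 0 X y).
  - apply (closed_2d_and (fun t _ => x <= t /\ - e <= - t)).
    + assert (C1 : cont2 (fun x _ => x)) by (intros u v; apply continuity_2d_pt_id1).
      apply closed_2d_and.
      * now apply (closed_2d_ge (fun t _ => t)).
      * apply (closed_2d_ge (fun t _ => - t)). now apply cont2_opp.
    + intros t s Hn.
      assert (HC : closed_2d (fun s t => flow_set s t /\ xx s t = x)).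
      { apply closed_2d_and; [apply flow_set_closed|apply closed_2d_eq, cxx]. }
      destruct (HC s t Hn) as [d Hd]. exists d. intros u v Hu Hv. now apply Hd.
  - intros t s [H1 [H2 _]]. assert (HT := proj1 H2). lra.
  - intros t Ht. split; [lra|now apply Hz].
  - intros s [_ [H1 H2]]. now apply Hzu. }
assert (Cid : forall y, cont_at_on x e (fun t => t) y).
{ intros y. apply continuity_pt_cont_at_on. apply derivable_continuous_pt, derivable_pt_id. }
assert (Cy : forall y, x <= y <= e -> cont_at_on x e (fun t => yy (z t) t) y).
{ intros y Hy. apply (cont_at_on_comp_2d x e yy z (fun t => t)); auto. apply cyy. }
exists z. split; [exact Hz|]. split; [exact Hzu|]. split; [exact Cy|].
intros y y' Hy Hy'. apply Ropp_lt_cancel.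
apply (incr_on y y' (fun t => - yy (z t) t)); [lra| |].
- intros t Ht. apply (cont_at_on_comp_pt y y' Ropp).
  + apply derivable_continuous_pt. reg.
  + apply (cont_at_on_subinterval x e); try lra. apply Cy. lra.
- intros t Ht. assert (Hte : x < t < e) by lra.
  destruct (Hz t) as [HG Ex]; [lra|]. assert (HT := proj1 HG).
  destruct (flow_set_pos _ _ HG) as [HP HQ].
  destruct (exx (z t) t) as [E1 E2]; try lra. destruct (eyy (z t) t) as [E3 E4]; try lra.
  (* On the vertical line dx = 0 forces d xi = - (Q / P) d eta, hence dy = - (lamp - lamm) Q d
     eta. *)
  destruct (implicit_curve x e t z (fun s => s) (fun _ => x) (fun s => s) xx (fun _ v => v)
    (xx1 (z t) t) (xx2 (z t) t) 0 1 0 1) as [Hd _]; try lra.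
  + apply Cz; lra.
  + apply Cid.
  + apply C1_differentiable; auto.
  + apply (C1_differentiable (fun _ v => v) (fun _ _ => 0) (fun _ _ => 1)).
    * intros u v. apply @is_derive_const.
    * intros u v. apply @is_derive_id.
    * apply continuity_2d_pt_const.
  + apply is_derive_on_const; lra.
  + apply is_derive_on_id; lra.
  + intros s Hs. now apply Hz.
  + intros s Hs. reflexivity.
  + rewrite is_derive_on_interior in Hd by exact Hte.
    assert (Hy1 : is_derive (fun t => yy (z t) t) t
      (yy1 (z t) t * ((0 * 1 - 1 * xx2 (z t) t) / (xx1 (z t) t * 1 - xx2 (z t) t * 0)) + yy2 (z t) t * 1)).
    { apply is_derive_Reals. apply derivable_pt_lim_comp_2d.
      - apply C1_differentiable; auto.
      - now apply is_derive_Reals.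
      - apply is_derive_Reals. apply @is_derive_id. }
    eexists. split; [apply (is_derive_opp (fun t => yy (z t) t)); exact Hy1|].
    simpl. rewrite E1, E2, E3, E4.
    assert (HL := lam_lt (z t) t ltac:(lra) ltac:(lra)).
    change (0 < - (lamp (z t) t * P (z t) t * ((0 * 1 - 1 * Q (z t) t) / (P (z t) t * 1 - Q (z t) t * 0))
      + lamm (z t) t * Q (z t) t * 1)).
    replace (- (lamp (z t) t * P (z t) t * ((0 * 1 - 1 * Q (z t) t) / (P (z t) t * 1 - Q (z t) t * 0))
      + lamm (z t) t * Q (z t) t * 1)) with ((lamp (z t) t - lamm (z t) t) * Q (z t) t) by (field; lra).
    apply Rmult_lt_0_compat; lra.
Qed.

Lemma hodograph_injective (s1 t1 s2 t2 : R) :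
  flow_set s1 t1 -> flow_set s2 t2 -> xx s1 t1 = xx s2 t2 -> yy s1 t1 = yy s2 t2 ->
  s1 = s2 /\ t1 = t2.
Proof.
(* The point with the larger eta fixes the range of eta on the vertical line; the other point then
   lies on the same line. *)
assert (Hwlog : forall s1 t1 s2 t2, flow_set s1 t1 -> flow_set s2 t2 -> t1 <= t2 ->
  xx s1 t1 = xx s2 t2 -> yy s1 t1 = yy s2 t2 -> s1 = s2 /\ t1 = t2).
{ clear s1 t1 s2 t2. intros s1 t1 s2 t2 H1 H2 Hle Ex Ey.
  assert (T1 := proj1 H1). assert (T2 := proj1 H2).
  assert (K1 := xx_le_eta _ _ H1). assert (K2 := xx_le_eta _ _ H2).
  destruct (vertical_line (xx s2 t2) t2) as [z [_ [Hu [_ Hd]]]]; try lra.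
  { unfold wedge_x. apply incr_xi_le.
    - apply w_spec. lra.
    - split; [now apply w_le|lra]. }
  assert (E2 : s2 = z t2) by (apply Hu; [lra|exact H2|reflexivity]).
  assert (E1 : s1 = z t1) by (apply Hu; [lra|exact H1|exact Ex]).
  destruct (Req_dec t1 t2) as [Et|Hne]; [subst t1; split; congruence|].
  exfalso. specialize (Hd t1 t2 ltac:(lra) ltac:(lra)). rewrite <- E1, <- E2 in Hd. lra. }
intros H1 H2 Ex Ey. destruct (Rle_dec t1 t2) as [Hle|Hgt].
- now apply Hwlog.
- destruct (Hwlog s2 t2 s1 t1 H2 H1) as [A B]; lra.
Qed.

Context (we : R -> R).
Context (we_spec : forall x, 0 <= x <= Xw -> 0 <= we x <= X /\ wedge_x (we x) = x).

Lemma we_unique (x y : R) : 0 <= y <= X -> wedge_x y = x -> y = we x.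
Proof.
intros Hy E0.
assert (H0 : 0 <= wedge_x y) by (rewrite <- wedge_x_0; apply wedge_x_incr_le; lra).
assert (H1 : wedge_x y <= Xw) by (apply wedge_x_incr_le; lra).
destruct (we_spec x) as [H2 H3]; [lra|].
destruct (Rtotal_order y (we x)) as [Hlt|[E1|Hgt]]; [|exact E1|].
- assert (K := wedge_x_incr y (we x)). lra.
- assert (K := wedge_x_incr (we x) y). lra.
Qed.

Lemma char_xi_exists : exists zg : R -> R, forall x, Xw <= x <= X ->
  flow_set (zg x) X /\ xx (zg x) X = x.
Proof.
exists (fun x => epsilon (inhabits 0) (fun s => flow_set s X /\ xx s X = x)).
intros x Hx. apply epsilon_spec. assert (Hw := w_range X ltac:(lra)).
destruct (ivt_on (w X) X (fun s => xx s X) x) as [s [Hs Es]].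
- lra.
- intros s _. apply cont_fst, cxx.
- rewrite xx_diag by lra. fold (wedge_x X). fold Xw. rewrite Rmin_left, Rmax_right; lra.
- exists s. split; [apply flow_set_right; lra|exact Es].
Qed.

Context (zg : R -> R).
Context (zg_spec : forall x, Xw <= x <= X -> flow_set (zg x) X /\ xx (zg x) X = x).

Definition wedge_f (x : R) : R := yy (w (we x)) (we x).
Definition char_g (x : R) : R := yy (zg x) X.

Lemma zg_unique (x s : R) : Xw <= x <= X -> flow_set s X -> xx s X = x -> s = zg x.
Proof.
intros Hx Hs Es. destruct (zg_spec x Hx) as [H1 H2].
assert (HT := proj1 Hs). assert (HT1 := proj1 H1).
destruct (Rtotal_order s (zg x)) as [Hlt|[E1|Hgt]]; [|exact E1|].
- destruct (incr_xi s (zg x) X Hs); lra.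
- destruct (incr_xi (zg x) s X H1); lra.
Qed.

Lemma we_0 : we 0 = 0.
Proof. symmetry. apply we_unique; [lra|apply wedge_x_0]. Qed.

Lemma we_Xw : we Xw = X.
Proof. symmetry. apply we_unique; [lra|reflexivity]. Qed.

Lemma we_gt (x : R) : 0 < x <= Xw -> x < we x.
Proof.
intros Hx. destruct (we_spec x) as [H1 H2]; [lra|].
destruct (Req_dec (we x) 0) as [E0|Hne]; [rewrite E0, wedge_x_0 in H2; lra|].
assert (K := wedge_x_lt (we x)). lra.
Qed.

Lemma char_g_X : char_g X = phi X.
Proof.
unfold char_g. rewrite <- (zg_unique X X).
- apply yy_diag. lra.
- assert (H := Xw_range). lra.
- apply flow_set_diag. lra.
- apply xx_diag. lra.
Qed.

Lemma char_g_Xw : char_g Xw = wedge_f Xw.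
Proof.
unfold char_g, wedge_f. rewrite we_Xw. rewrite <- (zg_unique Xw (w X)); [reflexivity| | |].
- assert (H := Xw_range). lra.
- apply w_spec. lra.
- reflexivity.
Qed.

Lemma z_shock (x e : R) (z : R -> R) : 0 <= x <= e -> e <= X ->
  (forall y s, x <= y <= e -> flow_set s y -> xx s y = x -> s = z y) -> yy (z x) x = phi x.
Proof.
intros Hx He Hu. rewrite <- (Hu x x).
- apply yy_diag. lra.
- lra.
- apply flow_set_diag. lra.
- apply xx_diag. lra.
Qed.

Lemma wedge_f_below (x : R) : 0 < x <= Xw -> wedge_f x < phi x.
Proof.
intros Hx. destruct (we_spec x) as [H1 H2]; [lra|]. assert (H3 := we_gt x Hx).
destruct (vertical_line x (we x)) as [z [Hz [Hu [_ Hd]]]]; try lra.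
rewrite <- (z_shock x (we x) z) by (try lra; exact Hu).
unfold wedge_f. rewrite (Hu (we x) (w (we x))).
- apply Hd; lra.
- lra.
- now apply w_spec.
- exact H2.
Qed.

Lemma char_g_below (x : R) : Xw <= x < X -> char_g x < phi x.
Proof.
intros Hx. assert (HXw := Xw_range). destruct (zg_spec x) as [H1 H2]; [lra|].
destruct (vertical_line x X) as [z [Hz [Hu [_ Hd]]]]; try lra.
{ fold Xw. lra. }
rewrite <- (z_shock x X z) by (try lra; exact Hu).
unfold char_g. rewrite (Hu X (zg x)); [apply Hd; lra|lra|exact H1|exact H2].
Qed.

Lemma hodograph_surjective (x y : R) : Omega_closure X phi Xw wedge_f char_g x y ->
  exists s t, flow_set s t /\ xx s t = x /\ yy s t = y.
Proof.
intros [Hx [Hy [Hf Hg]]]. assert (HXw := Xw_range).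
(* [e] is the eta-coordinate of the lower end of the vertical section: on the wedge when x <= Xw, on
   the closing characteristic eta = X otherwise. *)
assert (Hcase : exists e, x <= e <= X /\ wedge_x e <= x /\
  exists s, flow_set s e /\ xx s e = x /\ yy s e <= y).
{ destruct (Rle_dec x Xw) as [Hle|Hgt].
  - destruct (we_spec x) as [H1 H2]; [lra|]. exists (we x). repeat split; try lra.
    + destruct (Req_dec x 0) as [->|Hne]; [lra|]. left. apply we_gt. lra.
    + exists (w (we x)). destruct (w_spec (we x) H1) as [H3 _].
      split; [exact H3|]. split; [exact H2|]. now apply Hf.
  - destruct (zg_spec x) as [H1 H2]; [lra|]. exists X. fold Xw. repeat split; try lra.
    exists (zg x). split; [exact H1|]. split; [exact H2|]. apply Hg. lra. }
destruct Hcase as [e [He [Hwe [s [Hs [Es Ey]]]]]].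
destruct (vertical_line x e) as [z [Hz [Hu [Hc Hd]]]]; try lra.
rewrite (Hu e s) in Ey by (try lra; assumption).
assert (Esh := z_shock x e z ltac:(lra) ltac:(lra) Hu).
destruct (ivt_on x e (fun t => yy (z t) t) y) as [t [Ht Et]].
- lra.
- exact Hc.
- simpl. rewrite Esh, Rmin_right, Rmax_left; lra.
- exists (z t), t. destruct (Hz t Ht) as [H1 H2]. split; [exact H1|now split].
Qed.

Lemma inverse_exists : exists xi eta : R -> R -> R, forall x y,
  Omega_closure X phi Xw wedge_f char_g x y ->
  flow_set (xi x y) (eta x y) /\ xx (xi x y) (eta x y) = x /\ yy (xi x y) (eta x y) = y.
Proof.
set (c := fun x y => epsilon (inhabits (0, 0)) (fun p : R * R =>
  flow_set (fst p) (snd p) /\ xx (fst p) (snd p) = x /\ yy (fst p) (snd p) = y)).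
exists (fun x y => fst (c x y)), (fun x y => snd (c x y)).
intros x y H. unfold c. apply epsilon_spec.
destruct (hodograph_surjective x y H) as [s [t Hst]]. now exists (s, t).
Qed.

Context (phi_cont : forall x, 0 <= x <= X -> cont_at_on 0 X phi x).
Context (xi eta : R -> R -> R).
Context (inv_spec : forall x y, Omega_closure X phi Xw wedge_f char_g x y ->
  flow_set (xi x y) (eta x y) /\ xx (xi x y) (eta x y) = x /\ yy (xi x y) (eta x y) = y).

Lemma inverse_unique (x y s t : R) : Omega_closure X phi Xw wedge_f char_g x y ->
  flow_set s t -> xx s t = x -> yy s t = y -> xi x y = s /\ eta x y = t.
Proof.
intros H Hst Ex Ey. destruct (inv_spec x y H) as [H1 [H2 H3]].
apply hodograph_injective; try assumption; congruence.
Qed.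

Lemma wedge_f_le (x : R) : 0 <= x <= Xw -> wedge_f x <= phi x.
Proof.
intros Hx. destruct (Req_dec x 0) as [->|Hne]; [|left; apply wedge_f_below; lra].
unfold wedge_f. rewrite we_0. assert (Hw := w_range 0 ltac:(lra)).
replace (w 0) with 0 by lra. rewrite yy_diag; lra.
Qed.

Lemma char_g_le (x : R) : Xw <= x <= X -> char_g x <= phi x.
Proof.
intros Hx. destruct (Req_dec x X) as [->|Hne]; [rewrite char_g_X; lra|].
left. apply char_g_below. lra.
Qed.

Lemma closure_shock (x : R) : 0 <= x <= X -> Omega_closure X phi Xw wedge_f char_g x (phi x).
Proof.
intros Hx. split; [exact Hx|]. split; [lra|]. split; intros H.
- apply wedge_f_le. lra.
- apply char_g_le. lra.
Qed.

Lemma closure_wedge (x : R) : 0 <= x <= Xw -> Omega_closure X phi Xw wedge_f char_g x (wedge_f x).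
Proof.
intros Hx. assert (HXw := Xw_range). split; [lra|]. split; [now apply wedge_f_le|].
split; intros H; [lra|]. replace x with Xw by lra. rewrite char_g_Xw. lra.
Qed.

Lemma closure_char (x : R) : Xw <= x <= X -> Omega_closure X phi Xw wedge_f char_g x (char_g x).
Proof.
intros Hx. assert (HXw := Xw_range). split; [lra|]. split; [now apply char_g_le|].
split; intros H; [|lra]. replace x with Xw by lra. rewrite char_g_Xw. lra.
Qed.

Lemma Omega_in_closure (x y : R) :
  Omega X phi Xw wedge_f char_g x y -> Omega_closure X phi Xw wedge_f char_g x y.
Proof.
intros [H1 [H2 [H3 H4]]]. split; [lra|]. split; [lra|]. split; intros H; left; auto.
Qed.

Lemma inverse_shock (x : R) : 0 <= x <= X -> xi x (phi x) = x /\ eta x (phi x) = x.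
Proof.
intros Hx. apply inverse_unique.
- now apply closure_shock.
- now apply flow_set_diag.
- now apply xx_diag.
- now apply yy_diag.
Qed.

Lemma inverse_wedge (x : R) : 0 <= x <= Xw ->
  xi x (wedge_f x) = w (we x) /\ eta x (wedge_f x) = we x.
Proof.
intros Hx. destruct (we_spec x Hx) as [H1 H2]. apply inverse_unique.
- now apply closure_wedge.
- now apply w_spec.
- exact H2.
- reflexivity.
Qed.

Lemma inverse_char (x : R) : Xw <= x <= X ->
  xi x (char_g x) = zg x /\ eta x (char_g x) = X.
Proof.
intros Hx. destruct (zg_spec x Hx) as [H1 H2]. apply inverse_unique.
- now apply closure_char.
- exact H1.
- exact H2.
- reflexivity.
Qed.

(** A continuous injection of a compact set has a continuous inverse: at distance [eps] from the
    preimage, the distance of the images is positive, hence bounded below. *)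
Lemma inverse_cont (x y eps : R) : Omega_closure X phi Xw wedge_f char_g x y -> 0 < eps ->
  exists d, 0 < d /\ forall u v, Omega_closure X phi Xw wedge_f char_g u v ->
    Rabs (u - x) < d -> Rabs (v - y) < d ->
    Rabs (xi u v - xi x y) < eps /\ Rabs (eta u v - eta x y) < eps.
Proof.
intros Hxy Heps. destruct (inv_spec x y Hxy) as [HG [Ex Ey]].
set (s0 := xi x y) in *. set (t0 := eta x y) in *.
assert (CF : cont2 (fun s t => Rabs (xx s t - x) + Rabs (yy s t - y))).
{ assert (CA : forall F c, cont2 F -> cont2 (fun s t => Rabs (F s t - c))).
  { intros F c HF s t. apply (continuity_1d_2d_pt_comp Rabs (fun s t => F s t - c)).
    - apply Rcontinuity_abs.
    - apply continuity_2d_pt_minus; [apply HF|apply continuity_2d_pt_const]. }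
  apply cont2_plus; apply CA; [apply cxx|apply cyy]. }
assert (CA : forall c s, continuity_pt (fun s => Rabs (s - c)) s).
{ intros c s. apply (continuity_pt_comp (fun s => s - c) Rabs); [reg|apply Rcontinuity_abs]. }
destruct (pos_lower_bound_2d
  (fun s t => flow_set s t /\ (eps <= Rabs (s - s0) \/ eps <= Rabs (t - t0)))
  (fun s t => Rabs (xx s t - x) + Rabs (yy s t - y)) 0 X 0 X) as [d [Hd Hmin]].
- apply closed_2d_and; [apply flow_set_closed|]. apply closed_2d_or.
  + apply (closed_2d_ge (fun s _ => Rabs (s - s0))). now apply (cont2_fst (fun s => Rabs (s - s0))).
  + apply (closed_2d_ge (fun _ t => Rabs (t - t0))). now apply (cont2_snd (fun t => Rabs (t - t0))).
- intros s t [H _]. assert (HT := proj1 H). lra.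
- intros s t [H Hfar]. split; [apply CF|].
  assert (A1 := Rabs_pos (xx s t - x)). assert (A2 := Rabs_pos (yy s t - y)).
  apply Rnot_le_lt. intros Hle.
  assert (B1 : xx s t = x).
  { apply Rminus_diag_uniq. apply NNPP. intros Hne. apply Rabs_pos_lt in Hne. lra. }
  assert (B2 : yy s t = y).
  { apply Rminus_diag_uniq. apply NNPP. intros Hne. apply Rabs_pos_lt in Hne. lra. }
  destruct (inverse_unique x y s t Hxy H B1 B2) as [E1 E2].
  unfold s0, t0 in Hfar. rewrite E1, E2, !Rminus_diag, Rabs_R0 in Hfar. lra.
- exists (d / 2). split; [lra|]. intros u v Huv Hu Hv.
  destruct (inv_spec u v Huv) as [HG' [Eu Ev]].
  split; apply Rnot_le_lt; intros Hle.
  + specialize (Hmin (xi u v) (eta u v) (conj HG' (or_introl Hle))). simpl in Hmin.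
    rewrite Eu, Ev in Hmin. lra.
  + specialize (Hmin (xi u v) (eta u v) (conj HG' (or_intror Hle))). simpl in Hmin.
    rewrite Eu, Ev in Hmin. lra.
Qed.

Lemma we_cont (x : R) : 0 <= x <= Xw -> cont_at_on 0 Xw we x.
Proof.
intros Hx. assert (HXw := Xw_range).
set (wc := fun t => wedge_x (clamp 0 X t)).
assert (Hwc : forall t, continuity_pt wc t).
{ intros t. apply cont_at_on_clamp; [lra|]. apply wedge_x_cont. }
apply (closed_graph_cont (fun t y => (((0 <= t /\ - Xw <= - t) /\ 0 <= y) /\ - X <= - y)
  /\ wc y - t = 0) we 0 Xw 0 X x).
- assert (C1 : cont2 (fun x _ => x)) by (intros u v; apply continuity_2d_pt_id1).
  assert (C2 : cont2 (fun _ y => y)) by (intros u v; apply continuity_2d_pt_id2).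
  apply closed_2d_and; [repeat apply closed_2d_and|].
  + now apply (closed_2d_ge (fun x _ => x)).
  + apply (closed_2d_ge (fun t _ => - t)). now apply cont2_opp.
  + now apply (closed_2d_ge (fun _ y => y)).
  + apply (closed_2d_ge (fun _ y => - y)). now apply cont2_opp.
  + apply (closed_2d_eq (fun t y => wc y - t)). apply cont2_minus; [now apply cont2_snd|exact C1].
- intros t y H. lra.
- intros t Ht. destruct (we_spec t Ht) as [H1 H2]. split; [lra|].
  unfold wc. rewrite clamp_id by exact H1. lra.
- intros y [H1 H2]. apply we_unique; [lra|]. unfold wc in H2. rewrite clamp_id in H2 by lra. lra.
Qed.

(** The wedge is the level ps = 0 parametrised by x, so P dxi + Q deta = dt and Ap P dxi - Am Q deta
    = 0. Its slope is therefore the mean of [lamp] and [lamm] with weights [Am] and [Ap]. *)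
Lemma wedge_derive (t : R) : 0 <= t <= Xw ->
  is_derive_on 0 Xw (fun t => w (we t)) t
    (Am (w (we t)) (we t) / (P (w (we t)) (we t) * (Ap (w (we t)) (we t) + Am (w (we t)) (we t)))) /\
  is_derive_on 0 Xw we t
    (Ap (w (we t)) (we t) / (Q (w (we t)) (we t) * (Ap (w (we t)) (we t) + Am (w (we t)) (we t)))) /\
  is_derive_on 0 Xw wedge_f t
    ((lamp (w (we t)) (we t) * Am (w (we t)) (we t) + lamm (w (we t)) (we t) * Ap (w (we t)) (we t))
     / (Ap (w (we t)) (we t) + Am (w (we t)) (we t))).
Proof.
intros Ht. assert (HXw := Xw_range). destruct (we_spec t Ht) as [H1 H2].
destruct (w_spec (we t) H1) as [HG [H0 _]]. assert (HT := proj1 HG).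
destruct (flow_set_pos _ _ HG) as [HP HQ].
destruct (exx (w (we t)) (we t)) as [E1 E2]; try lra.
destruct (eyy (w (we t)) (we t)) as [E3 E4]; try lra.
destruct (eps_ (w (we t)) (we t)) as [E5 E6]; try lra.
assert (HAp := Ap_pos (w (we t)) (we t) ltac:(lra) ltac:(lra)).
assert (HAm := Am_pos (w (we t)) (we t) ltac:(lra) ltac:(lra)).
assert (Hdet : 0 < P (w (we t)) (we t) * Q (w (we t)) (we t) *
  (Ap (w (we t)) (we t) + Am (w (we t)) (we t))).
{ repeat apply Rmult_lt_0_compat; lra. }
assert (Cw : cont_at_on 0 Xw (fun t => w (we t)) t).
{ apply (cont_at_on_comp 0 Xw 0 X w we).
  - intros u Hu. now apply we_spec.
  - now apply w_cont.
  - now apply we_cont. }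
destruct (implicit_curve 0 Xw t (fun t => w (we t)) we (fun s => s) (fun _ => 0) xx ps
  (xx1 (w (we t)) (we t)) (xx2 (w (we t)) (we t)) (ps1 (w (we t)) (we t)) (ps2 (w (we t)) (we t))
  1 0) as [D1 D2]; try assumption.
- now apply we_cont.
- apply C1_differentiable; auto.
- apply C1_differentiable; auto.
- now apply is_derive_on_id.
- now apply is_derive_on_const.
- intros s Hs. now apply we_spec.
- intros s Hs. apply w_spec. now apply we_spec.
- rewrite E1, E2, E5, E6. lra.
- assert (D3 := is_derive_on_comp_2d 0 Xw t yy (fun t => w (we t)) we _ _ _ _ Ht
    (C1_differentiable yy yy1 yy2 _ _ dyy1 dyy2 (cyy1 _ _)) D1 D2).
  rewrite E1, E2, E5, E6 in D1, D2, D3. rewrite E3, E4 in D3.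
  set (p := P (w (we t)) (we t)) in *. set (q := Q (w (we t)) (we t)) in *.
  set (ap := Ap (w (we t)) (we t)) in *. set (am := Am (w (we t)) (we t)) in *.
  set (l1 := lamp (w (we t)) (we t)) in *. set (l2 := lamm (w (we t)) (we t)) in *.
  assert (Hd1 : p * (- am * q) - q * (ap * p) <> 0) by lra.
  assert (Hd2 : ap + am <> 0) by lra.
  split; [|split].
  + replace (am / (p * (ap + am))) with ((1 * (- am * q) - 0 * q) / (p * (- am * q) - q * (ap * p)));
      [exact D1|field; repeat split; lra].
  + replace (ap / (q * (ap + am))) with ((0 * p - 1 * (ap * p)) / (p * (- am * q) - q * (ap * p)));
      [exact D2|field; repeat split; lra].
  + replace ((l1 * am + l2 * ap) / (ap + am)) with
      (l1 * p * ((1 * (- am * q) - 0 * q) / (p * (- am * q) - q * (ap * p)))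
       + l2 * q * ((0 * p - 1 * (ap * p)) / (p * (- am * q) - q * (ap * p))));
      [exact D3|field; repeat split; lra].
Qed.

(** On the closing curve eta is constantly X, so dx = P dxi and dy = lamp P dxi. *)
Lemma char_derive (t : R) : Xw <= t <= X -> is_derive_on Xw X char_g t (lamp (zg t) X).
Proof.
intros Ht. assert (HXw := Xw_range). destruct (zg_spec t Ht) as [HG Ex]. assert (HT := proj1 HG).
destruct (flow_set_pos _ _ HG) as [HP HQ].
destruct (exx (zg t) X) as [E1 E2]; try lra. destruct (eyy (zg t) X) as [E3 E4]; try lra.
assert (Cz : cont_at_on Xw X zg t).
{ apply (closed_graph_cont (fun t s => (Xw <= t /\ - X <= - t) /\ flow_set s X /\ xx s X - t = 0)
    zg Xw X 0 X t).
  - assert (C1 : cont2 (fun x _ => x)) by (intros u v; apply continuity_2d_pt_id1).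
    apply closed_2d_and; [apply closed_2d_and|apply closed_2d_and].
    + now apply (closed_2d_ge (fun x _ => x)).
    + apply (closed_2d_ge (fun t _ => - t)). now apply cont2_opp.
    + intros u s Hn. destruct (flow_set_closed s X Hn) as [d Hd]. exists d.
      intros u' s' Hu Hs. apply Hd; [exact Hs|]. rewrite Rminus_diag, Rabs_R0. apply cond_pos.
    + apply (closed_2d_eq (fun t s => xx s X - t)). apply cont2_minus; [|exact C1].
      apply (cont2_snd (fun s => xx s X)). intros s. apply (continuity_2d_pt_fst_pt xx), cxx.
  - intros u s [H1 [H2 _]]. assert (HT' := proj1 H2). lra.
  - intros u Hu. destruct (zg_spec u Hu) as [H1 H2]. split; [lra|]. split; [exact H1|lra].
  - intros s [_ [H1 H2]]. apply zg_unique; [lra|exact H1|lra]. }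
destruct (implicit_curve Xw X t zg (fun _ => X) (fun s => s) (fun _ => X) xx (fun _ v => v)
  (xx1 (zg t) X) (xx2 (zg t) X) 0 1 1 0) as [D1 D2]; try assumption.
- apply continuity_pt_cont_at_on, continuity_pt_const. now intros a b.
- apply C1_differentiable; auto.
- apply (C1_differentiable (fun _ v => v) (fun _ _ => 0) (fun _ _ => 1)).
  + intros u v. apply @is_derive_const.
  + intros u v. apply @is_derive_id.
  + apply continuity_2d_pt_const.
- now apply is_derive_on_id.
- now apply is_derive_on_const.
- intros s Hs. now apply zg_spec.
- reflexivity.
- rewrite E1, E2. lra.
- assert (D3 := is_derive_on_comp_2d Xw X t yy zg (fun _ => X) _ _ _ _ Ht
    (C1_differentiable yy yy1 yy2 _ _ dyy1 dyy2 (cyy1 _ _)) D1 D2).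
  rewrite E1, E2, E3, E4 in D3.
  replace (lamp (zg t) X) with
    (lamp (zg t) X * P (zg t) X * ((1 * 1 - 0 * Q (zg t) X) / (P (zg t) X * 1 - Q (zg t) X * 0))
     + lamm (zg t) X * Q (zg t) X * ((0 * P (zg t) X - 1 * 0) / (P (zg t) X * 1 - Q (zg t) X * 0)));
  [exact D3|field; lra].
Qed.

Lemma Omega_open (x y : R) : Omega X phi Xw wedge_f char_g x y ->
  exists d, 0 < d /\ forall u v, Rabs (u - x) < d -> Rabs (v - y) < d ->
    Omega X phi Xw wedge_f char_g u v.
Proof.
intros [Hx [Hy [Hf Hg]]]. assert (HXw := Xw_range).
assert (Hbelow : exists d, 0 < d /\ forall u v, Rabs (u - x) < d -> Rabs (v - y) < d ->
  0 < u < X /\ v < phi u).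
{ destruct (phi_cont x ltac:(lra) ((phi x - y) / 2) ltac:(lra)) as [d [Hd Hc]].
  exists (Rmin (Rmin d ((phi x - y) / 2)) (Rmin x (X - x))).
  split; [repeat apply Rmin_glb_lt; lra|]. intros u v Hu Hv.
  assert (M1 := Rmin_l (Rmin d ((phi x - y) / 2)) (Rmin x (X - x))).
  assert (M2 := Rmin_r (Rmin d ((phi x - y) / 2)) (Rmin x (X - x))).
  assert (M3 := Rmin_l d ((phi x - y) / 2)). assert (M4 := Rmin_r d ((phi x - y) / 2)).
  assert (M5 := Rmin_l x (X - x)). assert (M6 := Rmin_r x (X - x)).
  assert (Hu' : Rabs (u - x) < d) by lra.
  apply Rabs_def2 in Hu. apply Rabs_def2 in Hv. split; [lra|].
  specialize (Hc u ltac:(lra) Hu'). apply Rabs_def2 in Hc. lra. }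
(* The lower bound is imposed only for abscissae in [a, b]; when x lies outside, a whole
   neighbourhood of x misses [a, b]. *)
assert (Habove : forall a b F, (forall t, a <= t <= b -> cont_at_on a b F t) ->
  0 <= a -> b <= X -> a <= b -> (a <= x <= b -> F x < y) ->
  exists d, 0 < d /\ forall u v, a <= u <= b -> Rabs (u - x) < d -> Rabs (v - y) < d -> F u < v).
{ intros a b F HF Ha Hb Hab HFx.
  destruct (classic (a <= x <= b)) as [Hin|Hout].
  - destruct (HF x Hin ((y - F x) / 2)) as [d [Hd Hc]].
    { specialize (HFx Hin). lra. }
    specialize (HFx Hin).
    exists (Rmin d ((y - F x) / 2)). split; [apply Rmin_glb_lt; lra|].
    intros u v Hu Hux Hv.
    assert (M1 := Rmin_l d ((y - F x) / 2)). assert (M2 := Rmin_r d ((y - F x) / 2)).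
    specialize (Hc u Hu ltac:(lra)). apply Rabs_def2 in Hc. apply Rabs_def2 in Hv. lra.
  - exists (Rmax (a - x) (x - b)). split.
    + destruct (Rle_dec a x).
      * apply Rlt_le_trans with (x - b); [lra|apply Rmax_r].
      * apply Rlt_le_trans with (a - x); [lra|apply Rmax_l].
    + intros u v Hu Hux _. exfalso. apply Rabs_def2 in Hux.
      unfold Rmax in Hux. destruct (Rle_dec (a - x) (x - b)); lra. }
destruct Hbelow as [d1 [Hd1 B1]].
destruct (Habove 0 Xw wedge_f) as [d2 [Hd2 B2]]; try lra.
{ intros t Ht. destruct (wedge_derive t Ht) as [_ [_ D]]. now apply (is_derive_on_cont _ _ _ _ _ Ht D). }
destruct (Habove Xw X char_g) as [d3 [Hd3 B3]]; try lra.
{ intros t Ht. apply (is_derive_on_cont _ _ _ _ _ Ht (char_derive t Ht)). }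
exists (Rmin d1 (Rmin d2 d3)). split; [repeat apply Rmin_glb_lt; assumption|].
intros u v Hu Hv.
assert (M1 := Rmin_l d1 (Rmin d2 d3)). assert (M2 := Rmin_r d1 (Rmin d2 d3)).
assert (M3 := Rmin_l d2 d3). assert (M4 := Rmin_r d2 d3).
destruct (B1 u v) as [H1 H2]; try lra.
split; [exact H1|]. split; [exact H2|]. split; intros H.
- apply B2; lra.
- apply B3; lra.
Qed.

(** The values eta = X and ps = 0 would put the point on the closing characteristic or on the wedge,
    which the strict inequalities of [Omega] exclude. The upper bound holds because [ps] increases
    along C+ up to the shock. *)
Lemma Omega_interior (x y : R) : Omega X phi Xw wedge_f char_g x y ->
  0 < xi x y < X /\ 0 < eta x y < X /\ 0 < ps (xi x y) (eta x y) /\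
  ps (xi x y) (eta x y) <= Ps (eta x y).
Proof.
intros H. assert (Hc := Omega_in_closure x y H). destruct (inv_spec x y Hc) as [HG [Ex Ey]].
destruct H as [Hx [Hy [Hf Hg]]]. assert (HT := proj1 HG). assert (HXw := Xw_range).
assert (Hb := xx_le_eta _ _ HG). rewrite Ex in Hb.
assert (He : eta x y <> X).
{ intros E0. rewrite E0 in *.
  assert (Hlow : Xw <= x).
  { rewrite <- Ex. unfold Xw, wedge_x. apply incr_xi_le; [apply w_spec; lra|].
    split; [now apply w_le|lra]. }
  specialize (Hg Hlow). unfold char_g in Hg.
  rewrite <- (zg_unique x (xi x y)) in Hg; try assumption; lra. }
assert (Hw0 : 0 < w (eta x y)) by (apply w_spec; lra).
assert (Hwle := w_le _ _ HG).
split; [lra|]. split; [lra|]. split.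
- assert (H0 : 0 <= ps (xi x y) (eta x y)) by (apply HG; lra).
  destruct (Req_dec (ps (xi x y) (eta x y)) 0) as [E0|Hne]; [|lra]. exfalso.
  assert (Ew := w_unique _ _ HG E0).
  assert (Ee : eta x y = we x).
  { apply we_unique; [lra|]. unfold wedge_x. now rewrite <- Ew. }
  assert (Hxw : x <= Xw).
  { rewrite <- Ex. rewrite Ew at 1. fold (wedge_x (eta x y)). apply wedge_x_incr_le; lra. }
  specialize (Hf Hxw). unfold wedge_f in Hf. rewrite <- Ee, <- Ew, Ey in Hf. lra.
- rewrite <- ps_diag by lra. apply incr_xi_le; [exact HG|lra].
Qed.

(** Inverse of the Jacobian matrix with rows (P, Q) and (lamp P, lamm Q), whose determinant is - P Q
    (lamp - lamm). *)
Lemma inverse_derive (x y : R) : Omega X phi Xw wedge_f char_g x y ->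
  let s := xi x y in let t := eta x y in
  is_derive (fun z => xi z y) x (- lamm s t / (P s t * (lamp s t - lamm s t))) /\
  is_derive (fun z => eta z y) x (lamp s t / (Q s t * (lamp s t - lamm s t))) /\
  is_derive (fun z => xi x z) y (1 / (P s t * (lamp s t - lamm s t))) /\
  is_derive (fun z => eta x z) y (- 1 / (Q s t * (lamp s t - lamm s t))).
Proof.
intros H s t. assert (Hc := Omega_in_closure x y H). destruct (inv_spec x y Hc) as [HG [Ex Ey]].
fold s t in HG, Ex, Ey. assert (HT := proj1 HG). destruct (flow_set_pos _ _ HG) as [HP HQ].
assert (HL := lam_lt s t ltac:(lra) ltac:(lra)).
destruct (exx s t) as [E1 E2]; try lra. destruct (eyy s t) as [E3 E4]; try lra.
destruct (Omega_open x y H) as [d [Hd Hbox]].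
assert (Hdet : P s t * (lamm s t * Q s t) - Q s t * (lamp s t * P s t) <> 0).
{ assert (0 < P s t * Q s t * (lamp s t - lamm s t)) by (repeat apply Rmult_lt_0_compat; lra). lra. }
assert (Hx : forall z, x - d / 2 <= z <= x + d / 2 -> Omega_closure X phi Xw wedge_f char_g z y).
{ intros z Hz. apply Omega_in_closure, Hbox.
  - apply Rabs_def1; lra.
  - rewrite Rminus_diag, Rabs_R0. exact Hd. }
assert (Hy : forall z, y - d / 2 <= z <= y + d / 2 -> Omega_closure X phi Xw wedge_f char_g x z).
{ intros z Hz. apply Omega_in_closure, Hbox.
  - rewrite Rminus_diag, Rabs_R0. exact Hd.
  - apply Rabs_def1; lra. }
assert (Cx : cont_at_on (x - d / 2) (x + d / 2) (fun z => xi z y) x /\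
             cont_at_on (x - d / 2) (x + d / 2) (fun z => eta z y) x).
{ split; intros e He; destruct (inverse_cont x y e Hc He) as [r [Hr HC]]; exists r;
  (split; [exact Hr|]); intros z Hz Hzx; apply (HC z y); auto;
  rewrite Rminus_diag, Rabs_R0; exact Hr. }
assert (Cy : cont_at_on (y - d / 2) (y + d / 2) (fun z => xi x z) y /\
             cont_at_on (y - d / 2) (y + d / 2) (fun z => eta x z) y).
{ split; intros e He; destruct (inverse_cont x y e Hc He) as [r [Hr HC]]; exists r;
  (split; [exact Hr|]); intros z Hz Hzx; apply (HC x z); auto;
  rewrite Rminus_diag, Rabs_R0; exact Hr. }
destruct (implicit_curve (x - d / 2) (x + d / 2) x (fun z => xi z y) (fun z => eta z y)
  (fun z => z) (fun _ => y) xx yy (xx1 s t) (xx2 s t) (yy1 s t) (yy2 s t) 1 0) as [D1 D2].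
{ lra. } { apply Cx. } { apply Cx. }
{ apply C1_differentiable; auto. } { apply C1_differentiable; auto. }
{ apply is_derive_on_id; lra. } { apply is_derive_on_const; lra. }
{ intros z Hz. now apply inv_spec, Hx. } { intros z Hz. now apply inv_spec, Hx. }
{ rewrite E1, E2, E3, E4. exact Hdet. }
destruct (implicit_curve (y - d / 2) (y + d / 2) y (fun z => xi x z) (fun z => eta x z)
  (fun _ => x) (fun z => z) xx yy (xx1 s t) (xx2 s t) (yy1 s t) (yy2 s t) 0 1) as [D3 D4].
{ lra. } { apply Cy. } { apply Cy. }
{ apply C1_differentiable; auto. } { apply C1_differentiable; auto. }
{ apply is_derive_on_const; lra. } { apply is_derive_on_id; lra. }
{ intros z Hz. now apply inv_spec, Hy. } { intros z Hz. now apply inv_spec, Hy. }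
{ rewrite E1, E2, E3, E4. exact Hdet. }
rewrite is_derive_on_interior in D1, D2 by lra.
rewrite is_derive_on_interior in D3, D4 by lra.
rewrite E1, E2, E3, E4 in D1, D2, D3, D4.
set (p := P s t) in *. set (q := Q s t) in *. set (l1 := lamp s t) in *. set (l2 := lamm s t) in *.
split; [|split; [|split]].
- replace (- l2 / (p * (l1 - l2))) with ((1 * (l2 * q) - 0 * q) / (p * (l2 * q) - q * (l1 * p)));
    [exact D1|field; repeat split; lra].
- replace (l1 / (q * (l1 - l2))) with ((0 * p - 1 * (l1 * p)) / (p * (l2 * q) - q * (l1 * p)));
    [exact D2|field; repeat split; lra].
- replace (1 / (p * (l1 - l2))) with ((0 * (l2 * q) - 1 * q) / (p * (l2 * q) - q * (l1 * p)));
    [exact D3|field; repeat split; lra].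
- replace (- 1 / (q * (l1 - l2))) with ((1 * p - 0 * (l1 * p)) / (p * (l2 * q) - q * (l1 * p)));
    [exact D4|field; repeat split; lra].
Qed.

End Inverse.

(** Interface between the inverse map and the gas dynamics: the flow is built from these properties,
    with the wedge described through the characteristic coordinates of its points. *)
Record hodograph_flow (Xw : R) (f g : R -> R) (xi eta : R -> R -> R) : Prop := {
  hf_Xw : 0 < Xw < X;
  hf_tip : f 0 = phi 0;
  hf_wedge_below : forall x, 0 < x <= Xw -> f x < phi x;
  hf_char_below : forall x, Xw <= x < X -> g x < phi x;
  hf_char_start : g X = phi X;
  hf_char_end : g Xw = f Xw;
  hf_shock_in : forall x, 0 <= x <= X -> Omega_closure X phi Xw f g x (phi x);
  hf_wedge_in : forall x, 0 <= x <= Xw -> Omega_closure X phi Xw f g x (f x);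
  hf_char_in : forall x, Xw <= x <= X -> Omega_closure X phi Xw f g x (g x);
  hf_triangle : forall x y, Omega_closure X phi Xw f g x y ->
    0 <= xi x y <= eta x y /\ eta x y <= X /\ 0 <= ps (xi x y) (eta x y) /\
    0 < P (xi x y) (eta x y) /\ 0 < Q (xi x y) (eta x y);
  hf_cont : forall x y eps, Omega_closure X phi Xw f g x y -> 0 < eps ->
    exists d, 0 < d /\ forall u v, Omega_closure X phi Xw f g u v ->
      Rabs (u - x) < d -> Rabs (v - y) < d ->
      Rabs (xi u v - xi x y) < eps /\ Rabs (eta u v - eta x y) < eps;
  hf_shock : forall x, 0 <= x <= X -> xi x (phi x) = x /\ eta x (phi x) = x;
  hf_wedge : forall t, 0 <= t <= Xw ->
    let s := xi t (f t) in let e := eta t (f t) in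
    is_derive_on 0 Xw (fun t => xi t (f t)) t (Am s e / (P s e * (Ap s e + Am s e))) /\
    is_derive_on 0 Xw (fun t => eta t (f t)) t (Ap s e / (Q s e * (Ap s e + Am s e))) /\
    is_derive_on 0 Xw f t
      ((lamp s e * Am s e + lamm s e * Ap s e) / (Ap s e + Am s e));
  hf_char : forall t, Xw <= t <= X ->
    is_derive_on Xw X g t (lamp (xi t (g t)) (eta t (g t)));
  hf_open : forall x y, Omega X phi Xw f g x y ->
    exists d, 0 < d /\ forall u v, Rabs (u - x) < d -> Rabs (v - y) < d ->
      Omega X phi Xw f g u v;
  hf_interior : forall x y, Omega X phi Xw f g x y ->
    0 < xi x y < X /\ 0 < eta x y < X /\ 0 < ps (xi x y) (eta x y) /\
    ps (xi x y) (eta x y) <= Ps (eta x y);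
  hf_derive : forall x y, Omega X phi Xw f g x y ->
    let s := xi x y in let t := eta x y in
    is_derive (fun z => xi z y) x (- lamm s t / (P s t * (lamp s t - lamm s t))) /\
    is_derive (fun z => eta z y) x (lamp s t / (Q s t * (lamp s t - lamm s t))) /\
    is_derive (fun z => xi x z) y (1 / (P s t * (lamp s t - lamm s t))) /\
    is_derive (fun z => eta x z) y (- 1 / (Q s t * (lamp s t - lamm s t)))
}.

Lemma hodograph_inverse : (forall x, 0 <= x <= X -> cont_at_on 0 X phi x) ->
  exists Xw f g xi eta, hodograph_flow Xw f g xi eta.
Proof.
intros Hphi.
destruct wedge_fun_exists as [w Hw].
destruct (wedge_eta_exists w Hw) as [we Hwe].
destruct (char_xi_exists w Hw) as [zg Hzg].
destruct (inverse_exists w Hw we Hwe zg Hzg) as [xi [eta Hinv]].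
exists (Xw w), (wedge_f w we), (char_g zg), xi, eta. split.
- now apply Xw_range.
- unfold wedge_f. rewrite (we_0 w Hw we Hwe). assert (Hr := w_range w Hw 0 ltac:(lra)).
  replace (w 0) with 0 by lra. apply yy_diag. lra.
- now apply wedge_f_below.
- now apply (char_g_below w).
- now apply (char_g_X w).
- now apply (char_g_Xw w Hw we).
- now apply (closure_shock w Hw we).
- now apply (closure_wedge w Hw we).
- now apply (closure_char w Hw we).
- intros x y H. destruct (Hinv x y H) as [HG _]. assert (HT := proj1 HG).
  destruct (flow_set_pos _ _ HG) as [H1 H2].
  assert (0 <= ps (xi x y) (eta x y)) by (apply HG; lra). repeat split; lra.
- exact (inverse_cont w Hw we zg xi eta Hinv).
- now apply (inverse_shock w Hw we Hwe zg Hzg).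
- intros t Ht. destruct (inverse_wedge w Hw we Hwe zg Hzg xi eta Hinv t Ht) as [-> ->].
  destruct (wedge_derive w Hw we Hwe t Ht) as [D1 [D2 D3]]. split; [|split; [|exact D3]].
  + apply (is_derive_on_ext 0 (Xw w) (fun t => w (we t))); [exact Ht| |exact D1].
    intros s Hs. now destruct (inverse_wedge w Hw we Hwe zg Hzg xi eta Hinv s Hs) as [-> _].
  + apply (is_derive_on_ext 0 (Xw w) we); [exact Ht| |exact D2].
    intros s Hs. now destruct (inverse_wedge w Hw we Hwe zg Hzg xi eta Hinv s Hs) as [_ ->].
- intros t Ht. destruct (inverse_char w Hw we Hwe zg Hzg xi eta Hinv t Ht) as [-> ->].
  now apply (char_derive w Hw).
- now apply (Omega_open w Hw we Hwe zg Hzg).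
- exact (Omega_interior w Hw we Hwe zg Hzg xi eta Hinv).
- exact (inverse_derive w Hw we Hwe zg Hzg Hphi xi eta Hinv).
Qed.

End Hodograph.

(** * Prandtl-Meyer function and flow quantities *)

Section PrandtlMeyer.

Context (gamma : R) (Hgamma : 1 < gamma).

Lemma is_derive_sqrt_sqr_minus (m : R) : 1 < m ->
  is_derive (fun m => sqrt (m ^ 2 - 1)) m (m / sqrt (m ^ 2 - 1)).
Proof.
intros Hm. assert (0 < m ^ 2 - 1) by nra. assert (0 < sqrt (m ^ 2 - 1)) by now apply sqrt_lt_R0.
auto_derive; [simpl in *; lra|].
replace (m * (m * 1) + - (1)) with (m ^ 2 - 1) by ring. field. lra.
Qed.

Definition nu' (m : R) : R := sqrt (m ^ 2 - 1) / (m * (1 + (gamma - 1) / 2 * m ^ 2)).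

Lemma is_derive_nu (m : R) : 1 < m -> is_derive (nu gamma) m (nu' m).
Proof.
intros Hm. assert (H1 : 0 < m ^ 2 - 1) by nra.
assert (H2 : 0 < sqrt (m ^ 2 - 1)) by now apply sqrt_lt_R0.
set (k2 := (gamma + 1) / (gamma - 1)).
assert (Hk2 : 0 < k2) by (apply Rdiv_lt_0_compat; lra).
set (k := sqrt k2). assert (Hk : 0 < k) by now apply sqrt_lt_R0.
assert (Hkk : k * k = k2) by (apply sqrt_sqrt; lra).
(* With k^2 = (gamma + 1) / (gamma - 1), nu depends on m only through sqrt (m^2 - 1), and only that
   root has to be differentiated in m. *)
apply (is_derive_ext_loc (fun m => k * atan (sqrt (m ^ 2 - 1) / k) - atan (sqrt (m ^ 2 - 1)))).
{ apply (locally_interior 1 (m + 1)); [lra|]. intros z Hz. unfold nu. fold k2. fold k.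
  replace ((gamma - 1) / (gamma + 1) * (z ^ 2 - 1)) with ((z ^ 2 - 1) / k2) by (unfold k2; field; lra).
  rewrite sqrt_div by nra. reflexivity. }
assert (Hs := is_derive_sqrt_sqr_minus m Hm).
set (s := sqrt (m ^ 2 - 1)) in *.
assert (Hss : s * s = m ^ 2 - 1) by (apply sqrt_sqrt; lra).
unfold nu'. fold s.
replace (s / (m * (1 + (gamma - 1) / 2 * m ^ 2))) with
  (m / s * (k * (/ k * / (1 + (s / k) ^ 2)) - / (1 + s ^ 2))).
2:{ replace (m ^ 2) with (s * s + 1) by lra.
    assert (0 < k * k + s * s) by nra.
    replace (k * (/ k * / (1 + (s / k) ^ 2))) with (k2 / (k2 + s * s)) by (rewrite <- Hkk; field; repeat split; nra).
    unfold k2. apply (Rmult_eq_reg_l (s * m * (1 + s * s) * (1 + (gamma - 1) / 2 * (s * s + 1)) * (gamma + 1 + (gamma - 1) * (s * s)))).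
    - transitivity (m * m * ((s * s) * (gamma + 1 - (gamma - 1)) * (1 + (gamma - 1) / 2 * (s * s + 1)))).
      + field. repeat split; nra.
      + replace (m * m) with (s * s + 1) by lra. field. repeat split; nra.
    - assert (0 < (1 + (gamma - 1) / 2 * (s * s + 1))) by nra.
      assert (0 < gamma + 1 + (gamma - 1) * (s * s)) by nra.
      apply Rgt_not_eq. repeat apply Rmult_lt_0_compat; nra. }
apply (is_derive_comp (fun s => k * atan (s / k) - atan s) (fun m => sqrt (m ^ 2 - 1))); [|exact Hs].
fold s. auto_derive; [exact I|]. field. repeat split; nra.
Qed.

Lemma nu'_pos (m : R) : 1 < m -> 0 < nu' m.
Proof.
intros Hm. unfold nu'. apply Rdiv_lt_0_compat; [apply sqrt_lt_R0; nra|].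
apply Rmult_lt_0_compat; nra.
Qed.

Lemma nu_cont (a b m : R) : 1 < m -> cont_at_on a b (nu gamma) m.
Proof.
intros Hm. apply continuity_pt_cont_at_on. exact (is_derive_continuity_pt _ _ _ (is_derive_nu m Hm)).
Qed.

Lemma nu_incr (a b : R) : 1 < a < b -> nu gamma a < nu gamma b.
Proof.
intros Hab. apply incr_on; [lra| |].
- intros x Hx. apply nu_cont. lra.
- intros x Hx. exists (nu' x). split; [apply is_derive_nu|apply nu'_pos]; lra.
Qed.

Lemma nu_inv_nu (m : R) : 1 < m -> nu_inv gamma (nu gamma m) = m.
Proof.
intros Hm. unfold nu_inv. apply (@iota_unique R_AbsRing R_CompleteNormedModule); [|now split].
intros y [Hy E]. destruct (Rtotal_order y m) as [H|[H|H]]; [|exact H|].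
- assert (K := nu_incr y m). lra.
- assert (K := nu_incr m y). lra.
Qed.

(** The values at which [nu_inv] is meaningful, described by existence of a preimage so that the end
    points of the interval never have to be computed. *)
Definition nu_range (w : R) : Prop := exists m, 1 < m /\ nu gamma m = w.

Lemma nu_inv_spec (w : R) : nu_range w -> 1 < nu_inv gamma w /\ nu gamma (nu_inv gamma w) = w.
Proof. intros [m [Hm <-]]. rewrite nu_inv_nu by exact Hm. now split. Qed.

Lemma nu_range_open (w : R) : nu_range w ->
  exists d, 0 < d /\ forall z, Rabs (z - w) < d -> nu_range z.
Proof.
intros [m [Hm <-]].
assert (L : nu gamma ((1 + m) / 2) < nu gamma m) by (apply nu_incr; lra).
assert (U : nu gamma m < nu gamma (m + 1)) by (apply nu_incr; lra).
exists (Rmin (nu gamma m - nu gamma ((1 + m) / 2)) (nu gamma (m + 1) - nu gamma m)).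
split; [apply Rmin_glb_lt; lra|]. intros z Hz.
assert (M1 := Rmin_l (nu gamma m - nu gamma ((1 + m) / 2)) (nu gamma (m + 1) - nu gamma m)).
assert (M2 := Rmin_r (nu gamma m - nu gamma ((1 + m) / 2)) (nu gamma (m + 1) - nu gamma m)).
apply Rabs_def2 in Hz.
destruct (ivt_on ((1 + m) / 2) (m + 1) (nu gamma) z) as [c [Hc E]]; [lra| | |].
- intros x Hx. apply nu_cont. lra.
- rewrite Rmin_left, Rmax_right; lra.
- exists c. split; [lra|exact E].
Qed.

Lemma nu_inv_decr (w w' : R) : nu_range w -> nu_range w' -> w <= w' -> nu_inv gamma w <= nu_inv gamma w'.
Proof.
intros [m [Hm <-]] [m' [Hm' <-]] H. rewrite !nu_inv_nu by assumption.
apply Rnot_lt_le. intros Hlt. assert (K := nu_incr m' m). lra.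
Qed.

Lemma is_derive_nu_inv (w : R) : nu_range w ->
  is_derive (nu_inv gamma) w (/ nu' (nu_inv gamma w)).
Proof.
intros Hw. destruct (nu_range_open w Hw) as [d [Hd Hopen]].
destruct (nu_inv_spec w Hw) as [Hm Em]. set (m := nu_inv gamma w) in *.
assert (Hp := nu'_pos m Hm).
assert (Hcont : cont_at_on (w - d / 2) (w + d / 2) (nu_inv gamma) w).
{ intros eps Heps. set (e := Rmin (eps / 2) ((m - 1) / 2)).
  assert (He : 0 < e) by (apply Rmin_glb_lt; lra).
  assert (He1 : e <= eps / 2) by apply Rmin_l. assert (He2 : e <= (m - 1) / 2) by apply Rmin_r.
  assert (L : nu gamma (m - e) < nu gamma m) by (apply nu_incr; lra).
  assert (U : nu gamma m < nu gamma (m + e)) by (apply nu_incr; lra).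
  exists (Rmin (nu gamma m - nu gamma (m - e)) (nu gamma (m + e) - nu gamma m)).
  split; [apply Rmin_glb_lt; lra|]. intros z Hz Hzw.
  assert (M1 := Rmin_l (nu gamma m - nu gamma (m - e)) (nu gamma (m + e) - nu gamma m)).
  assert (M2 := Rmin_r (nu gamma m - nu gamma (m - e)) (nu gamma (m + e) - nu gamma m)).
  apply Rabs_def2 in Hzw.
  destruct (ivt_on (m - e) (m + e) (nu gamma) z) as [c [Hc E]]; [lra| | |].
  - intros x Hx. apply nu_cont. lra.
  - rewrite Rmin_left, Rmax_right; lra.
  - rewrite <- E, nu_inv_nu by lra. fold m. apply Rabs_def1; lra. }
apply (is_derive_on_interior (w - d / 2) (w + d / 2)); [lra|].
(* The one-dimensional inverse function theorem, obtained from the planar one with a constant second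
   coordinate. *)
destruct (implicit_curve (w - d / 2) (w + d / 2) w (nu_inv gamma) (fun _ => 0)
  (fun z => z) (fun _ => 0) (fun u _ => nu gamma u) (fun _ v => v) (nu' m) 0 0 1 1 0) as [D _].
- lra.
- exact Hcont.
- apply continuity_pt_cont_at_on, continuity_pt_const. now intros a b.
- apply (differentiable_pt_lim_proj1_0 (nu gamma)). apply is_derive_Reals. now apply is_derive_nu.
- apply (C1_differentiable (fun _ v => v) (fun _ _ => 0) (fun _ _ => 1)).
  + intros u v. apply @is_derive_const.
  + intros u v. apply @is_derive_id.
  + apply continuity_2d_pt_const.
- apply is_derive_on_id; lra.
- apply is_derive_on_const; lra.
- intros s Hs. apply nu_inv_spec, Hopen. apply Rabs_def1; lra.
- reflexivity.
- lra.
- replace (/ nu' m) with ((1 * 1 - 0 * 0) / (nu' m * 1 - 0 * 0)); [exact D|field; lra].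
Qed.

Lemma mach_angle_atan (m : R) : 1 < m -> mach_angle m = atan (/ sqrt (m ^ 2 - 1)).
Proof.
intros Hm. unfold mach_angle.
assert (H0 : 0 < / m < 1).
{ split; [apply Rinv_0_lt_compat; lra|]. rewrite <- Rinv_1. apply Rinv_lt_contravar; lra. }
rewrite asin_atan by lra. f_equal. unfold Rsqr.
replace (1 - 1 / m * (1 / m)) with ((m ^ 2 - 1) / (m ^ 2)) by (field; lra).
rewrite sqrt_div by nra. rewrite sqrt_pow2 by lra.
assert (0 < sqrt (m ^ 2 - 1)) by (apply sqrt_lt_R0; nra). field. split; lra.
Qed.

Lemma mach_angle_range (m : R) : 1 < m -> 0 < mach_angle m < PI / 2.
Proof.
intros Hm. rewrite mach_angle_atan by exact Hm. split.
- rewrite <- atan_0. apply atan_increasing. apply Rinv_0_lt_compat, sqrt_lt_R0. nra.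
- apply atan_bound.
Qed.

Lemma sin_mach_angle (m : R) : 1 < m -> sin (mach_angle m) = 1 / m.
Proof.
intros Hm. unfold mach_angle. apply sin_asin.
assert (H0 : 0 < / m < 1).
{ split; [apply Rinv_0_lt_compat; lra|]. rewrite <- Rinv_1. apply Rinv_lt_contravar; lra. }
lra.
Qed.

Lemma cos_mach_angle (m : R) : 1 < m -> cos (mach_angle m) = sqrt (m ^ 2 - 1) / m.
Proof.
intros Hm. assert (H := mach_angle_range m Hm).
assert (Hc : 0 < cos (mach_angle m)) by (apply cos_gt_0; lra).
rewrite <- (sqrt_pow2 (cos (mach_angle m))) by lra.
replace (cos (mach_angle m) ^ 2) with ((m ^ 2 - 1) / m ^ 2).
- rewrite sqrt_div by nra. rewrite sqrt_pow2; [reflexivity|lra].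
- assert (E := sin2_cos2 (mach_angle m)). rewrite sin_mach_angle in E by exact Hm.
  unfold Rsqr in E. replace (cos (mach_angle m) ^ 2) with (1 - 1 / m * (1 / m)) by lra. field. lra.
Qed.

Lemma is_derive_mach_angle (m : R) : 1 < m ->
  is_derive mach_angle m (- / (m * sqrt (m ^ 2 - 1))).
Proof.
intros Hm. assert (H1 : 0 < m ^ 2 - 1) by nra.
assert (H2 : 0 < sqrt (m ^ 2 - 1)) by now apply sqrt_lt_R0.
apply (is_derive_ext_loc (fun m => atan (/ sqrt (m ^ 2 - 1)))).
{ apply (locally_interior 1 (m + 1)); [lra|]. intros z Hz. symmetry. apply mach_angle_atan. lra. }
assert (Hs := is_derive_sqrt_sqr_minus m Hm). set (s := sqrt (m ^ 2 - 1)) in *.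
assert (Hss : s * s = m ^ 2 - 1) by (apply sqrt_sqrt; lra).
replace (- / (m * s)) with (m / s * (- / (1 + s ^ 2))).
2:{ replace (1 + s ^ 2) with (m * m) by (simpl in *; lra). field. lra. }
apply (is_derive_comp (fun s => atan (/ s)) (fun m => sqrt (m ^ 2 - 1))); [|exact Hs].
fold s. auto_derive; [lra|]. field. nra.
Qed.

(* [mu] is the Mach angle as a function of nu = (R - S) / 2; one has
   d mu / d nu = 1 - mu_k. *)
Definition mu (w : R) : R := mach_angle (nu_inv gamma w).
Definition mu_k (w : R) : R :=
  (gamma + 1) / 2 * nu_inv gamma w ^ 2 / (nu_inv gamma w ^ 2 - 1).

Lemma mu_k_pos (w : R) : nu_range w -> 0 < mu_k w.
Proof.
intros Hw. destruct (nu_inv_spec w Hw) as [Hm _]. unfold mu_k. apply Rdiv_lt_0_compat; nra.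
Qed.

Lemma is_derive_mu (w : R) : nu_range w -> is_derive mu w (1 - mu_k w).
Proof.
intros Hw. destruct (nu_inv_spec w Hw) as [Hm _].
assert (D1 := is_derive_nu_inv w Hw).
assert (D2 := is_derive_mach_angle (nu_inv gamma w) Hm).
assert (D := is_derive_comp mach_angle (nu_inv gamma) w _ _ D2 D1).
unfold mu, mu_k. set (m := nu_inv gamma w) in *.
assert (H1 : 0 < m ^ 2 - 1) by nra.
assert (H2 : 0 < sqrt (m ^ 2 - 1)) by now apply sqrt_lt_R0.
replace (1 - (gamma + 1) / 2 * m ^ 2 / (m ^ 2 - 1)) with
  (scal (/ nu' m) (- / (m * sqrt (m ^ 2 - 1)))); [exact D|].
match goal with |- scal ?a ?b = ?c => change (@eq R (a * b) c) end. unfold nu'.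
assert (Hss : sqrt (m ^ 2 - 1) * sqrt (m ^ 2 - 1) = m ^ 2 - 1) by (apply sqrt_sqrt; lra).
set (s := sqrt (m ^ 2 - 1)) in *.
transitivity (- ((1 + (gamma - 1) / 2 * m ^ 2) / (s * s))).
- field. repeat split; nra.
- rewrite Hss. field. lra.
Qed.

Context (H0 : R) (HH0 : 0 < H0).

(* Squared sound speed at Mach number [m] on the Bernoulli surface
   q^2/2 + c^2/(gamma-1) = H0. *)
Definition csq (m : R) : R := H0 / (m ^ 2 / 2 + / (gamma - 1)).

Lemma csq_pos (m : R) : 0 < csq m.
Proof.
unfold csq. assert (0 < / (gamma - 1)) by (apply Rinv_0_lt_compat; lra).
apply Rdiv_lt_0_compat; nra.
Qed.

Lemma is_derive_csq (m : R) :
  is_derive csq m (- csq m * (m / (m ^ 2 / 2 + / (gamma - 1)))).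
Proof.
unfold csq. assert (0 < / (gamma - 1)) by (apply Rinv_0_lt_compat; lra).
auto_derive; [simpl; nra|]. simpl. field. nra.
Qed.

(* Up to the entropy factor, the mass flux density rho c. *)
Definition Gm (m : R) : R := Rpower (csq m) (/ (gamma - 1) + / 2).

Lemma is_derive_Gm (m : R) :
  is_derive Gm m (- Gm m * ((/ (gamma - 1) + / 2) * (m / (m ^ 2 / 2 + / (gamma - 1))))).
Proof.
assert (Hc := csq_pos m). assert (D := is_derive_csq m).
assert (0 < / (gamma - 1)) by (apply Rinv_0_lt_compat; lra).
unfold Gm, Rpower.
replace (- exp ((/ (gamma - 1) + / 2) * ln (csq m)) *
  ((/ (gamma - 1) + / 2) * (m / (m ^ 2 / 2 + / (gamma - 1))))) with
  ((- csq m * (m / (m ^ 2 / 2 + / (gamma - 1)))) *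
   ((/ (gamma - 1) + / 2) * / csq m * exp ((/ (gamma - 1) + / 2) * ln (csq m)))).
2:{ field. split; nra. }
apply (is_derive_comp (fun c => exp ((/ (gamma - 1) + / 2) * ln c)) csq); [|exact D].
auto_derive; [exact Hc|]. field. lra.
Qed.

Definition Gw (w : R) : R := Gm (nu_inv gamma w).

Lemma is_derive_Gw (w : R) : nu_range w ->
  is_derive Gw w (- Gw w * mu_k w * sqrt (nu_inv gamma w ^ 2 - 1)).
Proof.
intros Hw. destruct (nu_inv_spec w Hw) as [Hm _].
assert (D := is_derive_comp Gm (nu_inv gamma) w _ _ (is_derive_Gm _) (is_derive_nu_inv w Hw)).
unfold Gw, mu_k. set (m := nu_inv gamma w) in *.
assert (H1 : 0 < m ^ 2 - 1) by nra.
assert (H2 : 0 < sqrt (m ^ 2 - 1)) by now apply sqrt_lt_R0.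
assert (H3 : 0 < / (gamma - 1)) by (apply Rinv_0_lt_compat; lra).
match type of D with is_derive _ _ ?l =>
  replace (- Gm m * ((gamma + 1) / 2 * m ^ 2 / (m ^ 2 - 1)) * sqrt (m ^ 2 - 1)) with l; [exact D|] end.
match goal with |- scal ?a ?b = ?c => change (@eq R (a * b) c) end. unfold nu'.
assert (Hss : sqrt (m ^ 2 - 1) * sqrt (m ^ 2 - 1) = m ^ 2 - 1) by (apply sqrt_sqrt; lra).
set (s := sqrt (m ^ 2 - 1)) in *.
replace (m ^ 2 - 1) with (s * s).
field. repeat split; try nra.
Qed.

Lemma csq_decr (m m' : R) : 0 < m <= m' -> csq m' <= csq m.
Proof.
intros H. unfold csq. assert (H1 : 0 < / (gamma - 1)) by (apply Rinv_0_lt_compat; lra).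
apply Rmult_le_compat_l; [lra|]. apply Rinv_le_contravar; nra.
Qed.

Lemma Gm_decr (m m' : R) : 0 < m <= m' -> Gm m' <= Gm m.
Proof.
intros H. unfold Gm. assert (H1 : 0 < / (gamma - 1)) by (apply Rinv_0_lt_compat; lra).
apply Rle_Rpower_l; [lra|]. split; [apply csq_pos|now apply csq_decr].
Qed.

End PrandtlMeyer.

Section PhasePlane.

Context (gamma H0 : R) (Hgamma : 1 < gamma) (HH0 : 0 < H0).

Let w_ph (r s : R) : R := (r - s) / 2.
Let th_m (r s : R) : R := theta_ph r s - mu gamma (w_ph r s).
Let th_p (r s : R) : R := theta_ph r s + mu gamma (w_ph r s).

(** Pointwise form of the hypothesis on the phase region, separated from the shock so that the
    calculus below concerns the gas alone. *)
Definition good_phase (r s : R) : Prop :=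
  nu_range gamma ((r - s) / 2) /\
  - (PI / 2) < theta_ph r s - mu gamma ((r - s) / 2) /\
  theta_ph r s + mu gamma ((r - s) / 2) < PI / 2.

(* Mass flux per unit dx along C+ and C- (up to the entropy factor). *)
Definition flux_p (r s : R) : R :=
  Gw gamma H0 ((r - s) / 2) / cos (theta_ph r s + mu gamma ((r - s) / 2)).
Definition flux_m (r s : R) : R :=
  Gw gamma H0 ((r - s) / 2) / cos (theta_ph r s - mu gamma ((r - s) / 2)).

(** [ca] and [cb] are closed forms of [coef_a] and [coef_b] in which the sign is visible: the
    cosines are positive while both characteristic angles stay in (- pi/2, pi/2). *)
Definition ca (r s : R) : R := mu_k gamma ((r - s) / 2) / 2
  * cos (theta_ph r s + mu gamma ((r - s) / 2))
  / (cos (theta_ph r s - mu gamma ((r - s) / 2)) * sin (2 * mu gamma ((r - s) / 2))).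
Definition cb (r s : R) : R := mu_k gamma ((r - s) / 2) / 2
  * cos (theta_ph r s - mu gamma ((r - s) / 2))
  / (cos (theta_ph r s + mu gamma ((r - s) / 2)) * sin (2 * mu gamma ((r - s) / 2))).

Lemma mu_range (w : R) : nu_range gamma w -> 0 < mu gamma w < PI / 2.
Proof. intros Hw. apply mach_angle_range. now apply (nu_inv_spec gamma Hgamma). Qed.

Lemma good_facts (r s : R) : good_phase r s ->
  0 < cos (th_m r s) /\ 0 < cos (th_p r s) /\
  0 < sin (mu gamma (w_ph r s)) /\ 0 < cos (mu gamma (w_ph r s)) /\
  0 < sin (2 * mu gamma (w_ph r s)) /\ 0 < mu_k gamma (w_ph r s) /\
  - (PI / 2) < theta_ph r s < PI / 2.
Proof.
intros [Hw [H1 H2]]. assert (Hmu := mu_range _ Hw). fold (w_ph r s) in *.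
unfold th_m, th_p. assert (HPI := PI_RGT_0). repeat split; try lra.
- apply cos_gt_0; lra.
- apply cos_gt_0; lra.
- apply sin_gt_0; lra.
- apply cos_gt_0; lra.
- apply sin_gt_0; lra.
- now apply mu_k_pos.
Qed.

Lemma lam_diff (r s : R) : good_phase r s ->
  lp_ph gamma r s - lm_ph gamma r s =
  sin (2 * mu gamma (w_ph r s)) / (cos (th_p r s) * cos (th_m r s)).
Proof.
intros Hg. destruct (good_facts r s Hg) as [H1 [H2 _]].
change (tan (th_p r s) - tan (th_m r s) =
  sin (2 * mu gamma (w_ph r s)) / (cos (th_p r s) * cos (th_m r s))).
replace (2 * mu gamma (w_ph r s)) with (th_p r s - th_m r s) by (unfold th_p, th_m; ring).
rewrite sin_minus. unfold tan. field. lra.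
Qed.

Lemma lam_lt_ph (r s : R) : good_phase r s -> lm_ph gamma r s < lp_ph gamma r s.
Proof.
intros Hg. assert (E := lam_diff r s Hg).
destruct (good_facts r s Hg) as [H1 [H2 [_ [_ [H3 _]]]]].
assert (0 < sin (2 * mu gamma (w_ph r s)) / (cos (th_p r s) * cos (th_m r s))); [|lra].
apply Rdiv_lt_0_compat; [exact H3|now apply Rmult_lt_0_compat].
Qed.

Lemma flux_pos (r s : R) : good_phase r s -> 0 < flux_p r s /\ 0 < flux_m r s.
Proof.
intros Hg. destruct (good_facts r s Hg) as [H1 [H2 _]].
split; apply Rdiv_lt_0_compat; try assumption; apply exp_pos.
Qed.

Lemma ca_pos (r s : R) : good_phase r s -> 0 < ca r s.
Proof.
intros Hg. destruct (good_facts r s Hg) as [H1 [H2 [_ [_ [H3 [H4 _]]]]]].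
unfold ca. fold (w_ph r s). fold (th_p r s). fold (th_m r s).
apply Rdiv_lt_0_compat; apply Rmult_lt_0_compat; lra.
Qed.

Lemma cb_pos (r s : R) : good_phase r s -> 0 < cb r s.
Proof.
intros Hg. destruct (good_facts r s Hg) as [H1 [H2 [_ [_ [H3 [H4 _]]]]]].
unfold cb. fold (w_ph r s). fold (th_p r s). fold (th_m r s).
apply Rdiv_lt_0_compat; apply Rmult_lt_0_compat; lra.
Qed.

(** * Derivatives with respect to the Riemann invariants *)

Lemma is_derive_w_S (r s : R) : is_derive (fun s => w_ph r s) s (- / 2).
Proof. unfold w_ph. auto_derive; [exact I|field]. Qed.
Lemma is_derive_w_R (r s : R) : is_derive (fun r => w_ph r s) r (/ 2).
Proof. unfold w_ph. auto_derive; [exact I|field]. Qed.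

(** In 1/2 - (1 - mu_k) / 2 the halves cancel. The positive remainder mu_k / 2 expresses the genuine
    nonlinearity of the C+ family; [is_derive_th_m_R] is its counterpart for C-. *)
Lemma is_derive_th_p_S (r s : R) : good_phase r s ->
  is_derive (fun s => th_p r s) s (mu_k gamma (w_ph r s) / 2).
Proof.
intros [Hw _]. unfold th_p.
replace (mu_k gamma (w_ph r s) / 2) with (/ 2 + (1 - mu_k gamma (w_ph r s)) * (- / 2)) by field.
apply (is_derive_plus (fun s => theta_ph r s) (fun s => mu gamma (w_ph r s))).
- unfold theta_ph. auto_derive; [exact I|field].
- apply (is_derive_comp_R (mu gamma) (fun s => w_ph r s)); [now apply is_derive_mu|apply is_derive_w_S].
Qed.

Lemma is_derive_th_m_R (r s : R) : good_phase r s ->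
  is_derive (fun r => th_m r s) r (mu_k gamma (w_ph r s) / 2).
Proof.
intros [Hw _]. unfold th_m.
replace (mu_k gamma (w_ph r s) / 2) with (/ 2 - (1 - mu_k gamma (w_ph r s)) * (/ 2)) by field.
apply (is_derive_minus (fun r => theta_ph r s) (fun r => mu gamma (w_ph r s))).
- unfold theta_ph. auto_derive; [exact I|field].
- apply (is_derive_comp_R (mu gamma) (fun r => w_ph r s)); [now apply is_derive_mu|apply is_derive_w_R].
Qed.

Lemma is_derive_tan_R (x : R) : cos x <> 0 -> is_derive tan x (/ cos x ^ 2).
Proof.
intros Hc. unfold tan. auto_derive; [exact Hc|].
assert (E := sin2_cos2 x). unfold Rsqr in E.
apply (Rmult_eq_reg_r (cos x ^ 2)).
- transitivity (sin x * sin x + cos x * cos x); [field; exact Hc|rewrite E; field; exact Hc].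
- now apply pow_nonzero.
Qed.

Lemma is_derive_lp_S (r s : R) : good_phase r s ->
  is_derive (fun s => lp_ph gamma r s) s (cb r s * (lp_ph gamma r s - lm_ph gamma r s)).
Proof.
intros Hg. destruct (good_facts r s Hg) as [H1 [H2 [_ [_ [H3 _]]]]].
rewrite lam_diff by exact Hg. unfold cb. fold (w_ph r s). fold (th_p r s). fold (th_m r s).
replace (mu_k gamma (w_ph r s) / 2 * cos (th_m r s) /
  (cos (th_p r s) * sin (2 * mu gamma (w_ph r s))) *
  (sin (2 * mu gamma (w_ph r s)) / (cos (th_p r s) * cos (th_m r s))))
  with (/ cos (th_p r s) ^ 2 * (mu_k gamma (w_ph r s) / 2)) by (field; lra).
apply (is_derive_comp_R tan (fun s => th_p r s)).
- apply is_derive_tan_R. lra.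
- now apply is_derive_th_p_S.
Qed.

Lemma is_derive_lm_R (r s : R) : good_phase r s ->
  is_derive (fun r => lm_ph gamma r s) r (ca r s * (lp_ph gamma r s - lm_ph gamma r s)).
Proof.
intros Hg. destruct (good_facts r s Hg) as [H1 [H2 [_ [_ [H3 _]]]]].
rewrite lam_diff by exact Hg. unfold ca. fold (w_ph r s). fold (th_p r s). fold (th_m r s).
replace (mu_k gamma (w_ph r s) / 2 * cos (th_p r s) /
  (cos (th_m r s) * sin (2 * mu gamma (w_ph r s))) *
  (sin (2 * mu gamma (w_ph r s)) / (cos (th_p r s) * cos (th_m r s))))
  with (/ cos (th_m r s) ^ 2 * (mu_k gamma (w_ph r s) / 2)) by (field; lra).
apply (is_derive_comp_R tan (fun r => th_m r s)).
- apply is_derive_tan_R. lra.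
- now apply is_derive_th_m_R.
Qed.

Lemma coef_a_eq (r s : R) : good_phase r s -> coef_a gamma r s = ca r s.
Proof.
intros Hg. unfold coef_a. rewrite (is_derive_unique (fun t : R => lm_ph gamma t s) _ _ (is_derive_lm_R r s Hg)).
assert (H := lam_lt_ph r s Hg). field. lra.
Qed.

Lemma coef_b_eq (r s : R) : good_phase r s -> coef_b gamma r s = cb r s.
Proof.
intros Hg. unfold coef_b. rewrite (is_derive_unique (fun t : R => lp_ph gamma r t) _ _ (is_derive_lp_S r s Hg)).
assert (H := lam_lt_ph r s Hg). field. lra.
Qed.

Lemma cot_mu (w : R) : nu_range gamma w ->
  sqrt (nu_inv gamma w ^ 2 - 1) = cos (mu gamma w) / sin (mu gamma w).
Proof.
intros Hw. destruct (nu_inv_spec gamma Hgamma w Hw) as [Hm _]. unfold mu.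
rewrite sin_mach_angle, cos_mach_angle by exact Hm. field. lra.
Qed.

(* Conservation of mass in characteristic form. *)
Lemma is_derive_flux_p_S (r s : R) : good_phase r s ->
  is_derive (fun s => flux_p r s) s (cb r s * (flux_p r s + flux_m r s)).
Proof.
intros Hg. destruct (good_facts r s Hg) as [H1 [H2 [H3 [H4 [H5 _]]]]].
assert (Hw := proj1 Hg). fold (w_ph r s) in Hw.
assert (D1 : is_derive (fun s => Gw gamma H0 (w_ph r s)) s
  (- Gw gamma H0 (w_ph r s) * mu_k gamma (w_ph r s) *
     (cos (mu gamma (w_ph r s)) / sin (mu gamma (w_ph r s))) * - / 2)).
{ apply (is_derive_comp_R (Gw gamma H0) (fun s => w_ph r s)); [|apply is_derive_w_S].
  rewrite <- cot_mu by exact Hw. now apply is_derive_Gw. }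
assert (D2 : is_derive (fun s => cos (th_p r s)) s
  (- sin (th_p r s) * (mu_k gamma (w_ph r s) / 2))).
{ apply (is_derive_comp_R cos (fun s => th_p r s)); [apply is_derive_cos|now apply is_derive_th_p_S]. }
assert (D := is_derive_div _ _ _ _ _ D1 D2 ltac:(lra)).
unfold flux_p, flux_m, cb. fold (w_ph r s). fold (th_p r s). fold (th_m r s).
match type of D with is_derive _ _ ?l => match goal with |- is_derive _ _ ?l' =>
  replace l' with l; [exact D|] end end.
(* The sum is 2 cos theta cos mu, with theta written as th_p - mu so that it matches the derivative
   of G / cos th_p. *)
assert (Ec : cos (th_m r s) + cos (th_p r s) = 2 * (cos (th_p r s) * cos (mu gamma (w_ph r s))
   + sin (th_p r s) * sin (mu gamma (w_ph r s))) * cos (mu gamma (w_ph r s))).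
{ rewrite <- cos_minus.
  replace (th_p r s - mu gamma (w_ph r s)) with (theta_ph r s) by (unfold th_p; ring).
  unfold th_m, th_p. rewrite cos_minus, cos_plus. ring. }
rewrite sin_2a.
set (cp := cos (th_p r s)) in *. set (cm := cos (th_m r s)) in *. set (sp := sin (th_p r s)) in *.
set (c := cos (mu gamma (w_ph r s))) in *. set (q := sin (mu gamma (w_ph r s))) in *.
set (G := Gw gamma H0 (w_ph r s)). set (k := mu_k gamma (w_ph r s)).
change (@eq R ((- G * k * (c / q) * - / 2 * cp - G * (- sp * (k / 2))) / cp ^ 2)
  (k / 2 * cm / (cp * (2 * q * c)) * (G / cp + G / cm))).
replace (k / 2 * cm / (cp * (2 * q * c)) * (G / cp + G / cm)) with
  (k * G * (cm + cp) / (4 * q * c * cp ^ 2)) by (field; lra).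
rewrite Ec. field. lra.
Qed.

Lemma is_derive_flux_m_R (r s : R) : good_phase r s ->
  is_derive (fun r => flux_m r s) r (- ca r s * (flux_p r s + flux_m r s)).
Proof.
intros Hg. destruct (good_facts r s Hg) as [H1 [H2 [H3 [H4 [H5 _]]]]].
assert (Hw := proj1 Hg). fold (w_ph r s) in Hw.
assert (D1 : is_derive (fun r => Gw gamma H0 (w_ph r s)) r
  (- Gw gamma H0 (w_ph r s) * mu_k gamma (w_ph r s) *
     (cos (mu gamma (w_ph r s)) / sin (mu gamma (w_ph r s))) * / 2)).
{ apply (is_derive_comp_R (Gw gamma H0) (fun r => w_ph r s)); [|apply is_derive_w_R].
  rewrite <- cot_mu by exact Hw. now apply is_derive_Gw. }
assert (D2 : is_derive (fun r => cos (th_m r s)) r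
  (- sin (th_m r s) * (mu_k gamma (w_ph r s) / 2))).
{ apply (is_derive_comp_R cos (fun r => th_m r s)); [apply is_derive_cos|now apply is_derive_th_m_R]. }
assert (D := is_derive_div _ _ _ _ _ D1 D2 ltac:(lra)).
unfold flux_p, flux_m, ca. fold (w_ph r s). fold (th_p r s). fold (th_m r s).
match type of D with is_derive _ _ ?l => match goal with |- is_derive _ _ ?l' =>
  replace l' with l; [exact D|] end end.
assert (Ec : cos (th_m r s) + cos (th_p r s) = 2 * (cos (th_m r s) * cos (mu gamma (w_ph r s))
   - sin (th_m r s) * sin (mu gamma (w_ph r s))) * cos (mu gamma (w_ph r s))).
{ rewrite <- cos_plus.
  replace (th_m r s + mu gamma (w_ph r s)) with (theta_ph r s) by (unfold th_m; ring).
  unfold th_m, th_p. rewrite cos_minus, cos_plus. ring. }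
rewrite sin_2a.
set (cp := cos (th_p r s)) in *. set (cm := cos (th_m r s)) in *. set (sm := sin (th_m r s)) in *.
set (c := cos (mu gamma (w_ph r s))) in *. set (q := sin (mu gamma (w_ph r s))) in *.
set (G := Gw gamma H0 (w_ph r s)). set (k := mu_k gamma (w_ph r s)).
change (@eq R ((- G * k * (c / q) * / 2 * cm - G * (- sm * (k / 2))) / cm ^ 2)
  (- (k / 2 * cp / (cm * (2 * q * c))) * (G / cp + G / cm))).
replace (- (k / 2 * cp / (cm * (2 * q * c))) * (G / cp + G / cm)) with
  (- (k * G * (cm + cp)) / (4 * q * c * cm ^ 2)) by (field; lra).
rewrite Ec. field. lra.
Qed.

(** * Continuity of the coefficients in the phase plane *)

Lemma cont_w (f : R -> R) (r s : R) :
  continuity_pt f (w_ph r s) -> continuity_2d_pt (fun r s => f (w_ph r s)) r s.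
Proof.
intros H. apply (continuity_1d_2d_pt_comp f w_ph); [exact H|].
unfold w_ph. apply continuity_2d_pt_mult; [apply continuity_2d_pt_minus|apply continuity_2d_pt_const].
- apply continuity_2d_pt_id1.
- apply continuity_2d_pt_id2.
Qed.

Lemma cont_theta (r s : R) : continuity_2d_pt theta_ph r s.
Proof.
unfold theta_ph. apply continuity_2d_pt_mult; [apply continuity_2d_pt_plus|apply continuity_2d_pt_const].
- apply continuity_2d_pt_id1.
- apply continuity_2d_pt_id2.
Qed.

Lemma cont_mu (r s : R) : good_phase r s ->
  continuity_2d_pt (fun r s => mu gamma (w_ph r s)) r s.
Proof.
intros [Hw _]. apply cont_w. apply (is_derive_continuity_pt _ _ _ (is_derive_mu gamma Hgamma _ Hw)).
Qed.

Lemma cont_th_p (r s : R) : good_phase r s -> continuity_2d_pt th_p r s.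
Proof. intros H. apply continuity_2d_pt_plus; [apply cont_theta|now apply cont_mu]. Qed.

Lemma cont_th_m (r s : R) : good_phase r s -> continuity_2d_pt th_m r s.
Proof. intros H. apply continuity_2d_pt_minus; [apply cont_theta|now apply cont_mu]. Qed.

Lemma cont_mu_k (r s : R) : good_phase r s ->
  continuity_2d_pt (fun r s => mu_k gamma (w_ph r s)) r s.
Proof.
intros [Hw _]. apply cont_w. destruct (nu_inv_spec gamma Hgamma _ Hw) as [Hm _].
fold (w_ph r s) in Hw, Hm. unfold mu_k.
assert (C := is_derive_continuity_pt _ _ _ (is_derive_nu_inv gamma Hgamma _ Hw)).
apply (continuity_pt_comp (nu_inv gamma) (fun m => (gamma + 1) / 2 * m ^ 2 / (m ^ 2 - 1))); [exact C|].
apply (is_derive_continuity_pt _ _ (Derive (fun m => (gamma + 1) / 2 * m ^ 2 / (m ^ 2 - 1)) (nu_inv gamma (w_ph r s)))).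
apply Derive_correct. auto_derive. simpl in *. nra.
Qed.

Lemma cont_cos_th (f : R -> R -> R) (r s : R) :
  continuity_2d_pt f r s -> continuity_2d_pt (fun r s => cos (f r s)) r s.
Proof. intros H. apply (continuity_1d_2d_pt_comp cos f); [apply continuity_cos|exact H]. Qed.

Lemma cont_tan (f : R -> R -> R) (r s : R) :
  continuity_2d_pt f r s -> cos (f r s) <> 0 -> continuity_2d_pt (fun r s => tan (f r s)) r s.
Proof.
intros H Hc. apply (continuity_1d_2d_pt_comp tan f); [|exact H].
exact (is_derive_continuity_pt _ _ _ (is_derive_tan_R _ Hc)).
Qed.

Lemma cont_lp (r s : R) : good_phase r s -> continuity_2d_pt (lp_ph gamma) r s.
Proof.
intros Hg. destruct (good_facts r s Hg) as [H1 [H2 _]].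
apply (cont_tan th_p); [now apply cont_th_p|lra].
Qed.

Lemma cont_lm (r s : R) : good_phase r s -> continuity_2d_pt (lm_ph gamma) r s.
Proof.
intros Hg. destruct (good_facts r s Hg) as [H1 [H2 _]].
apply (cont_tan th_m); [now apply cont_th_m|lra].
Qed.

Lemma cont_Gw (r s : R) : good_phase r s ->
  continuity_2d_pt (fun r s => Gw gamma H0 (w_ph r s)) r s.
Proof.
intros [Hw _]. apply cont_w.
apply (is_derive_continuity_pt _ _ _ (is_derive_Gw gamma Hgamma H0 HH0 _ Hw)).
Qed.

Lemma cont_flux_p (r s : R) : good_phase r s -> continuity_2d_pt flux_p r s.
Proof.
intros Hg. destruct (good_facts r s Hg) as [H1 [H2 _]].
apply continuity_2d_pt_mult; [now apply cont_Gw|].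
apply (continuity_2d_pt_inv (fun r s => cos (th_p r s))); [|lra].
now apply cont_cos_th, cont_th_p.
Qed.

Lemma cont_flux_m (r s : R) : good_phase r s -> continuity_2d_pt flux_m r s.
Proof.
intros Hg. destruct (good_facts r s Hg) as [H1 [H2 _]].
apply continuity_2d_pt_mult; [now apply cont_Gw|].
apply (continuity_2d_pt_inv (fun r s => cos (th_m r s))); [|lra].
now apply cont_cos_th, cont_th_m.
Qed.

Lemma cont_sin2mu (r s : R) : good_phase r s ->
  continuity_2d_pt (fun r s => sin (2 * mu gamma (w_ph r s))) r s.
Proof.
intros Hg. apply (continuity_1d_2d_pt_comp sin (fun r s => 2 * mu gamma (w_ph r s))).
- apply continuity_sin.
- apply continuity_2d_pt_mult; [apply continuity_2d_pt_const|now apply cont_mu].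
Qed.

Lemma cont_ca (r s : R) : good_phase r s -> continuity_2d_pt ca r s.
Proof.
intros Hg. destruct (good_facts r s Hg) as [H1 [H2 [_ [_ [H3 _]]]]].
apply continuity_2d_pt_mult; [apply continuity_2d_pt_mult; [apply continuity_2d_pt_mult|]|].
- now apply cont_mu_k.
- apply continuity_2d_pt_const.
- now apply (cont_cos_th th_p), cont_th_p.
- apply (continuity_2d_pt_inv (fun r s => cos (th_m r s) * sin (2 * mu gamma (w_ph r s)))).
  + apply continuity_2d_pt_mult; [now apply cont_cos_th, cont_th_m|now apply cont_sin2mu].
  + apply Rgt_not_eq. now apply Rmult_lt_0_compat.
Qed.

Lemma cont_cb (r s : R) : good_phase r s -> continuity_2d_pt cb r s.
Proof.
intros Hg. destruct (good_facts r s Hg) as [H1 [H2 [_ [_ [H3 _]]]]].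
apply continuity_2d_pt_mult; [apply continuity_2d_pt_mult; [apply continuity_2d_pt_mult|]|].
- now apply cont_mu_k.
- apply continuity_2d_pt_const.
- now apply (cont_cos_th th_m), cont_th_m.
- apply (continuity_2d_pt_inv (fun r s => cos (th_p r s) * sin (2 * mu gamma (w_ph r s)))).
  + apply continuity_2d_pt_mult; [now apply cont_cos_th, cont_th_p|now apply cont_sin2mu].
  + apply Rgt_not_eq. now apply Rmult_lt_0_compat.
Qed.

End PhasePlane.

(** * The shock polar *)

Section ShockPolar.

Context (gamma rho_inf p_inf : R).
Context (Hgamma : 1 < gamma) (Hrho : 0 < rho_inf) (Hp : 0 < p_inf).
Context (HM : 1 < Minf2 gamma rho_inf p_inf).

Let e : R := eps gamma rho_inf p_inf.
(** Up to positive factors, [n] is the denominator of the density ratio, [b] the pressure, n b the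
    squared sound speed and [W] the squared speed behind the shock; [Z] is the squared Mach number
    there. *)
Let n (s : R) : R := 2 * e + (2 * e + gamma - 1) * s ^ 2.
Let b (s : R) : R := 2 * gamma * s ^ 2 - e * (gamma - 1) * (1 + s ^ 2).
Let W (s : R) : R := (gamma + 1) ^ 2 * s ^ 2 + n s ^ 2.
Let Z (s : R) : R := W s / (n s * b s).
Let P0 (s : R) : R := poly_P0 gamma rho_inf p_inf s.
Let B (s : R) : R := poly_B gamma rho_inf p_inf s.
Let N (s : R) : R := poly_N gamma rho_inf p_inf s.
Let U (s : R) : state := post_shock gamma rho_inf p_inf s.

Definition total_enthalpy : R := 1 / 2 + gamma * p_inf / ((gamma - 1) * rho_inf).

Lemma eps_range : 0 < e < 1.
Proof.
unfold e, eps. split.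
- apply Rinv_0_lt_compat. lra.
- rewrite <- Rinv_1. apply Rinv_lt_contravar; lra.
Qed.

Lemma eps_eq : e = gamma * p_inf / rho_inf.
Proof.
unfold e, eps, Minf2. field. lra.
Qed.

Lemma total_enthalpy_eq : total_enthalpy = 1 / 2 + e / (gamma - 1).
Proof. unfold total_enthalpy. rewrite eps_eq. field. lra. Qed.

Lemma total_enthalpy_pos : 0 < total_enthalpy.
Proof.
rewrite total_enthalpy_eq. assert (H := eps_range).
assert (0 < e / (gamma - 1)) by (apply Rdiv_lt_0_compat; lra). lra.
Qed.

(** The condition Mn2 s > 1 cleared of its denominator. *)
Definition supersonic_normal (s : R) : Prop := 0 < s /\ e * (1 + s ^ 2) < s ^ 2.

Lemma s_minus_supersonic (s : R) : s_minus gamma rho_inf p_inf < s -> supersonic_normal s.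
Proof.
intros Hs. unfold s_minus in Hs. fold e in Hs. assert (He := eps_range).
assert (H0 : 0 < e / (1 - e)) by (apply Rdiv_lt_0_compat; lra).
assert (H1 : 0 <= sqrt (e / (1 - e))) by apply sqrt_pos.
assert (H2 : sqrt (e / (1 - e)) * sqrt (e / (1 - e)) = e / (1 - e)) by (apply sqrt_sqrt; lra).
split; [lra|]. assert (H3 : e / (1 - e) < s ^ 2) by nra.
apply (Rmult_lt_compat_r (1 - e)) in H3; [|lra].
unfold Rdiv in H3. rewrite Rmult_assoc, Rinv_l in H3 by lra. lra.
Qed.

(** The difference b - n equals (gamma + 1) (s^2 - e (1 + s^2)). Since n / b is the squared normal
    Mach number behind the shock, n < b says that the normal component becomes subsonic. *)
Lemma nb_pos (s : R) : supersonic_normal s -> 0 < n s /\ 0 < b s /\ n s < b s.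
Proof.
intros [Hs Hn]. assert (He := eps_range). unfold n, b.
assert (0 < s ^ 2) by nra. repeat split; nra.
Qed.

Lemma W_pos (s : R) : supersonic_normal s -> 0 < W s.
Proof.
intros Hs. assert (H := nb_pos s Hs). destruct Hs as [Hs _]. unfold W.
assert (0 < s ^ 2) by nra. assert (0 < n s ^ 2) by nra. nra.
Qed.

Lemma shock_ratio_eq (s : R) : supersonic_normal s ->
  shock_ratio gamma rho_inf p_inf s = (gamma + 1) * s ^ 2 / n s.
Proof.
intros Hs. assert (He := eps_range). destruct (nb_pos s Hs) as [H1 _].
destruct Hs as [Hs _]. unfold shock_ratio, Mn2. fold e. unfold n in *.
assert (0 < s ^ 2) by nra.
field. repeat split; try nra.
Qed.

Lemma rho_eq (s : R) : supersonic_normal s -> rho (U s) = rho_inf * ((gamma + 1) * s ^ 2 / n s).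
Proof. intros Hs. unfold U, post_shock. simpl rho. now rewrite shock_ratio_eq. Qed.

Lemma prs_eq (s : R) : supersonic_normal s ->
  prs (U s) = rho_inf / gamma * b s / ((gamma + 1) * (1 + s ^ 2)).
Proof.
intros Hs. assert (He := eps_range). unfold U, post_shock, Mn2. simpl prs. fold e.
replace rho_inf with (gamma * p_inf / e).
2:{ rewrite eps_eq. field. lra. }
unfold b. field. repeat split; nra.
Qed.

Lemma vx_eq (s : R) : supersonic_normal s ->
  vx (U s) = (gamma + 1 + n s) / ((gamma + 1) * (1 + s ^ 2)).
Proof.
intros Hs. destruct (nb_pos s Hs) as [H1 _]. unfold U, post_shock. simpl vx.
rewrite shock_ratio_eq by exact Hs. destruct Hs as [Hs _]. field. repeat split; nra.
Qed.

Lemma vy_eq (s : R) : supersonic_normal s ->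
  vy (U s) = 2 * (s ^ 2 - e * (1 + s ^ 2)) / ((gamma + 1) * s * (1 + s ^ 2)).
Proof.
intros Hs. destruct (nb_pos s Hs) as [H1 _]. unfold U, post_shock. simpl vy.
rewrite shock_ratio_eq by exact Hs. destruct Hs as [Hs _].
replace (2 * (s ^ 2 - e * (1 + s ^ 2))) with ((gamma + 1) * s ^ 2 - n s) by (unfold n; ring).
field. repeat split; nra.
Qed.

Lemma state_pos (s : R) : supersonic_normal s ->
  0 < rho (U s) /\ 0 < prs (U s) /\ 0 < vx (U s) /\ 0 < vy (U s).
Proof.
intros Hs. destruct (nb_pos s Hs) as [H1 [H2 _]].
rewrite rho_eq, prs_eq, vx_eq, vy_eq by exact Hs. destruct Hs as [Hs Hn].
assert (0 < s ^ 2) by nra.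
repeat split.
- apply Rmult_lt_0_compat; [lra|]. apply Rdiv_lt_0_compat; nra.
- apply Rdiv_lt_0_compat; [|nra]. apply Rmult_lt_0_compat; [apply Rdiv_lt_0_compat; lra|lra].
- apply Rdiv_lt_0_compat; nra.
- apply Rdiv_lt_0_compat; [lra|]. repeat apply Rmult_lt_0_compat; lra.
Qed.

Lemma sound2_eq (s : R) : supersonic_normal s ->
  gamma * prs (U s) / rho (U s) = n s * b s / ((gamma + 1) ^ 2 * s ^ 2 * (1 + s ^ 2)).
Proof.
intros Hs. destruct (nb_pos s Hs) as [H1 [H2 _]]. rewrite rho_eq, prs_eq by exact Hs.
destruct Hs as [Hs Hn]. field. repeat split; nra.
Qed.

Lemma speed2_eq (s : R) : supersonic_normal s ->
  vx (U s) ^ 2 + vy (U s) ^ 2 = W s / ((gamma + 1) ^ 2 * s ^ 2 * (1 + s ^ 2)).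
Proof.
intros Hs. rewrite vx_eq, vy_eq by exact Hs. destruct Hs as [Hs Hn].
unfold W, n. field. repeat split; nra.
Qed.

Lemma sound2_pos (s : R) : supersonic_normal s -> 0 < gamma * prs (U s) / rho (U s).
Proof.
intros Hs. destruct (state_pos s Hs) as [H1 [H2 _]]. apply Rdiv_lt_0_compat; nra.
Qed.

Lemma mach_eq (s : R) : supersonic_normal s -> mach gamma (U s) = sqrt (Z s).
Proof.
intros Hs. unfold mach, speed, sound.
assert (Hc := sound2_pos s Hs). rewrite <- sqrt_div.
- f_equal. rewrite speed2_eq, sound2_eq by exact Hs. unfold Z.
  destruct (nb_pos s Hs) as [H1 [H2 _]]. destruct Hs as [Hs Hn]. field. repeat split; nra.
- nra.
- exact Hc.
Qed.

Lemma Z_pos (s : R) : supersonic_normal s -> 0 < Z s.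
Proof.
intros Hs. destruct (nb_pos s Hs) as [H1 [H2 _]]. unfold Z.
apply Rdiv_lt_0_compat; [now apply W_pos|nra].
Qed.

(** W - n b = (gamma + 1) P0, so [poly_P0] carries the sign of M^2 - 1 behind the shock. *)
Lemma Z_minus_1 (s : R) : supersonic_normal s ->
  Z s - 1 = (gamma + 1) * P0 s / (n s * b s).
Proof.
intros Hs. destruct (nb_pos s Hs) as [H1 [H2 _]].
unfold Z. apply (Rmult_eq_reg_r (n s * b s)); [|nra].
transitivity (W s - n s * b s); [field; split; lra|].
transitivity ((gamma + 1) * P0 s); [|field; split; lra].
unfold W, n, b, P0, poly_P0. fold e. ring.
Qed.

Lemma poly_C_eq (s : R) : poly_C gamma rho_inf p_inf s = n s * b s.
Proof. unfold poly_C, n, b. fold e. ring. Qed.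

(* Since s^2 C N^2 >= 0, the inequality D < 0 already forces M > 1. *)
Lemma poly_P0_pos (s : R) : supersonic_normal s -> poly_D gamma rho_inf p_inf s < 0 -> 0 < P0 s.
Proof.
intros Hs HD. destruct (nb_pos s Hs) as [H1 [H2 _]]. unfold poly_D in HD.
rewrite poly_C_eq in HD. fold (P0 s) in HD.
set (B2 := poly_B gamma rho_inf p_inf s) in *. set (N2 := poly_N gamma rho_inf p_inf s) in *.
assert (0 <= s ^ 2 * (n s * b s) * N2 ^ 2).
{ apply Rmult_le_pos; [|apply pow2_ge_0].
  apply Rmult_le_pos; [apply pow2_ge_0|left; now apply Rmult_lt_0_compat]. }
apply Rnot_le_lt. intros Hle.
assert (0 <= 4 * (gamma + 1) * B2 ^ 2 * - P0 s).
{ apply Rmult_le_pos; [|lra]. apply Rmult_le_pos; [lra|apply pow2_ge_0]. }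
lra.
Qed.

Lemma mach_gt_1 (s : R) : supersonic_normal s -> 0 < P0 s -> 1 < mach gamma (U s).
Proof.
intros Hs HP. rewrite mach_eq by exact Hs. rewrite <- sqrt_1. apply sqrt_lt_1_alt. split; [lra|].
assert (E := Z_minus_1 s Hs). destruct (nb_pos s Hs) as [H1 [H2 _]].
assert (0 < (gamma + 1) * P0 s / (n s * b s)) by (apply Rdiv_lt_0_compat; nra). lra.
Qed.

Lemma bernoulli_shock (s : R) : supersonic_normal s ->
  (vx (U s) ^ 2 + vy (U s) ^ 2) / 2 + gamma * prs (U s) / rho (U s) / (gamma - 1) = total_enthalpy.
Proof.
intros Hs. rewrite speed2_eq, sound2_eq, total_enthalpy_eq by exact Hs.
destruct Hs as [Hs Hn]. unfold W, n, b. field. repeat split; nra.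
Qed.

(** The post-shock state lies on the Bernoulli surface of the incoming flow, and there the Mach
    number determines the sound speed. *)
Lemma csq_shock (s : R) : supersonic_normal s ->
  csq gamma total_enthalpy (mach gamma (U s)) = gamma * prs (U s) / rho (U s).
Proof.
intros Hs. unfold csq. rewrite <- (bernoulli_shock s Hs).
assert (Hc := sound2_pos s Hs). rewrite mach_eq by exact Hs. rewrite pow2_sqrt.
2:{ left. now apply Z_pos. }
assert (HZ := Z_pos s Hs).
assert (EZ : vx (U s) ^ 2 + vy (U s) ^ 2 = Z s * (gamma * prs (U s) / rho (U s))).
{ rewrite speed2_eq, sound2_eq by exact Hs. unfold Z.
  destruct (nb_pos s Hs) as [H1 [H2 _]]. destruct Hs as [Hs Hn]. field. repeat split; nra. }
rewrite EZ. set (c := gamma * prs (U s) / rho (U s)) in *. 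
assert (0 < (gamma - 1) * Z s) by (apply Rmult_lt_0_compat; lra).
field. split; lra.
Qed.

(** The Rankine-Hugoniot mass balance for the upstream velocity (1, 0). *)
Lemma mass_shock (s : R) : supersonic_normal s ->
  rho (U s) * (vx (U s) * s - vy (U s)) = rho_inf * s.
Proof.
intros Hs. rewrite rho_eq, vx_eq, vy_eq by exact Hs. destruct (nb_pos s Hs) as [H1 _].
destruct Hs as [Hs Hn]. unfold n in *. field. repeat split; nra.
Qed.

Lemma speed_pos (s : R) : supersonic_normal s -> 0 < speed (U s).
Proof.
intros Hs. unfold speed. apply sqrt_lt_R0. destruct (state_pos s Hs) as [_ [_ [H1 H2]]]. nra.
Qed.

Lemma flow_angle_shock (s : R) : supersonic_normal s ->
  vx (U s) = speed (U s) * cos (flow_angle (U s)) /\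
  vy (U s) = speed (U s) * sin (flow_angle (U s)).
Proof.
intros Hs. destruct (state_pos s Hs) as [_ [_ [H1 H2]]].
assert (Hq := speed_pos s Hs).
unfold flow_angle. rewrite cos_atan, sin_atan.
assert (E : sqrt (1 + (vy (U s) / vx (U s)) ^ 2) = speed (U s) / vx (U s)).
{ unfold speed.
  replace (1 + (vy (U s) / vx (U s)) ^ 2) with ((vx (U s) ^ 2 + vy (U s) ^ 2) / vx (U s) ^ 2)
    by (field; lra).
  rewrite sqrt_div by nra. rewrite sqrt_pow2; [reflexivity|lra]. }
replace ((vy (U s) / vx (U s))²) with ((vy (U s) / vx (U s)) ^ 2) by (unfold Rsqr; ring).
rewrite E. split; field; lra.
Qed.

Lemma supersonic_open (s : R) : supersonic_normal s -> locally s supersonic_normal.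
Proof.
intros Hs.
destruct Hs as [Hs0 Hn].
assert (C : continuity_pt (fun s => s ^ 2 - e * (1 + s ^ 2)) s) by (apply derivable_continuous_pt; reg).
assert (Hpos : 0 < s ^ 2 - e * (1 + s ^ 2)) by lra.
destruct (C _ Hpos) as [d [Hd HC]].
assert (Hd' : 0 < Rmin d s) by (apply Rmin_glb_lt; lra).
exists (mkposreal _ Hd'). intros z Hz.
assert (Hz' : Rabs (z - s) < Rmin d s) by exact Hz.
assert (M1 := Rmin_l d s). assert (M2 := Rmin_r d s).
split.
- apply Rabs_def2 in Hz'. lra.
- destruct (Req_dec z s) as [->|Hne]; [exact Hn|].
  assert (K : Rabs (z ^ 2 - e * (1 + z ^ 2) - (s ^ 2 - e * (1 + s ^ 2))) < s ^ 2 - e * (1 + s ^ 2)).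
  { apply HC. split; [split; [exact I|auto]|]. unfold dist; simpl. unfold R_dist. lra. }
  apply Rabs_def2 in K. lra.
Qed.

(** * Derivatives along the shock polar *)

Lemma is_derive_flow_angle (s : R) : supersonic_normal s ->
  is_derive (fun s => flow_angle (U s)) s (2 * N s / ((1 + s ^ 2) * W s)).
Proof.
intros Hs. assert (He := eps_range).
assert (Hopen := supersonic_open s Hs).
apply (is_derive_ext_loc (fun s =>
  atan (2 * (s ^ 2 - e * (1 + s ^ 2)) / (s * (gamma + 1 + n s))))).
{ revert Hopen. apply filter_imp. intros z Hz. unfold flow_angle. f_equal.
  rewrite vx_eq, vy_eq by exact Hz. destruct (nb_pos z Hz) as [H1 _]. destruct Hz as [Hz _].
  field. repeat split; nra. }
destruct (nb_pos s Hs) as [H1 _]. assert (HW := W_pos s Hs). destruct Hs as [Hs _].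
set (A := gamma + 1 + n s). assert (HA : 0 < A) by (unfold A; lra).
set (D := 2 * (s ^ 2 - e * (1 + s ^ 2))).
(* With tan theta = D / (s A), these identities evaluate the denominator and the numerator of
   theta'; the second is the origin of the polynomial [N]. *)
assert (EW : s ^ 2 * A ^ 2 + D ^ 2 = (1 + s ^ 2) * W s).
{ unfold A, D, W, n. ring. }
assert (EN : 4 * (1 - e) * s * (s * A) - D * (A + s * (2 * (2 * e + gamma - 1) * s)) = 2 * N s).
{ unfold A, D, N, poly_N, poly_P0, n. fold e. ring. }
rewrite <- EN, <- EW.
assert (HDA : 0 < s ^ 2 * A ^ 2 + D ^ 2).
{ assert (0 < s ^ 2 * A ^ 2) by (apply Rmult_lt_0_compat; apply pow_lt; lra).
  assert (0 <= D ^ 2) by apply pow2_ge_0. lra. }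
replace ((4 * (1 - e) * s * (s * A) - D * (A + s * (2 * (2 * e + gamma - 1) * s))) /
  (s ^ 2 * A ^ 2 + D ^ 2)) with
  ((4 * (1 - e) * s * (s * A) - D * (A + s * (2 * (2 * e + gamma - 1) * s))) / (s * A) ^ 2 *
   / (1 + (D / (s * A)) ^ 2)).
2:{ field. repeat split; nra. }
rewrite Rmult_comm.
apply (is_derive_comp_R atan (fun s => 2 * (s ^ 2 - e * (1 + s ^ 2)) / (s * (gamma + 1 + n s)))).
- fold A. fold D. apply is_derive_Reals. apply derivable_pt_lim_atan.
- unfold n. assert (Hne : s * (gamma + 1 + (2 * e + (2 * e + gamma - 1) * s ^ 2)) <> 0).
  { fold (n s). fold A. apply Rgt_not_eq. now apply Rmult_lt_0_compat. }
  auto_derive; [simpl in *; lra|].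
  unfold D, A, n in *. simpl in *. field. repeat split; nra.
Qed.

Lemma is_derive_nu_mach (s : R) : supersonic_normal s -> 0 < P0 s ->
  is_derive (fun s => nu gamma (mach gamma (U s))) s
    (- (sqrt (Z s - 1) * (4 * B s / (s * ((1 + s ^ 2) * W s))))).
Proof.
intros Hs HP. assert (He := eps_range).
assert (HM1 := mach_gt_1 s Hs HP). rewrite mach_eq in HM1 by exact Hs.
assert (HZ := Z_pos s Hs). assert (HW := W_pos s Hs).
apply (is_derive_ext_loc (fun s => nu gamma (sqrt (Z s)))).
{ generalize (supersonic_open s Hs). apply filter_imp. intros z Hz. now rewrite mach_eq. }
destruct (nb_pos s Hs) as [H1 [H2 _]]. destruct Hs as [Hs _].
assert (Esq : sqrt (Z s) * sqrt (Z s) = Z s) by (apply sqrt_sqrt; lra).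
(* The first identity evaluates n b (2 + (gamma - 1) Z) and the second the numerator of Z'. Their
   common factor (gamma + 1)^2 (gamma - 1 + 2 e) cancels in the derivative of nu, which leaves the
   polynomial [B]. *)
assert (EW : 2 * (n s * b s) + (gamma - 1) * W s =
  (gamma + 1) ^ 2 * (gamma - 1 + 2 * e) * s ^ 2 * (1 + s ^ 2)).
{ unfold W, n, b. ring. }
assert (EZ : (2 * (gamma + 1) ^ 2 * s + 2 * n s * (2 * (2 * e + gamma - 1) * s)) * (n s * b s)
  - W s * (2 * (2 * e + gamma - 1) * s * b s + n s * (2 * (2 * gamma - e * (gamma - 1)) * s))
  = - (4 * B s * s * (gamma + 1) ^ 2 * (gamma - 1 + 2 * e))).
{ unfold W, n, b, B, poly_B. fold e. ring. }
assert (HnbW : 0 < 2 * (n s * b s) + (gamma - 1) * W s).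
{ assert (0 < n s * b s) by (now apply Rmult_lt_0_compat).
  assert (0 < (gamma - 1) * W s) by (apply Rmult_lt_0_compat; lra). lra. }
assert (DZ : is_derive Z s (- (4 * B s * s * (gamma + 1) ^ 2 * (gamma - 1 + 2 * e)) / (n s * b s) ^ 2)).
{ rewrite <- EZ. unfold Z, W, n, b.
  assert (Hne : (2 * e + (2 * e + gamma - 1) * s ^ 2) *
    (2 * gamma * s ^ 2 - e * (gamma - 1) * (1 + s ^ 2)) <> 0).
  { fold (n s). fold (b s). apply Rgt_not_eq. now apply Rmult_lt_0_compat. }
  auto_derive; [simpl in *; lra|]. unfold n, b in *. simpl in *. field.
  repeat split; lra. }
assert (DS : is_derive (fun s => sqrt (Z s)) s (/ (2 * sqrt (Z s)) *
  (- (4 * B s * s * (gamma + 1) ^ 2 * (gamma - 1 + 2 * e)) / (n s * b s) ^ 2))).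
{ apply (is_derive_comp_R sqrt Z); [|exact DZ].
  apply is_derive_Reals. now apply derivable_pt_lim_sqrt. }
assert (D := is_derive_comp_R (nu gamma) (fun s => sqrt (Z s)) s _ _ (is_derive_nu gamma Hgamma _ HM1) DS).
match type of D with is_derive _ _ ?l => match goal with |- is_derive _ _ ?l' =>
  replace l' with l; [exact D|] end end.
unfold nu'. replace (sqrt (Z s) ^ 2) with (Z s) by (simpl; lra).
set (t := sqrt (Z s - 1)).
transitivity (t * (- (4 * B s * s * (gamma + 1) ^ 2 * (gamma - 1 + 2 * e)) / (n s * b s) ^ 2)
  / (2 * Z s * (1 + (gamma - 1) / 2 * Z s))).
{ assert (HA : 0 < 1 + (gamma - 1) / 2 * Z s) by nra.
  assert (Hq : 0 < sqrt (Z s)) by now apply sqrt_lt_R0.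
  replace (2 * Z s * (1 + (gamma - 1) / 2 * Z s)) with
    (2 * (sqrt (Z s) * sqrt (Z s)) * (1 + (gamma - 1) / 2 * Z s)) by (rewrite Esq; reflexivity).
  set (q := sqrt (Z s)) in *. set (A := 1 + (gamma - 1) / 2 * Z s) in *.
  set (Y := - (4 * B s * s * (gamma + 1) ^ 2 * (gamma - 1 + 2 * e)) / (n s * b s) ^ 2).
  field. split; lra. }
assert (EW2 : 2 * Z s * (1 + (gamma - 1) / 2 * Z s) * (n s * b s) ^ 2 =
  W s * (2 * (n s * b s) + (gamma - 1) * W s)).
{ unfold Z. field. lra. }
transitivity (t * - (4 * B s * s * (gamma + 1) ^ 2 * (gamma - 1 + 2 * e)) /
  (W s * (2 * (n s * b s) + (gamma - 1) * W s))).
{ rewrite <- EW2. assert (0 < 1 + (gamma - 1) / 2 * Z s) by nra. field. repeat split; nra. }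
rewrite EW. assert (0 < gamma - 1 + 2 * e) by lra. field. repeat split; nra.
Qed.

(** [slope_th] and [slope_nu] are the derivatives along the polar of theta and, with the sign
    reversed, of nu (M). *)
Definition slope_th (s : R) : R := 2 * N s / ((1 + s ^ 2) * W s).
Definition slope_nu (s : R) : R := sqrt (Z s - 1) * (4 * B s / (s * ((1 + s ^ 2) * W s))).

(** The inequality D < 0 is this one squared: with t^2 = M^2 - 1, multiplying (2 N)^2 < (4 t B /
    s)^2 by s^2 C / 4 gives s^2 C N^2 < 4 (gamma + 1) B^2 P0. It is what gives R and S opposite
    monotonicity along the shock. *)
Lemma slope_th_lt_nu (s : R) : supersonic_normal s -> poly_D gamma rho_inf p_inf s < 0 ->
  Rabs (slope_th s) < slope_nu s.
Proof.
intros Hs HD. assert (HP := poly_P0_pos s Hs HD). assert (HW := W_pos s Hs).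
destruct (nb_pos s Hs) as [H1 [H2 _]]. assert (EZ := Z_minus_1 s Hs).
assert (He := eps_range).
assert (Hs0 : 0 < s) by apply Hs.
assert (HB : 0 < B s).
{ unfold B, poly_B. fold e. assert (0 < s ^ 4) by (now apply pow_lt).
  assert (0 <= e ^ 2 * (1 + s ^ 2) ^ 2) by (apply Rmult_le_pos; apply pow2_ge_0). nra. }
assert (HZ1 : 0 < Z s - 1).
{ rewrite EZ. apply Rdiv_lt_0_compat; apply Rmult_lt_0_compat; lra. }
assert (Ht : 0 < sqrt (Z s - 1)) by now apply sqrt_lt_R0.
assert (Ett : sqrt (Z s - 1) * sqrt (Z s - 1) = Z s - 1) by (apply sqrt_sqrt; lra).
assert (Hw : 0 < (1 + s ^ 2) * W s) by (apply Rmult_lt_0_compat; nra).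
unfold slope_th, slope_nu. set (t := sqrt (Z s - 1)) in *. set (w := (1 + s ^ 2) * W s) in *.
replace (t * (4 * B s / (s * w))) with (4 * t * B s / s / w) by (field; lra).
unfold Rdiv at 1 2. rewrite Rabs_mult, (Rabs_right (/ w)).
2:{ left. now apply Rinv_0_lt_compat. }
apply Rmult_lt_compat_r; [now apply Rinv_0_lt_compat|].
assert (Hy : 0 < 4 * t * B s / s).
{ apply Rdiv_lt_0_compat; [|exact Hs0]. apply Rmult_lt_0_compat; lra. }
assert (Hsq : (2 * N s) ^ 2 < (4 * t * B s / s) ^ 2).
{ unfold poly_D in HD. rewrite poly_C_eq in HD. fold (P0 s) (B s) (N s) in HD.
  assert (Hnb : 0 < s ^ 2 * (n s * b s)).
  { apply Rmult_lt_0_compat; [now apply pow_lt|now apply Rmult_lt_0_compat]. }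
  apply (Rmult_lt_reg_l (s ^ 2 * (n s * b s) / 4)); [lra|].
  replace (s ^ 2 * (n s * b s) / 4 * (4 * t * B s / s) ^ 2) with (4 * (t * t) * B s ^ 2 * (n s * b s))
    by (field; lra).
  rewrite Ett, EZ.
  replace (4 * ((gamma + 1) * P0 s / (n s * b s)) * B s ^ 2 * (n s * b s)) with
    (4 * (gamma + 1) * B s ^ 2 * P0 s) by (field; lra).
  lra. }
rewrite <- (Rabs_right (4 * t * B s / s)) by lra.
apply Rsqr_lt_abs_0. unfold Rsqr. lra.
Qed.

Lemma is_derive_inv_R (s : R) : supersonic_normal s -> 0 < P0 s ->
  is_derive (fun s => inv_R gamma (U s)) s (slope_th s - slope_nu s).
Proof.
intros Hs HP. unfold inv_R, Rminus.
apply (is_derive_plus (fun s => flow_angle (U s)) (fun s => nu gamma (mach gamma (U s)))).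
- now apply is_derive_flow_angle.
- now apply is_derive_nu_mach.
Qed.

Lemma is_derive_inv_S (s : R) : supersonic_normal s -> 0 < P0 s ->
  is_derive (fun s => inv_S gamma (U s)) s (slope_th s + slope_nu s).
Proof.
intros Hs HP. unfold inv_S. replace (slope_th s + slope_nu s) with (slope_th s - - slope_nu s) by ring.
apply (is_derive_minus (fun s => flow_angle (U s)) (fun s => nu gamma (mach gamma (U s)))).
- now apply is_derive_flow_angle.
- now apply is_derive_nu_mach.
Qed.

Lemma slope_th_cont (s : R) : supersonic_normal s -> continuity_pt slope_th s.
Proof.
intros Hs. assert (HW := W_pos s Hs). unfold slope_th, N, poly_N, poly_P0, W, n in *.
assert (0 < 1 + s ^ 2) by nra. apply continuity_pt_div; [reg|reg|].
apply Rgt_not_eq. now apply Rmult_lt_0_compat.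
Qed.

Lemma slope_nu_cont (s : R) : supersonic_normal s -> 0 < P0 s -> continuity_pt slope_nu s.
Proof.
intros Hs HP. assert (HW := W_pos s Hs). destruct (nb_pos s Hs) as [H1 [H2 _]].
assert (EZ := Z_minus_1 s Hs). destruct Hs as [Hs _].
assert (HZ1 : 0 < Z s - 1).
{ rewrite EZ. apply Rdiv_lt_0_compat; apply Rmult_lt_0_compat; lra. }
apply (continuity_pt_mult (fun s => sqrt (Z s - 1)) (fun s => 4 * B s / (s * ((1 + s ^ 2) * W s)))).
- apply (continuity_pt_comp (fun s => Z s - 1) sqrt).
  + unfold Z, W, n, b in *. apply continuity_pt_minus; [apply continuity_pt_div|reg]; [reg|reg|].
    apply Rgt_not_eq. now apply Rmult_lt_0_compat.
  + apply continuity_pt_sqrt. lra.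
- unfold B, poly_B, W, n in *. assert (0 < 1 + s ^ 2) by nra. apply continuity_pt_div; [reg|reg|].
  apply Rgt_not_eq. repeat apply Rmult_lt_0_compat; assumption.
Qed.

(* The Prandtl relation in the form: the normal Mach number behind the shock
   is below 1, so the shock angle relative to the flow is below the Mach angle. *)
Lemma shock_between_characteristics (s : R) : supersonic_normal s -> 0 < P0 s ->
  - (PI / 2) < flow_angle (U s) - mach_angle (mach gamma (U s)) ->
  flow_angle (U s) + mach_angle (mach gamma (U s)) < PI / 2 ->
  tan (flow_angle (U s) - mach_angle (mach gamma (U s))) < s <
  tan (flow_angle (U s) + mach_angle (mach gamma (U s))).
Proof.
intros Hs HP Hlo Hhi. assert (HM1 := mach_gt_1 s Hs HP).
destruct (state_pos s Hs) as [Hr [Hpr [Hu Hv]]].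
assert (Hq := speed_pos s Hs). destruct (flow_angle_shock s Hs) as [Eu Ev].
assert (Hmu := mach_angle_range _ HM1). assert (Hsin := sin_mach_angle _ HM1).
set (th := flow_angle (U s)) in *. set (ma := mach_angle (mach gamma (U s))) in *.
assert (Hth : - (PI / 2) < th < PI / 2) by lra.
assert (Hcos : 0 < cos th) by (apply cos_gt_0; lra).
assert (Hmass := mass_shock s Hs). assert (Hs0 : 0 < s) by apply Hs.
assert (Hus : 0 < vx (U s) * s - vy (U s)).
{ apply (Rmult_lt_reg_l (rho (U s))); [exact Hr|]. rewrite Hmass, Rmult_0_r. now apply Rmult_lt_0_compat. }
assert (Hb := atan_bound s).
assert (Hthb : th < atan s).
{ unfold th, flow_angle. apply atan_increasing.
  apply (Rmult_lt_reg_r (vx (U s))); [exact Hu|]. unfold Rdiv.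
  rewrite Rmult_assoc, Rinv_l by lra. lra. }
split.
- rewrite <- (tan_atan s). apply tan_increasing; lra.
- rewrite <- (tan_atan s). apply tan_increasing; try lra.
  (* The left side is the velocity normal to the shock over the speed, the right side the sound
     speed over the speed. *)
  assert (Hlt : sin (atan s - th) < sin ma).
  { rewrite sin_minus, sin_atan, cos_atan, Hsin.
    assert (Hw : 0 < sqrt (1 + s²)) by (apply sqrt_lt_R0; unfold Rsqr; nra).
    replace (s / sqrt (1 + s²) * cos th - 1 / sqrt (1 + s²) * sin th) with
      ((vx (U s) * s - vy (U s)) / (speed (U s) * sqrt (1 + s²))).
    2:{ rewrite Eu, Ev. field. lra. }
    unfold mach. assert (Hc := sound2_pos s Hs).
    assert (Hcs : 0 < sound gamma (U s)) by (now apply sqrt_lt_R0).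
    replace (1 / (speed (U s) / sound gamma (U s))) with
      (sound gamma (U s) * sqrt (1 + s²) / (speed (U s) * sqrt (1 + s²))) by (field; lra).
    apply Rmult_lt_compat_r.
    { apply Rinv_0_lt_compat. now apply Rmult_lt_0_compat. }
    unfold sound. rewrite <- sqrt_mult by (unfold Rsqr; nra).
    rewrite <- (sqrt_pow2 (vx (U s) * s - vy (U s))) by lra.
    apply sqrt_lt_1_alt. split; [nra|].
    (* In terms of [n] and [b] the comparison of the normal velocity with the sound speed is n n < n
       b. *)
    replace (vx (U s) * s - vy (U s)) with (n s / ((gamma + 1) * s)).
    2:{ rewrite vx_eq, vy_eq by exact Hs. unfold n. field. repeat split; nra. }
    rewrite sound2_eq by exact Hs. destruct (nb_pos s Hs) as [N1 [N2 N3]].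
    replace (n s * b s / ((gamma + 1) ^ 2 * s ^ 2 * (1 + s ^ 2)) * (1 + s²)) with
      (n s * b s / ((gamma + 1) * s) ^ 2) by (unfold Rsqr; field; repeat split; nra).
    replace ((n s / ((gamma + 1) * s)) ^ 2) with (n s * n s / ((gamma + 1) * s) ^ 2)
      by (field; repeat split; nra).
    apply Rmult_lt_compat_r; [|nra].
    apply Rinv_0_lt_compat. apply pow_lt. apply Rmult_lt_0_compat; lra. }
  destruct (Rlt_dec (atan s - th) ma) as [H|H]; [lra|].
  exfalso. assert (sin ma <= sin (atan s - th)); [|lra].
  destruct (Rle_lt_or_eq_dec ma (atan s - th)) as [H'|H']; [lra| |rewrite H'; lra].
  (* Beyond pi/2 the sine is no longer increasing; that case is excluded by th > 0, which holds
     because v > 0 behind the shock. *)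
  left. destruct (Rle_dec (atan s - th) (PI / 2)) as [H2|H2]; [apply sin_increasing_1; lra|].
  exfalso.
  assert (K := sin_gt_0 th). assert (0 < th); [|lra].
  unfold th, flow_angle. rewrite <- atan_0. apply atan_increasing. now apply Rdiv_lt_0_compat.
Qed.

(* (gamma p / rho^gamma)^(1/(gamma-1)): an increasing function of the entropy. *)
Definition entropy_factor (s : R) : R :=
  Rpower (csq gamma total_enthalpy (mach gamma (U s))) (/ (gamma - 1)) / rho (U s).

Lemma entropy_factor_eq (s : R) : supersonic_normal s -> entropy_factor s =
  Rpower (n s * b s / ((gamma + 1) ^ 2 * s ^ 2 * (1 + s ^ 2))) (/ (gamma - 1))
    * (n s / (rho_inf * ((gamma + 1) * s ^ 2))).
Proof.
intros Hs. unfold entropy_factor. rewrite csq_shock, sound2_eq, rho_eq by exact Hs.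
destruct (nb_pos s Hs) as [H1 _]. destruct Hs as [Hs _]. field. repeat split; nra.
Qed.

Lemma entropy_factor_pos (s : R) : supersonic_normal s -> 0 < entropy_factor s.
Proof.
intros Hs. destruct (state_pos s Hs) as [H1 _].
apply Rdiv_lt_0_compat; [apply exp_pos|exact H1].
Qed.

Definition entropy_slope (s : R) : R := entropy_factor s *
  (4 * gamma * (s ^ 2 - e * (1 + s ^ 2)) ^ 2 / (n s * b s * s * (1 + s ^ 2))).

(** Logarithmic differentiation, with [L] the logarithm of the factor. The terms combine into the
    square of s^2 - e (1 + s^2), whence the monotonicity; the square reflects that the entropy jump
    of a weak shock is of third order in its strength. *)
Lemma is_derive_entropy_factor (s : R) : supersonic_normal s ->
  is_derive entropy_factor s (entropy_slope s).
Proof.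
intros Hs.
set (c0 := - ln ((gamma + 1) ^ 2) / (gamma - 1) - ln (rho_inf * (gamma + 1))).
set (L := fun s => (ln (n s) + ln (b s) - 2 * ln s - ln (1 + s ^ 2)) / (gamma - 1)
  + ln (n s) - 2 * ln s + c0).
assert (EL : forall z, supersonic_normal z -> exp (L z) = entropy_factor z).
{ intros z Hz. rewrite entropy_factor_eq by exact Hz. destruct (nb_pos z Hz) as [H1 [H2 _]].
  destruct Hz as [Hz _]. assert (Hz2 : 0 < z ^ 2) by (now apply pow_lt).
  assert (Hg2 : 0 < (gamma + 1) ^ 2) by (apply pow_lt; lra).
  assert (Hr : 0 < rho_inf * (gamma + 1)) by (apply Rmult_lt_0_compat; lra).
  assert (Hn : 0 < n z / (rho_inf * ((gamma + 1) * z ^ 2))).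
  { apply Rdiv_lt_0_compat; [exact H1|]. rewrite <- Rmult_assoc. now apply Rmult_lt_0_compat. }
  rewrite <- (exp_ln _ Hn) at 1. unfold Rpower. rewrite <- exp_plus. f_equal.
  rewrite <- Rmult_assoc.
  rewrite !ln_div, !ln_mult; try assumption; try lra;
    try (repeat apply Rmult_lt_0_compat; assumption || lra).
  replace (ln (z ^ 2)) with (2 * ln z) by (rewrite ln_pow by exact Hz; simpl INR; ring).
  unfold L, c0. rewrite ln_mult by lra. field. lra. }
apply (is_derive_ext_loc (fun s => exp (L s))).
{ generalize (supersonic_open s Hs). apply filter_imp. exact EL. }
unfold entropy_slope. rewrite <- EL by exact Hs. rewrite Rmult_comm.
destruct (nb_pos s Hs) as [H1 [H2 _]]. destruct Hs as [Hs _].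
assert (Hs3 : 0 < 1 + s ^ 2) by nra.
rewrite Rmult_comm. apply (is_derive_comp_R exp L).
- apply is_derive_Reals, derivable_pt_lim_exp.
- unfold L. clearbody c0. clear EL L. unfold n, b in *.
  auto_derive; [simpl in *; repeat split; lra|]. simpl in *. field. repeat split; lra.
Qed.

Lemma entropy_factor_slope_nonneg (s : R) : supersonic_normal s -> 0 <= entropy_slope s.
Proof.
intros Hs. destruct (nb_pos s Hs) as [H1 [H2 _]]. assert (HK := entropy_factor_pos s Hs).
destruct Hs as [Hs _]. unfold entropy_slope. apply Rmult_le_pos; [lra|].
apply Rmult_le_pos.
- apply Rmult_le_pos; [lra|apply pow2_ge_0].
- left. apply Rinv_0_lt_compat. assert (0 < 1 + s ^ 2) by nra.
  repeat apply Rmult_lt_0_compat; assumption.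
Qed.

Lemma entropy_slope_cont (s : R) : supersonic_normal s -> continuity_pt entropy_slope s.
Proof.
intros Hs. destruct (nb_pos s Hs) as [H1 [H2 _]].
apply (continuity_pt_mult entropy_factor (fun s =>
  4 * gamma * (s ^ 2 - e * (1 + s ^ 2)) ^ 2 / (n s * b s * s * (1 + s ^ 2)))).
- exact (is_derive_continuity_pt _ _ _ (is_derive_entropy_factor s Hs)).
- destruct Hs as [Hs _]. unfold n, b in *. assert (0 < 1 + s ^ 2) by nra.
  apply continuity_pt_div; [reg|reg|].
  apply Rgt_not_eq. repeat apply Rmult_lt_0_compat; assumption.
Qed.

End ShockPolar.

(** * Functions of class C1 on a planar open set *)

Definition open_2d (D : R -> R -> Prop) : Prop := forall x y, D x y ->
  exists d, 0 < d /\ forall u v, Rabs (u - x) < d -> Rabs (v - y) < d -> D u v.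

(** The partial derivatives are explicit functions rather than [Derive], and continuity of [w] is
    carried along, so that sums, products and compositions need no locality argument. [C1_of_C1_in]
    passes to [C1_in] on open sets. *)
Definition C1_with (D : R -> R -> Prop) (w wx wy : R -> R -> R) : Prop :=
  forall x y, D x y -> continuity_2d_pt w x y /\
    is_derive (fun t => w t y) x (wx x y) /\ is_derive (fun t => w x t) y (wy x y) /\
    continuity_2d_pt wx x y /\ continuity_2d_pt wy x y.

Definition C1_of (D : R -> R -> Prop) (w : R -> R -> R) : Prop := exists wx wy, C1_with D w wx wy.

Lemma open_2d_locally (D Q : R -> R -> Prop) (x y : R) :
  open_2d D -> D x y -> (forall u v, D u v -> Q u v) -> locally_2d Q x y.
Proof.
intros HD H HQ. destruct (HD x y H) as [d [Hd Hbox]].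
exists (mkposreal d Hd). intros u v Hu Hv. apply HQ. now apply Hbox.
Qed.

Lemma open_2d_fst (D : R -> R -> Prop) (x y : R) (Q : R -> Prop) :
  open_2d D -> D x y -> (forall u, D u y -> Q u) -> locally x Q.
Proof.
intros HD H HQ. destruct (HD x y H) as [d [Hd Hbox]].
exists (mkposreal d Hd). intros u Hu. apply HQ, Hbox; [exact Hu|].
rewrite Rminus_diag, Rabs_R0. exact Hd.
Qed.

Lemma open_2d_snd (D : R -> R -> Prop) (x y : R) (Q : R -> Prop) :
  open_2d D -> D x y -> (forall v, D x v -> Q v) -> locally y Q.
Proof.
intros HD H HQ. destruct (HD x y H) as [d [Hd Hbox]].
exists (mkposreal d Hd). intros v Hv. apply HQ, Hbox; [|exact Hv].
rewrite Rminus_diag, Rabs_R0. exact Hd.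
Qed.

Lemma C1_of_C1_in (D : R -> R -> Prop) (w : R -> R -> R) : open_2d D -> C1_of D w -> C1_in D w.
Proof.
intros HD [wx [wy H]] x y Hxy. destruct (H x y Hxy) as [_ [H1 [H2 [H3 H4]]]].
split; [now exists (wx x y)|]. split; [now exists (wy x y)|]. split.
- apply (continuity_2d_pt_ext_loc wx); [|exact H3].
  apply (open_2d_locally D); [exact HD|exact Hxy|]. intros u v Huv.
  symmetry. apply is_derive_unique. now apply H.
- apply (continuity_2d_pt_ext_loc wy); [|exact H4].
  apply (open_2d_locally D); [exact HD|exact Hxy|]. intros u v Huv.
  symmetry. apply is_derive_unique. now apply H.
Qed.

Lemma C1_of_ext (D : R -> R -> Prop) (w w' : R -> R -> R) :
  open_2d D -> (forall x y, D x y -> w x y = w' x y) -> C1_of D w -> C1_of D w'.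
Proof.
intros HD E [wx [wy H]]. exists wx, wy. intros x y Hxy.
destruct (H x y Hxy) as [H0 [H1 [H2 [H3 H4]]]].
split; [|split; [|split; [|split; assumption]]].
- apply (continuity_2d_pt_ext_loc w); [|exact H0]. now apply (open_2d_locally D).
- apply (is_derive_ext_loc (fun t => w t y)); [|exact H1].
  apply (open_2d_fst D x y); [exact HD|exact Hxy|]. intros u Hu. now apply E.
- apply (is_derive_ext_loc (fun t => w x t)); [|exact H2].
  apply (open_2d_snd D x y); [exact HD|exact Hxy|]. intros u Hu. now apply E.
Qed.

Lemma C1_of_comp (D : R -> R -> Prop) (f f' : R -> R) (w : R -> R -> R) :
  (forall x y, D x y -> is_derive f (w x y) (f' (w x y)) /\ continuity_pt f' (w x y)) ->
  C1_of D w -> C1_of D (fun x y => f (w x y)).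
Proof.
intros Hf [wx [wy H]].
exists (fun x y => f' (w x y) * wx x y), (fun x y => f' (w x y) * wy x y). intros x y Hxy.
destruct (H x y Hxy) as [H0 [H1 [H2 [H3 H4]]]]. destruct (Hf x y Hxy) as [F1 F2].
split; [|split; [|split; [|split]]].
- apply (continuity_1d_2d_pt_comp f w); [|exact H0]. exact (is_derive_continuity_pt _ _ _ F1).
- now apply (is_derive_comp_R f (fun t => w t y)).
- now apply (is_derive_comp_R f (fun t => w x t)).
- apply continuity_2d_pt_mult; [|exact H3]. now apply (continuity_1d_2d_pt_comp f' w).
- apply continuity_2d_pt_mult; [|exact H4]. now apply (continuity_1d_2d_pt_comp f' w).
Qed.

Lemma C1_of_comp2 (D : R -> R -> Prop) (F F1 F2 u v : R -> R -> R) :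
  (forall x y, is_derive (fun t => F t y) x (F1 x y)) ->
  (forall x y, is_derive (fun t => F x t) y (F2 x y)) -> cont2 F1 -> cont2 F2 ->
  C1_of D u -> C1_of D v -> C1_of D (fun x y => F (u x y) (v x y)).
Proof.
intros D1 D2 C1 C2 [ux [uy Hu]] [vx [vy Hv]].
exists (fun x y => F1 (u x y) (v x y) * ux x y + F2 (u x y) (v x y) * vx x y),
  (fun x y => F1 (u x y) (v x y) * uy x y + F2 (u x y) (v x y) * vy x y). intros x y Hxy.
destruct (Hu x y Hxy) as [U0 [U1 [U2 [U3 U4]]]]. destruct (Hv x y Hxy) as [V0 [V1 [V2 [V3 V4]]]].
assert (HF : differentiable_pt_lim F (u x y) (v x y) (F1 (u x y) (v x y)) (F2 (u x y) (v x y))).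
{ now apply C1_differentiable. }
split; [|split; [|split; [|split]]].
- apply continuity_2d_pt_comp2; try assumption. apply differentiable_continuity_pt.
  now exists (F1 (u x y) (v x y)), (F2 (u x y) (v x y)).
- apply is_derive_Reals. apply (derivable_pt_lim_comp_2d F (fun t => u t y) (fun t => v t y));
    [exact HF|now apply is_derive_Reals|now apply is_derive_Reals].
- apply is_derive_Reals. apply (derivable_pt_lim_comp_2d F (fun t => u x t) (fun t => v x t));
    [exact HF|now apply is_derive_Reals|now apply is_derive_Reals].
- apply continuity_2d_pt_plus; (apply continuity_2d_pt_mult; [|assumption]);
    apply continuity_2d_pt_comp2; try assumption; [apply C1|apply C2].
- apply continuity_2d_pt_plus; (apply continuity_2d_pt_mult; [|assumption]);
    apply continuity_2d_pt_comp2; try assumption; [apply C1|apply C2].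
Qed.

Lemma C1_of_plus (D : R -> R -> Prop) (u v : R -> R -> R) :
  C1_of D u -> C1_of D v -> C1_of D (fun x y => u x y + v x y).
Proof.
apply (C1_of_comp2 D (fun x y => x + y) (fun _ _ => 1) (fun _ _ => 1)).
- intros x y. auto_derive; [exact I|ring].
- intros x y. auto_derive; [exact I|ring].
- apply cont2_const.
- apply cont2_const.
Qed.

Lemma C1_of_minus (D : R -> R -> Prop) (u v : R -> R -> R) :
  C1_of D u -> C1_of D v -> C1_of D (fun x y => u x y - v x y).
Proof.
apply (C1_of_comp2 D (fun x y => x - y) (fun _ _ => 1) (fun _ _ => - 1)).
- intros x y. auto_derive; [exact I|ring].
- intros x y. auto_derive; [exact I|ring].
- apply cont2_const.
- apply cont2_const.
Qed.

Lemma C1_of_mult (D : R -> R -> Prop) (u v : R -> R -> R) :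
  C1_of D u -> C1_of D v -> C1_of D (fun x y => u x y * v x y).
Proof.
apply (C1_of_comp2 D (fun x y => x * y) (fun _ y => y) (fun x _ => x)).
- intros x y. auto_derive; [exact I|ring].
- intros x y. auto_derive; [exact I|ring].
- intros x y. apply continuity_2d_pt_id2.
- intros x y. apply continuity_2d_pt_id1.
Qed.

Lemma C1_of_const (D : R -> R -> Prop) (c : R) : C1_of D (fun _ _ => c).
Proof.
exists (fun _ _ => 0), (fun _ _ => 0). intros x y _.
split; [|split; [|split; [|split]]]; try apply continuity_2d_pt_const; apply @is_derive_const.
Qed.

(** * The shock trace in the phase plane *)

(** [max_over] is defined by [iota]; it satisfies its description because the maximum is attained
    and its value is unique. *)
Lemma cont_at_on_max_over (a b : R) (h : R -> R) :
  a <= b -> (forall t, a <= t <= b -> cont_at_on a b h t) ->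
  (exists t, a <= t <= b /\ h t = max_over (fun t => a <= t <= b) h) /\
  forall t, a <= t <= b -> h t <= max_over (fun t => a <= t <= b) h.
Proof.
intros Hab Hc. destruct (max_attained_on a b h Hab Hc) as [c [Hcab Hmax]].
apply (@iota_correct R_AbsRing R_CompleteNormedModule
  (fun m : R => (exists t, a <= t <= b /\ h t = m) /\ forall t, a <= t <= b -> h t <= m)).
exists (h c). split.
- split; [now exists c|exact Hmax].
- intros x [[t [Ht <-]] Hx]. apply Rle_antisym; [now apply Hx|now apply Hmax].
Qed.

Lemma cont_at_on_min_over (a b : R) (h : R -> R) :
  a <= b -> (forall t, a <= t <= b -> cont_at_on a b h t) ->
  (exists t, a <= t <= b /\ h t = min_over (fun t => a <= t <= b) h) /\
  forall t, a <= t <= b -> min_over (fun t => a <= t <= b) h <= h t.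
Proof.
intros Hab Hc. destruct (max_attained_on a b (fun t => - h t) Hab) as [c [Hcab Hmax]].
{ intros t Ht. apply (cont_at_on_comp_pt a b Ropp); [|now apply Hc].
  apply derivable_continuous_pt. reg. }
apply (@iota_correct R_AbsRing R_CompleteNormedModule
  (fun m : R => (exists t, a <= t <= b /\ h t = m) /\ forall t, a <= t <= b -> m <= h t)).
assert (Hmin : forall t, a <= t <= b -> h c <= h t).
{ intros t Ht. specialize (Hmax t Ht). simpl in Hmax. lra. }
exists (h c). split.
- split; [now exists c|exact Hmin].
- intros x [[t [Ht <-]] Hx]. apply Rle_antisym; [now apply Hmin|now apply Hx].
Qed.

Lemma cont_at_on_interior (a b : R) (f : R -> R) (x : R) :
  a < x < b -> cont_at_on a b f x -> continuity_pt f x.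
Proof.
intros Hx H eps Heps. destruct (H eps Heps) as [d [Hd H']].
exists (Rmin d (Rmin (x - a) (b - x))). split; [repeat apply Rmin_glb_lt; lra|].
intros y [_ Hy].
assert (Hy' : Rabs (y - x) < Rmin d (Rmin (x - a) (b - x))) by exact Hy.
assert (M1 := Rmin_l d (Rmin (x - a) (b - x))). assert (M2 := Rmin_r d (Rmin (x - a) (b - x))).
assert (M3 := Rmin_l (x - a) (b - x)). assert (M4 := Rmin_r (x - a) (b - x)).
apply H'; [|lra]. apply Rabs_def2 in Hy'. lra.
Qed.

Lemma cont_at_on_mult (a b : R) (f g : R -> R) (x : R) :
  cont_at_on a b f x -> cont_at_on a b g x -> cont_at_on a b (fun t => f t * g t) x.
Proof.
intros Hf Hg. apply (cont_at_on_comp_2d a b Rmult f g x); [|exact Hf|exact Hg].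
apply continuity_2d_pt_mult; [apply continuity_2d_pt_id1|apply continuity_2d_pt_id2].
Qed.

Section ShockData.

Context (gamma rho_inf p_inf : R) (Hgamma : 1 < gamma < 3) (Hrho : 0 < rho_inf) (Hp : 0 < p_inf).
Context (HM : 1 < Minf2 gamma rho_inf p_inf).
Context (X : R) (phi : R -> R) (HX : 0 < X) (Hphi : C2_on 0 X phi) (Hphi0 : phi 0 = 0).
Context (Hi : forall x, 0 <= x <= X ->
     0 < d2phi X phi x /\
     I_sup gamma rho_inf p_inf (dphi X phi x) /\
     poly_D gamma rho_inf p_inf (dphi X phi x) < 0).
Context (Hii : forall r s, phase_region gamma rho_inf p_inf X phi r s ->
     (exists m, 1 < m /\ nu gamma m = (r - s) / 2) /\
     - (PI / 2) < theta_ph r s - theta_m_ph gamma r s /\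
     theta_ph r s - theta_m_ph gamma r s
       < theta_ph r s + theta_m_ph gamma r s /\
     theta_ph r s + theta_m_ph gamma r s < PI / 2).
Context (Hbounds : forall x, 0 <= x <= X ->
     B_mass gamma rho_inf p_inf X phi x < B_nd gamma rho_inf p_inf X phi x).

Let s (x : R) : R := dphi X phi x.
Let s' (x : R) : R := d2phi X phi x.
Let Rs : R -> R := R_sh gamma rho_inf p_inf X phi.
Let Ss : R -> R := S_sh gamma rho_inf p_inf X phi.
Let Us : R -> state := U_sh gamma rho_inf p_inf X phi.
Let H0 : R := total_enthalpy gamma rho_inf p_inf.
Let Hg1 : 1 < gamma := proj1 Hgamma.

Lemma H0_pos : 0 < H0.
Proof. apply total_enthalpy_pos; assumption. Qed.

Lemma phi_derive (x : R) : 0 <= x <= X -> is_derive_on 0 X phi x (s x).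
Proof. intros Hx. apply Derive_on_correct; [exact HX|exact Hx|]. now apply Hphi. Qed.

Lemma s_derive (x : R) : 0 <= x <= X -> is_derive_on 0 X s x (s' x).
Proof. intros Hx. apply Derive_on_correct; [exact HX|exact Hx|]. now apply Hphi. Qed.

Lemma s_cont (x : R) : 0 <= x <= X -> cont_at_on 0 X s x.
Proof. intros Hx. apply (is_derive_on_cont _ _ _ _ _ Hx (s_derive x Hx)). Qed.

Lemma s'_cont (x : R) : 0 <= x <= X -> cont_at_on 0 X s' x.
Proof. apply continuous_on_iff. apply Hphi. Qed.

Lemma phi_cont (x : R) : 0 <= x <= X -> cont_at_on 0 X phi x.
Proof. intros Hx. apply (is_derive_on_cont _ _ _ _ _ Hx (phi_derive x Hx)). Qed.

Lemma s_supersonic (x : R) : 0 <= x <= X -> supersonic_normal gamma rho_inf p_inf (s x).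
Proof.
intros Hx. destruct (Hi x Hx) as [_ [[H _] _]]. apply s_minus_supersonic; assumption.
Qed.

Lemma s_P0 (x : R) : 0 <= x <= X -> 0 < poly_P0 gamma rho_inf p_inf (s x).
Proof.
intros Hx. destruct (Hi x Hx) as [_ [_ H]].
apply poly_P0_pos; try assumption. now apply s_supersonic.
Qed.

Lemma s_pos (x : R) : 0 <= x <= X -> 0 < s x.
Proof. intros Hx. apply (s_supersonic x Hx). Qed.

(** [R1] and [S1] are the derivatives of [R_sh] and [S_sh] by the chain rule through the slope.
    Convexity of the shock and |slope_th| < slope_nu give R1 < 0 < S1. *)
Definition R1 (x : R) : R :=
  (slope_th gamma rho_inf p_inf (s x) - slope_nu gamma rho_inf p_inf (s x)) * s' x.
Definition S1 (x : R) : R :=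
  (slope_th gamma rho_inf p_inf (s x) + slope_nu gamma rho_inf p_inf (s x)) * s' x.

Lemma R1_neg (x : R) : 0 <= x <= X -> R1 x < 0.
Proof.
intros Hx. destruct (Hi x Hx) as [H1 [_ H2]]. fold (s x) in H2. fold (s' x) in H1.
assert (K := slope_th_lt_nu gamma rho_inf p_inf Hg1 HM (s x) (s_supersonic x Hx) H2).
apply Rabs_def2 in K. unfold R1. nra.
Qed.

Lemma S1_pos (x : R) : 0 <= x <= X -> 0 < S1 x.
Proof.
intros Hx. destruct (Hi x Hx) as [H1 [_ H2]]. fold (s x) in H2. fold (s' x) in H1.
assert (K := slope_th_lt_nu gamma rho_inf p_inf Hg1 HM (s x) (s_supersonic x Hx) H2).
apply Rabs_def2 in K. unfold S1. nra.
Qed.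

Lemma is_derive_on_comp_pt (a b : R) (f u : R -> R) (x l l' : R) :
  a <= x <= b -> is_derive f (u x) l -> is_derive_on a b u x l' ->
  is_derive_on a b (fun t => f (u t)) x (l * l').
Proof.
intros Hx Hf Hu.
assert (D := is_derive_on_comp_2d a b x (fun p _ => f p) u (fun _ => 0) l 0 l' 0 Hx).
replace (l * l') with (l * l' + 0 * 0) by ring. apply D.
- apply (differentiable_pt_lim_proj1_0 f). now apply is_derive_Reals.
- exact Hu.
- now apply is_derive_on_const.
Qed.

Lemma R_derive (x : R) : 0 <= x <= X -> is_derive_on 0 X Rs x (R1 x).
Proof.
intros Hx. apply (is_derive_on_comp_pt 0 X (fun s => inv_R gamma (post_shock gamma rho_inf p_inf s)) s).
- exact Hx.
- apply is_derive_inv_R; try assumption; [now apply s_supersonic|now apply s_P0].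
- now apply s_derive.
Qed.

Lemma S_derive (x : R) : 0 <= x <= X -> is_derive_on 0 X Ss x (S1 x).
Proof.
intros Hx. apply (is_derive_on_comp_pt 0 X (fun s => inv_S gamma (post_shock gamma rho_inf p_inf s)) s).
- exact Hx.
- apply is_derive_inv_S; try assumption; [now apply s_supersonic|now apply s_P0].
- now apply s_derive.
Qed.

Lemma R_cont (x : R) : 0 <= x <= X -> cont_at_on 0 X Rs x.
Proof. intros Hx. apply (is_derive_on_cont _ _ _ _ _ Hx (R_derive x Hx)). Qed.

Lemma S_cont (x : R) : 0 <= x <= X -> cont_at_on 0 X Ss x.
Proof. intros Hx. apply (is_derive_on_cont _ _ _ _ _ Hx (S_derive x Hx)). Qed.

Lemma R1_cont (x : R) : 0 <= x <= X -> cont_at_on 0 X R1 x.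
Proof.
intros Hx. apply cont_at_on_mult; [|now apply s'_cont].
apply (cont_at_on_comp_pt 0 X (fun s => slope_th gamma rho_inf p_inf s - slope_nu gamma rho_inf p_inf s) s);
  [|now apply s_cont].
apply continuity_pt_minus; [apply slope_th_cont|apply slope_nu_cont]; try assumption;
  try now apply s_supersonic. now apply s_P0.
Qed.

Lemma S1_cont (x : R) : 0 <= x <= X -> cont_at_on 0 X S1 x.
Proof.
intros Hx. apply cont_at_on_mult; [|now apply s'_cont].
apply (cont_at_on_comp_pt 0 X (fun s => slope_th gamma rho_inf p_inf s + slope_nu gamma rho_inf p_inf s) s);
  [|now apply s_cont].
apply continuity_pt_plus; [apply slope_th_cont|apply slope_nu_cont]; try assumption;
  try now apply s_supersonic. now apply s_P0.
Qed.

Lemma S_incr (x y : R) : 0 <= x < y -> y <= X -> Ss x < Ss y.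
Proof.
intros H1 H2. apply incr_on; [lra| |].
- intros t Ht. apply (cont_at_on_subinterval 0 X); try lra. apply S_cont. lra.
- intros t Ht. exists (S1 t). split; [|apply S1_pos; lra].
  apply (is_derive_on_interior 0 X); [lra|]. apply S_derive. lra.
Qed.

Lemma R_decr (x y : R) : 0 <= x < y -> y <= X -> Rs y < Rs x.
Proof.
intros H1 H2. apply Ropp_lt_cancel. apply (incr_on x y (fun t => - Rs t)); [lra| |].
- intros t Ht. apply (cont_at_on_comp_pt x y Ropp); [apply derivable_continuous_pt; reg|].
  apply (cont_at_on_subinterval 0 X); try lra. apply R_cont. lra.
- intros t Ht. exists (- R1 t). assert (K := R1_neg t ltac:(lra)). split; [|lra].
  apply (is_derive_opp Rs). apply (is_derive_on_interior 0 X); [lra|]. apply R_derive. lra.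
Qed.

Lemma S_incr_le (x y : R) : 0 <= x <= y -> y <= X -> Ss x <= Ss y.
Proof.
intros H1 H2. destruct (Req_dec x y) as [->|Hne]; [lra|]. left. apply S_incr; lra.
Qed.

Lemma R_decr_le (x y : R) : 0 <= x <= y -> y <= X -> Rs y <= Rs x.
Proof.
intros H1 H2. destruct (Req_dec x y) as [->|Hne]; [lra|]. left. apply R_decr; lra.
Qed.

(** Strict monotonicity of [R_sh] determines the abscissa from its R-value, so the shock trace is a
    graph over R. *)
Lemma chi_eq (x : R) : 0 <= x <= X -> chi gamma rho_inf p_inf X phi (Rs x) = Ss x.
Proof.
intros Hx. unfold chi. apply (@iota_unique R_AbsRing R_CompleteNormedModule).
- intros y [z [Hz [E <-]]]. fold Rs in E. fold Ss.
  destruct (Rtotal_order x z) as [H|[->|H]]; [|reflexivity|].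
  + assert (K := R_decr x z). lra.
  + assert (K := R_decr z x). lra.
- now exists x.
Qed.

Lemma phase_at (x t : R) : 0 <= x <= X -> Ss x <= t <= Ss X ->
  phase_region gamma rho_inf p_inf X phi (Rs x) t.
Proof.
intros Hx Ht. split.
- split; [apply R_decr_le; lra|apply R_decr_le; lra].
- rewrite chi_eq by exact Hx. exact Ht.
Qed.

Lemma good_at (x t : R) : 0 <= x <= X -> Ss x <= t <= Ss X -> good_phase gamma (Rs x) t.
Proof.
intros Hx Ht. destruct (Hii _ _ (phase_at x t Hx Ht)) as [H1 [H2 [_ H3]]].
split; [exact H1|]. split; assumption.
Qed.

(** In the coordinates (R_sh x, S_sh y) the phase region is the triangle 0 <= x <= y <= X, because
    chi (R_sh x) = S_sh x <= S_sh y <= S_max. *)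
Lemma good_xy (x y : R) : 0 <= x <= y -> y <= X -> good_phase gamma (Rs x) (Ss y).
Proof.
intros H1 H2. apply good_at; [lra|]. split; apply S_incr_le; lra.
Qed.

(** Transport of a phase-plane function to characteristic coordinates, extended from the triangle to
    the plane by the retraction; its argument is always a good phase point. *)
Definition pull (F : R -> R -> R) (x y : R) : R := F (Rs (retr1 X x y)) (Ss (retr2 X x y)).

Lemma pull_eq (F : R -> R -> R) (x y : R) : 0 <= x <= y -> y <= X -> pull F x y = F (Rs x) (Ss y).
Proof. intros H1 H2. unfold pull. destruct (retr_id X x y H1 H2) as [-> ->]. reflexivity. Qed.

Lemma cont2_clamped (f : R -> R) (r : R -> R -> R) :
  (forall x, 0 <= x <= X -> cont_at_on 0 X f x) -> cont2 r ->
  (forall x y, 0 <= r x y <= X) -> cont2 (fun x y => f (r x y)).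
Proof.
intros Hf Hr Hrange x y.
apply (continuity_2d_pt_ext (fun x y => f (clamp 0 X (r x y)))).
- intros u v. now rewrite clamp_id.
- apply (continuity_1d_2d_pt_comp (fun t => f (clamp 0 X t)) r); [|apply Hr].
  apply cont_at_on_clamp; [lra|exact Hf].
Qed.

Lemma cont2_retr1_comp (f : R -> R) :
  (forall x, 0 <= x <= X -> cont_at_on 0 X f x) -> cont2 (fun x y => f (retr1 X x y)).
Proof.
intros Hf. apply cont2_clamped; [exact Hf|apply cont2_retr1|].
intros x y. destruct (retr_range X x y); lra.
Qed.

Lemma cont2_retr2_comp (f : R -> R) :
  (forall x, 0 <= x <= X -> cont_at_on 0 X f x) -> cont2 (fun x y => f (retr2 X x y)).
Proof.
intros Hf. apply cont2_clamped; [exact Hf|apply cont2_retr2|].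
intros x y. destruct (retr_range X x y); lra.
Qed.

Lemma good_pull (x y : R) : good_phase gamma (Rs (retr1 X x y)) (Ss (retr2 X x y)).
Proof. destruct (retr_range X x y ltac:(lra)) as [H1 H2]. apply good_xy; lra. Qed.

Lemma cont2_pull (F : R -> R -> R) :
  (forall r t, good_phase gamma r t -> continuity_2d_pt F r t) -> cont2 (pull F).
Proof.
intros HF x y.
apply (continuity_2d_pt_comp2 F (fun x y => Rs (retr1 X x y)) (fun x y => Ss (retr2 X x y))).
- apply HF, good_pull.
- apply (cont2_retr1_comp Rs R_cont).
- apply (cont2_retr2_comp Ss S_cont).
Qed.

Lemma pull_derive_eta (F : R -> R -> R) (x y l : R) : 0 <= x < y -> y < X ->
  is_derive (fun t => F (Rs x) t) (Ss y) l -> is_derive (fun t => pull F x t) y (l * S1 y).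
Proof.
intros H1 H2 HF.
apply (is_derive_ext_loc (fun t => F (Rs x) (Ss t))).
- apply (locally_interior x X); [lra|]. intros t Ht. rewrite pull_eq by lra. reflexivity.
- apply (is_derive_comp_R (fun t => F (Rs x) t) Ss); [exact HF|].
  apply (is_derive_on_interior 0 X); [lra|]. apply S_derive. lra.
Qed.

Lemma pull_derive_xi (F : R -> R -> R) (x y l : R) : 0 < x < y -> y <= X ->
  is_derive (fun t => F t (Ss y)) (Rs x) l -> is_derive (fun t => pull F t y) x (l * R1 x).
Proof.
intros H1 H2 HF.
apply (is_derive_ext_loc (fun t => F (Rs t) (Ss y))).
- apply (locally_interior 0 y); [lra|]. intros t Ht. rewrite pull_eq by lra. reflexivity.
- apply (is_derive_comp_R (fun t => F t (Ss y)) Rs); [exact HF|].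
  apply (is_derive_on_interior 0 X); [lra|]. apply R_derive. lra.
Qed.

(** ** Coefficients and data of the characteristic problem *)

Definition h_lamp : R -> R -> R := pull (lp_ph gamma).
Definition h_lamm : R -> R -> R := pull (lm_ph gamma).
Definition h_Ap : R -> R -> R := pull (flux_p gamma H0).
Definition h_Am : R -> R -> R := pull (flux_m gamma H0).
(** Equating the mixed derivatives of y, where y_xi = lamp P and y_eta = lamm Q, gives (lamp - lamm)
    P_eta = (d_xi lamm) Q - (d_eta lamp) P. Division by lamp - lamm leaves the coefficients a R' and
    - b S'; as R' < 0, the sign chosen here makes [h_ta] nonnegative. *)
Definition h_ta (x y : R) : R := - pull (ca gamma) x y * R1 (retr1 X x y).
Definition h_tb (x y : R) : R := pull (cb gamma) x y * S1 (retr2 X x y).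
(** [h_P0] and [h_Q0] solve P + Q = 1 and lamp P + lamm Q = phi' on the diagonal: the shock is
    parametrised by its abscissa and has slope phi'. *)
Definition h_P0 (x : R) : R := (s (clamp 0 X x) - h_lamm x x) / (h_lamp x x - h_lamm x x).
Definition h_Q0 (x : R) : R := (h_lamp x x - s (clamp 0 X x)) / (h_lamp x x - h_lamm x x).

Lemma cont2_lamp : cont2 h_lamp.
Proof. apply cont2_pull. intros r t Hg. now apply cont_lp. Qed.
Lemma cont2_lamm : cont2 h_lamm.
Proof. apply cont2_pull. intros r t Hg. now apply cont_lm. Qed.
Lemma cont2_Ap : cont2 h_Ap.
Proof. apply cont2_pull. intros r t Hg. apply cont_flux_p; [exact Hg1|apply H0_pos|exact Hg]. Qed.
Lemma cont2_Am : cont2 h_Am.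
Proof. apply cont2_pull. intros r t Hg. apply cont_flux_m; [exact Hg1|apply H0_pos|exact Hg]. Qed.
Lemma cont2_ta : cont2 h_ta.
Proof.
apply cont2_mult; [apply cont2_opp, cont2_pull; intros r t Hg; now apply cont_ca|].
apply (cont2_retr1_comp R1 R1_cont).
Qed.
Lemma cont2_tb : cont2 h_tb.
Proof.
apply cont2_mult; [apply cont2_pull; intros r t Hg; now apply cont_cb|].
apply (cont2_retr2_comp S1 S1_cont).
Qed.

Lemma cont_diag (F : R -> R -> R) (x : R) : cont2 F -> continuity_pt (fun t => F t t) x.
Proof.
intros HF. apply (continuity_2d_pt_fst_pt (fun u v => F u u) x 0).
apply (continuity_2d_pt_comp2 F (fun u _ => u) (fun u _ => u));
[apply HF|apply continuity_2d_pt_id1|apply continuity_2d_pt_id1].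
Qed.

Lemma lam_lt_h (x y : R) : h_lamm x y < h_lamp x y.
Proof. apply lam_lt_ph; [exact Hg1|apply good_pull]. Qed.

Lemma s_clamp_cont (x : R) : continuity_pt (fun t => s (clamp 0 X t)) x.
Proof. apply cont_at_on_clamp; [lra|exact s_cont]. Qed.

Lemma P0_cont (x : R) : continuity_pt h_P0 x.
Proof.
assert (H := lam_lt_h x x). apply continuity_pt_div; [apply continuity_pt_minus|apply continuity_pt_minus|].
- apply s_clamp_cont.
- apply (cont_diag h_lamm), cont2_lamm.
- apply (cont_diag h_lamp), cont2_lamp.
- apply (cont_diag h_lamm), cont2_lamm.
- lra.
Qed.

Lemma Q0_cont (x : R) : continuity_pt h_Q0 x.
Proof.
assert (H := lam_lt_h x x). apply continuity_pt_div; [apply continuity_pt_minus|apply continuity_pt_minus|].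
- apply (cont_diag h_lamp), cont2_lamp.
- apply s_clamp_cont.
- apply (cont_diag h_lamp), cont2_lamp.
- apply (cont_diag h_lamm), cont2_lamm.
- lra.
Qed.

Lemma P0_Q0 (x : R) : h_P0 x + h_Q0 x = 1.
Proof. assert (H := lam_lt_h x x). unfold h_P0, h_Q0. field. lra. Qed.

Lemma lam_P0_Q0 (x : R) : h_lamp x x * h_P0 x + h_lamm x x * h_Q0 x = s (clamp 0 X x).
Proof. assert (H := lam_lt_h x x). unfold h_P0, h_Q0. field. lra. Qed.

Lemma mach_sh_gt_1 (x : R) : 0 <= x <= X -> 1 < mach gamma (Us x).
Proof. intros Hx. apply mach_gt_1; try assumption; [now apply s_supersonic|now apply s_P0]. Qed.

Lemma trace_invariants (x : R) : 0 <= x <= X ->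
  theta_ph (Rs x) (Ss x) = flow_angle (Us x) /\
  (Rs x - Ss x) / 2 = nu gamma (mach gamma (Us x)) /\
  nu_inv gamma ((Rs x - Ss x) / 2) = mach gamma (Us x).
Proof.
intros Hx. assert (E : (Rs x - Ss x) / 2 = nu gamma (mach gamma (Us x))).
{ unfold Rs, Ss, R_sh, S_sh, inv_R, inv_S. fold (Us x). field. }
split; [|split; [exact E|]].
- unfold theta_ph, Rs, Ss, R_sh, S_sh, inv_R, inv_S. fold (Us x). field.
- rewrite E. apply nu_inv_nu; [exact Hg1|now apply mach_sh_gt_1].
Qed.

Lemma shock_slope_between (x : R) : 0 <= x <= X ->
  lm_ph gamma (Rs x) (Ss x) < s x < lp_ph gamma (Rs x) (Ss x).
Proof.
intros Hx. destruct (trace_invariants x Hx) as [E1 [E2 E3]].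
destruct (good_xy x x) as [_ [H1 H2]]; try lra. unfold mu in H1, H2.
unfold lm_ph, lp_ph, theta_m_ph, mach_ph. rewrite E1, E3 in *.
apply shock_between_characteristics; try assumption; [now apply s_supersonic|now apply s_P0].
Qed.

Lemma P0_eq (x : R) : 0 <= x <= X -> h_P0 x =
  (s x - lm_ph gamma (Rs x) (Ss x)) / (lp_ph gamma (Rs x) (Ss x) - lm_ph gamma (Rs x) (Ss x)).
Proof.
intros Hx. unfold h_P0, h_lamm, h_lamp. rewrite !pull_eq by lra. now rewrite clamp_id.
Qed.

Lemma P0_Q0_pos (x : R) : 0 <= x <= X -> 0 < h_P0 x /\ 0 < h_Q0 x.
Proof.
intros Hx. assert (H := shock_slope_between x Hx).
unfold h_P0, h_Q0, h_lamm, h_lamp. rewrite !pull_eq by lra. rewrite clamp_id by exact Hx.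
split; apply Rdiv_lt_0_compat; lra.
Qed.

Lemma ta_nonneg_h (x y : R) : 0 <= h_ta x y.
Proof.
assert (H1 := ca_pos gamma Hg1 _ _ (good_pull x y)).
destruct (retr_range X x y ltac:(lra)) as [H2 H3].
assert (H4 := R1_neg (retr1 X x y) ltac:(lra)). unfold h_ta, pull. nra.
Qed.

Lemma tb_nonneg_h (x y : R) : 0 <= h_tb x y.
Proof.
assert (H1 := cb_pos gamma Hg1 _ _ (good_pull x y)).
destruct (retr_range X x y ltac:(lra)) as [H2 H3].
assert (H4 := S1_pos (retr2 X x y) ltac:(lra)). unfold h_tb, pull. nra.
Qed.

Lemma lamp_eta (x y : R) : 0 <= x < y -> y < X ->
  is_derive (fun t => h_lamp x t) y (h_tb x y * (h_lamp x y - h_lamm x y)).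
Proof.
intros H1 H2. unfold h_tb, h_lamp, h_lamm. rewrite !pull_eq by lra.
destruct (retr_id X x y) as [_ ->]; try lra.
replace (cb gamma (Rs x) (Ss y) * S1 y * (lp_ph gamma (Rs x) (Ss y) - lm_ph gamma (Rs x) (Ss y)))
  with (cb gamma (Rs x) (Ss y) * (lp_ph gamma (Rs x) (Ss y) - lm_ph gamma (Rs x) (Ss y)) * S1 y) by ring.
apply pull_derive_eta; try lra. apply is_derive_lp_S; [exact Hg1|apply good_xy; lra].
Qed.

Lemma lamm_xi (x y : R) : 0 < x < y -> y <= X ->
  is_derive (fun t => h_lamm t y) x (- h_ta x y * (h_lamp x y - h_lamm x y)).
Proof.
intros H1 H2. unfold h_ta, h_lamp, h_lamm. rewrite !pull_eq by lra.
destruct (retr_id X x y) as [-> _]; try lra.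
replace (- (- ca gamma (Rs x) (Ss y) * R1 x) * (lp_ph gamma (Rs x) (Ss y) - lm_ph gamma (Rs x) (Ss y)))
  with (ca gamma (Rs x) (Ss y) * (lp_ph gamma (Rs x) (Ss y) - lm_ph gamma (Rs x) (Ss y)) * R1 x) by ring.
apply pull_derive_xi; try lra. apply is_derive_lm_R; [exact Hg1|apply good_xy; lra].
Qed.

(** The double sign matches the shape required by [char_potential], in which the coefficient Km of
    the stream function is [- h_Am]. *)
Lemma Ap_eta (x y : R) : 0 <= x < y -> y < X ->
  is_derive (fun t => h_Ap x t) y (h_tb x y * (h_Ap x y - - h_Am x y)).
Proof.
intros H1 H2. unfold h_tb, h_Ap, h_Am. rewrite !pull_eq by lra.
destruct (retr_id X x y) as [_ ->]; try lra.
replace (cb gamma (Rs x) (Ss y) * S1 y * (flux_p gamma H0 (Rs x) (Ss y) - - flux_m gamma H0 (Rs x) (Ss y)))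
  with (cb gamma (Rs x) (Ss y) * (flux_p gamma H0 (Rs x) (Ss y) + flux_m gamma H0 (Rs x) (Ss y)) * S1 y) by ring.
apply pull_derive_eta; try lra. apply is_derive_flux_p_S; [exact Hg1|apply H0_pos|apply good_xy; lra].
Qed.

Lemma Am_xi (x y : R) : 0 < x < y -> y <= X ->
  is_derive (fun t => - h_Am t y) x (- h_ta x y * (h_Ap x y - - h_Am x y)).
Proof.
intros H1 H2.
assert (D : is_derive (fun t => h_Am t y) x (h_ta x y * (h_Ap x y - - h_Am x y))).
{ unfold h_ta, h_Ap, h_Am. rewrite !pull_eq by lra.
  destruct (retr_id X x y) as [-> _]; try lra.
  replace (- ca gamma (Rs x) (Ss y) * R1 x * (flux_p gamma H0 (Rs x) (Ss y) - - flux_m gamma H0 (Rs x) (Ss y)))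
    with (- ca gamma (Rs x) (Ss y) * (flux_p gamma H0 (Rs x) (Ss y) + flux_m gamma H0 (Rs x) (Ss y)) * R1 x) by ring.
  apply pull_derive_xi; try lra. apply is_derive_flux_m_R; [exact Hg1|apply H0_pos|apply good_xy; lra]. }
replace (- h_ta x y * (h_Ap x y - - h_Am x y)) with (- (h_ta x y * (h_Ap x y - - h_Am x y))) by ring.
exact (is_derive_opp (fun t => h_Am t y) x _ D).
Qed.


(** ** The nondegeneracy bound *)

Lemma Us_angle (x : R) : 0 <= x <= X ->
  vx (Us x) = speed (Us x) * cos (flow_angle (Us x)) /\
  vy (Us x) = speed (Us x) * sin (flow_angle (Us x)).
Proof. intros Hx. apply flow_angle_shock; try assumption. now apply s_supersonic. Qed.

Lemma Us_mass (x : R) : 0 <= x <= X -> rho (Us x) * (vx (Us x) * s x - vy (Us x)) = rho_inf * s x.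
Proof. intros Hx. apply mass_shock; try assumption. now apply s_supersonic. Qed.

Lemma Us_csq (x : R) : 0 <= x <= X ->
  csq gamma H0 (mach gamma (Us x)) = gamma * prs (Us x) / rho (Us x).
Proof. intros Hx. apply csq_shock; try assumption. now apply s_supersonic. Qed.

Lemma Us_pos (x : R) : 0 <= x <= X ->
  0 < rho (Us x) /\ 0 < prs (Us x) /\ 0 < vx (Us x) /\ 0 < vy (Us x).
Proof. intros Hx. apply state_pos; try assumption. now apply s_supersonic. Qed.

Lemma Us_sound2 (x : R) : 0 <= x <= X -> 0 < gamma * prs (Us x) / rho (Us x).
Proof. intros Hx. apply sound2_pos; try assumption. now apply s_supersonic. Qed.

Lemma Us_speed (x : R) : 0 <= x <= X -> 0 < speed (Us x).
Proof. intros Hx. apply speed_pos; try assumption. now apply s_supersonic. Qed.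

(** The value on the shock of the potential with coefficients [h_Ap] and [- h_Am], that is, of the
    stream function. *)
Definition h_Ps (x : R) : R := RInt (fun z => h_Ap z z * h_P0 z + - h_Am z z * h_Q0 z) 0 x.
Definition sh_K (x : R) : R := entropy_factor gamma rho_inf p_inf (s x).
(** The exponential factor of [ampl] at (R_sh x, S_sh y). Clamping keeps the integrand inside the
    phase region, hence continuous on the whole line. *)
Definition h_E (x y : R) : R :=
  exp (RInt (fun t => cb gamma (Rs x) (clamp (Ss x) (Ss X) t)) (Ss x) (Ss y)).
Definition h_al (x : R) : R := - alpha gamma rho_inf p_inf X phi (Rs x) * R1 x.
(** Lower bound of the flux across the C- characteristic from [x]: the flux factor G at its foot
    times the least 1 / cos of the characteristic angle. *)
Definition h_m (x : R) : R := Gw gamma H0 ((Rs x - Ss x) / 2)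
  * sqrt (1 + beta gamma rho_inf p_inf X phi (Rs x)).

(** The flux factor is G = K rho c, and c / cos (theta + mu) and - c / cos (theta - mu) equal u
    lambda - v for the two characteristic slopes. With the diagonal data the combination is K rho (u
    phi' - v), which the mass balance across the shock evaluates. *)
Lemma Ps_slope (x : R) : 0 <= x <= X ->
  h_Ap x x * h_P0 x + - h_Am x x * h_Q0 x = rho_inf * s x * sh_K x.
Proof.
intros Hx. unfold h_Ap, h_Am. rewrite !pull_eq by lra.
assert (Hs := s_supersonic x Hx). destruct (trace_invariants x Hx) as [E1 [E2 E3]].
assert (Hg := good_xy x x ltac:(lra) ltac:(lra)).
destruct (good_facts gamma Hg1 _ _ Hg) as [C1 [C2 [C3 [C4 _]]]].
assert (HM1 := mach_sh_gt_1 x Hx).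
destruct (Us_angle x Hx) as [Eu Ev].
assert (Hmass := Us_mass x Hx).
assert (Hcsq := Us_csq x Hx).
destruct (Us_pos x Hx) as [Hr [Hpr [Hu Hv]]].
assert (Hc := Us_sound2 x Hx).
assert (Hq := Us_speed x Hx).
assert (HlP := lam_P0_Q0 x). rewrite clamp_id in HlP by exact Hx.
unfold h_lamp, h_lamm in HlP. rewrite !pull_eq in HlP by lra.
assert (HPQ := P0_Q0 x).
unfold flux_p, flux_m, Gw. unfold lp_ph, lm_ph, theta_m_ph, mach_ph, mu in *.
rewrite E1, E3 in *.
set (th := flow_angle (Us x)) in *. set (M := mach gamma (Us x)) in *. set (ma := mach_angle M) in *.
assert (Esin : sin ma * speed (Us x) = sqrt (csq gamma H0 M)).
{ unfold ma. rewrite sin_mach_angle by exact HM1. rewrite Hcsq.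
  unfold M, mach, sound. assert (0 < sqrt (gamma * prs (Us x) / rho (Us x))) by now apply sqrt_lt_R0.
  field. lra. }
assert (EG : Gm gamma H0 M = sh_K x * rho (Us x) * (sin ma * speed (Us x))).
{ rewrite Esin. unfold Gm, sh_K, entropy_factor.
  change (post_shock gamma rho_inf p_inf (s x)) with (Us x).
  fold M. change (total_enthalpy gamma rho_inf p_inf) with H0. rewrite Rpower_plus, Rpower_sqrt by (rewrite Hcsq; exact Hc).
  field. lra. }
rewrite EG.
(* c = q sin mu is the velocity component normal to a characteristic; dividing by the cosine of its
   angle expresses it per unit of x. *)
assert (Kp : sin ma * speed (Us x) / cos (th + ma) = vx (Us x) * tan (th + ma) - vy (Us x)).
{ rewrite Eu, Ev. fold th. replace (sin ma) with (sin ((th + ma) - th)) by (f_equal; ring).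
  rewrite sin_minus. unfold tan. field. lra. }
assert (Km : sin ma * speed (Us x) / cos (th - ma) = - (vx (Us x) * tan (th - ma) - vy (Us x))).
{ rewrite Eu, Ev. fold th. replace (sin ma) with (sin (th - (th - ma))) by (f_equal; ring).
  rewrite sin_minus. unfold tan. field. lra. }
transitivity (sh_K x * rho (Us x) * ((sin ma * speed (Us x) / cos (th + ma)) * h_P0 x
  - (sin ma * speed (Us x) / cos (th - ma)) * h_Q0 x)).
{ field. lra. }
rewrite Kp, Km.
transitivity (sh_K x * (rho (Us x) * (vx (Us x) * (tan (th + ma) * h_P0 x + tan (th - ma) * h_Q0 x)
  - vy (Us x) * (h_P0 x + h_Q0 x)))); [ring|].
rewrite HlP, HPQ, Rmult_1_r, Hmass. ring.
Qed.

Lemma Ps_integrand_cont (x : R) :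
  continuity_pt (fun z => h_Ap z z * h_P0 z + - h_Am z z * h_Q0 z) x.
Proof.
apply continuity_pt_plus; apply continuity_pt_mult.
- apply (cont_diag h_Ap), cont2_Ap.
- apply P0_cont.
- apply continuity_pt_opp. apply (cont_diag h_Am), cont2_Am.
- apply Q0_cont.
Qed.

Lemma Ps_derive (x : R) : is_derive h_Ps x (h_Ap x x * h_P0 x + - h_Am x x * h_Q0 x).
Proof. apply (is_derive_RInt_upper (fun z => h_Ap z z * h_P0 z + - h_Am z z * h_Q0 z)), Ps_integrand_cont. Qed.

Lemma Ps_zero : h_Ps 0 = 0.
Proof. apply RInt_point_R. Qed.

Lemma sh_K_pos (x : R) : 0 <= x <= X -> 0 < sh_K x.
Proof. intros Hx. apply entropy_factor_pos; try assumption. now apply s_supersonic. Qed.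

Lemma Ps_slope_pos (x : R) : 0 <= x <= X -> 0 < rho_inf * s x * sh_K x.
Proof.
intros Hx. assert (H1 := s_pos x Hx). assert (H2 := sh_K_pos x Hx).
apply Rmult_lt_0_compat; [apply Rmult_lt_0_compat|]; assumption.
Qed.

Lemma Ps_increasing (x y : R) : 0 <= x < y -> y <= X -> h_Ps x < h_Ps y.
Proof.
intros H1 H2. apply incr_on; [lra| |].
- intros t _. apply continuity_pt_cont_at_on. exact (is_derive_continuity_pt _ _ _ (Ps_derive t)).
- intros t Ht. eexists. split; [apply Ps_derive|]. rewrite Ps_slope by lra. apply Ps_slope_pos. lra.
Qed.

Lemma phi_nonneg (x : R) : 0 <= x <= X -> 0 <= phi x.
Proof.
intros Hx. rewrite <- Hphi0. apply nondecr_on; [lra| |].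
- intros t Ht. apply (cont_at_on_subinterval 0 X); try lra. apply phi_cont. lra.
- intros t Ht. exists (s t). split.
  + apply (is_derive_on_interior 0 X); [lra|]. apply phi_derive. lra.
  + left. apply s_pos. lra.
Qed.

Definition sh_K1 (x : R) : R := entropy_slope gamma rho_inf p_inf (s x) * s' x.

Lemma sh_K_derive (x : R) : 0 <= x <= X -> is_derive_on 0 X sh_K x (sh_K1 x).
Proof.
intros Hx. apply (is_derive_on_comp_pt 0 X (entropy_factor gamma rho_inf p_inf) s).
- exact Hx.
- apply is_derive_entropy_factor; try assumption. now apply s_supersonic.
- now apply s_derive.
Qed.

(* The streamlines crossed by a C- characteristic entered at smaller abscissae,
   where the convex shock is weaker and the entropy smaller. *)
Lemma Ps_le (x : R) : 0 <= x <= X -> h_Ps x <= rho_inf * sh_K x * phi x.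
Proof.
intros Hx.
(* The difference has derivative rho_inf K' phi, nonnegative because the slope, and with it K,
   increases along the convex shock. *)
assert (Hcomp : rho_inf * sh_K 0 * phi 0 - h_Ps 0 <= rho_inf * sh_K x * phi x - h_Ps x).
{ apply (nondecr_on 0 x (fun t => rho_inf * sh_K t * phi t - h_Ps t)); [lra| |].
  - intros t Ht. apply (cont_at_on_subinterval 0 X); try lra.
    apply (cont_at_on_comp_2d 0 X Rminus (fun t => rho_inf * sh_K t * phi t) h_Ps).
    + apply continuity_2d_pt_minus; [apply continuity_2d_pt_id1|apply continuity_2d_pt_id2].
    + apply cont_at_on_mult; [apply cont_at_on_mult|apply phi_cont; lra].
      * apply continuity_pt_cont_at_on, continuity_pt_const. now intros a b.
      * assert (Htt : 0 <= t <= X) by lra. exact (is_derive_on_cont 0 X sh_K t _ Htt (sh_K_derive t Htt)).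
    + apply continuity_pt_cont_at_on. exact (is_derive_continuity_pt _ _ _ (Ps_derive t)).
  - intros t Ht. exists ((rho_inf * sh_K1 t * phi t + rho_inf * sh_K t * s t)
      - (h_Ap t t * h_P0 t + - h_Am t t * h_Q0 t)). split.
    + apply (is_derive_minus (fun t => rho_inf * sh_K t * phi t) h_Ps); [|apply Ps_derive].
      apply (is_derive_mult (fun t => rho_inf * sh_K t) phi).
      * apply (is_derive_scal sh_K). apply (is_derive_on_interior 0 X); [lra|]. apply sh_K_derive. lra.
      * apply (is_derive_on_interior 0 X); [lra|]. apply phi_derive. lra.
      * intros u v. apply Rmult_comm.
    + rewrite Ps_slope by lra.
      replace (rho_inf * sh_K1 t * phi t + rho_inf * sh_K t * s t - rho_inf * s t * sh_K t)
        with (rho_inf * (sh_K1 t * phi t)) by ring.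
      apply Rmult_le_pos; [lra|]. apply Rmult_le_pos; [|apply phi_nonneg; lra].
      destruct (Hi t) as [H1 _]; [lra|]. apply Rmult_le_pos; [|left; exact H1].
      apply entropy_factor_slope_nonneg; try assumption. apply s_supersonic. lra. }
rewrite Hphi0, Ps_zero in Hcomp. lra.
Qed.

Lemma cb_clamped_cont (x : R) : 0 <= x <= X ->
  forall t, continuity_pt (fun t => cb gamma (Rs x) (clamp (Ss x) (Ss X) t)) t.
Proof.
intros Hx t.
apply (continuity_pt_comp (clamp (Ss x) (Ss X)) (fun t => cb gamma (Rs x) t)).
- apply continuity_clamp.
- apply (continuity_2d_pt_snd_pt (cb gamma)). apply cont_cb; [exact Hg1|]. apply good_at; [exact Hx|].
  apply clamp_range. apply S_incr_le; lra.
Qed.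

Lemma E_cont (x y : R) : 0 <= x <= y -> y <= X -> cont_at_on x X (h_E x) y.
Proof.
intros H1 H2.
apply (cont_at_on_comp_pt x X (fun z => exp (RInt (fun t => cb gamma (Rs x) (clamp (Ss x) (Ss X) t)) (Ss x) z)) Ss).
- apply (continuity_pt_comp (fun z => RInt (fun t => cb gamma (Rs x) (clamp (Ss x) (Ss X) t)) (Ss x) z) exp).
  + eapply is_derive_continuity_pt.
    apply (is_derive_RInt_upper (fun t => cb gamma (Rs x) (clamp (Ss x) (Ss X) t))).
    apply cb_clamped_cont. lra.
  + apply derivable_continuous_pt, derivable_pt_exp.
- apply (cont_at_on_subinterval 0 X); try lra. apply S_cont. lra.
Qed.

Lemma E_derive (x y : R) : 0 <= x < y -> y < X ->
  is_derive (fun t => h_E x t) y (h_tb x y * h_E x y).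
Proof.
intros H1 H2. unfold h_tb. rewrite pull_eq by lra. destruct (retr_id X x y) as [_ ->]; try lra.
replace (cb gamma (Rs x) (Ss y) * S1 y * h_E x y) with (h_E x y * (cb gamma (Rs x) (Ss y) * S1 y)) by ring.
apply (is_derive_comp_R exp (fun y => RInt (fun t => cb gamma (Rs x) (clamp (Ss x) (Ss X) t)) (Ss x) (Ss y))).
- apply is_derive_Reals, derivable_pt_lim_exp.
- apply (is_derive_comp_R (fun z => RInt (fun t => cb gamma (Rs x) (clamp (Ss x) (Ss X) t)) (Ss x) z) Ss).
  + assert (E1 : clamp (Ss x) (Ss X) (Ss y) = Ss y).
    { apply clamp_id. split; apply S_incr_le; lra. }
    rewrite <- E1 at 2.
    apply (is_derive_RInt_upper (fun t => cb gamma (Rs x) (clamp (Ss x) (Ss X) t))).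
    apply cb_clamped_cont. lra.
  + apply (is_derive_on_interior 0 X); [lra|]. apply S_derive. lra.
Qed.

Lemma E_diag (x : R) : h_E x x = 1.
Proof. unfold h_E. rewrite RInt_point_R. apply exp_0. Qed.

Lemma ampl_eq (x t : R) : 0 <= x <= X -> Ss x <= t <= Ss X ->
  ampl gamma rho_inf p_inf X phi (Rs x) t = ca gamma (Rs x) t *
    exp (RInt (fun t => cb gamma (Rs x) (clamp (Ss x) (Ss X) t)) (Ss x) t).
Proof.
intros Hx Ht. unfold ampl. rewrite chi_eq by exact Hx. rewrite coef_a_eq; [|exact Hg1|now apply good_at].
f_equal. f_equal. apply RInt_ext. intros z Hz. rewrite Rmin_left, Rmax_right in Hz by lra.
rewrite clamp_id by lra. apply coef_b_eq; [exact Hg1|]. apply good_at; lra.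
Qed.

Lemma alpha_spec (x t : R) : 0 <= x <= X -> Ss x <= t <= Ss X ->
  ca gamma (Rs x) t * exp (RInt (fun t => cb gamma (Rs x) (clamp (Ss x) (Ss X) t)) (Ss x) t)
  <= alpha gamma rho_inf p_inf X phi (Rs x).
Proof.
intros Hx Ht. rewrite <- ampl_eq by assumption. unfold alpha. rewrite chi_eq by exact Hx.
change (S_max gamma rho_inf p_inf X phi) with (Ss X).
apply (cont_at_on_max_over (Ss x) (Ss X) (fun s => ampl gamma rho_inf p_inf X phi (Rs x) s)); [lra| |exact Ht].
clear t Ht. intros t Ht.
apply (cont_at_on_ext (Ss x) (Ss X) (fun t => ca gamma (Rs x) t *
    exp (RInt (fun t => cb gamma (Rs x) (clamp (Ss x) (Ss X) t)) (Ss x) t))).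
- exact Ht.
- intros z Hz. symmetry. now apply ampl_eq.
- apply cont_at_on_mult; apply continuity_pt_cont_at_on.
  + apply (continuity_2d_pt_snd_pt (ca gamma)). apply cont_ca; [exact Hg1|]. now apply good_at.
  + apply (continuity_pt_comp (fun z => RInt (fun t => cb gamma (Rs x) (clamp (Ss x) (Ss X) t)) (Ss x) z) exp).
    * eapply is_derive_continuity_pt.
      apply (is_derive_RInt_upper (fun t => cb gamma (Rs x) (clamp (Ss x) (Ss X) t))).
      now apply cb_clamped_cont.
    * apply derivable_continuous_pt, derivable_pt_exp.
Qed.

Lemma alpha_pos (x : R) : 0 <= x <= X -> 0 < alpha gamma rho_inf p_inf X phi (Rs x).
Proof.
intros Hx. assert (HS : Ss x <= Ss x <= Ss X) by (split; [lra|apply S_incr_le; lra]).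
eapply Rlt_le_trans; [|apply (alpha_spec x (Ss x) Hx HS)].
apply Rmult_lt_0_compat; [|apply exp_pos]. apply ca_pos; [exact Hg1|]. now apply good_at.
Qed.

Lemma al_bound_h (x y : R) : 0 <= x <= y -> y <= X -> h_ta x y * h_E x y <= h_al x.
Proof.
intros H1 H2. unfold h_ta, h_al. rewrite pull_eq by lra. destruct (retr_id X x y) as [-> _]; try lra.
assert (HS : Ss x <= Ss y <= Ss X) by (split; apply S_incr_le; lra).
assert (K := alpha_spec x (Ss y) ltac:(lra) HS). fold (h_E x y) in K.
assert (HR := R1_neg x ltac:(lra)). nra.
Qed.

Lemma beta_spec (x t : R) : 0 <= x <= X -> Ss x <= t <= Ss X ->
  beta gamma rho_inf p_inf X phi (Rs x) <= lm_ph gamma (Rs x) t ^ 2.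
Proof.
intros Hx Ht. unfold beta. rewrite chi_eq by exact Hx.
change (S_max gamma rho_inf p_inf X phi) with (Ss X).
apply (cont_at_on_min_over (Ss x) (Ss X) (fun s => lm_ph gamma (Rs x) s ^ 2)); [lra| |exact Ht].
clear t Ht. intros t Ht. apply continuity_pt_cont_at_on.
apply (continuity_pt_comp (fun t => lm_ph gamma (Rs x) t) (fun z => z ^ 2)).
- apply (continuity_2d_pt_snd_pt (lm_ph gamma)). apply cont_lm; [exact Hg1|]. now apply good_at.
- apply derivable_continuous_pt. reg.
Qed.

Lemma beta_nonneg (x : R) : 0 <= x <= X -> 0 <= beta gamma rho_inf p_inf X phi (Rs x).
Proof.
intros Hx. unfold beta. rewrite chi_eq by exact Hx.
change (S_max gamma rho_inf p_inf X phi) with (Ss X).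
destruct (cont_at_on_min_over (Ss x) (Ss X) (fun s => lm_ph gamma (Rs x) s ^ 2)) as [[t [_ <-]] _].
- apply S_incr_le; lra.
- intros t Ht. apply continuity_pt_cont_at_on.
  apply (continuity_pt_comp (fun t => lm_ph gamma (Rs x) t) (fun z => z ^ 2)).
  + apply (continuity_2d_pt_snd_pt (lm_ph gamma)). apply cont_lm; [exact Hg1|]. now apply good_at.
  + apply derivable_continuous_pt. reg.
- apply pow2_ge_0.
Qed.

Lemma m_pos_h (x : R) : 0 <= x <= X -> 0 < h_m x.
Proof.
intros Hx. apply Rmult_lt_0_compat; [apply exp_pos|]. apply sqrt_lt_R0.
assert (K := beta_nonneg x Hx). lra.
Qed.

(** Along a C- characteristic R is fixed and S grows, so nu and M fall and G rises; and 1 / cos =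
    sqrt (1 + lamm^2) is at least sqrt (1 + beta). *)
Lemma m_bound_h (x y : R) : 0 <= x <= y -> y <= X -> h_m x <= h_Am x y.
Proof.
intros H1 H2. unfold h_Am, h_m. rewrite pull_eq by lra.
assert (Hg := good_xy x y H1 H2). assert (Hgx := good_xy x x ltac:(lra) ltac:(lra)).
destruct (good_facts gamma Hg1 _ _ Hg) as [C1 _].
assert (HS : Ss x <= Ss y <= Ss X) by (split; apply S_incr_le; lra).
unfold flux_m. apply Rmult_le_compat.
- left. apply exp_pos.
- apply sqrt_pos.
- apply Gm_decr; [exact Hg1|apply H0_pos|].
  destruct (nu_inv_spec gamma Hg1 _ (proj1 Hg)) as [M1 _]. split; [lra|].
  apply nu_inv_decr; [exact Hg1|apply Hg|apply Hgx|lra].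
- assert (K := beta_spec x (Ss y) ltac:(lra) HS).
  set (d := theta_ph (Rs x) (Ss y) - mu gamma ((Rs x - Ss y) / 2)) in *.
  change (lm_ph gamma (Rs x) (Ss y)) with (tan d) in K.
  rewrite <- (sqrt_pow2 (/ cos d)) by (left; now apply Rinv_0_lt_compat).
  apply sqrt_le_1_alt.
  replace ((/ cos d) ^ 2) with (1 + tan d ^ 2); [lra|].
  assert (E := sin2_cos2 d). unfold Rsqr in E. unfold tan.
  apply (Rmult_eq_reg_r (cos d ^ 2)); [|apply pow_nonzero; lra].
  transitivity (sin d * sin d + cos d * cos d); [field; lra|]. rewrite E. field. lra.
Qed.

(** As h_m = K rho c sqrt (1 + beta) and Ps <= rho_inf K phi, the factor K cancels and Ps / h_m <=
    B_mass. Multiplication by - alpha R1, which converts dR into dx, turns B_nd into the diagonal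
    value of P. *)
Lemma nondegenerate_h (x : R) : 0 <= x <= X -> h_al x * (h_Ps x / h_m x) < h_P0 x.
Proof.
intros Hx. assert (HB := Hbounds x Hx). unfold B_mass, B_nd, xR_sh in HB.
fold Us Rs Ss in HB. change (dphi X phi x) with (s x) in HB.
rewrite (Derive_on_eq 0 X Rs x (R1 x) HX Hx (R_derive x Hx)) in HB.
assert (Ha := alpha_pos x Hx). assert (HR := R1_neg x Hx). assert (Hb := beta_nonneg x Hx).
assert (Hl := shock_slope_between x Hx). assert (HP := P0_eq x Hx).
assert (Hs := s_supersonic x Hx). destruct (trace_invariants x Hx) as [E1 [E2 E3]].
destruct (Us_pos x Hx) as [Hr [Hpr _]].
assert (Hcsq := Us_csq x Hx).
assert (Hc := Us_sound2 x Hx).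
assert (Hm := m_pos_h x Hx). assert (HPs := Ps_le x Hx).
assert (HK := sh_K_pos x Hx).
set (a := alpha gamma rho_inf p_inf X phi (Rs x)) in *.
set (bb := beta gamma rho_inf p_inf X phi (Rs x)) in *.
set (lp := lp_ph gamma (Rs x) (Ss x)) in *. set (lm := lm_ph gamma (Rs x) (Ss x)) in *.
set (sb := sqrt (1 + bb)) in *.
assert (Hsb : 0 < sb) by (apply sqrt_lt_R0; lra).
set (c := sqrt (gamma * prs (Us x) / rho (Us x))).
assert (Hcp : 0 < c) by now apply sqrt_lt_R0.
assert (Erp : sqrt (gamma * rho (Us x) * prs (Us x)) = rho (Us x) * c).
{ unfold c. rewrite <- (sqrt_pow2 (rho (Us x))) at 2 by lra. rewrite <- sqrt_mult by nra.
  f_equal. field. lra. }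
rewrite Erp in HB.
assert (Em : h_m x = sh_K x * rho (Us x) * c * sb).
{ unfold h_m. fold bb sb. f_equal. unfold Gw. rewrite E3. unfold Gm, sh_K, entropy_factor, c.
  change (post_shock gamma rho_inf p_inf (s x)) with (Us x).
  change (total_enthalpy gamma rho_inf p_inf) with H0. rewrite Rpower_plus, Rpower_sqrt by (rewrite Hcsq; exact Hc).
  rewrite Hcsq. field. lra. }
assert (Hbm : h_Ps x / h_m x <= rho_inf * phi x / (rho (Us x) * c * sb)).
{ apply (Rmult_le_reg_r (h_m x)); [exact Hm|].
  replace (h_Ps x / h_m x * h_m x) with (h_Ps x) by (field; lra).
  eapply Rle_trans; [exact HPs|]. right. rewrite Em. field. repeat split; lra. }
assert (Hlt : h_Ps x / h_m x < - ((s x - lm) / ((lp - lm) * R1 x)) / a) by lra.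
unfold h_al. fold a. rewrite HP.
apply (Rmult_lt_compat_l (- a * R1 x)) in Hlt; [|nra].
eapply Rlt_le_trans; [exact Hlt|]. right. field. repeat split; lra.
Qed.


(** Three potentials of one Goursat solution: the coefficients (1, 1) give x, (lamp, lamm) give y,
    and (Ap, - Am) give the stream function. On the diagonal they reduce to x, phi and [h_Ps]. *)
Lemma hodograph_exists : exists P Q ps ps1 ps2 Xw f g xi eta,
  cont2 P /\ cont2 Q /\ cont2 ps1 /\ cont2 ps2 /\
  (forall x y, is_derive (fun t => ps t y) x (ps1 x y)) /\
  (forall x y, is_derive (fun t => ps x t) y (ps2 x y)) /\
  (forall x y, 0 <= x <= y -> y <= X ->
     ps1 x y = h_Ap x y * P x y /\ ps2 x y = - h_Am x y * Q x y) /\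
  (forall x, ps x x = h_Ps x) /\
  hodograph_flow X P Q h_lamp h_lamm h_Ap h_Am ps phi h_Ps Xw f g xi eta.
Proof.
destruct (goursat_solution X h_ta h_tb h_P0 h_Q0) as [h [Hh Heq]].
{ lra. } { apply cont2_ta. } { apply cont2_tb. } { apply P0_cont. } { apply Q0_cont. }
set (P := char_P h h_P0). set (Q := char_Q h h_Q0).
assert (Hxy0 : forall x y, 0 <= x <= y -> y <= X -> h x y = h_ta x y * Q x y + h_tb x y * P x y).
{ exact Heq. }
assert (Hpot := char_potential X h_ta h_tb h h_P0 h_Q0 cont2_ta cont2_tb Hh P0_cont Q0_cont Hxy0).
destruct (Hpot (fun _ _ => 1) (fun _ _ => 1)) as [xx [xx1 [xx2 [X1 [X2 [X3 [X4 [X5 X6]]]]]]]].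
{ apply cont2_const. } { apply cont2_const. }
{ intros x y _ _. replace (h_tb x y * (1 - 1)) with 0 by ring. apply @is_derive_const. }
{ intros x y _ _. replace (- h_ta x y * (1 - 1)) with 0 by ring. apply @is_derive_const. }
destruct (Hpot h_lamp h_lamm cont2_lamp cont2_lamm lamp_eta lamm_xi)
  as [yy [yy1 [yy2 [Y1 [Y2 [Y3 [Y4 [Y5 Y6]]]]]]]].
destruct (Hpot h_Ap (fun x y => - h_Am x y) cont2_Ap (cont2_opp _ cont2_Am) Ap_eta Am_xi)
  as [ps [ps1 [ps2 [Z1 [Z2 [Z3 [Z4 [Z5 Z6]]]]]]]].
fold P Q in X5, Y5, Z5.
assert (Hmain : exists Xw f g xi eta,
  hodograph_flow X P Q h_lamp h_lamm h_Ap h_Am ps phi h_Ps Xw f g xi eta).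
{ apply (hodograph_inverse X HX h_ta h_tb h P Q h_lamp h_lamm h_Ap h_Am xx yy ps
    xx1 xx2 yy1 yy2 ps1 ps2 h_E phi h_Ps h_al h_m).
  - intros x y _ _. apply ta_nonneg_h.
  - intros x y _ _. apply tb_nonneg_h.
  - now apply cont2_char_P, P0_cont.
  - now apply cont2_char_Q, Q0_cont.
  - intros x y. now apply is_derive_char_P.
  - intros x y. now apply is_derive_char_Q.
  - exact Hxy0.
  - intros x Hx. unfold P. rewrite char_P_diag. now apply P0_Q0_pos.
  - intros x Hx. unfold Q. rewrite char_Q_diag. now apply P0_Q0_pos.
  - exact X3.
  - exact X4.
  - exact X1.
  - intros x y H1 H2. destruct (X5 x y H1 H2) as [-> ->]. split; ring.
  - intros x Hx. rewrite X6. transitivity (RInt (fun _ => 1) 0 x).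
    + apply RInt_ext. intros z _. assert (K := P0_Q0 z).
      change (@eq R (1 * h_P0 z + 1 * h_Q0 z) 1). lra.
    + rewrite RInt_const. change (@eq R ((x - 0) * 1) x). ring.
  - exact Y3.
  - exact Y4.
  - exact Y1.
  - exact Y5.
  - intros x Hx. rewrite Y6.
    rewrite (RInt_ext _ (fun z => s (clamp 0 X z))) by (intros z _; apply lam_P0_Q0).
    (* On the diagonal y is the integral of the shock slope, which differs from phi by a constant;
       the constant is zero since phi 0 = 0. *)
    assert (Ed : RInt (fun z => s (clamp 0 X z)) 0 0 - phi 0 = RInt (fun z => s (clamp 0 X z)) 0 x - phi x).
    { apply (is_derive_zero_eq 0 x (fun t => RInt (fun z => s (clamp 0 X z)) 0 t - phi t)); [lra| |].
      - intros t Ht. apply (cont_at_on_comp_2d 0 x Rminus (fun t => RInt (fun z => s (clamp 0 X z)) 0 t) phi).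
        + apply continuity_2d_pt_minus; [apply continuity_2d_pt_id1|apply continuity_2d_pt_id2].
        + apply continuity_pt_cont_at_on. eapply is_derive_continuity_pt.
          apply (is_derive_RInt_upper (fun z => s (clamp 0 X z))). apply s_clamp_cont.
        + apply (cont_at_on_subinterval 0 X); try lra. apply phi_cont. lra.
      - intros t Ht.
        assert (D : is_derive (fun t => RInt (fun z => s (clamp 0 X z)) 0 t - phi t) t
          (s (clamp 0 X t) - s t)).
        { apply (is_derive_minus (fun t => RInt (fun z => s (clamp 0 X z)) 0 t) phi).
          - apply (is_derive_RInt_upper (fun z => s (clamp 0 X z))). apply s_clamp_cont.
          - apply (is_derive_on_interior 0 X); [lra|]. apply phi_derive. lra. }
        replace (s (clamp 0 X t) - s t) with 0 in D by (rewrite clamp_id by lra; ring).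
        exact D. }
    rewrite RInt_point_R, Hphi0 in Ed. lra.
  - exact Z3.
  - exact Z4.
  - exact Z1.
  - exact Z5.
  - intros x Hx. apply Z6.
  - exact Ps_zero.
  - exact Ps_increasing.
  - intros x y _ _. apply lam_lt_h.
  - intros x y _ _. apply flux_pos; [exact Hg1|apply good_pull].
  - exact E_cont.
  - exact E_derive.
  - intros x y _ _. apply exp_pos.
  - intros x _. apply E_diag.
  - exact al_bound_h.
  - exact m_pos_h.
  - exact m_bound_h.
  - intros x Hx. unfold P. rewrite char_P_diag. now apply nondegenerate_h.
  - exact phi_cont. }
destruct Hmain as [Xw [f [g [xi [eta HF]]]]].
exists P, Q, ps, ps1, ps2, Xw, f, g, xi, eta.
split; [now apply cont2_char_P, P0_cont|]. split; [now apply cont2_char_Q, Q0_cont|].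
split; [exact Z1|]. split; [exact Z2|]. split; [exact Z3|]. split; [exact Z4|].
split; [exact Z5|]. split; [exact Z6|exact HF].
Qed.


(** * The post-shock flow *)

Lemma foot_exists : exists foot : R -> R, forall p, 0 <= p <= h_Ps X ->
  0 <= foot p <= X /\ h_Ps (foot p) = p.
Proof.
exists (fun p => epsilon (inhabits 0) (fun x => 0 <= x <= X /\ h_Ps x = p)).
intros p Hpp. apply epsilon_spec. apply (ivt_on 0 X h_Ps p); [lra| |].
- intros x _. apply continuity_pt_cont_at_on. exact (is_derive_continuity_pt _ _ _ (Ps_derive x)).
- rewrite Ps_zero, Rmin_left, Rmax_right; lra.
Qed.

Lemma PsX_pos : 0 < h_Ps X.
Proof. rewrite <- Ps_zero. apply Ps_increasing; lra. Qed.

Lemma Ps_range (x : R) : 0 <= x <= X -> 0 <= h_Ps x <= h_Ps X.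
Proof.
intros Hx. split; [rewrite <- Ps_zero|].
- destruct (Req_dec 0 x) as [<-|Hne]; [lra|]. left. apply Ps_increasing; lra.
- destruct (Req_dec x X) as [->|Hne]; [lra|]. left. apply Ps_increasing; lra.
Qed.

Section Flow.

Context (P Q ps ps1 ps2 : R -> R -> R) (Xw : R) (f g : R -> R) (xi eta : R -> R -> R).
Context (cP : cont2 P) (cQ : cont2 Q) (cps1 : cont2 ps1) (cps2 : cont2 ps2).
Context (dps1 : forall x y, is_derive (fun t => ps t y) x (ps1 x y)).
Context (dps2 : forall x y, is_derive (fun t => ps x t) y (ps2 x y)).
Context (eps_ : forall x y, 0 <= x <= y -> y <= X ->
     ps1 x y = h_Ap x y * P x y /\ ps2 x y = - h_Am x y * Q x y).
Context (ps_diag : forall x, ps x x = h_Ps x).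
Context (HF : hodograph_flow X P Q h_lamp h_lamm h_Ap h_Am ps phi h_Ps Xw f g xi eta).
(* [foot p] is the shock abscissa of the streamline with stream function [p]. *)
Context (foot : R -> R).
Context (foot_spec : forall p, 0 <= p <= h_Ps X -> 0 <= foot p <= X /\ h_Ps (foot p) = p).

Let cl : R -> R -> Prop := Omega_closure X phi Xw f g.
Let om : R -> R -> Prop := Omega X phi Xw f g.

Lemma foot_unique (x : R) : 0 <= x <= X -> foot (h_Ps x) = x.
Proof.
intros Hx. assert (Hr := Ps_range x Hx).
destruct (foot_spec _ Hr) as [H1 H2].
destruct (Rtotal_order (foot (h_Ps x)) x) as [H|[H|H]]; [|exact H|].
- assert (K := Ps_increasing (foot (h_Ps x)) x). lra.
- assert (K := Ps_increasing x (foot (h_Ps x))). lra.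
Qed.

Lemma foot_cont (p : R) : 0 <= p <= h_Ps X -> cont_at_on 0 (h_Ps X) foot p.
Proof.
intros Hpp. apply (closed_graph_cont (fun t x => (0 <= t /\ - h_Ps X <= - t) /\ (0 <= x /\ - X <= - x)
  /\ h_Ps x - t = 0) foot 0 (h_Ps X) 0 X p).
- assert (C1 : cont2 (fun x _ => x)) by (intros u v; apply continuity_2d_pt_id1).
  assert (C2 : cont2 (fun _ y => y)) by (intros u v; apply continuity_2d_pt_id2).
  apply closed_2d_and; [apply closed_2d_and|apply closed_2d_and; [apply closed_2d_and|]].
  + now apply (closed_2d_ge (fun x _ => x)).
  + apply (closed_2d_ge (fun t _ => - t)). now apply cont2_opp.
  + now apply (closed_2d_ge (fun _ y => y)).
  + apply (closed_2d_ge (fun _ y => - y)). now apply cont2_opp.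
  + apply (closed_2d_eq (fun t x => h_Ps x - t)). apply cont2_minus; [apply cont2_snd|exact C1].
    intros x. exact (is_derive_continuity_pt _ _ _ (Ps_derive x)).
- intros t x H. lra.
- intros t Ht. destruct (foot_spec t Ht). lra.
- intros x [_ [H1 H2]]. replace p with (h_Ps x) by lra. rewrite foot_unique; [reflexivity|lra].
Qed.

Lemma foot_derive (p : R) : 0 < p < h_Ps X ->
  is_derive foot p (/ (rho_inf * s (foot p) * sh_K (foot p))).
Proof.
intros Hpp. destruct (foot_spec p) as [H1 H2]; [lra|].
apply (is_derive_on_interior 0 (h_Ps X)); [exact Hpp|].
assert (Hs := Ps_slope_pos (foot p) H1).
destruct (implicit_curve 0 (h_Ps X) p foot (fun _ => 0) (fun z => z) (fun _ => 0)
  (fun u _ => h_Ps u) (fun _ v => v) (rho_inf * s (foot p) * sh_K (foot p)) 0 0 1 1 0) as [D _].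
- lra.
- apply foot_cont. lra.
- apply continuity_pt_cont_at_on, continuity_pt_const. now intros a b.
- apply (differentiable_pt_lim_proj1_0 h_Ps). apply is_derive_Reals.
  rewrite <- Ps_slope by exact H1. apply Ps_derive.
- apply (C1_differentiable (fun _ v => v) (fun _ _ => 0) (fun _ _ => 1)).
  + intros u v. apply @is_derive_const.
  + intros u v. apply @is_derive_id.
  + apply continuity_2d_pt_const.
- apply is_derive_on_id; lra.
- apply is_derive_on_const; lra.
- intros t Ht. now apply foot_spec.
- reflexivity.
- lra.
- replace (/ (rho_inf * s (foot p) * sh_K (foot p))) with
    ((1 * 1 - 0 * 0) / (rho_inf * s (foot p) * sh_K (foot p) * 1 - 0 * 0)); [exact D|].
  field. repeat split; try lra; intros E0; rewrite E0 in Hs; lra.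
Qed.

(** The entropy factor as a function of the stream function: each streamline carries the value of K
    at the shock point where it enters. Clamping defines it for all arguments. *)
Definition Kf (p : R) : R := sh_K (foot (clamp 0 (h_Ps X) p)).

Lemma Kf_foot_range (p : R) : 0 <= foot (clamp 0 (h_Ps X) p) <= X.
Proof. apply foot_spec. apply clamp_range. left. apply PsX_pos. Qed.

Lemma Kf_pos (p : R) : 0 < Kf p.
Proof. apply sh_K_pos, Kf_foot_range. Qed.

Lemma sh_K_cont (x : R) : 0 <= x <= X -> cont_at_on 0 X sh_K x.
Proof. intros Hx. exact (is_derive_on_cont _ _ _ _ _ Hx (sh_K_derive x Hx)). Qed.

Lemma Kf_cont (p : R) : continuity_pt Kf p.
Proof.
apply (cont_at_on_clamp 0 (h_Ps X) (fun p => sh_K (foot p))); [left; apply PsX_pos|].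
intros t Ht. apply (cont_at_on_comp 0 (h_Ps X) 0 X sh_K foot).
- intros z Hz. now apply foot_spec.
- apply sh_K_cont. now apply foot_spec.
- now apply foot_cont.
Qed.

Lemma Kf_shock (x : R) : 0 <= x <= X -> Kf (ps x x) = sh_K x.
Proof.
intros Hx. unfold Kf. rewrite ps_diag, clamp_id; [now rewrite foot_unique|].
now apply Ps_range.
Qed.

Definition Kf1 (p : R) : R :=
  sh_K1 (foot p) * / (rho_inf * s (foot p) * sh_K (foot p)).

Lemma Kf_derive (p : R) : 0 < p < h_Ps X -> is_derive Kf p (Kf1 p) /\ continuity_pt Kf1 p.
Proof.
intros Hpp. destruct (foot_spec p) as [H1 H2]; [lra|].
assert (Hs := Ps_slope_pos (foot p) H1).
assert (Hint : 0 < foot p < X).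
{ split.
  - destruct (Req_dec 0 (foot p)) as [E0|]; [rewrite <- E0, Ps_zero in H2; lra|lra].
  - destruct (Req_dec (foot p) X) as [E0|]; [rewrite E0 in H2; lra|lra]. }
assert (Df := foot_derive p Hpp). split.
- apply (is_derive_ext_loc (fun p => sh_K (foot p))).
  { apply (locally_interior 0 (h_Ps X)); [exact Hpp|]. intros t Ht. unfold Kf. rewrite clamp_id; lra. }
  apply (is_derive_comp_R sh_K foot); [|exact Df].
  apply (is_derive_on_interior 0 X); [exact Hint|]. now apply sh_K_derive.
- assert (Cf := is_derive_continuity_pt _ _ _ Df).
  assert (Cs : continuity_pt s (foot p)) by (apply (cont_at_on_interior 0 X); [exact Hint|now apply s_cont]).
  assert (CK : continuity_pt sh_K (foot p)) by (apply (cont_at_on_interior 0 X); [exact Hint|now apply sh_K_cont]).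
  apply (continuity_pt_comp foot (fun x => sh_K1 x * / (rho_inf * s x * sh_K x))); [exact Cf|].
  apply continuity_pt_mult.
  + apply continuity_pt_mult.
    * apply (continuity_pt_comp s (entropy_slope gamma rho_inf p_inf)); [exact Cs|].
      apply entropy_slope_cont; try assumption. now apply s_supersonic.
    * apply (cont_at_on_interior 0 X); [exact Hint|now apply s'_cont].
  + apply (continuity_pt_inv (fun x => rho_inf * s x * sh_K x)); [|lra].
    apply continuity_pt_mult; [apply continuity_pt_mult|exact CK]; [|exact Cs].
    apply continuity_pt_const. now intros a b.
Qed.

Definition f_th : R -> R -> R := pull theta_ph.
Definition f_M : R -> R -> R := pull (fun r t => nu_inv gamma ((r - t) / 2)).
Definition f_c2 (x y : R) : R := csq gamma H0 (f_M x y).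
Definition f_q (x y : R) : R := f_M x y * sqrt (f_c2 x y).
Definition f_rho (x y : R) : R := Rpower (f_c2 x y) (/ (gamma - 1)) * / Kf (ps x y).

(** R and S determine theta and M, the Bernoulli relation then gives the sound speed, and the
    entropy factor of the streamline gives the density through K rho = c^(2 / (gamma - 1)); the
    pressure is rho c^2 / gamma. *)
Definition flow_state (x y : R) : state :=
  State (f_rho x y) (f_q x y * cos (f_th x y)) (f_q x y * sin (f_th x y))
    (f_rho x y * f_c2 x y / gamma).

Lemma f_facts (x y : R) : 1 < f_M x y /\ 0 < f_c2 x y /\ 0 < f_q x y /\ 0 < f_rho x y /\
  - (PI / 2) < f_th x y < PI / 2 /\ 0 < cos (f_th x y).
Proof.
assert (Hg := good_pull x y). destruct (good_facts gamma Hg1 _ _ Hg) as [_ [_ [_ [_ [_ [_ Hth]]]]]].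
destruct (nu_inv_spec gamma Hg1 _ (proj1 Hg)) as [HM1 _].
assert (Hc : 0 < f_c2 x y) by (apply csq_pos; [exact Hg1|apply H0_pos]).
assert (HMf : 1 < f_M x y) by exact HM1.
repeat split; try assumption.
- apply Rmult_lt_0_compat; [lra|now apply sqrt_lt_R0].
- apply Rmult_lt_0_compat; [apply exp_pos|]. apply Rinv_0_lt_compat, Kf_pos.
- apply Hth.
- apply Hth.
- apply cos_gt_0; apply Hth.
Qed.

Lemma flow_state_angle (x y : R) : flow_angle (flow_state x y) = f_th x y.
Proof.
destruct (f_facts x y) as [H1 [H2 [H3 [H4 [H5 H6]]]]]. unfold flow_angle. simpl.
replace (f_q x y * sin (f_th x y) / (f_q x y * cos (f_th x y))) with (tan (f_th x y))
  by (unfold tan; field; lra).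
now apply atan_tan.
Qed.

Lemma flow_state_speed (x y : R) : speed (flow_state x y) = f_q x y.
Proof.
destruct (f_facts x y) as [H1 [H2 [H3 [H4 [H5 H6]]]]]. unfold speed. cbn [vx vy flow_state].
replace ((f_q x y * cos (f_th x y)) ^ 2 + (f_q x y * sin (f_th x y)) ^ 2) with (f_q x y ^ 2).
- apply sqrt_pow2. lra.
- assert (E := sin2_cos2 (f_th x y)). unfold Rsqr in E.
  transitivity (f_q x y ^ 2 * (sin (f_th x y) * sin (f_th x y) + cos (f_th x y) * cos (f_th x y)));
    [rewrite E; ring|ring].
Qed.

Lemma flow_state_sound2 (x y : R) :
  gamma * prs (flow_state x y) / rho (flow_state x y) = f_c2 x y.
Proof.
destruct (f_facts x y) as [H1 [H2 [H3 [H4 [H5 H6]]]]]. simpl. field. lra.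
Qed.

Lemma flow_state_mach (x y : R) : mach gamma (flow_state x y) = f_M x y.
Proof.
destruct (f_facts x y) as [H1 [H2 [H3 [H4 [H5 H6]]]]].
unfold mach, sound. rewrite flow_state_speed, flow_state_sound2. unfold f_q.
assert (0 < sqrt (f_c2 x y)) by now apply sqrt_lt_R0. field. lra.
Qed.

Lemma flow_state_lambda (x y : R) :
  lambda_plus gamma (flow_state x y) = h_lamp x y /\
  lambda_minus gamma (flow_state x y) = h_lamm x y.
Proof.
unfold lambda_plus, lambda_minus. rewrite flow_state_angle, flow_state_mach. split; reflexivity.
Qed.

Lemma flow_state_invariants (x y : R) : 0 <= x <= y -> y <= X ->
  inv_R gamma (flow_state x y) = Rs x /\ inv_S gamma (flow_state x y) = Ss y.
Proof.
intros H1 H2. unfold inv_R, inv_S. rewrite flow_state_angle, flow_state_mach.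
unfold f_th, f_M. rewrite !pull_eq by assumption.
destruct (nu_inv_spec gamma Hg1 _ (proj1 (good_xy x y H1 H2))) as [_ E0]. rewrite E0.
unfold theta_ph. split; field.
Qed.

Lemma flow_state_bernoulli (x y : R) :
  (vx (flow_state x y) ^ 2 + vy (flow_state x y) ^ 2) / 2
  + gamma * prs (flow_state x y) / ((gamma - 1) * rho (flow_state x y)) = H0.
Proof.
destruct (f_facts x y) as [H1 [H2 [H3 [H4 [H5 H6]]]]].
replace (gamma * prs (flow_state x y) / ((gamma - 1) * rho (flow_state x y))) with
  (f_c2 x y / (gamma - 1)).
2:{ rewrite <- (flow_state_sound2 x y). simpl rho. field. lra. }
replace (vx (flow_state x y) ^ 2 + vy (flow_state x y) ^ 2) with (f_q x y ^ 2).
2:{ rewrite <- flow_state_speed. unfold speed. rewrite pow2_sqrt; [reflexivity|].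
    apply Rplus_le_le_0_compat; apply pow2_ge_0. }
unfold f_q. rewrite Rpow_mult_distr, pow2_sqrt by lra. unfold f_c2, csq.
assert (0 < / (gamma - 1)) by (apply Rinv_0_lt_compat; lra).
assert (0 < (gamma - 1) * f_M x y ^ 2) by (apply Rmult_lt_0_compat; [lra|apply pow_lt; lra]).
field. split; lra.
Qed.

(** p / rho^gamma = c^2 rho^(1 - gamma) / gamma, and c^2 = (K rho)^(gamma - 1). Thus the entropy
    depends on the stream function alone. *)
Lemma flow_state_entropy (x y : R) :
  entropy gamma (flow_state x y) = Rpower (Kf (ps x y)) (gamma - 1) / gamma.
Proof.
destruct (f_facts x y) as [H1 [H2 [H3 [H4 [H5 H6]]]]]. assert (HK := Kf_pos (ps x y)).
unfold entropy. simpl. unfold f_rho in *.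
set (c := f_c2 x y) in *. set (k := Kf (ps x y)) in *. set (r := Rpower c (/ (gamma - 1)) * / k) in *.
assert (Er : ln r = / (gamma - 1) * ln c - ln k).
{ unfold r. rewrite ln_mult; [|apply exp_pos|now apply Rinv_0_lt_compat].
  rewrite ln_Rinv by exact HK. unfold Rpower. rewrite ln_exp. ring. }
assert (E : r * c / gamma / Rpower r gamma = / gamma * exp (ln r + ln c - gamma * ln r)).
{ unfold Rpower, Rminus. rewrite !exp_plus, exp_Ropp, !exp_ln by assumption.
  assert (0 < exp (gamma * ln r)) by apply exp_pos. field. lra. }
rewrite E. unfold Rpower, Rdiv. rewrite (Rmult_comm _ (/ gamma)). f_equal. f_equal.
rewrite Er. field. lra.
Qed.

Lemma flow_state_shock (x : R) : 0 <= x <= X -> flow_state x x = Us x.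
Proof.
intros Hx. destruct (trace_invariants x Hx) as [E1 [E2 E3]].
destruct (Us_angle x Hx) as [Eu Ev]. destruct (Us_pos x Hx) as [Hr [Hpr [Hu Hv]]].
assert (HM1 : f_M x x = mach gamma (Us x)) by (unfold f_M; rewrite pull_eq by lra; exact E3).
assert (Hth : f_th x x = flow_angle (Us x)) by (unfold f_th; rewrite pull_eq by lra; exact E1).
assert (Hc : f_c2 x x = gamma * prs (Us x) / rho (Us x)).
{ unfold f_c2. rewrite HM1. now apply Us_csq. }
assert (Hq : f_q x x = speed (Us x)).
{ unfold f_q. rewrite Hc, HM1. unfold mach, sound.
  assert (0 < sqrt (gamma * prs (Us x) / rho (Us x))) by (apply sqrt_lt_R0; now apply Us_sound2).
  field. lra. }
assert (Hrho' : f_rho x x = rho (Us x)).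
{ unfold f_rho. rewrite Kf_shock by exact Hx. unfold sh_K, entropy_factor.
  change (post_shock gamma rho_inf p_inf (s x)) with (Us x).
  change (total_enthalpy gamma rho_inf p_inf) with H0.
  unfold f_c2. rewrite HM1.
  set (z := Rpower (csq gamma H0 (mach gamma (Us x))) (/ (gamma - 1))).
  assert (0 < z) by apply exp_pos. field. lra. }
unfold flow_state. rewrite Hrho', Hq, Hth, Hc, <- Eu, <- Ev.
replace (rho (Us x) * (gamma * prs (Us x) / rho (Us x)) / gamma) with (prs (Us x)) by (field; lra).
now destruct (Us x).
Qed.

Definition flow_field (x y : R) : state := flow_state (xi x y) (eta x y).

(** * Continuity up to the boundary and C1 regularity in the interior *)

Lemma continuous_on_closure (F : R -> R -> R) :
  cont2 F -> continuous_on_2d cl (fun x y => F (xi x y) (eta x y)).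
Proof.
intros HFc [x y] Hxy Pr [e He]. simpl in *.
destruct (HFc (xi x y) (eta x y) e) as [d Hd].
destruct (hf_cont _ _ _ _ _ _ _ _ _ _ _ _ _ _ _ HF x y d Hxy (cond_pos d)) as [r [Hr H]].
exists (mkposreal r Hr). intros [u v] [Hu Hv] Huv. simpl in *.
apply He. destruct (H u v Huv Hu Hv) as [K1 K2]. exact (Hd _ _ K1 K2).
Qed.

Lemma cont_f_th : cont2 f_th.
Proof. apply cont2_pull. intros r t _. apply cont_theta. Qed.

Lemma cont_f_M : cont2 f_M.
Proof.
apply cont2_pull. intros r t [Hg _]. apply (cont_w (nu_inv gamma)).
exact (is_derive_continuity_pt _ _ _ (is_derive_nu_inv gamma Hg1 _ Hg)).
Qed.

Lemma cont2_comp_pt (h : R -> R) (F : R -> R -> R) :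
  (forall x y, continuity_pt h (F x y)) -> cont2 F -> cont2 (fun x y => h (F x y)).
Proof. intros Hh HFc x y. apply (continuity_1d_2d_pt_comp h F); [apply Hh|apply HFc]. Qed.

Lemma cont_f_c2 : cont2 f_c2.
Proof.
apply (cont2_comp_pt (csq gamma H0)); [|apply cont_f_M].
intros x y. eapply is_derive_continuity_pt. now apply is_derive_csq.
Qed.

Lemma cont_f_q : cont2 f_q.
Proof.
apply cont2_mult; [apply cont_f_M|]. apply (cont2_comp_pt sqrt); [|apply cont_f_c2].
intros x y. apply continuity_pt_sqrt. left. apply f_facts.
Qed.

Lemma cont_ps : cont2 ps.
Proof.
intros x y. apply differentiable_continuity_pt. exists (ps1 x y), (ps2 x y).
now apply C1_differentiable.
Qed.

Lemma is_derive_Rpower (a x : R) : 0 < x ->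
  is_derive (fun z => Rpower z a) x (a * Rpower x (a - 1)).
Proof. intros Hx. apply is_derive_Reals. now apply derivable_pt_lim_power. Qed.

Lemma cont_f_rho : cont2 f_rho.
Proof.
apply cont2_mult.
- apply (cont2_comp_pt (fun z => Rpower z (/ (gamma - 1)))); [|apply cont_f_c2].
  intros x y. eapply is_derive_continuity_pt. apply is_derive_Rpower. apply f_facts.
- apply (cont2_comp_pt (fun p => / Kf p) ps); [|apply cont_ps].
  intros x y. apply (continuity_pt_inv Kf); [apply Kf_cont|].
  assert (H := Kf_pos (ps x y)). lra.
Qed.

Lemma cont_flow_state :
  cont2 (fun x y => vx (flow_state x y)) /\ cont2 (fun x y => vy (flow_state x y)) /\
  cont2 (fun x y => prs (flow_state x y)).
Proof.
split; [|split].
- apply (cont2_mult f_q (fun x y => cos (f_th x y))); [apply cont_f_q|].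
  apply (cont2_comp_pt cos); [|apply cont_f_th]. intros x y. apply continuity_cos.
- apply (cont2_mult f_q (fun x y => sin (f_th x y))); [apply cont_f_q|].
  apply (cont2_comp_pt sin); [|apply cont_f_th]. intros x y. apply continuity_sin.
- apply (cont2_mult (fun x y => f_rho x y * f_c2 x y) (fun _ _ => / gamma)).
  + apply cont2_mult; [apply cont_f_rho|apply cont_f_c2].
  + apply cont2_const.
Qed.

Lemma closure_of_Omega (x y : R) : om x y -> cl x y.
Proof.
intros [H1 [H2 [H3 H4]]]. split; [lra|]. split; [lra|]. split; intros H; left; auto.
Qed.

Lemma om_open : open_2d om.
Proof. exact (hf_open _ _ _ _ _ _ _ _ _ _ _ _ _ _ _ HF). Qed.

Lemma cl_triangle (x y : R) : cl x y ->
  0 <= xi x y <= eta x y /\ eta x y <= X /\ 0 <= ps (xi x y) (eta x y) /\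
  0 < P (xi x y) (eta x y) /\ 0 < Q (xi x y) (eta x y).
Proof. exact (hf_triangle _ _ _ _ _ _ _ _ _ _ _ _ _ _ _ HF x y). Qed.

Lemma om_interior (x y : R) : om x y ->
  0 < xi x y < X /\ 0 < eta x y < X /\ 0 < ps (xi x y) (eta x y) < h_Ps X.
Proof.
intros H. destruct (hf_interior _ _ _ _ _ _ _ _ _ _ _ _ _ _ _ HF x y H) as [H1 [H2 [H3 H4]]].
split; [exact H1|]. split; [exact H2|]. split; [exact H3|].
eapply Rle_lt_trans; [exact H4|]. apply Ps_increasing; lra.
Qed.

Lemma om_derive (x y : R) : om x y ->
  let s := xi x y in let t := eta x y in
  is_derive (fun z => xi z y) x (- h_lamm s t / (P s t * (h_lamp s t - h_lamm s t))) /\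
  is_derive (fun z => eta z y) x (h_lamp s t / (Q s t * (h_lamp s t - h_lamm s t))) /\
  is_derive (fun z => xi x z) y (1 / (P s t * (h_lamp s t - h_lamm s t))) /\
  is_derive (fun z => eta x z) y (- 1 / (Q s t * (h_lamp s t - h_lamm s t))).
Proof. exact (hf_derive _ _ _ _ _ _ _ _ _ _ _ _ _ _ _ HF x y). Qed.

Lemma om_cont (x y : R) : om x y -> continuity_2d_pt xi x y /\ continuity_2d_pt eta x y.
Proof.
intros H. destruct (om_open x y H) as [d [Hd Hbox]].
split; intros e; destruct (hf_cont _ _ _ _ _ _ _ _ _ _ _ _ _ _ _ HF x y e
  (closure_of_Omega x y H) (cond_pos e)) as [r [Hr HC]];
(assert (Hm : 0 < Rmin d r) by (now apply Rmin_glb_lt)); exists (mkposreal _ Hm); simpl;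
intros u v Hu Hv; assert (M1 := Rmin_l d r); assert (M2 := Rmin_r d r);
apply (HC u v); try lra; apply closure_of_Omega, Hbox; lra.
Qed.

Lemma cont_quotient (F G : R -> R -> R) (x y : R) :
  continuity_2d_pt F x y -> continuity_2d_pt G x y -> G x y <> 0 ->
  continuity_2d_pt (fun u v => F u v / G u v) x y.
Proof. intros H1 H2 H3. apply continuity_2d_pt_mult; [exact H1|now apply continuity_2d_pt_inv]. Qed.

Lemma C1_xi_eta : C1_of om xi /\ C1_of om eta.
Proof.
assert (Hc : forall (F : R -> R -> R) x y, om x y ->
  continuity_2d_pt F (xi x y) (eta x y) -> continuity_2d_pt (fun x y => F (xi x y) (eta x y)) x y).
{ intros F x y H HFc. apply continuity_2d_pt_comp2; [exact HFc|now apply om_cont|now apply om_cont]. }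
assert (HP : forall x y, om x y -> 0 < P (xi x y) (eta x y) /\ 0 < Q (xi x y) (eta x y)).
{ intros x y H. apply (cl_triangle x y), closure_of_Omega, H. }
assert (HD : cont2 (fun s t => h_lamp s t - h_lamm s t)).
{ apply cont2_minus; [apply cont2_lamp|apply cont2_lamm]. }
split.
- exists (fun x y => (fun s t => - h_lamm s t / (P s t * (h_lamp s t - h_lamm s t))) (xi x y) (eta x y)),
    (fun x y => (fun s t => 1 / (P s t * (h_lamp s t - h_lamm s t))) (xi x y) (eta x y)).
  intros x y H. destruct (om_derive x y H) as [D1 [D2 [D3 D4]]]. destruct (HP x y H) as [H1 H2].
  assert (HL := lam_lt_h (xi x y) (eta x y)).
  assert (Hne : P (xi x y) (eta x y) * (h_lamp (xi x y) (eta x y) - h_lamm (xi x y) (eta x y)) <> 0).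
  { apply Rgt_not_eq. apply Rmult_lt_0_compat; lra. }
  split; [now apply om_cont|]. split; [exact D1|]. split; [exact D3|].
  split.
  + apply (Hc (fun s t => - h_lamm s t / (P s t * (h_lamp s t - h_lamm s t)))); [exact H|].
    apply cont_quotient; [apply continuity_2d_pt_opp, cont2_lamm| |exact Hne].
    apply continuity_2d_pt_mult; [apply cP|apply HD].
  + apply (Hc (fun s t => 1 / (P s t * (h_lamp s t - h_lamm s t)))); [exact H|].
    apply cont_quotient; [apply continuity_2d_pt_const| |exact Hne].
    apply continuity_2d_pt_mult; [apply cP|apply HD].
- exists (fun x y => (fun s t => h_lamp s t / (Q s t * (h_lamp s t - h_lamm s t))) (xi x y) (eta x y)),
    (fun x y => (fun s t => - 1 / (Q s t * (h_lamp s t - h_lamm s t))) (xi x y) (eta x y)).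
  intros x y H. destruct (om_derive x y H) as [D1 [D2 [D3 D4]]]. destruct (HP x y H) as [H1 H2].
  assert (HL := lam_lt_h (xi x y) (eta x y)).
  assert (Hne : Q (xi x y) (eta x y) * (h_lamp (xi x y) (eta x y) - h_lamm (xi x y) (eta x y)) <> 0).
  { apply Rgt_not_eq. apply Rmult_lt_0_compat; lra. }
  split; [now apply om_cont|]. split; [exact D2|]. split; [exact D4|].
  split.
  + apply (Hc (fun s t => h_lamp s t / (Q s t * (h_lamp s t - h_lamm s t)))); [exact H|].
    apply cont_quotient; [apply cont2_lamp| |exact Hne].
    apply continuity_2d_pt_mult; [apply cQ|apply HD].
  + apply (Hc (fun s t => - 1 / (Q s t * (h_lamp s t - h_lamm s t)))); [exact H|].
    apply cont_quotient; [apply continuity_2d_pt_const| |exact Hne].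
    apply continuity_2d_pt_mult; [apply cQ|apply HD].
Qed.

Lemma C1_Rs_Ss : C1_of om (fun x y => Rs (xi x y)) /\ C1_of om (fun x y => Ss (eta x y)).
Proof.
destruct C1_xi_eta as [C1 C2]. split.
- apply (C1_of_comp om Rs R1); [|exact C1]. intros x y H. destruct (om_interior x y H) as [H1 [H2 _]].
  split.
  + apply (is_derive_on_interior 0 X); [lra|]. apply R_derive. lra.
  + apply (cont_at_on_interior 0 X); [lra|]. apply R1_cont. lra.
- apply (C1_of_comp om Ss S1); [|exact C2]. intros x y H. destruct (om_interior x y H) as [H1 [H2 _]].
  split.
  + apply (is_derive_on_interior 0 X); [lra|]. apply S_derive. lra.
  + apply (cont_at_on_interior 0 X); [lra|]. apply S1_cont. lra.
Qed.

Lemma pull_om (F : R -> R -> R) (x y : R) : om x y ->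
  F (Rs (xi x y)) (Ss (eta x y)) = pull F (xi x y) (eta x y).
Proof.
intros H. destruct (cl_triangle x y (closure_of_Omega x y H)) as [H1 [H2 _]].
now rewrite pull_eq.
Qed.

Lemma C1_f_th : C1_of om (fun x y => f_th (xi x y) (eta x y)).
Proof.
destruct C1_Rs_Ss as [C1 C2].
apply (C1_of_ext om (fun x y => (Rs (xi x y) + Ss (eta x y)) * / 2)); [apply om_open| |].
- intros x y H. exact (pull_om theta_ph x y H).
- apply C1_of_mult; [now apply C1_of_plus|apply C1_of_const].
Qed.

Lemma nu'_cont (m : R) : 1 < m -> continuity_pt (nu' gamma) m.
Proof.
intros Hm. eapply is_derive_continuity_pt. apply Derive_correct. unfold nu'.
assert (0 < 1 + (gamma - 1) / 2 * m ^ 2).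
{ assert (0 <= (gamma - 1) / 2 * m ^ 2) by (apply Rmult_le_pos; [lra|apply pow2_ge_0]). lra. }
auto_derive. split; [simpl; nra|]. split; [|exact I].
apply Rgt_not_eq. apply Rmult_lt_0_compat; [lra|]. simpl in *. lra.
Qed.

Lemma C1_f_M : C1_of om (fun x y => f_M (xi x y) (eta x y)).
Proof.
destruct C1_Rs_Ss as [C1 C2].
apply (C1_of_ext om (fun x y => nu_inv gamma ((Rs (xi x y) - Ss (eta x y)) * / 2))); [apply om_open| |].
- intros x y H. exact (pull_om (fun r t => nu_inv gamma ((r - t) / 2)) x y H).
- apply (C1_of_comp om (nu_inv gamma) (fun w => / nu' gamma (nu_inv gamma w))
    (fun x y => (Rs (xi x y) - Ss (eta x y)) * / 2)).
  + intros x y H. destruct (cl_triangle x y (closure_of_Omega x y H)) as [H1 [H2 _]].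
    assert (Hw := proj1 (good_xy _ _ H1 H2)). fold ((Rs (xi x y) - Ss (eta x y)) / 2).
    destruct (nu_inv_spec gamma Hg1 _ Hw) as [Hm _].
    assert (Dn := is_derive_nu_inv gamma Hg1 _ Hw). split; [exact Dn|].
    apply (continuity_pt_inv (fun w => nu' gamma (nu_inv gamma w))).
    * apply (continuity_pt_comp (nu_inv gamma) (nu' gamma)).
      -- exact (is_derive_continuity_pt _ _ _ Dn).
      -- now apply nu'_cont.
    * apply Rgt_not_eq. now apply nu'_pos.
  + apply C1_of_mult; [now apply C1_of_minus|apply C1_of_const].
Qed.

Lemma C1_f_c2 : C1_of om (fun x y => f_c2 (xi x y) (eta x y)).
Proof.
apply (C1_of_comp om (csq gamma H0) (fun m => - csq gamma H0 m * (m / (m ^ 2 / 2 + / (gamma - 1))))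
  (fun x y => f_M (xi x y) (eta x y))); [|apply C1_f_M].
intros x y _. set (m := f_M (xi x y) (eta x y)).
assert (Dc : is_derive (csq gamma H0) m (- csq gamma H0 m * (m / (m ^ 2 / 2 + / (gamma - 1)))))
  by now apply is_derive_csq.
split; [exact Dc|]. apply continuity_pt_mult.
- apply continuity_pt_opp. exact (is_derive_continuity_pt _ _ _ Dc).
- assert (0 < / (gamma - 1)) by (apply Rinv_0_lt_compat; lra).
  assert (0 <= m ^ 2) by apply pow2_ge_0.
  apply (continuity_pt_div (fun m => m) (fun m => m ^ 2 / 2 + / (gamma - 1))); [reg| |lra].
  apply derivable_continuous_pt. reg.
Qed.

Lemma C1_f_q : C1_of om (fun x y => f_q (xi x y) (eta x y)).
Proof.
apply (C1_of_mult om (fun x y => f_M (xi x y) (eta x y)) (fun x y => sqrt (f_c2 (xi x y) (eta x y)))).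
{ apply C1_f_M. }
apply (C1_of_comp om sqrt (fun z => / (2 * sqrt z)) (fun x y => f_c2 (xi x y) (eta x y)));
  [|apply C1_f_c2].
intros x y _. destruct (f_facts (xi x y) (eta x y)) as [_ [H2 _]].
assert (Hs : 0 < sqrt (f_c2 (xi x y) (eta x y))) by now apply sqrt_lt_R0.
split.
- apply is_derive_Reals. now apply derivable_pt_lim_sqrt.
- apply (continuity_pt_inv (fun z => 2 * sqrt z)); [|lra].
  apply continuity_pt_mult; [apply continuity_pt_const; now intros a b|].
  apply continuity_pt_sqrt. lra.
Qed.

Lemma C1_ps : C1_of om (fun x y => ps (xi x y) (eta x y)).
Proof. destruct C1_xi_eta as [C1 C2]. now apply (C1_of_comp2 om ps ps1 ps2). Qed.

Lemma C1_f_rho : C1_of om (fun x y => f_rho (xi x y) (eta x y)).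
Proof.
apply (C1_of_mult om (fun x y => Rpower (f_c2 (xi x y) (eta x y)) (/ (gamma - 1)))
  (fun x y => / Kf (ps (xi x y) (eta x y)))).
- apply (C1_of_comp om (fun z => Rpower z (/ (gamma - 1)))
    (fun z => / (gamma - 1) * Rpower z (/ (gamma - 1) - 1))
    (fun x y => f_c2 (xi x y) (eta x y))); [|apply C1_f_c2].
  intros x y _. destruct (f_facts (xi x y) (eta x y)) as [_ [H2 _]].
  split; [now apply is_derive_Rpower|].
  apply continuity_pt_mult; [apply continuity_pt_const; now intros a b|].
  eapply is_derive_continuity_pt. now apply is_derive_Rpower.
- apply (C1_of_comp om (fun p => / Kf p) (fun p => - Kf1 p / Kf p ^ 2)
    (fun x y => ps (xi x y) (eta x y))); [|apply C1_ps].
  (* In the open domain the stream function stays strictly between 0 and its value at the end of the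
     shock, where [Kf] is continuously differentiable. *)
  intros x y H. destruct (om_interior x y H) as [_ [_ Hp']].
  destruct (Kf_derive _ Hp') as [D C]. assert (HK := Kf_pos (ps (xi x y) (eta x y))). split.
  + apply is_derive_inv; [exact D|lra].
  + apply (continuity_pt_div (fun p => - Kf1 p) (fun p => Kf p ^ 2)).
    * now apply continuity_pt_opp.
    * apply (continuity_pt_comp Kf (fun z => z ^ 2)); [apply Kf_cont|].
      apply derivable_continuous_pt. reg.
    * apply pow_nonzero. lra.
Qed.

Lemma flow_is_C1 : flow_C1 om flow_field.
Proof.
assert (HO := om_open). split; [|split; [|split]]; apply C1_of_C1_in; try exact HO.
- apply C1_f_rho.
- apply (C1_of_mult om (fun x y => f_q (xi x y) (eta x y)) (fun x y => cos (f_th (xi x y) (eta x y))));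
    [apply C1_f_q|].
  apply (C1_of_comp om cos (fun z => - sin z) (fun x y => f_th (xi x y) (eta x y))); [|apply C1_f_th].
  intros x y _. split; [apply is_derive_cos|]. apply continuity_pt_opp, continuity_sin.
- apply (C1_of_mult om (fun x y => f_q (xi x y) (eta x y)) (fun x y => sin (f_th (xi x y) (eta x y))));
    [apply C1_f_q|].
  apply (C1_of_comp om sin cos (fun x y => f_th (xi x y) (eta x y))); [|apply C1_f_th].
  intros x y _. split; [apply is_derive_sin|]. apply continuity_cos.
- apply (C1_of_mult om (fun x y => f_rho (xi x y) (eta x y) * f_c2 (xi x y) (eta x y)) (fun _ _ => / gamma)).
  + apply C1_of_mult; [apply C1_f_rho|apply C1_f_c2].
  + apply C1_of_const.
Qed.

(* The kernel of the mass flux form is the streamline direction tan theta. *)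
Lemma streamline_slope (x y : R) :
  h_lamp x y * h_Am x y + h_lamm x y * h_Ap x y = tan (f_th x y) * (h_Ap x y + h_Am x y).
Proof.
assert (Hg := good_pull x y). destruct (good_facts gamma Hg1 _ _ Hg) as [C1 [C2 _]].
destruct (f_facts x y) as [_ [_ [_ [_ [_ C3]]]]].
unfold h_lamp, h_lamm, h_Am, h_Ap, pull, flux_p, flux_m, lp_ph, lm_ph, theta_m_ph, mach_ph.
unfold f_th, pull in *. fold (mu gamma ((Rs (retr1 X x y) - Ss (retr2 X x y)) / 2)).
set (th := theta_ph (Rs (retr1 X x y)) (Ss (retr2 X x y))) in *.
set (ma := mu gamma ((Rs (retr1 X x y) - Ss (retr2 X x y)) / 2)) in *.
set (G := Gw gamma H0 ((Rs (retr1 X x y) - Ss (retr2 X x y)) / 2)).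
transitivity (G * (sin (th + ma) + sin (th - ma)) / (cos (th + ma) * cos (th - ma))).
{ unfold tan. field. lra. }
transitivity (tan th * (G * (cos (th + ma) + cos (th - ma)) / (cos (th + ma) * cos (th - ma)))).
2:{ field. lra. }
replace (sin (th + ma) + sin (th - ma)) with (2 * sin th * cos ma)
  by (rewrite sin_plus, sin_minus; ring).
replace (cos (th + ma) + cos (th - ma)) with (2 * cos th * cos ma)
  by (rewrite cos_plus, cos_minus; ring).
unfold tan at 1. field. lra.
Qed.

(** * The transport equations *)

Lemma flow_field_invariants (x y : R) : cl x y ->
  inv_R gamma (flow_field x y) = Rs (xi x y) /\ inv_S gamma (flow_field x y) = Ss (eta x y).
Proof.
intros H. destruct (cl_triangle x y H) as [H1 [H2 _]]. now apply flow_state_invariants.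
Qed.

(** R is a function of xi alone, and the inverse Jacobian gives xi_x + lamm xi_y = 0. The equation
    for S is the same with eta and [lamp]. *)
Lemma flow_transport_R : transported_in om (fun _ _ => 1)
  (fun x y => lambda_minus gamma (flow_field x y)) (fun x y => inv_R gamma (flow_field x y)).
Proof.
intros x y H. destruct (om_derive x y H) as [D1 [_ [D3 _]]]. destruct (om_interior x y H) as [H1 _].
destruct (cl_triangle x y (closure_of_Omega x y H)) as [_ [_ [_ [HP _]]]].
assert (HL := lam_lt_h (xi x y) (eta x y)).
assert (DR : is_derive Rs (xi x y) (R1 (xi x y))).
{ apply (is_derive_on_interior 0 X); [lra|]. apply R_derive. lra. }
eexists. eexists. split; [|split].
- apply (is_derive_ext_loc (fun t => Rs (xi t y))).
  + apply (open_2d_fst om x y); [apply om_open|exact H|]. intros u Hu. symmetry.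
    apply flow_field_invariants. now apply closure_of_Omega.
  + apply (is_derive_comp_R Rs (fun t => xi t y)); [exact DR|exact D1].
- apply (is_derive_ext_loc (fun t => Rs (xi x t))).
  + apply (open_2d_snd om x y); [apply om_open|exact H|]. intros u Hu. symmetry.
    apply flow_field_invariants. now apply closure_of_Omega.
  + apply (is_derive_comp_R Rs (fun t => xi x t)); [exact DR|exact D3].
- simpl. unfold flow_field. destruct (flow_state_lambda (xi x y) (eta x y)) as [_ ->]. field. lra.
Qed.

Lemma flow_transport_S : transported_in om (fun _ _ => 1)
  (fun x y => lambda_plus gamma (flow_field x y)) (fun x y => inv_S gamma (flow_field x y)).
Proof.
intros x y H. destruct (om_derive x y H) as [_ [D1 [_ D3]]]. destruct (om_interior x y H) as [_ [H1 _]].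
destruct (cl_triangle x y (closure_of_Omega x y H)) as [_ [_ [_ [_ HQ]]]].
assert (HL := lam_lt_h (xi x y) (eta x y)).
assert (DR : is_derive Ss (eta x y) (S1 (eta x y))).
{ apply (is_derive_on_interior 0 X); [lra|]. apply S_derive. lra. }
eexists. eexists. split; [|split].
- apply (is_derive_ext_loc (fun t => Ss (eta t y))).
  + apply (open_2d_fst om x y); [apply om_open|exact H|]. intros u Hu. symmetry.
    apply flow_field_invariants. now apply closure_of_Omega.
  + apply (is_derive_comp_R Ss (fun t => eta t y)); [exact DR|exact D1].
- apply (is_derive_ext_loc (fun t => Ss (eta x t))).
  + apply (open_2d_snd om x y); [apply om_open|exact H|]. intros u Hu. symmetry.
    apply flow_field_invariants. now apply closure_of_Omega.
  + apply (is_derive_comp_R Ss (fun t => eta x t)); [exact DR|exact D3].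
- simpl. unfold flow_field. destruct (flow_state_lambda (xi x y) (eta x y)) as [-> _]. field. lra.
Qed.

(** The entropy is a function of [ps] alone, and the gradient of [ps] is orthogonal to the velocity:
    by the inverse Jacobian this is the relation of [streamline_slope]. *)
Lemma flow_transport_entropy : transported_in om (fun x y => vx (flow_field x y))
  (fun x y => vy (flow_field x y)) (fun x y => entropy gamma (flow_field x y)).
Proof.
intros x y H. destruct (om_derive x y H) as [D1 [D2 [D3 D4]]].
destruct (om_interior x y H) as [_ [_ Hp']].
destruct (cl_triangle x y (closure_of_Omega x y H)) as [T1 [T2 [_ [HP HQ]]]].
assert (HL := lam_lt_h (xi x y) (eta x y)).
destruct (eps_ (xi x y) (eta x y) T1 T2) as [E1 E2].
assert (Hslope := streamline_slope (xi x y) (eta x y)).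
destruct (f_facts (xi x y) (eta x y)) as [_ [_ [_ [_ [_ C3]]]]].
destruct (Kf_derive _ Hp') as [DK _]. assert (HK := Kf_pos (ps (xi x y) (eta x y))).
assert (Dh : is_derive (fun p => Rpower (Kf p) (gamma - 1) * / gamma) (ps (xi x y) (eta x y))
  ((gamma - 1) * Rpower (Kf (ps (xi x y) (eta x y))) (gamma - 1 - 1) * Kf1 (ps (xi x y) (eta x y)) * / gamma)).
{ rewrite (Rmult_comm _ (/ gamma)).
  apply (is_derive_ext (fun p => / gamma * Rpower (Kf p) (gamma - 1))); [intros; apply Rmult_comm|].
  apply is_derive_scal. apply (is_derive_comp_R (fun z => Rpower z (gamma - 1)) Kf); [|exact DK].
  now apply is_derive_Rpower. }
set (l := (gamma - 1) * Rpower (Kf (ps (xi x y) (eta x y))) (gamma - 1 - 1)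
  * Kf1 (ps (xi x y) (eta x y)) * / gamma) in *.
assert (HFd : differentiable_pt_lim ps (xi x y) (eta x y)
  (ps1 (xi x y) (eta x y)) (ps2 (xi x y) (eta x y))) by now apply C1_differentiable.
assert (G1 := derivable_pt_lim_comp_2d ps (fun t => xi t y) (fun t => eta t y) x _ _ _ _ HFd
  (proj1 (is_derive_Reals _ _ _) D1) (proj1 (is_derive_Reals _ _ _) D2)).
assert (G2 := derivable_pt_lim_comp_2d ps (fun t => xi x t) (fun t => eta x t) y _ _ _ _ HFd
  (proj1 (is_derive_Reals _ _ _) D3) (proj1 (is_derive_Reals _ _ _) D4)).
apply is_derive_Reals in G1, G2. rewrite E1, E2 in G1, G2.
eexists. eexists. split; [|split].
- apply (is_derive_ext (fun t => Rpower (Kf (ps (xi t y) (eta t y))) (gamma - 1) * / gamma)).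
  + intros t. symmetry. apply flow_state_entropy.
  + apply (is_derive_comp_R (fun p => Rpower (Kf p) (gamma - 1) * / gamma)
      (fun t => ps (xi t y) (eta t y))); [exact Dh|exact G1].
- apply (is_derive_ext (fun t => Rpower (Kf (ps (xi x t) (eta x t))) (gamma - 1) * / gamma)).
  + intros t. symmetry. apply flow_state_entropy.
  + apply (is_derive_comp_R (fun p => Rpower (Kf p) (gamma - 1) * / gamma)
      (fun t => ps (xi x t) (eta x t))); [exact Dh|exact G2].
- cbn [vx vy flow_field flow_state].
  set (xi0 := xi x y) in *. set (eta0 := eta x y) in *.
  set (l1 := h_lamp xi0 eta0) in *. set (l2 := h_lamm xi0 eta0) in *.
  set (ap := h_Ap xi0 eta0) in *. set (am := h_Am xi0 eta0) in *.
  set (p := P xi0 eta0) in *. set (q := Q xi0 eta0) in *. set (th := f_th xi0 eta0) in *.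
  set (z := f_q xi0 eta0).
  transitivity (z * l / (l1 - l2) * (sin th * (ap + am) - cos th * (l1 * am + l2 * ap))).
  + change (vx (flow_field x y)) with (z * cos th). change (vy (flow_field x y)) with (z * sin th). field. lra.
  + rewrite Hslope. unfold tan. field. lra.
Qed.

(** * The wedge: boundary condition and second derivative *)

Lemma wedge_slope (t : R) : 0 <= t <= Xw ->
  is_derive_on 0 Xw f t (tan (f_th (xi t (f t)) (eta t (f t)))).
Proof.
intros Ht. destruct (hf_wedge _ _ _ _ _ _ _ _ _ _ _ _ _ _ _ HF t Ht) as [_ [_ D]].
rewrite streamline_slope in D.
assert (H1 : 0 < h_Ap (xi t (f t)) (eta t (f t)) /\ 0 < h_Am (xi t (f t)) (eta t (f t))).
{ apply flux_pos; [exact Hg1|apply good_pull]. }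
replace (tan (f_th (xi t (f t)) (eta t (f t)))) with
  (tan (f_th (xi t (f t)) (eta t (f t))) * (h_Ap (xi t (f t)) (eta t (f t)) + h_Am (xi t (f t)) (eta t (f t)))
   / (h_Ap (xi t (f t)) (eta t (f t)) + h_Am (xi t (f t)) (eta t (f t)))); [exact D|field; lra].
Qed.

Lemma Xw_pos : 0 < Xw < X.
Proof. exact (hf_Xw _ _ _ _ _ _ _ _ _ _ _ _ _ _ _ HF). Qed.

Lemma wedge_Derive (t : R) : 0 <= t <= Xw ->
  Derive_on 0 Xw f t = tan (f_th (xi t (f t)) (eta t (f t))).
Proof. intros Ht. apply Derive_on_eq; [apply Xw_pos|exact Ht|now apply wedge_slope]. Qed.

Lemma wedge_in (t : R) : 0 <= t <= Xw -> cl t (f t).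
Proof. exact (hf_wedge_in _ _ _ _ _ _ _ _ _ _ _ _ _ _ _ HF t). Qed.

(** The derivative of f' = tan theta along the wedge, with theta = (R + S) / 2 differentiated
    through the characteristic coordinates of the wedge point. *)
Definition wedge_f2 (t : R) : R :=
  let a := xi t (f t) in let e := eta t (f t) in
  / cos (f_th a e) ^ 2 *
  ((R1 a * (h_Am a e / (P a e * (h_Ap a e + h_Am a e)))
    + S1 e * (h_Ap a e / (Q a e * (h_Ap a e + h_Am a e)))) / 2).

Lemma wedge_second (t : R) : 0 <= t <= Xw -> is_derive_on 0 Xw (Derive_on 0 Xw f) t (wedge_f2 t).
Proof.
intros Ht. destruct (hf_wedge _ _ _ _ _ _ _ _ _ _ _ _ _ _ _ HF t Ht) as [D1 [D2 _]].
assert (Hrange : forall u, 0 <= u <= Xw -> 0 <= xi u (f u) <= eta u (f u) /\ eta u (f u) <= X).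
{ intros u Hu. destruct (cl_triangle u (f u) (wedge_in u Hu)) as [H1 [H2 _]]. split; assumption. }
destruct (f_facts (xi t (f t)) (eta t (f t))) as [_ [_ [_ [_ [_ Hc]]]]].
apply (is_derive_on_ext 0 Xw (fun t => tan (f_th (xi t (f t)) (eta t (f t))))); [exact Ht| |].
{ intros u Hu. symmetry. now apply wedge_Derive. }
apply (is_derive_on_comp_pt 0 Xw tan (fun t => f_th (xi t (f t)) (eta t (f t)))); [exact Ht| |].
{ apply is_derive_tan_R. lra. }
apply (is_derive_on_ext 0 Xw (fun t => (fun r q => (r + q) / 2) (Rs (xi t (f t))) (Ss (eta t (f t)))));
  [exact Ht| |].
{ intros u Hu. destruct (Hrange u Hu) as [H1 H2]. symmetry. exact (pull_eq theta_ph _ _ H1 H2). }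
assert (DR : is_derive_on 0 Xw (fun t => Rs (xi t (f t))) t
  (R1 (xi t (f t)) * (h_Am (xi t (f t)) (eta t (f t)) / (P (xi t (f t)) (eta t (f t)) *
     (h_Ap (xi t (f t)) (eta t (f t)) + h_Am (xi t (f t)) (eta t (f t))))))).
{ apply (is_derive_on_comp 0 Xw 0 X Rs (fun t => xi t (f t))); [exact Ht| | |exact D1].
  - intros u Hu. destruct (Hrange u Hu). lra.
  - apply R_derive. destruct (Hrange t Ht). lra. }
assert (DS : is_derive_on 0 Xw (fun t => Ss (eta t (f t))) t
  (S1 (eta t (f t)) * (h_Ap (xi t (f t)) (eta t (f t)) / (Q (xi t (f t)) (eta t (f t)) *
     (h_Ap (xi t (f t)) (eta t (f t)) + h_Am (xi t (f t)) (eta t (f t))))))).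
{ apply (is_derive_on_comp 0 Xw 0 X Ss (fun t => eta t (f t))); [exact Ht| | |exact D2].
  - intros u Hu. destruct (Hrange u Hu). lra.
  - apply S_derive. destruct (Hrange t Ht). lra. }
match goal with |- is_derive_on _ _ _ _ ((?a + ?b) / 2) =>
  replace ((a + b) / 2) with (/ 2 * a + / 2 * b) by (unfold Rdiv; ring) end.
apply (is_derive_on_comp_2d 0 Xw t (fun r q => (r + q) / 2) (fun t => Rs (xi t (f t)))
  (fun t => Ss (eta t (f t)))); [exact Ht| |exact DR|exact DS].
apply (C1_differentiable (fun r q => (r + q) / 2) (fun _ _ => / 2) (fun _ _ => / 2)).
- intros u v. auto_derive; [exact I|field].
- intros u v. auto_derive; [exact I|field].
- apply continuity_2d_pt_const.
Qed.

Lemma wedge_f2_cont (t : R) : 0 <= t <= Xw -> cont_at_on 0 Xw wedge_f2 t.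
Proof.
intros Ht. destruct (hf_wedge _ _ _ _ _ _ _ _ _ _ _ _ _ _ _ HF t Ht) as [D1 [D2 _]].
assert (Cx := is_derive_on_cont _ _ _ _ _ Ht D1). assert (Ce := is_derive_on_cont _ _ _ _ _ Ht D2).
destruct (cl_triangle t (f t) (wedge_in t Ht)) as [T1 [T2 [_ [HP HQ]]]].
destruct (f_facts (xi t (f t)) (eta t (f t))) as [_ [_ [_ [_ [_ Hc]]]]].
assert (Hfl : 0 < h_Ap (xi t (f t)) (eta t (f t)) /\ 0 < h_Am (xi t (f t)) (eta t (f t))).
{ apply flux_pos; [exact Hg1|apply good_pull]. }
assert (HS : cont2 (fun a e => h_Ap a e + h_Am a e)) by (apply cont2_plus; [apply cont2_Ap|apply cont2_Am]).
(* The retractions make [R1] and [S1] continuous on the plane and act as the identity at the wedge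
   points. *)
set (F := fun a e => / cos (f_th a e) ^ 2 *
  ((R1 (retr1 X a e) * (h_Am a e / (P a e * (h_Ap a e + h_Am a e)))
    + S1 (retr2 X a e) * (h_Ap a e / (Q a e * (h_Ap a e + h_Am a e)))) / 2)).
apply (cont_at_on_ext 0 Xw (fun t => F (xi t (f t)) (eta t (f t)))); [exact Ht| |].
{ intros u Hu. destruct (cl_triangle u (f u) (wedge_in u Hu)) as [U1 [U2 _]].
  unfold F, wedge_f2. destruct (retr_id X _ _ U1 U2) as [-> ->]. reflexivity. }
apply cont_at_on_comp_2d; [|exact Cx|exact Ce].
apply continuity_2d_pt_mult.
- apply (continuity_2d_pt_inv (fun a e => cos (f_th a e) ^ 2)).
  + apply (continuity_1d_2d_pt_comp (fun z => cos z ^ 2) f_th); [|apply cont_f_th].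
    apply derivable_continuous_pt. reg.
  + apply pow_nonzero. lra.
- apply continuity_2d_pt_mult; [|apply continuity_2d_pt_const].
  apply continuity_2d_pt_plus; apply continuity_2d_pt_mult.
  + apply (cont2_retr1_comp R1 R1_cont).
  + apply cont_quotient; [apply cont2_Am|apply continuity_2d_pt_mult; [apply cP|apply HS]|].
    apply Rgt_not_eq. apply Rmult_lt_0_compat; lra.
  + apply (cont2_retr2_comp S1 S1_cont).
  + apply cont_quotient; [apply cont2_Ap|apply continuity_2d_pt_mult; [apply cQ|apply HS]|].
    apply Rgt_not_eq. apply Rmult_lt_0_compat; lra.
Qed.

Lemma wedge_C2 : C2_on 0 Xw f.
Proof.
assert (HXw := Xw_pos). split; split.
- intros t Ht. exists (tan (f_th (xi t (f t)) (eta t (f t)))). now apply wedge_slope.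
- apply continuous_on_iff. intros t Ht.
  exact (is_derive_on_cont _ _ _ _ _ Ht (wedge_second t Ht)).
- intros t Ht. exists (wedge_f2 t). now apply wedge_second.
- apply continuous_on_iff. intros t Ht.
  apply (cont_at_on_ext 0 Xw wedge_f2); [exact Ht| |now apply wedge_f2_cont].
  intros u Hu. symmetry. apply Derive_on_eq; [lra|exact Hu|now apply wedge_second].
Qed.

Lemma flow_field_solution : hybrid_solution gamma rho_inf p_inf X phi Xw f g flow_field.
Proof.
destruct cont_flow_state as [K1 [K2 K3]].
split.
- exact Xw_pos.
- rewrite (hf_tip _ _ _ _ _ _ _ _ _ _ _ _ _ _ _ HF). exact Hphi0.
- exact (hf_wedge_below _ _ _ _ _ _ _ _ _ _ _ _ _ _ _ HF).
- exact (hf_char_below _ _ _ _ _ _ _ _ _ _ _ _ _ _ _ HF).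
- exact (hf_char_start _ _ _ _ _ _ _ _ _ _ _ _ _ _ _ HF).
- exact (hf_char_end _ _ _ _ _ _ _ _ _ _ _ _ _ _ _ HF).
- intros x Hx. unfold flow_field. rewrite (proj1 (flow_state_lambda _ _)).
  exact (hf_char _ _ _ _ _ _ _ _ _ _ _ _ _ _ _ HF x Hx).
- intros x y _. unfold flow_field. rewrite flow_state_mach.
  destruct (f_facts (xi x y) (eta x y)) as [H1 [H2 [H3 [H4 [H5 H6]]]]].
  split; [exact H4|]. split.
  + simpl. apply Rdiv_lt_0_compat; [now apply Rmult_lt_0_compat|lra].
  + split; [simpl; now apply Rmult_lt_0_compat|exact H1].
- intros x y _. unfold flow_field. rewrite flow_state_angle, flow_state_mach.
  destruct (good_facts gamma Hg1 _ _ (good_pull (xi x y) (eta x y))) as [C1 [C2 _]].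
  split; [exact (Rgt_not_eq _ _ C2)|exact (Rgt_not_eq _ _ C1)].
- exact (continuous_on_closure f_rho cont_f_rho).
- exact (continuous_on_closure _ K1).
- exact (continuous_on_closure _ K2).
- exact (continuous_on_closure _ K3).
- exact flow_transport_R.
- exact flow_transport_S.
- exact flow_transport_entropy.
- intros x y _. exact (flow_state_bernoulli (xi x y) (eta x y)).
- intros x Hx. unfold flow_field. destruct (hf_shock _ _ _ _ _ _ _ _ _ _ _ _ _ _ _ HF x Hx) as [-> ->].
  now apply flow_state_shock.
- intros x Hx. split.
  + exists (tan (f_th (xi x (f x)) (eta x (f x)))). now apply wedge_slope.
  + rewrite wedge_Derive by exact Hx. unfold flow_field. simpl.
    destruct (f_facts (xi x (f x)) (eta x (f x))) as [_ [_ [_ [_ [_ Hc]]]]].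
    unfold tan. field. lra.
Qed.

End Flow.
End ShockData.

Theorem theorem1p1
  (gamma rho_inf p_inf : R)
  (Hgamma : 1 < gamma < 3)
  (Hrho : 0 < rho_inf)
  (Hp : 0 < p_inf)
  (HM : 1 < Minf2 gamma rho_inf p_inf)
  (X : R) (phi : R -> R)
  (HX : 0 < X)
  (Hphi : C2_on 0 X phi)
  (Hphi0 : phi 0 = 0)
  (Hi : forall x, 0 <= x <= X ->
     0 < d2phi X phi x /\
     I_sup gamma rho_inf p_inf (dphi X phi x) /\
     poly_D gamma rho_inf p_inf (dphi X phi x) < 0)
  (Hii : forall r s, phase_region gamma rho_inf p_inf X phi r s ->
     (exists m, 1 < m /\ nu gamma m = (r - s) / 2) /\
     - (PI / 2) < theta_ph r s - theta_m_ph gamma r s /\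
     theta_ph r s - theta_m_ph gamma r s
       < theta_ph r s + theta_m_ph gamma r s /\
     theta_ph r s + theta_m_ph gamma r s < PI / 2)
  (Hbounds : forall x, 0 <= x <= X ->
     B_mass gamma rho_inf p_inf X phi x < B_nd gamma rho_inf p_inf X phi x) :
  exists (Xw : R) (f g : R -> R) (U : R -> R -> state),
    hybrid_solution gamma rho_inf p_inf X phi Xw f g U /\
    C2_on 0 Xw f /\
    flow_C1 (Omega X phi Xw f g) U.
Proof.
destruct (hodograph_exists gamma rho_inf p_inf Hgamma Hrho Hp HM X phi HX Hphi Hphi0 Hi Hii Hbounds)
  as [P [Q [ps [ps1 [ps2 [Xw [f [g [xi [eta
     [cP [cQ [c1 [c2 [d1 [d2 [e1 [diag HF]]]]]]]]]]]]]]]]]].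
destruct (foot_exists gamma rho_inf p_inf Hgamma Hrho Hp HM X phi HX Hphi Hi Hii) as [foot Hfoot].
exists Xw, f, g, (flow_field gamma rho_inf p_inf X phi ps xi eta foot).
split; [|split].
- eapply flow_field_solution with (ps1 := ps1) (ps2 := ps2); eassumption.
- eapply wedge_C2 with (gamma := gamma) (rho_inf := rho_inf) (p_inf := p_inf) (P := P) (Q := Q);
    eassumption.
- eapply flow_is_C1 with (P := P) (Q := Q) (ps1 := ps1) (ps2 := ps2); eassumption.
Qed.
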